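(* For $C(X,Y)=XY^2+1$ we have, as $X\to\infty$, $$\sum_{n_1,n_2\le X} d(C(n_1,n_2))=\Bigl(1+O\Bigl(\Bigl(\frac{\log\log X}{\log X}\Bigr)^{1/2}\Bigr)\Bigr)\frac{3}{\zeta(2)}X^2\log X,$$ that is, the displayed formula holds for the sum of $d(n_1n_2^2+1)$ over positive integers $n_1,n_2\le X$.
   Context: $d(n)$ is the divisor function (number of positive divisors of $n$) and $\zeta$ is the Riemann zeta function. The implied constant is absolute. *)

(* Defs.v *)
From mathcomp Require Import all_boot all_order all_algebra archimedean.
From mathcomp Require Import boolp classical_sets reals topology normedtype.
From mathcomp Require Import landau sequences exp.
Set Implicit Arguments.
Unset Strict Implicit.
Unset Printing Implicit Defensive.
Import Order.TTheory GRing.Theory Num.Theory.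
Import numFieldNormedType.Exports.
Local Open Scope ring_scope.

(* The filter +oo bundled with its filter structure, as required by the Landau
   notations. *)
Definition at_pinfty (R : realType) : filter_on R :=
  FilterType (+oo_ R) _.

Definition ndivisors (n : nat) : nat := size (divisors n).

(* The Dirichlet series of the Riemann zeta function; it is only meaningful
   for 1 < s, where it converges. *)
Definition zeta (R : realType) (s : R) : R :=
  limn (fun N : nat => \sum_(1 <= n < N) n%:R `^ (- s)).

Definition Cpoly (x y : nat) : nat := (x * y ^ 2 + 1)%N.

(* For X >= 0, the conditions n <= Num.truncn X and n%:R <= X are equivalent. *)
Definition divisor_sum (R : realType) (X : R) : nat :=
  (\sum_(1 <= n1 < (Num.truncn X).+1) \sum_(1 <= n2 < (Num.truncn X).+1)
     ndivisors (Cpoly n1 n2))%N.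

(* Main.v *)
(** The divisors of [a b^2 + 1] are the [d] with [d e = 1 (mod b^2)] for the
    complementary divisor [e], and the hyperbola method restricts them to
    [d <= b sqrt N].  For a typical [b] the number of [(a, d)] with
    [d | a b^2 + 1] and [d] in a short interval is computed as follows.  Fourier
    analysis modulo [b^2] produces Kloosterman sums to a square modulus, which
    stationary phase turns into sums over the [X] with [X^2 = k / h (mod b)].
    Write [b = n r] with a prime [r] of moderate size.  For each [X (mod n)] the
    frequencies [(h, k)] run over a lattice of index [n]; shifting them along its
    shortest vector and averaging over [X + u], [u < r^2], gives cancellation,
    because a fourfold correlation of Kloosterman sums modulo [r^2] vanishes
    outside the zero set of a nonzero polynomial.  This covers every [d] except
    [O(log r)] dyadic intervals, in which congruences between the lattice points
    give an upper bound of the right order of magnitude up to a factor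
    [2 ^ #{p | b : p large}].  Since almost all [b] have small admissible prime
    factors [r], the total loss is smaller than [sqrt (log N)]; the main term
    [2 N sum_b sum_d 1 / d] over coprime [d <= b sqrt N] is evaluated by Moebius
    inversion. *)

Require Import Defs.
From mathcomp Require Import all_boot all_order all_algebra archimedean.
From mathcomp Require Import boolp classical_sets reals topology normedtype.
From mathcomp Require Import landau sequences exp derive realfun trigo.
From mathcomp Require Import complex.
From mathcomp Require Import zify ring lra.
Set Implicit Arguments.
Unset Strict Implicit.
Unset Printing Implicit Defensive.
Import Order.TTheory GRing.Theory Num.Theory.
Import numFieldNormedType.Exports.
Local Open Scope ring_scope.


(** * Additive characters *)

(** A dyadic box of pairs [(d, e)] has area about [N q], where [q = b ^ 2], so its dual box holds
    about [q / N] frequencies. The pointwise bound [sqrt q = b] for each Kloosterman sum then leaves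
    an error of size about [b], and for [b] near [N] this is the size of the main term. A power of
    [log N] must therefore be gained beyond the pointwise bound, from the average over the
    frequencies. The gain is limited by [r], but [r] only has to exceed a fixed power of [log N],
    and this is why almost every [b] qualifies. In the ranges left to the upper bound, a loss of
    [2 ^ omega b] would be fatal, since its average is of order [log N]. The small primes of [b] are
    therefore put into a factor [b1], which is below [sqrt N] and is treated by counting residues,
    without square roots. Only the primes of the cofactor [b2] cost a factor [2]. With large primes
    meaning those above [N ^ (1 / log log N)], up to a constant in the exponent, this loss averages
    [O(log log N)]. *)

Section Exponentials.
Variable R : realType.
Implicit Types (z w : R[i]) (t : R) (a b : int).

Definition cabs z : R := ComplexField.Normc.normc z.

Lemma cabsM z w : cabs (z * w) = cabs z * cabs w.
Proof. exact: ComplexField.Normc.normcM. Qed.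

Lemma cabsD z w : cabs (z + w) <= cabs z + cabs w.
Proof. exact: complex.le_normcD. Qed.

Lemma cabsN z : cabs (- z) = cabs z.
Proof. exact: complex.normcN. Qed.

Lemma cabs_ge0 z : 0 <= cabs z.
Proof. by case: z => a b; rewrite /cabs /= sqrtr_ge0. Qed.

Lemma cabs0 : cabs 0 = 0.
Proof. exact: ComplexField.Normc.normc0. Qed.

Lemma cabs1 : cabs 1 = 1.
Proof. exact: ComplexField.Normc.normc1. Qed.


Lemma cabs_real t : cabs t%:C%C = `|t|.
Proof. by rewrite /cabs /= expr0n addr0 sqrtr_sqr. Qed.

Lemma cabs_nat n : cabs n%:R = n%:R.
Proof. by rewrite -[n%:R](rmorph_nat (real_complex R)) cabs_real ger0_norm. Qed.

Lemma cabs_conj z : cabs z^*%C = cabs z.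
Proof. by case: z => a b; rewrite /cabs /= sqrrN. Qed.

Lemma cabs_sqr z : z * z^*%C = ((cabs z) ^+ 2)%:C%C.
Proof.
case: z => a b; rewrite /cabs /= sqr_sqrtr ?addr_ge0 ?sqr_ge0 //.
by apply/eqP; rewrite eq_complex /=; apply/andP; split; apply/eqP; ring.
Qed.

Lemma cabs_sum (I : Type) (r : seq I) (P : pred I) (F : I -> R[i]) :
  cabs (\sum_(i <- r | P i) F i) <= \sum_(i <- r | P i) cabs (F i).
Proof.
elim/big_ind2: _ => [|z x w y zx wy|//]; first by rewrite cabs0.
exact: le_trans (cabsD _ _) (lerD zx wy).
Qed.

Lemma cabs_Re_ge z : `|complex.Re z| <= cabs z.
Proof.
case: z => a b; rewrite /cabs /= -(sqrtr_sqr a).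
by rewrite ler_wsqrtr // lerDl sqr_ge0.
Qed.

Lemma abs_sin_le t : `|sin t| <= `|t|.
Proof.
wlog t0 : t / 0 <= t => [H|].
  have [/H//|/ltW t0] := leP 0 t.
  by rewrite -(normrN t) -(normrN (sin t)) -sinN; apply: H; rewrite oppr_ge0.
move: t0; rewrite le_eqVlt => /predU1P[<-|t0]; first by rewrite sin0.
have [c _] := @MVT R sin cos 0 t t0 (fun x _ => is_derive_sin x)
  (continuous_subspaceT (@continuous_sin R)).
rewrite sin0 !subr0 => ->.
by rewrite normrM ler_piMl // cos_max.
Qed.

Definition ee (q : nat) (a : int) : R[i] :=
  (let t := 2 * pi * a%:~R / q%:R in cos t +i* sin t)%C.

Lemma ee0 q : ee q 0 = 1.
Proof. by rewrite /ee mulr0 mul0r cos0 sin0. Qed.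

Lemma eeD q a b : ee q (a + b) = ee q a * ee q b.
Proof.
rewrite /ee rmorphD /= mulrDr mulrDl cosD sinD.
by apply/eqP; rewrite eq_complex /=; apply/andP; split; apply/eqP; ring.
Qed.

Lemma ee_conj q a : (ee q a)^*%C = ee q (- a).
Proof. by rewrite /ee /= rmorphN /= mulrN mulNr cosN sinN. Qed.

Lemma cabs_ee q a : cabs (ee q a) = 1.
Proof. by rewrite /cabs /ee /= cos2Dsin2 sqrtr1. Qed.

Lemma ee_natl q a n : ee q (a *+ n) = ee q a ^+ n.
Proof.
elim: n => [|n IHn]; first by rewrite mulr0n ee0.
by rewrite mulrS eeD IHn exprS.
Qed.

Lemma ee_period q : (0 < q)%N -> ee q q%:Z = 1.
Proof.
move=> q0; rewrite /ee -pmulrn mulfK ?pnatr_eq0 -?lt0n //.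
by rewrite mulr_natl cos2pi sin2pi.
Qed.

Lemma ee_dvd q a : (0 < q)%N -> (q %| a)%Z -> ee q a = 1.
Proof.
move=> q0 /dvdzP[c ->].
have H n : ee q (n%:Z * q) = 1.
  by rewrite -[n%:Z]natz mulr_natl ee_natl ee_period // expr1n.
case: c => n; first exact: H.
by rewrite NegzE mulNr -ee_conj H conjc1.
Qed.

Lemma ee_congr q a b : (0 < q)%N -> (q %| a - b)%Z -> ee q a = ee q b.
Proof. by move=> q0 ab; rewrite -(subrK b a) eeD ee_dvd ?mul1r. Qed.

Lemma ee_scale q m a : (0 < m)%N -> ee (q * m) (a * m) = ee q a.
Proof.
move=> m0; rewrite /ee natrM rmorphM /= -pmulrn.
suff -> : 2 * pi * (a%:~R * m%:R) / (q%:R * m%:R) = 2 * pi * a%:~R / q%:R :> R by [].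
by rewrite mulrA -mulf_div divff ?mulr1 // pnatr_eq0 -lt0n.
Qed.

Lemma cabs_ee_sub1 q a : cabs (ee q a - 1) ^+ 2 =
   2 - 2 * cos (2 * pi * a%:~R / q%:R).
Proof.
rewrite /cabs /ee /= subr0 sqr_sqrtr ?addr_ge0 ?sqr_ge0 //.
have := cos2Dsin2 (2 * pi * a%:~R / q%:R : R); nra.
Qed.

(** The chord is shorter than the arc [2 pi |a| / q]; the constant [8] bounds [2 pi] by way of
    [pi / 2 < 2]. *)
Lemma cabs_ee_sub1_le q a : (0 < q)%N ->
  cabs (ee q a - 1) <= 8 * `|a|%:~R / q%:R.
Proof.
move=> q0; set t : R := 2 * pi * a%:~R / q%:R.
have q0R : 0 < q%:R :> R by rewrite ltr0n.
have tle : `|t| <= 8 * `|a|%:~R / q%:R.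
  rewrite /t !normrM normfV (ger0_norm (ltW q0R)).
  rewrite intr_norm; apply: ler_wpM2r; first by rewrite invr_ge0 ltW.
  apply: ler_wpM2r; first exact: normr_ge0.
  have p2 := pihalf_lt2 R; have p1 := pi_ge0 R.
  by rewrite !ger0_norm //; lra.
apply: le_trans tle; rewrite -(@ler_pXn2r _ 2) ?nnegrE ?cabs_ge0 //.
rewrite cabs_ee_sub1 -/t.
have -> : cos t = 1 - 2 * sin (t / 2) ^+ 2.
  rewrite [in LHS](_ : t = t / 2 + t / 2); last by field.
  rewrite cosD; have := cos2Dsin2 (t / 2); nra.
have : sin (t / 2) ^+ 2 <= (t / 2) ^+ 2.
  rewrite -(real_normK (num_real (sin _))) -(real_normK (num_real (t / 2))).
  by rewrite ler_pXn2r ?nnegrE // abs_sin_le.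
by rewrite real_normK ?num_real //; nra.
Qed.

(** Some multiple [m a] lands between a quarter and a half turn, where the distance to [1] is at
    least [1]. Passing from [z] to [z ^ m] multiplies that distance by at most [m], which bounds it
    from below for [z] itself. *)
Lemma cabs_ee_sub1_ge q a : (0 < q)%N -> (2 * `|a| <= q)%N ->
  2 * `|a|%:~R / q%:R <= cabs (ee q a - 1).
Proof.
move=> q0 aq; have [->|a0] := eqVneq a 0.
  by rewrite normr0 mulr0 mul0r cabs_ge0.
wlog ap : a a0 aq / 0 < a.
  move=> H; have [ap|] := ltP 0 a; [exact: H|rewrite le_eqVlt (negPf a0) /= => ap].
  have := H (- a); rewrite oppr_eq0 abszN normrN oppr_gt0 => /(_ a0 aq ap).
  suff -> : cabs (ee q (- a) - 1) = cabs (ee q a - 1) by [].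
  by rewrite -(cabs_conj (ee q a - 1)) rmorphB rmorph1 -ee_conj.
case: a ap aq {a0} => [n|//] n0 aq; rewrite absz_nat in aq.
have {}n0 : (0 < n)%N by [].
pose m := (q %/ (2 * n))%N.
have m0 : (0 < m)%N by rewrite divn_gt0; lia.
have mle : (2 * (m * n) <= q)%N.
  by have := leq_trunc_div q (2 * n); rewrite -/m; lia.
have mge : (q <= 4 * (m * n))%N.
  have n20 : (0 < 2 * n)%N by lia.
  by have := ltn_ceil q n20; have := leq_pmull n m0; rewrite -/m; lia.
have q0R : 0 < q%:R :> R by rewrite ltr0n.
have H1 : 1 <= cabs (ee q (n%:Z *+ m) - 1).
  apply: le_trans (cabs_Re_ge _).
  rewrite [complex.Re _](_ : _ = cos (2 * pi * (m * n)%N%:R / q%:R) - 1).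
    set t : R := 2 * pi * _ / _.
    have : cos t <= 0.
      rewrite -(subrK (pi / 2) t) cosDpihalf oppr_le0 sin_ge0_pi //.
      have pi0 := pi_ge0 R.
      have e1 : t - pi / 2 = pi * (2 * ((m * n)%N%:R / q%:R) - 1 / 2) :> R.
        by rewrite /t; field; lra.
      have e2 : (m * n)%N%:R / q%:R <= 1 / 2 :> R.
        rewrite ler_pdivrMr //; have : (2 * (m * n))%N%:R <= q%:R :> R.
          by rewrite ler_nat.
        by rewrite natrM; lra.
      have e3 : 1 / 4 <= (m * n)%N%:R / q%:R :> R.
        rewrite ler_pdivlMr //; have : q%:R <= (4 * (m * n))%N%:R :> R.
          by rewrite ler_nat.
        by rewrite natrM; lra.
      by rewrite e1; apply/andP; split; nra.
    by move=> ct; rewrite ler0_norm; lra.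
  rewrite /ee /=; congr (cos _ - 1).
  by have -> : n%:Z *+ m = (m * n)%N; [rewrite -mulr_natl natz PoszM|rewrite -pmulrn].
have H2 : cabs (ee q (n%:Z *+ m) - 1) <= m%:R * cabs (ee q n - 1).
  rewrite ee_natl; elim: (m) => [|k IHk]; first by rewrite expr0 subrr cabs0 mul0r.
  rewrite exprS.
  have -> : ee q n * ee q n ^+ k - 1 = ee q n * (ee q n ^+ k - 1) + (ee q n - 1).
    by ring.
  apply: le_trans (cabsD _ _) _; rewrite cabsM cabs_ee mul1r -addn1 natrD.
  by rewrite mulrDl mul1r lerD2r.
have mR : 0 < m%:R :> R by rewrite ltr0n.
have := le_trans H1 H2; rewrite -ler_pdivrMl // mulr1 => H3.
apply: le_trans H3; rewrite ler_pdivrMr //.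
have : (2 * (m * n))%N%:R <= q%:R :> R by rewrite ler_nat.
rewrite !natrM => H4; rewrite ler_pdivlMl //.
by rewrite ger0_norm // -pmulrn; lra.
Qed.

Lemma ee_neq1 q a : (0 < q)%N -> ~~ (q %| a)%Z -> ee q a != 1.
Proof.
move=> q0 na; apply/eqP => e1.
have qz : (q%:Z != 0) by rewrite eqz_nat -lt0n.
have H b : (2 * `|b| <= q)%N -> b != 0 -> ee q b = 1 -> False.
  move=> bq b0 eb; have := cabs_ee_sub1_ge q0 bq.
  rewrite eb subrr cabs0; apply/negP; rewrite -ltNge.
  by rewrite divr_gt0 ?ltr0n // mulr_gt0 // ltr0z normr_gt0.
have m1 : ee q (a %% q)%Z = 1.
  by rewrite -e1; apply: ee_congr => //; rewrite -opprB rpredN {1}(divz_eq a q) addrK dvdz_mull.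
have m0 : (a %% q)%Z != 0 by apply: contra na => /eqP/dvdz_mod0P.
have mge := modz_ge0 a qz; have mlt : (a %% q)%Z < q by rewrite ltz_pmod.
have [le2|gt2] := leqP (2 * `|(a %% q)%Z|) q; first exact: H le2 m0 m1.
apply: (H ((a %% q)%Z - q%:Z)); [lia|lia|].
rewrite -m1; apply: ee_congr => //.
by rewrite addrAC subrr add0r rpredN.
Qed.

Lemma sum_ee q a : (0 < q)%N ->
  \sum_(t < q) ee q (t%:Z * a) = if (q %| a)%Z then q%:R else 0.
Proof.
move=> q0; case: ifPn => [qa|na].
  rewrite (eq_bigr (fun=> 1)) => [|t _]; last by rewrite ee_dvd // dvdz_mull.
  by rewrite sumr_const card_ord.
have := ee_neq1 q0 na; rewrite -subr_eq0 => /mulfI; apply.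
rewrite mulr0 (eq_bigr (fun t : 'I_q => ee q a ^+ t)) => [|t _].
  rewrite -subrX1 -ee_natl; apply/eqP; rewrite subr_eq0; apply/eqP.
  by apply: ee_dvd => //; rewrite -mulr_natr natz dvdz_mull.
by rewrite -ee_natl; congr ee; rewrite -[in RHS]mulr_natl natz.
Qed.

Lemma cabs_geometric q a M : (0 < q)%N -> a != 0 -> (2 * `|a| <= q)%N ->
  cabs (\sum_(m < M) ee q (m%:Z * a)) <= q%:R / `|a|%:~R.
Proof.
move=> q0 a0 aq; have ge := cabs_ee_sub1_ge q0 aq.
have q0R : 0 < q%:R :> R by rewrite ltr0n.
have a0R : 0 < `|a|%:~R :> R by rewrite ltr0z normr_gt0.
have : (ee q a - 1) * \sum_(m < M) ee q (m%:Z * a) = ee q (a *+ M) - 1.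
  rewrite (eq_bigr (fun m : 'I_M => ee q a ^+ m)) => [|m _].
    by rewrite -subrX1 -ee_natl.
  by rewrite -ee_natl; congr ee; rewrite -[in RHS]mulr_natl natz.
move/(congr1 cabs); rewrite cabsM => e1.
have le2 : cabs (ee q (a *+ M) - 1) <= 2.
  by apply: le_trans (cabsD _ _) _; rewrite cabsN cabs_ee cabs1.
rewrite ler_pdivlMr //.
move: ge le2; rewrite -e1 ler_pdivrMr //; set u := cabs _; set v := cabs _ => ge le2.
have u0 : 0 <= u := cabs_ge0 _; have v0 : 0 <= v := cabs_ge0 _.
have := ler_wpM2l v0 ge; nra.
Qed.

Lemma cabs_ee_sum_le (I : finType) (P : pred I) (f : I -> int) q :
  cabs (\sum_(i | P i) ee q (f i)) <= #|P|%:R.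
Proof.
apply: le_trans (cabs_sum _ _ _) _.
by rewrite (eq_bigr (fun=> 1)) => [|i _]; rewrite ?cabs_ee // sumr_const.
Qed.

End Exponentials.

(** * Kloosterman sums to square moduli *)

Lemma sum_nat_mul (V : nmodType) m n (F : nat -> V) :
  \sum_(y < m * n) F y = \sum_(x < m) \sum_(t < n) F (x + m * t)%N.
Proof.
elim: n => [|n IHn].
  by rewrite muln0 big_ord0 big1 // => x _; rewrite big_ord0.
rewrite mulnSr big_split_ord /= IHn -big_split /=.
by apply: eq_bigr => x _; rewrite big_ord_recr /= addnC.
Qed.

Lemma sum_crt (V : nmodType) m n (F : nat -> nat -> V) : coprime m n ->
    (0 < m)%N -> (0 < n)%N ->
  \sum_(y < m * n) F (y %% m)%N (y %% n)%N = \sum_(x < m) \sum_(z < n) F x z.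
Proof.
move=> co m0 n0; have mn0 : (0 < m * n)%N by rewrite muln_gt0 m0.
rewrite pair_big /=.
pose f (y : 'I_(m * n)) := (Ordinal (ltn_pmod y m0), Ordinal (ltn_pmod y n0)).
rewrite [RHS](reindex f) //=.
pose g (p : 'I_m * 'I_n) := Ordinal (ltn_pmod (chinese m n p.1 p.2) mn0).
exists g => [y _|[x z] _]; rewrite /f /g /=.
  apply/val_inj => /=; have /chinese_mod := co => /(_ y) e.
  by rewrite -e modn_small.
congr (_, _); apply/val_inj => /=.
  by rewrite modn_dvdm ?dvdn_mulr // chinese_modl // modn_small.
by rewrite modn_dvdm ?dvdn_mull // chinese_modr // modn_small.
Qed.

(** A Bezout coefficient in the role of the inverse of [x]. It is not reduced modulo [n], so every
    use goes through a congruence. *)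
Definition invm (n x : nat) : nat := (egcdn x n).1.

Lemma invmP n x : coprime x n -> (n%:Z %| x%:Z * (invm n x)%:Z - 1)%Z.
Proof.
move=> co; have [x0|x0] := posnP x.
  by move: co; rewrite x0 /coprime gcd0n => /eqP ->; rewrite dvd1z.
rewrite /invm; case: egcdnP => // km kn e _ /=.
apply/dvdzP; exists kn%:Z; move: e; rewrite (eqP co) => e.
by rewrite -!PoszM mulnC e addnC PoszD addrAC subrr add0r.
Qed.

Lemma dvdz_inv_unique (n x y y' : int) :
  (n %| x * y - 1)%Z -> (n %| x * y' - 1)%Z -> (n %| y - y')%Z.
Proof.
move=> a b; have -> : y - y' = y * (- (x * y' - 1)) + y' * (x * y - 1) by ring.
by rewrite rpredD ?dvdz_mull // ?rpredN.
Qed.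

Section KloostermanSums.
Variable R : realType.
Implicit Types (h k c : int).

(** The twist [c] is there for the Chinese remainder theorem, which splits a sum modulo [m n] into
    twisted sums modulo [m] and [n]. *)
Definition kloosterman (q : nat) c h k : R[i] :=
  \sum_(y < q | coprime y q) ee R q (c * (h * y%:Z + k * (invm q y)%:Z)).

(* The terms of a Kloosterman sum modulo a square that survive stationary
   phase: [x] runs over the units modulo [n] with [h x^2 = k]. *)
Definition stationary (n : nat) c h k : R[i] :=
  \sum_(x < n | coprime x n && (n%:Z %| k - h * x%:Z ^+ 2)%Z)
    ee R (n ^ 2) (c * (h * x%:Z + k * (invm (n ^ 2) x)%:Z)).

(** Write [y = x + n t]. The inverse of [y] modulo [n ^ 2] is [x' - x' ^ 2 n t], linear in [t], so
    the sum over [t] is a complete character sum modulo [n]. It vanishes unless its frequency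
    [h - k x' ^ 2] does, that is, unless [h x ^ 2 = k] modulo [n]. *)
Lemma kloosterman_square n c h k : (0 < n)%N -> coprimez c n ->
  kloosterman (n ^ 2) c h k = n%:R * stationary n c h k.
Proof.
move=> n0 cn; rewrite /kloosterman /stationary.
pose G (y : nat) : R[i] := if coprime y (n ^ 2) then
  ee R (n ^ 2) (c * (h * y%:Z + k * (invm (n ^ 2) y)%:Z)) else 0.
rewrite big_mkcond /= -/(G) (eq_bigr (fun y : 'I__ => G y)) //.
have -> : \sum_(y < n ^ 2) G y = \sum_(y < n * n) G y by rewrite mulnn.
rewrite sum_nat_mul [in RHS]big_mkcond mulr_sumr /=; apply: eq_bigr => x _.
have coE t : coprime (x + n * t) (n ^ 2) = coprime x n.
  by rewrite coprime_pexpr // /coprime addnC mulnC gcdnC gcdnMDl gcdnC.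
rewrite /G; case: (boolP (coprime x n)) => /= cox; last first.
  rewrite mulr0 big1 // => t _.
  by rewrite coE (negPf cox).
have n20 : (0 < n ^ 2)%N by rewrite expn_gt0 n0.
have coxx : coprime x (n ^ 2) by rewrite coprimeXr.
set x' : int := (invm (n ^ 2) x)%:Z.
have xx' : ((n ^ 2)%N%:Z %| x%:Z * x' - 1)%Z := invmP coxx.
have nn : (n ^ 2)%N%:Z = n%:Z * n%:Z by rewrite -PoszM mulnn.
rewrite (eq_bigr (fun t : 'I_n => ee R (n ^ 2) (c * (h * x%:Z + k * x')) *
    ee R n (t%:Z * (c * (h - k * x' ^+ 2))))) => [|t _]; last first.
  rewrite coE cox -[in ee R n _](ee_scale R n _ n0) mulnn -eeD.
  apply: ee_congr => //.
  have := invmP (etrans (coE t) cox); set z : int := (invm _ _)%:Z => hz.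
  have hz2 : ((n ^ 2)%N%:Z %| z - (x' - x' ^+ 2 * n%:Z * t%:Z))%Z.
    apply: dvdz_inv_unique hz _.
    have [w ew] : exists w, x%:Z * x' = 1 + w * (n%:Z * n%:Z).
      move: xx'; rewrite nn => /dvdzP[w ew]; exists w.
      by rewrite -ew; ring.
    rewrite nn PoszD PoszM; apply/dvdzP.
    exists (w - w * x' * n%:Z * t%:Z - x' ^+ 2 * t%:Z ^+ 2).
    have -> : (x%:Z + n%:Z * t%:Z) * (x' - x' ^+ 2 * n%:Z * t%:Z) - 1 =
      (x%:Z * x') - (x%:Z * x') * x' * n%:Z * t%:Z + n%:Z * t%:Z * x' -
      x' ^+ 2 * t%:Z ^+ 2 * (n%:Z * n%:Z) - 1 by ring.
    by rewrite ew; ring.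
  move: hz2 => /dvdzP[w ew].
  have -> : z = x' - x' ^+ 2 * n%:Z * t%:Z + w * (n ^ 2)%N%:Z.
    by rewrite -ew; ring.
  apply/dvdzP; exists (c * k * w).
  by rewrite PoszD PoszM; ring.
rewrite -mulr_sumr sum_ee // mulrC.
have -> : (n%:Z %| c * (h - k * x' ^+ 2))%Z = (n%:Z %| k - h * x%:Z ^+ 2)%Z.
  rewrite Gauss_dvdzr; last by rewrite coprimez_sym.
  have xn : (n%:Z %| x%:Z * x' - 1)%Z.
    by apply: dvdz_trans xx'; rewrite nn dvdz_mulr.
  move: xn => /dvdzP[w ew].
  have e1 : x%:Z * x' = 1 + w * n%:Z by rewrite -ew; ring.
  apply/idP/idP => /dvdzP[v ev]; apply/dvdzP.
    exists (- v * x%:Z ^+ 2 - k * w * (2 + w * n%:Z)).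
    have -> : k - h * x%:Z ^+ 2 = - ((h - k * x' ^+ 2) * x%:Z ^+ 2) -
       k * ((x%:Z * x') ^+ 2 - 1) by ring.
    by rewrite ev e1; ring.
  exists (- v * x' ^+ 2 - h * w * (2 + w * n%:Z)).
  have -> : h - k * x' ^+ 2 = - ((k - h * x%:Z ^+ 2) * x' ^+ 2) -
       h * ((x%:Z * x') ^+ 2 - 1) by ring.
  by rewrite ev e1; ring.
by case: ifP => _; rewrite ?mul0r ?mulr0.
Qed.

(** The relation [n c1 + m c2 = 1] modulo [m n] splits the additive character, and modulo each
    factor the inverse of [y] is the inverse of the residue of [y]. *)
Lemma kloosterman_crt m n c1 c2 h k : coprime m n -> (0 < m)%N -> (0 < n)%N ->
    (m%:Z %| n%:Z * c1 - 1)%Z -> (n%:Z %| m%:Z * c2 - 1)%Z ->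
  kloosterman (m * n) 1 h k = kloosterman m c1 h k * kloosterman n c2 h k.
Proof.
move=> co m0 n0 h1 h2; rewrite /kloosterman.
pose G (x z : nat) : R[i] := if coprime x m && coprime z n then
  ee R m (c1 * (h * x%:Z + k * (invm m x)%:Z)) *
  ee R n (c2 * (h * z%:Z + k * (invm n z)%:Z)) else 0.
transitivity (\sum_(y < m * n) G (y %% m)%N (y %% n)%N); last first.
  rewrite sum_crt // mulr_suml [RHS]big_mkcond; apply: eq_bigr => x _ /=.
  rewrite /G; case: ifP => cx; last by rewrite big1.
  rewrite mulr_sumr [RHS]big_mkcond; apply: eq_bigr => z _ /=.
  by case: ifP.
rewrite big_mkcond; apply: eq_bigr => y _ /=.
rewrite /G coprimeMr !coprime_modl.
case: ifP => // /andP[cym cyn].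
have mn0 : (0 < m * n)%N by rewrite muln_gt0 m0.
rewrite -[ee R m _](ee_scale R m _ n0) -[ee R n _](ee_scale R n _ m0).
rewrite [(n * m)%N]mulnC -eeD; apply: ee_congr => //.
have iy : ((m * n)%N%:Z %| y%:Z * (invm (m * n) y)%:Z - 1)%Z.
  by apply: invmP; rewrite coprimeMr cym.
set y' : int := (invm _ _)%:Z in iy *.
have key p (s : int) : (0 < p)%N -> coprime y p -> (p%:Z %| (m * n)%N%:Z)%Z ->
    (p%:Z %| s - 1)%Z ->
    (p%:Z %| h * y%:Z + k * y' - s * (h * (y %% p)%N%:Z + k * (invm p (y %% p))%:Z))%Z.
  move=> p0 cp pmn /dvdzP[w1 e1].
  have := dvdz_trans pmn iy => i1.
  have i2 : (p%:Z %| y%:Z * (invm p (y %% p))%:Z - 1)%Z.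
    have cop : coprime (y %% p) p by rewrite coprime_modl.
    have := invmP cop; set u : int := (invm _ _)%:Z => /dvdzP[w ew].
    apply/dvdzP; exists (w + (y %/ p)%N%:Z * u).
    rewrite {1}(divn_eq y p) PoszD PoszM.
    have -> : ((y %/ p)%N%:Z * p%:Z + (y %% p)%N%:Z) * u - 1 =
      (y %/ p)%N%:Z * p%:Z * u + ((y %% p)%N%:Z * u - 1) by ring.
    by rewrite ew; ring.
  have /dvdzP[w2 e2] := dvdz_inv_unique i1 i2.
  have -> : s = 1 + w1 * p%:Z by rewrite -e1; ring.
  have -> : y' = (invm p (y %% p))%:Z + w2 * p%:Z by rewrite -e2; ring.
  have -> : y%:Z = (y %/ p)%N%:Z * p%:Z + (y %% p)%N%:Z.
    by rewrite -PoszM -PoszD -divn_eq.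
  apply/dvdzP; exists (h * (y %/ p)%N%:Z + k * w2 - w1 * (h * (y %% p)%N%:Z + k * (invm p (y %% p))%:Z)).
  by ring.
rewrite PoszM Gauss_dvdz; last by rewrite coprimezE.
rewrite mul1r; apply/andP; split.
  have mmn : (m%:Z %| (m * n)%N%:Z)%Z by rewrite PoszM dvdz_mulr.
  have /dvdzP[w ew] := key m (n%:Z * c1) m0 cym mmn h1.
  apply/dvdzP; exists (w - c2 * (h * (y %% n)%N%:Z + k * (invm n (y %% n))%:Z)).
  by rewrite mulrBl -ew; ring.
have nmn : (n%:Z %| (m * n)%N%:Z)%Z by rewrite PoszM dvdz_mull.
have /dvdzP[w ew] := key n (m%:Z * c2) n0 cyn nmn h2.
apply/dvdzP; exists (w - c1 * (h * (y %% m)%N%:Z + k * (invm m (y %% m))%:Z)).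
by rewrite mulrBl -ew; ring.
Qed.

End KloostermanSums.

Definition omega (n : nat) : nat := size (primes n).

(** An odd [p] cannot divide both [x - a] and [x + a], since it would divide [2 a]. For [p = 2] both
    may be even, but their halves differ by the odd number [a], so one half is a unit; the doubling
    in the conclusion absorbs this case. *)
Lemma part_dvd_double (n p : nat) (a x : int) : prime p -> (0 < n)%N -> (p %| n)%N ->
    coprimez a n -> (n%:Z %| x ^+ 2 - a ^+ 2)%Z ->
    ((n`_p)%N%:Z %| 2 * (x - a))%Z || ((n`_p)%N%:Z %| 2 * (x + a))%Z.
Proof.
move=> pp n0 pn ca nx; set P : nat := (n`_p)%N.
have Pp : P = (p ^ logn p n)%N by rewrite /P p_part.
have Px : (P%:Z %| (x - a) * (x + a))%Z.
  have -> : (x - a) * (x + a) = x ^+ 2 - a ^+ 2 by ring.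
  by apply: dvdz_trans nx; rewrite dvdzE /= dvdn_part.
have pa : ~~ (p%:Z %| a)%Z.
  rewrite dvdzE /= -prime_coprime // coprime_sym.
  by apply: coprime_dvdr pn _; move: ca; rewrite coprimezE.
have gauss (y z : int) : ~~ (p%:Z %| y)%Z -> (P%:Z %| y * z)%Z -> (P%:Z %| z)%Z.
  move=> py; rewrite Gauss_dvdzr // coprimezE Pp coprimeXl //.
  by rewrite prime_coprime.
have [pxa|pxa] := boolP (p%:Z %| x - a)%Z; last first.
  by apply/orP; right; rewrite dvdz_mull // (gauss _ _ pxa).
have [pya|pya] := boolP (p%:Z %| x + a)%Z; last first.
  by apply/orP; left; rewrite dvdz_mull // (gauss _ _ pya) // mulrC.
have p2 : p = 2.
  have : (p%:Z %| 2 * a)%Z.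
    have -> : 2 * a = (x + a) - (x - a) by ring.
    by rewrite rpredB.
  rewrite Gauss_dvdzl; first by rewrite dvdzE /= dvdn_prime2 // => /eqP.
  by rewrite coprimezE prime_coprime.
move: pxa pya; rewrite p2 => /dvdzP[u eu] /dvdzP[w ew].
have [u2|u2] := boolP (2 %| u)%Z.
  have w2 : ~~ (2 %| w)%Z.
    apply: contra pa => w2; rewrite p2.
    have -> : a = w - u by move: eu ew; clear; lia.
    by rewrite rpredB.
  apply/orP; left; apply: (gauss w); first by rewrite p2.
  by rewrite eu; move: Px; rewrite eu ew; congr (_ %| _)%Z; ring.
apply/orP; right; apply: (gauss u); first by rewrite p2.
by rewrite ew; move: Px; rewrite eu ew; congr (_ %| _)%Z; ring.
Qed.

(** The set of primes at which the first alternative of [part_dvd_double] holds determines [2 x]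
    modulo [n]; the extra bit [2 x < n] separates the two [x] that may share a double. *)
Lemma card_square_roots (n : nat) (a : int) : (0 < n)%N -> coprimez a n ->
  (#|[pred x : 'I_n | (n%:Z %| (x%:Z ^+ 2 - a ^+ 2)%R)%Z]| <= 2 * 2 ^ omega n)%N.
Proof.
move=> n0 ca; set A := [pred x : 'I_n | _].
pose T (x : 'I_n) : {set 'I_(omega n)} * bool :=
  ([set i : 'I_(omega n) | ((n`_(nth 0%N (primes n) i))%N%:Z %| 2 * (x%:Z - a))%Z], (2 * x < n)%N).
have injT : {in A &, injective T}.
  move=> x y; rewrite !inE => nx ny [] /setP eT eb.
  suff : (n%:Z %| 2 * (x%:Z - y%:Z))%Z.
    move=> /dvdzP[w ew]; apply/val_inj => /=.
    have := ltn_ord x; have := ltn_ord y.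
    move: {eT nx ny}(val x) (val y) eb ew => /= {}x {}y eb ew yn xn.
    (* Here [2 (x - y) = w n] and [|x - y| < n]. The values [w = 1] and [w = -1] would put [x] and
       [y] on different sides of [n / 2]. *)
    have [e|[e|e]] : w = 0 \/ w = 1 \/ w = -1 by clear -ew xn yn; nia.
    - by rewrite e in ew; clear -ew; lia.
    - by rewrite e in ew; clear -ew eb xn yn; lia.
    by rewrite e in ew; clear -ew eb xn yn; lia.
  rewrite dvdzE; apply/dvdn_partP => // p; rewrite mem_primes => /and3P[pp _ pn].
  have ip : (index p (primes n) < omega n)%N.
    by rewrite index_mem mem_primes pp n0.
  have := eT (Ordinal ip); rewrite !inE /= nth_index; last by rewrite mem_primes pp n0.
  have := part_dvd_double pp n0 pn ca nx; have := part_dvd_double pp n0 pn ca ny.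
  have [p1|p1] := boolP (_ %| 2 * (x%:Z - a))%Z => /=.
    move=> _ _ /esym p2.
    have : ((n`_p)%N%:Z %| 2 * (x%:Z - y%:Z))%Z.
      have -> : 2 * (x%:Z - y%:Z) = 2 * (x%:Z - a) - 2 * (y%:Z - a) by ring.
      by rewrite rpredB.
    by rewrite dvdzE.
  move=> + p2 /esym /negbT p3; rewrite (negPf p3) /= => p4.
  have : ((n`_p)%N%:Z %| 2 * (x%:Z - y%:Z))%Z.
    have -> : 2 * (x%:Z - y%:Z) = 2 * (x%:Z + a) - 2 * (y%:Z + a) by ring.
    by rewrite rpredB.
  by rewrite dvdzE.
rewrite -(card_in_image injT); apply: leq_trans (max_card _) _.
by rewrite card_prod card_bool mulnC leq_mul2l /= -cardsT -powersetT card_powerset cardsT card_ord.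
Qed.

Lemma omega_dvd m n : (0 < n)%N -> (m %| n)%N -> (omega m <= omega n)%N.
Proof.
move=> n0 mn; apply: uniq_leq_size (primes_uniq m) _ => p.
rewrite !mem_primes => /and3P[-> m0 pm] /=.
by rewrite n0 (dvdn_trans pm).
Qed.

(** A solution forces [g | k]. After division by [g], all solutions become square roots of one
    [a ^ 2] modulo [n / g], and each class modulo [n / g] has [g] lifts. *)
Lemma card_quadratic_roots (n : nat) (h k : int) : (0 < n)%N ->
  (#|[pred x : 'I_n | coprime x n && (n%:Z %| (k - h * x%:Z ^+ 2)%R)%Z]| <=
   2 * 2 ^ omega n * gcdn `|h| n * ((gcdn `|h| n)%N%:Z %| k)%Z)%N.
Proof.
move=> n0; set A := [pred x : 'I_n | _]; set g := gcdn _ _.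
have g0 : (0 < g)%N by rewrite gcdn_gt0 n0 orbT.
have [a Aa|A0] := pickP A; last by rewrite (eq_card0 A0).
have /andP[coa na] := Aa.
have gh : (g%:Z %| h)%Z by rewrite dvdzE /= dvdn_gcdl.
have gn : (g %| n)%N by rewrite dvdn_gcdr.
have gk : (g%:Z %| k)%Z.
  rewrite -[k](subrK (h * a%:Z ^+ 2)) rpredD //; last by rewrite dvdz_mulr.
  by apply: dvdz_trans na; rewrite dvdzE.
rewrite gk muln1; pose n' := (n %/ g)%N.
have n'0 : (0 < n')%N by rewrite divn_gt0 // dvdn_leq.
have nE : n = (n' * g)%N by rewrite divnK.
have n'n : (n' %| n)%N by rewrite nE dvdn_mulr.
pose f (x : 'I_n) := (Ordinal (ltn_pmod x n'0), (Ordinal (ltn_pmod (x %/ n') g0))).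
have injf : {in A &, injective f}.
  move=> x y _ _ [] e1 e2; apply/val_inj => /=.
  have lt z : (z < n)%N -> ((z %/ n') %% g = z %/ n')%N.
    by move=> zn; rewrite modn_small // ltn_divLR // mulnC -nE.
  rewrite (divn_eq x n') (divn_eq y n') e1; congr (_ * _ + _)%N.
  by rewrite -(lt x) // -(lt y).
rewrite -(card_in_image injf).
have ca : coprimez a%:Z n' by rewrite coprimezE; apply: coprime_dvdr n'n _.
have /subset_leq_card : [seq f x | x in A] \subset
   [predX [pred x : 'I_n' | (n'%:Z %| x%:Z ^+ 2 - a%:Z ^+ 2)%Z] & 'I_g].
  apply/fintype.subsetP => z /fintype.imageP[x /andP[cox nx] ->]; rewrite !inE andbT /=.
  have e : ((n' * g)%N%:Z %| h * (x%:Z ^+ 2 - a%:Z ^+ 2))%Z.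
    rewrite -nE; have -> : h * (x%:Z ^+ 2 - a%:Z ^+ 2) =
      (k - h * a%:Z ^+ 2) - (k - h * x%:Z ^+ 2) by ring.
    by rewrite rpredB.
  have : (n'%:Z %| x%:Z ^+ 2 - a%:Z ^+ 2)%Z.
    have /dvdzP[h' eh] := gh.
    have gz : g%:Z != 0 by rewrite eqz_nat -lt0n.
    have : (n'%:Z %| h' * (x%:Z ^+ 2 - a%:Z ^+ 2))%Z.
      move: e; rewrite eh PoszM [h' * _]mulrC -mulrA [n'%:Z * _]mulrC.
      by rewrite dvdz_mul2l ?unitfE.
    rewrite Gauss_dvdzr // coprimezE /=.
    have := eh => /(congr1 absz); rewrite abszM absz_nat => eh'.
    have : gcdn `|h| n = (gcdn `|h'| n' * g)%N by rewrite eh' {1}nE muln_gcdl.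
    rewrite -/g coprime_sym /coprime.
    by move=> eg; rewrite -(eqn_pmul2r g0) -eg mul1n.
  rewrite {1}(divn_eq x n') PoszD PoszM => /dvdzP[w ew].
  apply/dvdzP; exists (w - (x %/ n')%N%:Z ^+ 2 * n'%:Z - 2 * (x %/ n')%N%:Z * (x %% n')%N%:Z).
  by rewrite !mulrBl -ew; ring.
move/leq_trans; apply; rewrite cardX card_ord leq_mul2r.
apply/orP; right; apply: leq_trans (card_square_roots n'0 ca) _.
by rewrite leq_mul2l leq_exp2l //= omega_dvd.
Qed.

(** * Correlations of Kloosterman sums *)

Section FourCorrelation.
Variable R : realType.

Lemma size_mul_le (F : nzRingType) (p q : {poly F}) m n :
  (size p <= m.+1)%N -> (size q <= n.+1)%N -> (size (p * q)%R <= (m + n).+1)%N.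
Proof. by move=> pm qn; apply: leq_trans (size_polyMleq _ _) _; lia. Qed.

Lemma size_add_le (F : nzRingType) (p q : {poly F}) n :
  (size p <= n)%N -> (size q <= n)%N -> (size (p + q)%R <= n)%N.
Proof. by move=> pn qn; apply: leq_trans (size_polyD _ _) _; rewrite geq_max pn. Qed.

(* [y0 + y1 + y2 + y3 = 0] forces this symmetric expression in the squares
   [yi ^ 2] to vanish: it is the product of [y0 +- y1 +- y2 +- y3]. *)
Definition radical_norm (F : comNzRingType) (a b c d : F) : F :=
  ((a + b - c - d) ^+ 2 - (a * b) *+ 4 - (c * d) *+ 4) ^+ 2 - (a * b * c * d) *+ 64.

Lemma radical_norm_eq0 (F : comNzRingType) (a b c d t : F) : a + b + c + d = 0 ->
  radical_norm (a ^+ 2 * t) (b ^+ 2 * t) (c ^+ 2 * t) (d ^+ 2 * t) = 0.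
Proof.
move=> /eqP; rewrite addr_eq0 => /eqP e.
have -> : d = - (a + b + c) by rewrite e opprK.
by rewrite /radical_norm; ring.
Qed.

Lemma rmorph_radical_norm (F G : comNzRingType) (f : {rmorphism F -> G}) a b c d :
  f (radical_norm a b c d) = radical_norm (f a) (f b) (f c) (f d).
Proof. by rewrite /radical_norm !(rmorphB, rmorphXn, rmorphMn, rmorphM, rmorphD) /=. Qed.

Section Radicals.
Variables (F : fieldType) (s kap : 'I_4 -> F).
Hypothesis s0 : s ord0 != 0.
Hypothesis kap0 : forall m : 'I_4, m != ord0 -> kap m != kap ord0.

Let l (n : 'I_4) : {poly F} := 'X + (kap n)%:P.
Let a (n : 'I_4) : {poly F} := (s n)%:P * \prod_(m < 4 | m != n) l m.
Let o1 : 'I_4 := @Ordinal 4 1 isT.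
Let o2 : 'I_4 := @Ordinal 4 2 isT.
Let o3 : 'I_4 := @Ordinal 4 3 isT.

(** If [x_n ^ 2 = u + kap n] and [(y_n x_n) ^ 2 = s n], then [a n] at [u] equals [y_n ^ 2] times the
    common factor [\prod x_m ^ 2]. Clearing denominators in this way makes [\sum y_n = 0] imply a
    polynomial condition on [u]. *)
Definition radical_poly : {poly F} := radical_norm (a ord0) (a o1) (a o2) (a o3).

Lemma size_radical_poly : (size radical_poly <= 13)%N.
Proof.
have sl n : (size (l n) <= 2)%N by rewrite /l size_XaddC.
have sC (x : F) n : (size x%:P <= n.+1)%N by apply: leq_trans (size_polyC_leq1 _) _.
have sa n : (size (a n) <= 4)%N.
  rewrite /a; apply: (@size_mul_le _ _ _ 0 3) => //.
  have H (r : seq 'I_4) (P : pred 'I_4) :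
      (size (\prod_(m <- r | P m) l m)%R <= (count P r).+1)%N.
    elim: r => [|m r IHr]; first by rewrite big_nil size_poly1.
    rewrite big_cons /=; case: (P m) => //=.
    exact: (@size_mul_le _ _ _ 1).
  apply: leq_trans (H _ _) _; rewrite ltnS.
  rewrite -sum1_count sum1_card.
  by rewrite (eq_card (_ : _ =i predC1 n)) // cardC1 card_ord.
have s4 (p : {poly F}) m (n : nat) : (size p <= m)%N -> (size (p *+ n)%R <= m)%N.
  by move=> pm; elim: n => [|n IHn]; rewrite ?mulr0n ?size_poly0 // mulrS size_add_le.
have sN (p : {poly F}) m : (size p <= m)%N -> (size (- p)%R <= m)%N by rewrite size_polyN.
rewrite /radical_poly /radical_norm.
apply: size_add_le; last first.
  apply: sN; apply: s4.
  apply: (@size_mul_le _ _ _ 9 3) => //; apply: (@size_mul_le _ _ _ 6 3) => //.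
  by apply: (@size_mul_le _ _ _ 3 3).
rewrite expr2; apply: (@size_mul_le _ _ _ 6 6).
- apply: size_add_le; last by apply: sN; apply: s4; apply: (@size_mul_le _ _ _ 3 3).
  apply: size_add_le; last by apply: sN; apply: s4; apply: (@size_mul_le _ _ _ 3 3).
  by rewrite expr2; apply: (@size_mul_le _ _ _ 3 3); do 3?[apply: size_add_le => //]; rewrite size_polyN.
apply: size_add_le; last by apply: sN; apply: s4; apply: (@size_mul_le _ _ _ 3 3).
apply: size_add_le; last by apply: sN; apply: s4; apply: (@size_mul_le _ _ _ 3 3).
by rewrite expr2; apply: (@size_mul_le _ _ _ 3 3); do 3?[apply: size_add_le => //]; rewrite size_polyN.
Qed.

(** At [u = - kap ord0] the products [a n] with [n != ord0] contain a vanishing factor, and the norm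
    collapses to the fourth power of [a ord0]. Only the ratio at [ord0] has to be isolated; the
    other three may coincide. *)
Lemma radical_poly_neq0 : radical_poly != 0.
Proof.
have az n : n != ord0 -> (a n).[- kap ord0] = 0.
  move=> n0; rewrite /a hornerM (bigD1 ord0) 1?eq_sym //= hornerM hornerD hornerX hornerC.
  by rewrite hornerC addNr mul0r mulr0.
have a0 : (a ord0).[- kap ord0] != 0.
  rewrite /a hornerM hornerC mulf_neq0 // horner_prod; apply/prodf_neq0 => m m0.
  by rewrite hornerD hornerX hornerC addrC subr_eq0 kap0.
apply/eqP => /(congr1 (horner_eval (- kap ord0))).
rewrite /radical_poly rmorph_radical_norm rmorph0.
change (radical_norm (a ord0).[- kap ord0] (a o1).[- kap ord0]
  (a o2).[- kap ord0] (a o3).[- kap ord0] = 0 -> False).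
rewrite (az o1) // (az o2) // (az o3) // /radical_norm !(mulr0, mul0r, addr0, oppr0, subr0, mul0rn).
by apply/eqP; rewrite !expf_neq0.
Qed.

Lemma root_radical_poly (u : F) (x y : 'I_4 -> F) :
    (forall n, x n ^+ 2 = u + kap n) -> (forall n, (y n * x n) ^+ 2 = s n) ->
    \sum_n y n = 0 -> root radical_poly u.
Proof.
move=> xu ys y0; apply/eqP; rewrite -[LHS]/(horner_eval u _).
rewrite /radical_poly rmorph_radical_norm.
change (radical_norm (a ord0).[u] (a o1).[u] (a o2).[u] (a o3).[u] = 0).
have E n : (a n).[u] = y n ^+ 2 * \prod_(m < 4) x m ^+ 2.
  rewrite /a hornerM hornerC -ys exprMn [in RHS](bigD1 n) //= [RHS]mulrA; congr (_ * _).
  rewrite horner_prod; apply: eq_bigr => m _.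
  by rewrite hornerD hornerX hornerC xu.
rewrite !E; apply: radical_norm_eq0; rewrite -y0 !big_ord_recl big_ord0 addr0 !addrA.
by congr (_ + y _ + y _ + y _); apply/val_inj.
Qed.

End Radicals.

Lemma Euclid_dvdzM (p : nat) (x y : int) : prime p ->
  (p%:Z %| x * y)%Z = (p%:Z %| x)%Z || (p%:Z %| y)%Z.
Proof. by move=> pp; rewrite !dvdzE /= abszM Euclid_dvdM. Qed.

Lemma card_roots_prime (r : nat) (h k : int) : prime r -> ~~ (r%:Z %| h)%Z ->
  (#|[pred x : 'I_r | coprime x r && (r%:Z %| (k - h * x%:Z ^+ 2)%R)%Z]| <= 2)%N.
Proof.
move=> pr nh; set A := [pred x | _].
have [a Aa|A0] := pickP A; last by rewrite (eq_card0 A0).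
have /andP[_ ka] := Aa.
have r0 := prime_gt0 pr.
pose b : 'I_r := Ordinal (ltn_pmod (r - a) r0).
have : A \subset pred2 a b.
  apply/fintype.subsetP.
  move=> x; rewrite !inE => /andP[_ kx].
  have : (r%:Z %| h * ((x%:Z - a%:Z) * (x%:Z + a%:Z)))%Z.
    have -> : h * ((x%:Z - a%:Z) * (x%:Z + a%:Z)) =
      (k - h * a%:Z ^+ 2) - (k - h * x%:Z ^+ 2) by ring.
    by rewrite rpredB.
  rewrite !Euclid_dvdzM // (negPf nh) /=.
  have xr := ltn_ord x; have ar := ltn_ord a.
  move=> /orP[/dvdzP[w ew]|/dvdzP[w ew]]; apply/orP; [left|right]; apply/eqP/val_inj => /=.
    have w0 : w = 0 by clear -ew xr ar; move: (nat_of_ord x) (nat_of_ord a) ew xr ar => {}x {}a; nia.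
    by move: ew; rewrite w0; lia.
  have [xa0|xa0] := posnP (x + a)%N.
    by have -> : nat_of_ord a = 0%N by [lia]; rewrite subn0 modnn; lia.
  have w1 : (x + a)%N = r.
    have w1 : w = 1.
      by clear -ew xr ar xa0; move: (nat_of_ord x) (nat_of_ord a) ew xr ar xa0 => {}x {}a; nia.
    by move: ew; rewrite w1; lia.
  by rewrite (_ : (r - a)%N = x :> nat) ?modn_small //; clear -w1; lia.
move/subset_leq_card => /leq_trans; apply.
by rewrite card2; case: (_ != _).
Qed.


Lemma card_ffun_family_le (I J : finType) (F : I -> pred J) m :
  (forall i, #|F i| <= m)%N -> (#|[pred f : {ffun I -> J} | [forall i, F i (f i)]]| <= m ^ #|I|)%N.
Proof.
move=> Fm; have -> : #|[pred f : {ffun I -> J} | [forall i, F i (f i)]]| = #|family F|.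
  by apply: eq_card => f; rewrite !inE; apply: eq_forallb => i.
rewrite card_family /image_mem cardT !enumT.
elim: (Finite.enum I) => //= i s IHs.
by rewrite expnS leq_mul.
Qed.

(** The root condition modulo [r] does not see the part [r t] of the shift, so [t] survives only in
    a character modulo [r] whose frequency is proportional to the inverse of the root. *)
Lemma stationary_shift (r : nat) (c h k : int) (u t : nat) : (0 < r)%N ->
  stationary R r c h (k + (u + r * t)%N%:Z * h) =
  \sum_(x < r) if coprime x r && (r%:Z %| k + u%:Z * h - h * x%:Z ^+ 2)%Z then
    ee R (r ^ 2) (c * (h * x%:Z + (k + u%:Z * h) * (invm (r ^ 2) x)%:Z)) *
    ee R r (t%:Z * (c * h * (invm (r ^ 2) x)%:Z)) else 0.
Proof.
move=> r0; rewrite /stationary big_mkcond; apply: eq_bigr => x _ /=.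
have -> : (r%:Z %| k + (u + r * t)%N%:Z * h - h * x%:Z ^+ 2)%Z =
          (r%:Z %| k + u%:Z * h - h * x%:Z ^+ 2)%Z.
  have -> : k + (u + r * t)%N%:Z * h - h * x%:Z ^+ 2 =
    (k + u%:Z * h - h * x%:Z ^+ 2) + t%:Z * h * r%:Z by rewrite PoszD PoszM; ring.
  by rewrite rpredDr // dvdz_mull.
case: ifP => // _.
rewrite -[ee R r _](ee_scale R r _ r0) mulnn -eeD; congr ee.
by rewrite PoszD PoszM; ring.
Qed.

Section FourTerms.
Variables (r : nat) (c h k : 'I_4 -> int).
Hypothesis pr : prime r.
Hypothesis cr : forall n, ~~ (r%:Z %| c n)%Z.
Hypothesis hk : forall m : 'I_4, m != ord0 ->
  ~~ (r%:Z %| h ord0 * k m - h m * k ord0)%Z.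

Let compat (u : nat) (f : {ffun 'I_4 -> 'I_r}) :=
  [forall n, coprime (f n) r && (r%:Z %| (k n + u%:Z * h n - h n * (f n)%:Z ^+ 2)%R)%Z].
Let slope (f : {ffun 'I_4 -> 'I_r}) : int :=
  \sum_n c n * h n * (invm (r ^ 2) (f n))%:Z.

Lemma compat_unit u f : compat u f -> forall n, ~~ (r%:Z %| h n)%Z.
Proof.
move=> /forallP uf n; apply/negP => rh.
have := uf n => /andP[_]; rewrite -addrA rpredDr; last first.
  by rewrite rpredB //; [exact: dvdz_mull | exact: dvdz_mulr].
move=> rk; have [n0|n0] := eqVneq n ord0.
  have := hk (isT : (@Ordinal 4 1 isT) != ord0); rewrite -n0 rpredB //.
    exact: dvdz_mulr.
  exact: dvdz_mull.
by have := hk n0; rewrite rpredB //; [exact: dvdz_mull | exact: dvdz_mulr].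
Qed.

Let F := 'F_r.
Let phi (z : int) : F := z%:~R.
Let s n : F := phi (c n * h n) ^+ 2.
Let kap n : F := phi (k n) / phi (h n).

Let phi0 z : (phi z == 0) = (r%:Z %| z)%Z.
Proof. by rewrite /phi (dvdz_pcharf (pchar_Fp pr)). Qed.

Let phiM a b : phi (a * b) = phi a * phi b. Proof. exact: rmorphM. Qed.
Let phiB a b : phi (a - b) = phi a - phi b. Proof. exact: rmorphB. Qed.
Let phiD a b : phi (a + b) = phi a + phi b. Proof. exact: rmorphD. Qed.

Lemma compat_root u f : compat u f -> (r%:Z %| slope f)%Z ->
  root (radical_poly s kap) (phi u%:Z).
Proof.
move=> uf; rewrite -phi0 => /eqP.
have hu := compat_unit uf; have /forallP {}uf := uf.
pose x n := phi (f n)%:Z.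
pose y n := phi (c n * h n) * phi (invm (r ^ 2) (f n))%:Z.
have xi n : x n * phi (invm (r ^ 2) (f n))%:Z = 1.
  have /andP[co _] := uf n.
  have /invmP : coprime (f n) (r ^ 2) by rewrite coprimeXr.
  have rr : (r%:Z %| (r ^ 2)%N%:Z)%Z by rewrite -mulnn PoszM dvdz_mulr.
  move=> /(dvdz_trans rr).
  by rewrite -phi0 /phi rmorphB rmorphM /= subr_eq0 => /eqP.
move=> e; apply: (@root_radical_poly _ _ _ _ x y) => [n|n|].
- have /andP[_] := uf n; rewrite -phi0 /kap /x.
  have := hu n; rewrite -phi0 => hn.
  rewrite expr2 phiB phiD !phiM subr_eq0 => /eqP e1.
  by apply: (mulfI hn); rewrite expr2 -e1; field.
- by rewrite /y /s -mulrA [phi _ * x n]mulrC xi mulr1.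
rewrite /y -[RHS]e /slope /phi rmorph_sum /=; apply: eq_bigr => n _.
by rewrite !rmorphM.
Qed.

Lemma card_compat u : (#|[pred f | compat u f]| <= 16)%N.
Proof.
have [f uf|none] := pickP [pred f | compat u f]; last by rewrite (eq_card0 none).
have hu := compat_unit uf.
apply: leq_trans (@card_ffun_family_le _ _ (fun n : 'I_4 =>
  [pred x : 'I_r | coprime x r && (r%:Z %| ((k n + u%:Z * h n) - h n * x%:Z ^+ 2)%R)%Z]) 2 _) _.
- by move=> n; apply: card_roots_prime.
by rewrite card_ord.
Qed.

(** With the shift split as [u + r t], the sum over [t] forces [slope] to vanish modulo [r], and
    then [u] is a root of [radical_poly]. At most [12] values of [u], at most [2 ^ 4] choices of the
    four roots and the factor [r] from the sum over [t] give [192 r]. *)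
Lemma sum_four_correlation :
  cabs (\sum_(u < r ^ 2) \prod_n stationary R r (c n) (h n) (k n + u%:Z * h n)) <=
  192 * r%:R.
Proof.
have r0 := prime_gt0 pr.
pose G (u : nat) := \prod_n stationary R r (c n) (h n) (k n + u%:Z * h n).
have -> : \sum_(u < r ^ 2) \prod_n stationary R r (c n) (h n) (k n + u%:Z * h n) =
   \sum_(u < r * r) G u by rewrite mulnn.
rewrite sum_nat_mul.
pose ph u (f : {ffun 'I_4 -> 'I_r}) := \prod_n ee R (r ^ 2)
  (c n * (h n * (f n)%:Z + (k n + u%:Z * h n) * (invm (r ^ 2) (f n))%:Z)).
have E (u : nat) : \sum_(t < r) G (u + r * t)%N =
    \sum_(f | compat u f) ph u f * (if (r%:Z %| slope f)%Z then r%:R else 0).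
  under eq_bigr do rewrite /G.
  transitivity (\sum_(t < r) \sum_(f | compat u f) ph u f * ee R r (t%:Z * slope f)).
    apply: eq_bigr => t _.
    under eq_bigr do rewrite stationary_shift //.
    rewrite bigA_distr_bigA [RHS]big_mkcond; apply: eq_bigr => f _ /=.
    case: ifPn => [/forallP uf|]; last first.
      rewrite negb_forall => /existsP[n]; rewrite (bigD1 n) //= => /negPf ->.
      by rewrite mul0r.
    rewrite (eq_bigr (fun n => ee R (r ^ 2) (c n * (h n * (f n)%:Z + (k n + u%:Z * h n) *
       (invm (r ^ 2) (f n))%:Z)) * ee R r (t%:Z * (c n * h n * (invm (r ^ 2) (f n))%:Z)))).
      rewrite big_split /=; congr (_ * _); rewrite /slope mulr_sumr.
      by elim/big_ind2: _ => [|a1 b1 a2 b2 -> ->|//]; rewrite ?ee0 ?eeD.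
    by move=> n _; rewrite uf.
  rewrite exchange_big; apply: eq_bigr => f _ /=.
  by rewrite -mulr_sumr sum_ee.
apply: le_trans (cabs_sum _ _ _) _.
have phn u f : cabs (ph u f) = 1.
  rewrite /ph; elim/big_ind: _ => [|a b ea eb|n _]; rewrite ?cabs1 ?cabs_ee //.
  by rewrite cabsM ea eb mulr1.
have r0R : 0 <= r%:R :> R by rewrite ler0n.
pose rt (u : nat) : bool := root (radical_poly s kap) (phi u%:Z) &&
  [exists f, compat u f].
apply: (@le_trans _ _ (\sum_(u < r) (rt u)%:R * (16 * r%:R))).
  apply: ler_sum => u _; rewrite E; apply: le_trans (cabs_sum _ _ _) _.
  case: (boolP (rt u)) => ru; last first.
    rewrite mul0r big1 // => f uf; case: ifP => [sf|]; last by rewrite mulr0 cabs0.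
    by case/negP: ru; rewrite /rt (compat_root uf sf); apply/existsP; exists f.
  rewrite mul1r; apply: (@le_trans _ _ (\sum_(f | compat u f) r%:R)).
    apply: ler_sum => f _; rewrite cabsM phn mul1r.
    by case: ifP => _; rewrite ?cabs_nat ?cabs0.
  rewrite sumr_const -[leLHS]mulr_natl; apply: ler_wpM2r => //.
  by rewrite ler_nat; exact: card_compat.
rewrite -mulr_suml -natr_sum.
have -> : 192 * r%:R = 12 * (16 * r%:R) :> R by ring.
apply: ler_wpM2r; first by rewrite mulr_ge0.
rewrite ler_nat.
have -> : (\sum_(u < r) rt u = #|[pred u : 'I_r | rt u]|)%N.
  by rewrite -sum1_card [RHS]big_mkcond; apply: eq_bigr => u _; rewrite inE; case: (rt u).
case: (pickP [pred u : 'I_r | rt u]) => [u0 /andP[_ /existsP[f uf]]|none]; last first.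
  by rewrite (eq_card0 none).
rewrite cardE -(size_map (fun u : 'I_r => phi u%:Z)) -ltnS.
apply: leq_trans (size_radical_poly s kap).
  have hu := compat_unit uf.
  apply: max_poly_roots.
  - apply: radical_poly_neq0 => [|m m0].
      by rewrite expf_neq0 // phi0 Euclid_dvdzM // negb_or cr hu.
    apply/negP => /eqP e; have := hk m0; rewrite -phi0.
    have := hu m; have := hu ord0; rewrite -!phi0 => h0 hm.
    move: e; rewrite /kap => /(congr1 (fun z => z * phi (h m) * phi (h ord0))).
    rewrite mulfVK // mulrAC mulfVK // => e.
    by rewrite phiB !phiM subr_eq0 mulrC e mulrC eqxx.
  - by apply/seq.allP => z /mapP[u]; rewrite mem_enum inE => /andP[ru _] ->.
  rewrite map_inj_in_uniq ?enum_uniq // => u v _ _ /eqP.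
  rewrite -subr_eq0 -phiB phi0 => /dvdzP[w ew].
  apply/val_inj => /=; have ur := ltn_ord u; have vr := ltn_ord v.
  have w0 : w = 0 by clear -ew ur vr; move: (nat_of_ord u) (nat_of_ord v) ew ur vr => {}u {}v; nia.
  by move: ew; rewrite w0; lia.
Qed.

End FourTerms.
End FourCorrelation.

Lemma sqr_sum_le (R : realDomainType) (I : finType) (F : I -> R) :
  (\sum_i F i) ^+ 2 <= #|I|%:R * \sum_i F i ^+ 2.
Proof.
have H : \sum_i \sum_j (F i - F j) ^+ 2 = 2 * (#|I|%:R * \sum_i F i ^+ 2 - (\sum_i F i) ^+ 2).
  under eq_bigr => i _.
    rewrite (eq_bigr (fun j => F i ^+ 2 + F j ^+ 2 - 2 * F i * F j)); last by move=> j _; ring.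
    rewrite big_split /= big_split /= sumr_const -mulr_natl sumrN -mulr_sumr.
    over.
  rewrite (eq_bigr (fun i => #|I|%:R * F i ^+ 2 + \sum_i F i ^+ 2 - 2 * (\sum_i F i) * F i)).
    rewrite big_split /= big_split /= sumr_const -mulr_sumr sumrN -mulr_sumr -[_ *+ #|I|]mulr_natl.
    by ring.
  by move=> i _ /=; rewrite -mulr_natl; ring.
have : 0 <= \sum_i \sum_j (F i - F j) ^+ 2.
  by apply: sumr_ge0 => i _; apply: sumr_ge0 => j _; exact: sqr_ge0.
by rewrite H; lra.
Qed.

(** * Stationary sums along an arithmetic progression, averaged over shifts *)

Section ShiftedCorrelation.
Variable R : realType.

Lemma stationary_conj n (c h k : int) :
  (stationary R n c h k)^*%C = stationary R n (- c) h k.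
Proof.
rewrite /stationary rmorph_sum; apply: eq_bigr => x _.
by rewrite [LHS]ee_conj mulNr.
Qed.

Lemma cabs_stationary_le n (c h k : int) : cabs (stationary R n c h k) <= n%:R.
Proof.
rewrite /stationary; apply: le_trans (cabs_ee_sum_le _ _ _ _) _.
by rewrite ler_nat; apply: leq_trans (max_card _) _; rewrite card_ord.
Qed.

Lemma cabs_stationary_le2 r (c h k : int) : prime r ->
  ~~ ((r%:Z %| h)%Z && (r%:Z %| k)%Z) -> cabs (stationary R r c h k) <= 2.
Proof.
move=> pr; rewrite negb_and => rhk.
rewrite /stationary; apply: le_trans (cabs_ee_sum_le _ _ _ _) _.
rewrite ler_nat; have [rh|rh] := boolP (r%:Z %| h)%Z; last exact: card_roots_prime.
rewrite rh /= in rhk.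
rewrite eq_card0 // => x; rewrite !inE; apply/negbTE; rewrite negb_and; apply/orP; right.
apply: contra rhk => rk.
have -> : k = (k - h * x%:Z ^+ 2) + h * x%:Z ^+ 2 by ring.
by rewrite rpredD // dvdz_mulr.
Qed.

Variables (r I : nat) (c h0 k0 h k : int).
Hypothesis pr : prime r.
Hypothesis I0 : (0 < I)%N.
Hypothesis Ir : (I <= r)%N.
Hypothesis cr : ~~ (r%:Z %| c)%Z.
Hypothesis vr : ~~ (r%:Z %| h * k0 - k * h0)%Z.

Let hh (i : 'I_I) : int := h + (i : nat)%:Z * h0.
Let kk (i : 'I_I) : int := k + (i : nat)%:Z * k0.
Let K (u : nat) (i : 'I_I) := stationary R r c (hh i) (kk i + u%:Z * hh i).
(** The class of a pair is the difference of its indices, raised by [I] to stay nonnegative. *)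
Let cls (p : 'I_I * 'I_I) : 'I_(I + I).+1 := inord (p.1 + I - p.2).
Let C (d : 'I_(I + I).+1) (u : nat) := \sum_(p | cls p == d) K u p.1 * (K u p.2)^*%C.

Let det_hk (i j : 'I_I) : hh i * kk j - hh j * kk i = ((j : nat)%:Z - (i : nat)%:Z) * (h * k0 - k * h0).
Proof. by rewrite /hh /kk; ring. Qed.

Let Kle2 u i : cabs (K u i) <= 2.
Proof.
apply: cabs_stationary_le2 => //; apply: contra vr => /andP[rh rk].
have -> : h * k0 - k * h0 = hh i * k0 - (kk i + u%:Z * hh i) * h0 + u%:Z * h0 * hh i.
  by rewrite /hh /kk; ring.
apply: rpredD; last exact: dvdz_mull.
by apply: rpredB; exact: dvdz_mulr.
Qed.

Let quad (q : ('I_I * 'I_I) * ('I_I * 'I_I)) u :=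
  K u q.1.1 * (K u q.1.2)^*%C * (K u q.2.1 * (K u q.2.2)^*%C)^*%C.

Let quad_le q u : cabs (quad q u) <= 16.
Proof.
rewrite /quad !cabsM !cabs_conj !cabsM !cabs_conj.
have := Kle2 u q.1.1; have := Kle2 u q.1.2; have := Kle2 u q.2.1; have := Kle2 u q.2.2.
have := cabs_ge0 (K u q.1.1); have := cabs_ge0 (K u q.1.2).
have := cabs_ge0 (K u q.2.1); have := cabs_ge0 (K u q.2.2).
move: (cabs _) (cabs _) (cabs _) (cabs _) => a b d e a0 b0 d0 e0 a2 b2 d2 e2.
have -> : 16 = (2 * 2) * (2 * 2) :> R by ring.
by rewrite ler_pM ?mulr_ge0 // ler_pM.
Qed.

(** One index differs from the other three: exactly the isolation that makes [radical_poly]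
    nonzero. *)
Let good (q : ('I_I * 'I_I) * ('I_I * 'I_I)) :=
  [&& q.1.1 != q.1.2, q.1.1 != q.2.1 & q.1.1 != q.2.2].

Let sum_quad_good q : good q -> cabs (\sum_(u < r ^ 2) quad q u) <= 192 * r%:R.
Proof.
move=> /and3P[g1 g2 g3].
pose f := fun n : 'I_4 => nth q.1.1 [:: q.1.1; q.1.2; q.2.1; q.2.2] n.
pose s := fun n : 'I_4 => nth (0 : int) [:: c; - c; - c; c] n.
have -> : \sum_(u < r ^ 2) quad q u =
    \sum_(u < r ^ 2) \prod_n stationary R r (s n) (hh (f n)) (kk (f n) + u%:Z * hh (f n)).
  apply: eq_bigr => u _; rewrite !big_ord_recl big_ord0 mulr1 /= /quad /K.
  rewrite !stationary_conj rmorphM /= !stationary_conj opprK /f /s /=.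
  by rewrite !mulrA.
apply: sum_four_correlation => //.
  by move=> n; rewrite /s; case: n => -[|[|[|[|//]]]] /= _; rewrite ?rpredN.
move=> m m0.
have ne : q.1.1 != f m.
  by case: m m0 => -[|[|[|[|//]]]] i_ //= _; rewrite /f /=.
have -> : f ord0 = q.1.1 by [].
rewrite det_hk Euclid_dvdzM // negb_or vr andbT.
apply: contra ne => /dvdzP[w ew]; apply/eqP/val_inj => /=.
have := ltn_ord q.1.1; have := ltn_ord (f m).
move: (nat_of_ord _) (nat_of_ord _) ew => x y ew yI xI.
have w0 : w = 0 by clear -ew yI xI Ir; nia.
by move: ew; rewrite w0; lia.
Qed.

Let sum_quad q : cabs (\sum_(u < r ^ 2) quad q u) <=
  (~~ good q)%:R * (16 * r%:R ^+ 2) + 192 * r%:R.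
Proof.
case: (boolP (good q)) => g; first by rewrite mul0r add0r sum_quad_good.
rewrite mul1r; apply: le_trans (cabs_sum _ _ _) _.
apply: (@le_trans _ _ (16 * r%:R ^+ 2)); last by rewrite lerDl mulr_ge0.
apply: (@le_trans _ _ (\sum_(u < r ^ 2) 16)).
  by apply: ler_sum => u _; exact: quad_le.
by rewrite sumr_const card_ord -natrX -[leLHS]mulr_natr.
Qed.

(** Expanding the squares gives quadruples with [i - j = i' - j'], at most [I ^ 3] in number, of
    which at most [3 I ^ 2] are not [good]. The latter cost an extra [16 r ^ 2] each, all cost
    [192 r], and [I <= r] merges the totals into [48 + 192 = 240]. *)
Let sum_C_sqr : \sum_d \sum_(u < r ^ 2) cabs (C d u) ^+ 2 <= 240 * I%:R ^+ 2 * r%:R ^+ 2.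
Proof.
have E d : \sum_(u < r ^ 2) cabs (C d u) ^+ 2 <=
   \sum_(q | (cls q.1 == d) && (cls q.2 == d)) cabs (\sum_(u < r ^ 2) quad q u).
  apply: le_trans (cabs_sum _ _ _).
  apply: le_trans (ler_norm _) _.
  rewrite -cabs_real rmorph_sum /= exchange_big /=.
  rewrite le_eqVlt; apply/orP; left; apply/eqP; congr cabs; apply: eq_bigr => u _.
  rewrite -cabs_sqr /C rmorph_sum /= mulr_suml.
  rewrite [RHS](eq_bigl (fun q => (cls q.1 == d) && (cls q.2 == d))) //.
  rewrite -(pair_big (fun p => cls p == d) (fun p => cls p == d)
    (fun p q => quad (p, q) u)) /=.
  by apply: eq_bigr => p _; rewrite mulr_sumr.
apply: le_trans (ler_sum _ (fun d _ => E d)) _.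
have E2 : \sum_d \sum_(q | (cls q.1 == d) && (cls q.2 == d)) cabs (\sum_(u < r ^ 2) quad q u)
  = \sum_(q | cls q.1 == cls q.2) cabs (\sum_(u < r ^ 2) quad q u).
  rewrite [RHS](partition_big (fun q => cls q.1) predT) //=; apply: eq_bigr => d _.
  apply: eq_bigl => q; rewrite andbC.
  by case: (eqVneq (cls q.1) d) => [->|]; rewrite ?andbT ?andbF // eq_sym.
rewrite E2.
apply: le_trans (ler_sum _ (fun q _ => sum_quad q)) _.
rewrite big_split /= -mulr_suml sumr_const -natr_sum.
pose A : {set 'I_I * 'I_I * ('I_I * 'I_I)} := [set q | cls q.1 == cls q.2].
have dec (q : 'I_I * 'I_I * ('I_I * 'I_I)) : cls q.1 == cls q.2 ->
    (q.1.1 + q.2.2 = q.2.1 + q.1.2)%N.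
  move=> /eqP/(congr1 val); rewrite /= /cls !inordK; last 2 first.
  - by have := ltn_ord q.2.1; have := ltn_ord q.2.2; lia.
  - by have := ltn_ord q.1.1; have := ltn_ord q.1.2; lia.
  by have := ltn_ord q.2.2; have := ltn_ord q.1.2; lia.
have cA : (#|[pred q : 'I_I * 'I_I * ('I_I * 'I_I) | cls q.1 == cls q.2]| <= I ^ 3)%N.
  pose g (q : 'I_I * 'I_I * ('I_I * 'I_I)) := (q.1, q.2.1).
  rewrite -(card_in_imset (f := g)); last first.
    move=> [[a b] [d e]] [[a' b'] [d' e']] /dec /= e1 /dec /= e2 [] ea eb ed.
    rewrite ea eb ed; congr (_, (_, _)); apply/val_inj => /=.
    by rewrite ea eb ed in e1; lia.
  apply: leq_trans (max_card _) _.
  by rewrite !card_prod !card_ord; lia.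
have cB : (\sum_(q | cls q.1 == cls q.2) ~~ good q <= 3 * I ^ 2)%N.
  have P (F : 'I_I * 'I_I * ('I_I * 'I_I) -> 'I_I * 'I_I) (B : pred ('I_I * 'I_I * ('I_I * 'I_I))) :
     {in [pred q | (cls q.1 == cls q.2) && B q] &, injective F} ->
     (\sum_(q | cls q.1 == cls q.2) B q <= I ^ 2)%N.
    move=> inj; rewrite -big_mkcondr /= sum1_card -(card_in_imset inj).
    by apply: leq_trans (max_card _) _; rewrite card_prod !card_ord.
  rewrite (_ : 3 * I ^ 2 = I ^ 2 + (I ^ 2 + I ^ 2))%N; last by lia.
  apply: (@leq_trans (\sum_(q | cls q.1 == cls q.2) ((q.1.1 == q.1.2) +
     ((q.1.1 == q.2.1) + (q.1.1 == q.2.2))))%N).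
    by apply: leq_sum => q _; rewrite /good; do 3!case: eqP.
  rewrite big_split /= leq_add // ?big_split /= ?leq_add //.
  - apply: (P (fun q => (q.1.1, q.2.1))).
    move=> [[a b] [d e]] [[a' b'] [d' e']]; rewrite !inE.
    move=> /andP[/dec e1 /eqP e3] /andP[/dec e2 /eqP e4]; move: e1 e2 e3 e4 => /= e1 e2 e3 e4 [] ea ed.
    by subst; congr (_, (_, _)); apply/val_inj => /=; lia.
  - apply: (P (fun q => (q.1.1, q.1.2))).
    move=> [[a b] [d e]] [[a' b'] [d' e']]; rewrite !inE.
    move=> /andP[/dec e1 /eqP e3] /andP[/dec e2 /eqP e4]; move: e1 e2 e3 e4 => /= e1 e2 e3 e4 [] ea ed.
    by subst; congr (_, (_, _)); apply/val_inj => /=; lia.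
  apply: (P (fun q => (q.1.1, q.2.1))).
  move=> [[a b] [d e]] [[a' b'] [d' e']]; rewrite !inE.
  move=> /andP[/dec e1 /eqP e3] /andP[/dec e2 /eqP e4]; move: e1 e2 e3 e4 => /= e1 e2 e3 e4 [] ea ed.
  by subst; congr ((_, _), (_, _)); apply/val_inj => /=; lia.
have r0 : 0 <= r%:R :> R by [].
have I0R : 0 <= I%:R :> R by [].
have rI : I%:R <= r%:R :> R by rewrite ler_nat.
have cAR : (#|[pred q : 'I_I * 'I_I * ('I_I * 'I_I) | cls q.1 == cls q.2]|)%:R <= I%:R ^+ 3 :> R.
  by rewrite -natrX ler_nat.
have cBR : (\sum_(q | cls q.1 == cls q.2) ~~ good q)%N%:R <= 3 * I%:R ^+ 2 :> R.
  by rewrite -natrX -natrM ler_nat.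
rewrite -[X in _ + X]mulr_natl.
apply: (@le_trans _ _ (3 * I%:R ^+ 2 * (16 * r%:R ^+ 2) + I%:R ^+ 3 * (192 * r%:R))).
  by apply: lerD; apply: ler_wpM2r => //; rewrite mulr_ge0 // exprn_ge0.
have : I%:R ^+ 2 * r%:R * I%:R <= I%:R ^+ 2 * r%:R * r%:R :> R by rewrite ler_wpM2l // mulr_ge0 // exprn_ge0.
by rewrite !exprSr !expr0; lra.
Qed.

(* Only the additive character [w u ^+ i] depends on [u] in an uncontrolled
   way; collecting the pairs [(i, j)] according to [i - j] removes it. *)
Lemma sum_shift_average (w : nat -> R[i]) : (forall u, cabs (w u) = 1) ->
  (\sum_(u < r ^ 2) cabs (\sum_(i < I) w u ^+ i * K u i)) ^+ 4 <= 720 * I%:R ^+ 3 * r%:R ^+ 8.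
Proof.
move=> w1.
pose S u := cabs (\sum_(i < I) w u ^+ i * K u i).
have S2 u : S u ^+ 2 <= \sum_d cabs (C d u).
  apply: le_trans (ler_norm _) _; rewrite -cabs_real -cabs_sqr.
  rewrite rmorph_sum big_distrlr /= pair_big /= (partition_big cls predT) //=.
  apply: le_trans (cabs_sum _ _ _) _; apply: ler_sum => d _.
  have -> : \sum_(p : 'I_I * 'I_I | cls p == d)
      w u ^+ p.1 * K u p.1 * (w u ^+ p.2 * K u p.2)^*%C =
      (w u ^+ d * (w u)^*%C ^+ I) * C d u.
    rewrite /C mulr_sumr; apply: eq_bigr => p /eqP <-.
    have ww : w u * (w u)^*%C = 1 by rewrite cabs_sqr w1 expr1n.
    rewrite rmorphM rmorphXn /= /cls; case: p => i j /=.
    have iI := ltn_ord i; have jI := ltn_ord j.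
    rewrite inordK; last by lia.
    have -> : (i + I - j = i + (I - j))%N by lia.
    rewrite exprD.
    have -> : (w u)^*%C ^+ I = (w u)^*%C ^+ (I - j) * (w u)^*%C ^+ j.
      by rewrite -exprD; congr (_ ^+ _); lia.
    have -> : forall a b d' e' f g : R[i], a * b * (d' * e') * (f * g) = (b * d') * (a * f * (e' * g)).
      by move=> *; ring.
    by rewrite -exprMn ww expr1n mul1r; ring.
  have w1c : cabs (w u)^*%C = 1 by rewrite cabs_conj.
  have cX (z : R[i]) n : cabs z = 1 -> cabs (z ^+ n) = 1.
    by move=> z1; elim: n => [|n IHn]; rewrite ?expr0 ?cabs1 // exprS cabsM IHn z1 mulr1.
  by rewrite cabsM cabsM !cX // !mul1r.
have r2 : 0 <= r%:R ^+ 2 :> R by rewrite exprn_ge0.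
have T1 : (\sum_(u < r ^ 2) S u) ^+ 2 <= r%:R ^+ 2 * \sum_(u < r ^ 2) \sum_d cabs (C d u).
  apply: le_trans (sqr_sum_le _) _; rewrite card_ord natrX; apply: ler_wpM2l => //.
  by apply: ler_sum.
have T2 : (\sum_(u < r ^ 2) \sum_d cabs (C d u)) ^+ 2 <= 720 * I%:R ^+ 3 * r%:R ^+ 4.
  rewrite pair_big /=; apply: le_trans (sqr_sum_le _) _.
  rewrite card_prod !card_ord -(pair_big predT predT (fun (u : 'I_(r ^ 2)) d => cabs (C d u) ^+ 2)) /=.
  rewrite exchange_big /= natrM natrX.
  apply: le_trans (ler_wpM2l _ sum_C_sqr) _; first by rewrite mulr_ge0.
  have I3 : (I + I).+1%:R <= 3 * I%:R :> R by rewrite -natrM ler_nat; lia.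
  apply: (@le_trans _ _ (r%:R ^+ 2 * (3 * I%:R) * (240 * I%:R ^+ 2 * r%:R ^+ 2))).
    by rewrite ler_wpM2r ?ler_wpM2l // !mulr_ge0 // exprn_ge0.
  by rewrite le_eqVlt; apply/orP; left; apply/eqP; ring.
have -> : (\sum_(u < r ^ 2) S u) ^+ 4 = ((\sum_(u < r ^ 2) S u) ^+ 2) ^+ 2 by rewrite -exprM.
apply: (@le_trans _ _ ((r%:R ^+ 2 * \sum_(u < r ^ 2) \sum_d cabs (C d u)) ^+ 2)).
  rewrite lerXn2r // nnegrE ?sqr_ge0 // mulr_ge0 //.
  by apply: sumr_ge0 => u _; apply: sumr_ge0 => d _; exact: cabs_ge0.
rewrite exprMn -exprM; apply: le_trans (ler_wpM2l _ T2) _; first by rewrite exprn_ge0.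
by rewrite le_eqVlt; apply/orP; left; apply/eqP; ring.
Qed.

End ShiftedCorrelation.

(** * Lattice sums *)

Definition zsum (V : nmodType) (Z : nat) (f : int -> V) : V :=
  \sum_(m < (2 * Z).+1) f (m%:Z - Z%:Z).

Section IntervalSums.

Lemma eq_zsum (V : nmodType) Z (f g : int -> V) :
  (forall h, (`|h| <= Z)%N -> f h = g h) -> zsum Z f = zsum Z g.
Proof. by move=> fg; apply: eq_bigr => m _; apply: fg; have := ltn_ord m; lia. Qed.

Lemma zsum0 (V : nmodType) Z (f : int -> V) :
  (forall h, (`|h| <= Z)%N -> f h = 0) -> zsum Z f = 0.
Proof. by move=> f0; apply: big1 => m _; apply: f0; have := ltn_ord m; lia. Qed.

Lemma zsum_exchange (V : nmodType) Z (I : Type) (s : seq I) (P : pred I) (f : I -> int -> V) :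
  \sum_(i <- s | P i) zsum Z (f i) = zsum Z (fun h => \sum_(i <- s | P i) f i h).
Proof. exact: exchange_big. Qed.

Lemma zsum_split (V : nmodType) Z (f g : int -> V) :
  zsum Z (fun h => f h + g h) = zsum Z f + zsum Z g.
Proof. exact: big_split. Qed.

Lemma zsumZ (F : pzRingType) Z (c : F) (f : int -> F) :
  zsum Z (fun h => c * f h) = c * zsum Z f.
Proof. by rewrite /zsum mulr_sumr. Qed.

Lemma ler_zsum (F : numDomainType) Z (f g : int -> F) :
  (forall h, (`|h| <= Z)%N -> f h <= g h) -> zsum Z f <= zsum Z g.
Proof. by move=> fg; apply: ler_sum => m _; apply: fg; have := ltn_ord m; lia. Qed.

Lemma zsum_ge0 (F : numDomainType) Z (f : int -> F) :
  (forall h, (`|h| <= Z)%N -> 0 <= f h) -> 0 <= zsum Z f.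
Proof. by move=> f0; apply: sumr_ge0 => m _; apply: f0; have := ltn_ord m; lia. Qed.

Lemma cabs_zsum (R : realType) Z (f : int -> R[i]) :
  cabs (zsum Z f) <= zsum Z (fun h => cabs (f h)).
Proof. exact: cabs_sum. Qed.

Lemma zsum_single (V : nmodType) Z (f : int -> V) (a : int) : (`|a| <= Z)%N ->
  (forall h, h != a -> f h = 0) -> zsum Z f = f a.
Proof.
move=> aZ fa.
have aP : (`|(a + Z%:Z)%R| < (2 * Z).+1)%N by lia.
rewrite /zsum (bigD1 (Ordinal aP)) //= big1 ?addr0.
  by congr f; lia.
move=> m; rewrite -val_eqE /= => ma; apply: fa.
by apply: contra ma => /eqP; lia.
Qed.

Lemma zsum_split0 (V : nmodType) Z (f : int -> V) :
  zsum Z f = f 0 + \sum_(1 <= h < Z.+1) (f h%:Z + f (- h%:Z)).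
Proof.
rewrite /zsum -(big_mkord xpredT (fun m => f (m%:Z - Z%:Z))) (@big_cat_nat _ _ _ Z) /=; try lia.
rewrite [X in _ + X]big_ltn; last by lia.
rewrite subrr addrCA; congr (_ + _).
rewrite big_split /= addrC; congr (_ + _).
  rewrite -{1}(addn1 Z) addnC (_ : (2 * Z).+1 = Z.+1 + Z)%N; last by lia.
  rewrite -{1}(add0n Z.+1) big_addn (_ : (Z.+1 + Z - Z = Z.+1)%N); last by lia.
  by apply: eq_bigr => i _; congr f; lia.
rewrite big_nat_rev /= add0n [RHS]big_add1 /=.
by apply: eq_big_nat => i ?; congr f; lia.
Qed.

(** The window is moved one step at a time; as long as it contains the support, the term dropped and
    the term gained are both zero. *)
Lemma zsum_shift (V : nmodType) (M Z : nat) (c : int) (f : int -> V) :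
  (M + `|c| <= Z)%N -> (forall h, (M < `|h|)%N -> f h = 0) ->
  zsum Z (fun h => f (h + c)) = zsum Z f.
Proof.
move=> MZ f0.
pose S (lo : int) := \sum_(m < (2 * Z).+1) f (m%:Z + lo).
have step (n : nat) (lo : int) : (lo + n%:Z <= - M%:Z) -> (M%:Z - (2 * Z)%:Z - 1 < lo) ->
    S (lo + n%:Z) = S lo.
  elim: n => [|n IHn] l1 l2; first by rewrite addr0.
  rewrite -[RHS]IHn; [|lia..].
  rewrite /S big_ord_recr big_ord_recl /=.
  rewrite (f0 ((2 * Z)%N%:Z + _)); last by lia.
  rewrite (f0 (0%N%:Z + _)); last by lia.
  by rewrite addr0 add0r; apply: eq_bigr => i _; congr f; rewrite /bump /=; lia.
have E c' : zsum Z (fun h => f (h + c')) = S (c' - Z%:Z).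
  by apply: eq_bigr => m _; congr f; ring.
have -> : zsum Z f = S (0 - Z%:Z) by rewrite -E; apply: eq_bigr => m _; rewrite addr0.
rewrite E; case: (ltP c 0) => c0.
  have -> : 0 - Z%:Z = (c - Z%:Z) + `|c|%N%:Z by lia.
  by rewrite step //; lia.
have -> : c - Z%:Z = (0 - Z%:Z) + `|c|%N%:Z by lia.
by rewrite step //; lia.
Qed.

End IntervalSums.

(** For a fixed point [(h, k)] this counts the lattices [k = h X] modulo [n] that contain it; sums
    over [X] of lattice sums are estimated by exchanging the two summations. *)
Lemma card_linear_roots n (h k : int) : (0 < n)%N ->
  (#|[pred x : 'I_n | (n%:Z %| (k - h * x%:Z)%R)%Z]| <=
   gcdn `|h| n * ((gcdn `|h| n)%:Z %| k)%Z)%N.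
Proof.
move=> n0; set g := gcdn _ _.
have g0 : (0 < g)%N by rewrite gcdn_gt0 n0 orbT.
set A := [pred x | _].
have [a Aa|A0] := pickP A; last by rewrite (eq_card0 A0).
have gn : (g %| n)%N by apply: dvdn_gcdr.
have gh : (g%:Z %| h)%Z by rewrite dvdzE /=; apply: dvdn_gcdl.
have -> : (g%:Z %| k)%Z.
  have -> : k = (k - h * a%:Z) + h * a%:Z by ring.
  rewrite rpredD ?dvdz_mulr //.
  by apply: (@dvdz_trans n%:Z) => //; rewrite dvdzE.
rewrite muln1.
have [w ew] := dvdnP gn.
have w0 : (0 < w)%N by move: n0; rewrite ew muln_gt0 => /andP[].
have qP (x : 'I_n) : (x %/ w < g)%N by rewrite ltn_divLR // mulnC -ew.
rewrite -(card_in_imset (f := fun x : 'I_n => Ordinal (qP x))).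
  by apply: leq_trans (max_card _) _; rewrite card_ord.
move=> x y; rewrite !inE => Ax Ay [] e.
apply/val_inj => /=; rewrite (divn_eq x w) (divn_eq y w) e; congr (_ + _)%N.
have D : (n%:Z %| h * (x%:Z - y%:Z))%Z.
  have -> : h * (x%:Z - y%:Z) = (k - h * y%:Z) - (k - h * x%:Z) by ring.
  by rewrite rpredB.
have hg : `|h|%N = (`|h| %/ g * g)%N by rewrite divnK // dvdn_gcdl.
have : (w %| `|x%:Z - y%:Z|)%N.
  move: (x%:Z - y%:Z)%R D => t; rewrite dvdzE /= abszM {1}ew {1}hg.
  rewrite -mulnA mulnCA [(w * g)%N]mulnC dvdn_pmul2l //.
  rewrite Gauss_dvdr //.
  by rewrite /coprime -(eqn_pmul2r g0) mul1n muln_gcdl -ew -hg gcdnC.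
move=> xyw; apply/eqP; wlog xy : x y xyw {Ax Ay e D} / (y <= x)%N.
  move=> H; have [/H->//|yx] := leqP y x.
  by rewrite eq_sym H // ?(ltnW yx) // -abszN opprB.
by rewrite eqn_mod_dvd //; move: xyw; congr (_ %| _)%N; lia.
Qed.

(** The [H + 1] residues of the multiples of [X] fall into [H] intervals of length [K]. *)
Lemma dirichlet_pigeonhole n (H K X : nat) : (0 < n)%N -> (0 < H)%N -> (n <= H * K)%N ->
  exists h : nat, exists k : int, [/\ (0 < h <= H)%N, (`|k| <= K)%N & (n%:Z %| k - h%:Z * X%:Z)%Z].
Proof.
move=> n0 H0 nHK.
have K0 : (0 < K)%N by lia.
have bP (i : 'I_H.+1) : ((i * X) %% n %/ K < H)%N.
  by rewrite ltn_divLR //; apply: leq_trans nHK; rewrite ltn_mod.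
have [inj|] := boolP (injectiveb (fun i : 'I_H.+1 => Ordinal (bP i))).
  by have := leq_card _ (injectiveP _ inj); rewrite !card_ord ltnn.
move=> /injectivePn[x [y xy [] e]].
wlog xy' : x y e {xy} / (y < x)%N.
  move=> W; move: xy; rewrite -val_eqE /= neq_ltn => /orP[xy|xy].
    by apply: (W y x).
  by apply: (W x y).
exists (x - y)%N, (((x * X) %% n)%N%:Z - ((y * X) %% n)%N%:Z); split.
- by have := ltn_ord x; lia.
- have e1 := divn_eq ((x * X) %% n) K; have e2 := divn_eq ((y * X) %% n) K.
  have := ltn_pmod ((x * X) %% n) K0; have := ltn_pmod ((y * X) %% n) K0.
  by rewrite e in e1; move: e1 e2; set p := (_ %/ _ * _)%N; lia.
have e1 := divn_eq (x * X) n; have e2 := divn_eq (y * X) n.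
apply/dvdzP; exists (((y * X) %/ n)%N%:Z - ((x * X) %/ n)%N%:Z).
have -> : (x - y)%N%:Z = x%:Z - y%:Z by lia.
move/(congr1 Posz): e1; move/(congr1 Posz): e2; rewrite !PoszD !PoszM => e2 e1.
have -> : forall a b : int, a - b - (x%:Z - y%:Z) * X%:Z = a - x%:Z * X%:Z - (b - y%:Z * X%:Z) by move=> *; ring.
rewrite [X in _ - X - _]e1 [X in _ - (_ - X)]e2; ring.
Qed.

(* The vector [(h, k)] of the lattice [k = h X mod n] with least positive first
   coordinate among those with [|k| <= K]. *)
Lemma minimal_vector n (H K X : nat) : (0 < n)%N -> (0 < H)%N -> (n <= H * K)%N ->
  exists (v : nat * int), [/\ (0 < v.1 <= H)%N, (`|v.2| <= K)%N, (n%:Z %| v.2 - v.1%:Z * X%:Z)%Z &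
    forall (h : nat) (k : int), (0 < h < v.1)%N -> (`|k| <= K)%N -> ~~ (n%:Z %| k - h%:Z * X%:Z)%Z].
Proof.
move=> n0 H0 nHK.
pose P h := (0 < h)%N && `[< exists k : int, (`|k| <= K)%N /\ (n%:Z %| k - h%:Z * X%:Z)%Z >].
have exP : exists h, P h.
  have [h [k [/andP[h0 hH] kK d]]] := dirichlet_pigeonhole X n0 H0 nHK.
  by exists h; rewrite /P h0; apply/asboolP; exists k.
have [h /andP[h0 /asboolP[k [kK d]]] hmin] := ex_minnP exP.
exists (h, k); split => //=.
  have [h' [k' [/andP[h0' hH'] kK' d']]] := dirichlet_pigeonhole X n0 H0 nHK.
  rewrite h0 /=; apply: leq_trans hH'; apply: hmin; rewrite /P h0'; apply/asboolP.
  by exists k'.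
move=> h' k' /andP[h0' hh'] kK'; apply/negP => d'.
have : (h <= h')%N by apply: hmin; rewrite /P h0'; apply/asboolP; exists k'.
by lia.
Qed.

Lemma zsum_widen (V : nmodType) M Z (f : int -> V) : (M <= Z)%N ->
  (forall h, (M < `|h|)%N -> f h = 0) -> zsum Z f = zsum M f.
Proof.
move=> MZ f0; rewrite !zsum_split0 (@big_cat_nat _ _ _ M.+1) //=.
rewrite [X in _ + (_ + X)]big_nat [X in _ + (_ + X)]big1 ?addr0 // => i /andP[Mi _].
rewrite (f0 i%:Z) ?(f0 (- i%:Z)) ?addr0 //; lia.
Qed.

Definition harm (R : realType) (n : nat) : R := \sum_(1 <= k < n.+1) k%:R^-1.

Lemma natr_zsum (F : pzSemiRingType) Z (f : int -> nat) :
  (zsum Z f)%:R = zsum Z (fun h => (f h)%:R) :> F.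
Proof. exact: natr_sum. Qed.

Lemma zsum_dvd_le Z g : (0 < g)%N -> (zsum Z (fun k => g * (g%:Z %| k)%Z) <= g + 2 * Z)%N.
Proof.
move=> g0; rewrite zsum_split0 dvdz0 muln1 leq_add2l.
rewrite (eq_bigr (fun h => 2 * g * (g %| h)%N)%N); last first.
  by move=> h _; rewrite !dvdzE abszN /=; lia.
rewrite -big_distrr /=.
have -> : (\sum_(1 <= h < Z.+1) (g %| h) = Z %/ g)%N.
  elim: Z => [|M IHM]; first by rewrite big_geq // div0n.
  by rewrite big_nat_recr //= IHM divnS // addnC.
by rewrite -[(_ * _)%R]/(2 * g * (Z %/ g))%N -mulnA leq_mul // mulnC leq_trunc_div.
Qed.

Lemma sum_shift_mod (V : nmodType) n (u : nat) (f : nat -> V) : (0 < n)%N ->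
  \sum_(X < n) f ((X + u) %% n)%N = \sum_(X < n) f X.
Proof.
move=> n0; have P (X : 'I_n) : ((X + u) %% n < n)%N by rewrite ltn_mod.
rewrite [RHS](reindex_inj (h := fun X => Ordinal (P X))) //.
move=> x y [] /eqP; rewrite eqn_modDr !modn_small // => /eqP e; exact/val_inj.
Qed.

(** * Lattice sums averaged along a short vector *)

Section LatticeBound.
Variable R : realType.
Variables (n r m H K H0 K0 : nat) (c : int).
Hypothesis n0 : (0 < n)%N.
Hypothesis pr : prime r.
Hypothesis nr : coprime n r.
Hypothesis cr : ~~ (r%:Z %| c)%Z.
Hypothesis m0 : (0 < m)%N.
Let I := (m ^ 4)%N.
Hypothesis Ir : (I <= r)%N.
Hypothesis H00 : (0 < H0)%N.
Hypothesis nHK : (n <= H0 * K0)%N.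
Hypothesis HK0 : (r ^ 2 * H0 <= K0)%N.
Hypothesis IH : (I * H0 <= H)%N.
Hypothesis IK : (2 * I * K0 <= K)%N.
Hypothesis HK : (2 * r ^ 2 * H <= K)%N.
Hypothesis detn : (2 * H * K0 + 3 * K * H0 < n * r)%N.
Hypothesis Kn : (3 * K < n)%N.

Variables (F : int -> int -> R[i]) (A B : R).
Hypothesis A0 : 0 <= A.
Hypothesis B0 : 0 <= B.
Hypothesis F1 : forall h k, cabs (F h k) <= 1.
Hypothesis FL : forall h k h' k', cabs (F (h + h') (k + k') - F h k) <=
  A * `|h'|%:~R + B * `|k'|%:~R.
(** Variation of [F] along one step of the short vector, whose coordinates after the shear are at
    most [H0] and [2 K0]. *)
Let eps := A * H0%:R + B * (2 * K0%:R).

Let lat (X : nat) (h k : int) : bool := (n%:Z %| k - h * X%:Z)%Z.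
Let S h k := stationary R r c h k.
Let box a b (h k : int) := (`|h| <= a)%N && (`|k| <= b)%N.

Definition additive_character (psi : int -> int -> R[i]) :=
  (forall h k h' k', psi (h + h') (k + k') = psi h k * psi h' k') /\
  (forall h k, cabs (psi h k) = 1).

(** The range exceeds the essential support [H] by [K] of the weight, leaving room for the shifts;
    what the weight retains outside [H] by [K] is charged to [lattice_tail]. *)
Definition lattice_sum X psi : R[i] := zsum (3 * H) (fun h => zsum (3 * K) (fun k =>
  if lat X h k && ((h != 0) || (k != 0)) then F h k * psi h k * S h k else 0)).

Definition lattice_tail X : R := zsum (3 * H) (fun h => zsum (3 * K) (fun k =>
  if lat X h k && ~~ box H K h k then cabs (F h k) * cabs (S h k) else 0)).

Section ShortVector.
Variables (X u h0 : nat) (k0 : int).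
Hypothesis ur : (u < r ^ 2)%N.
Hypothesis h00 : (0 < h0)%N.
Hypothesis h0H : (h0 <= H0)%N.
Hypothesis k0K : (`|k0| <= K0)%N.
Hypothesis vlat : lat X h0%:Z k0.
Hypothesis vmin : forall (h : nat) (k : int), (0 < h < h0)%N -> (`|k| <= K0)%N -> ~~ lat X h%:Z k.
(** The shear [(h, k) -> (h, k + u h)] maps the lattice of [X] onto the lattice of [X + u];
    [(h0, ku)] is the image of the short vector. *)
Let ku := k0 + u%:Z * h0%:Z.

Let ku_le : (`|ku| <= 2 * K0)%N.
Proof.
have : (u * h0 <= r ^ 2 * H0)%N by apply: leq_mul => //; exact: ltnW.
by move: HK0 k0K; rewrite /ku -PoszM; move: (u * h0)%N (r ^ 2 * H0)%N => a b; lia.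
Qed.

Let lat_shear h k : lat (X + u) h (k + u%:Z * h) = lat X h k.
Proof. by rewrite /lat PoszD; congr (_ %| _)%Z; ring. Qed.

Let vlat_u : lat (X + u) h0%:Z ku.
Proof. by rewrite /ku lat_shear. Qed.

Let latD X' h k h' k' : lat X' h' k' -> lat X' (h + h') (k + k') = lat X' h k.
Proof.
rewrite /lat => l; have -> : k + k' - (h + h') * X'%:Z = (k - h * X'%:Z) + (k' - h' * X'%:Z) by ring.
by rewrite rpredDr.
Qed.

Let latM X' (i : nat) h k : lat X' h k -> lat X' (i%:Z * h) (i%:Z * k).
Proof.
rewrite /lat => l; have -> : i%:Z * k - i%:Z * h * X'%:Z = i%:Z * (k - h * X'%:Z) by ring.
exact: dvdz_mull.
Qed.

(** Otherwise reduction modulo [h0] along the line through [(h0, k0)] produces a lattice point with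
    smaller positive first coordinate and second coordinate still at most [K0], against
    minimality. *)
Let parallel_dvd h k : lat X h k -> h * k0 = k * h0%:Z -> (h0%:Z %| h)%Z.
Proof.
move=> l e; apply/dvdz_mod0P; set h' := (h %% h0%:Z)%Z.
have h0Z : h0%:Z != 0 :> int by lia.
have h'0 : 0 <= h' by apply: modz_ge0.
have h'h : h' < h0%:Z by rewrite /h'; have := ltz_mod h h0Z; lia.
have eh : h = (h %/ h0%:Z)%Z * h0%:Z + h' by exact: divz_eq.
move: eh; set w := (h %/ h0%:Z)%Z => eh.
pose k' := k - w * k0.
have e' : h' * k0 = k' * h0%:Z.
  have -> : h' = h - w * h0%:Z by rewrite eh; ring.
  by rewrite mulrBl e /k'; ring.
apply/eqP/negPn/negP => hn.
have ha : h' = `|h'|%N by lia.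
have kk : (`|k'| <= K0)%N.
  apply: leq_trans k0K; have : (`|h'| * `|k0| = `|k'| * h0)%N by rewrite -[h0]/(`|h0%:Z|%N) -!abszM e'.
  have : (`|h'| < h0)%N by lia.
  move: (`|h'|)%N (`|k0|)%N (`|k'|)%N => a b d ah e3.
  by rewrite -(leq_pmul2r h00) -e3 mulnC leq_mul // ltnW.
have hh : (0 < `|h'| < h0)%N by clear -ha h'0 h'h hn; apply/andP; split; lia.
apply/negP: (vmin hh kk); rewrite negbK.
rewrite -ha /lat.
have -> : k' - h' * X%:Z = (k - h * X%:Z) - w * (k0 - h0%:Z * X%:Z).
  have -> : h' = h - w * h0%:Z by rewrite eh; ring.
  by rewrite /k'; ring.
by rewrite rpredB // dvdz_mull.
Qed.

(** Since [r] is a unit modulo [n], dividing the vector by [r] would stay in the lattice and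
    contradict the minimality of [h0]. *)
Let vr : ~~ ((r%:Z %| h0%:Z)%Z && (r%:Z %| ku)%Z).
Proof.
apply/negP => /andP[rh rk].
have rk0 : (r%:Z %| k0)%Z.
  have -> : k0 = ku - u%:Z * h0%:Z by rewrite /ku; ring.
  by rewrite rpredB // dvdz_mull.
have [h1 e1] := dvdnP rh; have [k1 e2] := dvdzP rk0.
rewrite /= in e1.
have r1 := prime_gt1 pr.
have h10 : (0 < h1)%N by move: h00; rewrite e1 muln_gt0 => /andP[].
have hh : (0 < h1 < h0)%N by rewrite h10 /= e1 ltn_Pmulr.
have kk : (`|k1| <= K0)%N.
  by apply: leq_trans k0K; rewrite e2 abszM /= leq_pmulr // ltnW.
apply/negP: (vmin hh kk); rewrite negbK.
have := vlat; rewrite /lat e2 e1 PoszM.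
have -> : k1 * r%:Z - h1%:Z * r%:Z * X%:Z = (k1 - h1%:Z * X%:Z) * r%:Z by ring.
by rewrite mulrC Gauss_dvdzr // /coprimez /gcdz /= -/(coprime _ _) nr.
Qed.

(** The determinant of two lattice points is a multiple of [n]. If [r] divided it too, it would be a
    nonzero multiple of [n r] of absolute value below [n r]. This nondegeneracy is the hypothesis of
    the fourfold correlation. *)
Lemma det_ndvd h k : box (2 * H) (3 * K) h k -> lat X h k -> h * k0 != k * h0%:Z ->
  ~~ (r%:Z %| h * k0 - k * h0%:Z)%Z.
Proof.
move=> /andP[hH kK] l; rewrite -subr_eq0; apply: contra => rd.
have nd : (n%:Z %| h * k0 - k * h0%:Z)%Z.
  have -> : h * k0 - k * h0%:Z = h * (k0 - h0%:Z * X%:Z) - h0%:Z * (k - h * X%:Z) by ring.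
  by rewrite rpredB // dvdz_mull.
have : (n * r %| `|(h * k0 - k * h0%:Z)%R|)%N by rewrite Gauss_dvd // -[n]/(`|n%:Z|%N) -[r]/(`|r%:Z|%N) -!dvdzE nd.
have : (`|(h * k0 - k * h0%:Z)%R| < n * r)%N.
  apply: leq_ltn_trans detn.
  have a1 : (`|(h * k0)%R| <= 2 * H * K0)%N by rewrite abszM leq_mul.
  have a2 : (`|(k * h0%:Z)%R| <= 3 * K * H0)%N by rewrite abszM leq_mul.
  by apply: leq_trans (leq_add a1 a2); clear; move: (h * k0) (k * _) => x y; lia.
move: (h * k0 - k * h0%:Z) => d dn dd.
rewrite -absz_eq0 -leqn0 leqNgt; apply/negP => d0.
by have := dvdn_leq d0 dd; rewrite leqNgt dn.
Qed.

(** These points are multiples [w (h0, ku)], at most one for each multiple [h] of [h0]. The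
    stationary sum is at most [2], or at most [r] when [r | w], which happens for one multiple in
    [r]; both signs together give [12 + 6 = 18]. *)
Lemma parallel_part :
  zsum (3 * H) (fun h => zsum (3 * K) (fun k =>
    if [&& lat (X + u) h k, (h != 0) || (k != 0) & h * ku == k * h0%:Z] then cabs (S h k) else 0))
  <= 18 * H%:R / h0%:R.
Proof.
have r0 := prime_gt0 pr.
pose f (h : int) : R := if h == 0 then 0 else
  (h0%:Z %| h)%Z%:R * 2 + ((h0 * r)%N%:Z %| h)%Z%:R * r%:R.
have f0 h : 0 <= f h by rewrite /f; case: eqP => // _; rewrite addr_ge0 // mulr_ge0.
have h0Z : h0%:Z != 0 :> int by lia.
apply: (@le_trans _ _ (zsum (3 * H) f)).
  apply: ler_zsum => h hH.
  have [/dvdzP[w ew]|hh] := boolP (h0%:Z %| h)%Z; last first.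
    rewrite zsum0 // => k kK; case: ifP => // /and3P[l _ /eqP e]; exfalso; case/negP: hh.
    apply: (@parallel_dvd h (k - u%:Z * h)); first by rewrite -lat_shear subrK.
    move: e; rewrite /ku => e.
    have -> : (k - u%:Z * h) * h0%:Z = k * h0%:Z - u%:Z * h * h0%:Z by ring.
    by rewrite -e; ring.
  have kw k : h * ku == k * h0%:Z -> k = w * ku.
    by move=> /eqP e; apply: (mulIf h0Z); rewrite -e ew; ring.
  have [h00'|hn0] := eqVneq h 0.
    rewrite zsum0 //= => k _; case: ifP => // /and3P[_ kn e].
    have w0 : w = 0 by apply: (mulIf h0Z); rewrite -ew h00' mul0r.
    by move: kn; rewrite (kw _ e) w0 mul0r h00' eqxx.
  have Sle : cabs (S h (w * ku)) <= f h.
    rewrite /f (negPf hn0) ew dvdz_mull // mul1r.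
    have [rw|rw] := boolP (r%:Z %| w)%Z.
      rewrite [(h0 * r)%N]mulnC PoszM dvdz_mul // mul1r.
      by apply: le_trans (cabs_stationary_le _ _ _ _ _) _; rewrite lerDr.
    apply: le_trans (cabs_stationary_le2 _ _ _ _) _ => //; last by rewrite lerDl mulr_ge0.
    apply: contra vr; rewrite !Euclid_dvdzM // (negPf rw) /=.
    by move=> /andP[-> ->].
  have [wK|wK] := boolP (`|(w * ku)%R| <= 3 * K)%N.
    rewrite (zsum_single wK); last by move=> k; apply: contraNeq; case: ifP; rewrite ?eqxx // => /and3P[_ _ /kw ->].
    by case: ifP.
  rewrite zsum0 // => k kK; case: ifP => // /and3P[_ _ /kw e].
  by case/negP: wK; rewrite -e.
rewrite zsum_split0 {1}/f eqxx add0r.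
have fE h : (1 <= h < (3 * H).+1)%N -> f h%:Z + f (- h%:Z) = (h0 %| h)%N%:R * 4 + (h0 * r %| h)%N%:R * (2 * r%:R).
  move=> /andP[h1 _]; rewrite /f !dvdzE !abszN /=.
  have -> : (h%:Z == 0) = false by lia.
  by have -> : (- h%:Z == 0) = false by [lia]; ring.
rewrite (eq_big_nat _ _ fE) big_split /= -!mulr_suml.
have cnt d : (0 < d)%N -> \sum_(1 <= h < (3 * H).+1) (d %| h)%N%:R <= 3 * H%:R / d%:R :> R.
  move=> d0; rewrite -natr_sum ler_pdivlMr ?ltr0n // -natrM -natrM ler_nat.
  have -> : (\sum_(1 <= h < (3 * H).+1) (d %| h) = 3 * H %/ d)%N.
    elim: (3 * H)%N => [|M IHM]; first by rewrite big_geq // div0n.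
    by rewrite big_nat_recr //= IHM divnS // addnC.
  exact: leq_trunc_div.
have r0R : r%:R != 0 :> R by rewrite pnatr_eq0 -lt0n.
have h0R : h0%:R != 0 :> R by rewrite pnatr_eq0 -lt0n.
have c1 := cnt _ h00; have c2 := cnt (h0 * r)%N; rewrite muln_gt0 h00 r0 in c2.
apply: (@le_trans _ _ (3 * H%:R / h0%:R * 4 + 3 * H%:R / (h0 * r)%:R * (2 * r%:R))).
  by apply: lerD; apply: ler_wpM2r; rewrite ?mulr_ge0 //; exact: c2.
by rewrite natrM le_eqVlt; apply/orP; left; apply/eqP; field; rewrite h0R.
Qed.

Variable psi : int -> int -> R[i].
Hypothesis psiP : additive_character psi.

(** Indexed by points of the unsheared lattice of [X], so that [u] occurs only in the stationary
    sums and in the value of the character. *)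
Let inner (h k : int) : R := if lat X h k && (h * k0 != k * h0%:Z) then
  cabs (\sum_(i < I) psi h0%:Z ku ^+ i *
    S (h + (i : nat)%:Z * h0%:Z) (k + (i : nat)%:Z * k0 + u%:Z * (h + (i : nat)%:Z * h0%:Z)))
  + 2 * I%:R ^+ 2 * eps else 0.

Let G (h k : int) : R[i] :=
  if [&& lat (X + u) h k, box (3 * H) (3 * K) h k & h * ku != k * h0%:Z]
  then F h k * psi h k * S h k else 0.

Let tail (h k : int) : R :=
  if [&& lat (X + u) h k, box (3 * H) (3 * K) h k & ~~ box H K h k]
  then cabs (F h k) * cabs (S h k) else 0.

Let zz (V : nmodType) (f : int -> int -> V) : V :=
  zsum (4 * H) (fun h => zsum (4 * K) (f h)).

Let stepH (i : 'I_I) : (`|((i : nat)%:Z * h0%:Z)%R| <= H)%N.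
Proof. by rewrite abszM /=; apply: leq_trans IH; apply: leq_mul => //; apply: ltnW. Qed.

Let stepK (i : 'I_I) : (`|((i : nat)%:Z * ku)%R| <= K)%N.
Proof.
rewrite abszM /=; apply: leq_trans IK; rewrite mulnAC mulnC; apply: leq_mul => //.
exact: ltnW.
Qed.

Let zz_shift (V : nmodType) (f : int -> int -> V) (i : 'I_I) :
  (forall h k, ~~ box (3 * H) (3 * K) h k -> f h k = 0) ->
  zz (fun h k => f (h + (i : nat)%:Z * h0%:Z) (k + (i : nat)%:Z * ku)) = zz f.
Proof.
move=> f0; have sH := stepH i; have sK := stepK i.
pose g h := zsum (4 * K) (f h).
transitivity (zsum (4 * H) (fun h => g (h + (i : nat)%:Z * h0%:Z))).
  apply: eq_bigr => a _; apply: (@zsum_shift _ (3 * K)); first by clear -sK; lia.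
  by move=> k kK; apply: f0; rewrite /box negb_and -!ltnNge kK orbT.
apply: (@zsum_shift _ (3 * H)); first by clear -sH; lia.
move=> h hH; apply: zsum0 => k _; apply: f0.
by rewrite /box negb_and -!ltnNge hH.
Qed.

Let I0 : (0 < I)%N. Proof. by rewrite expn_gt0 m0. Qed.

Let psi_pow (i : nat) h k : psi (h + i%:Z * h0%:Z) (k + i%:Z * ku) = psi h k * psi h0%:Z ku ^+ i.
Proof.
have [pD _] := psiP; elim: i => [|i IHi]; first by rewrite !mul0r !addr0 mulr1.
have -> : h + i.+1%:Z * h0%:Z = (h + i%:Z * h0%:Z) + h0%:Z by rewrite intS; ring.
have -> : k + i.+1%:Z * ku = (k + i%:Z * ku) + ku by rewrite intS; ring.
by rewrite pD IHi exprSr mulrA.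
Qed.

Let eps0 : 0 <= eps. Proof. by rewrite /eps addr_ge0 // !mulr_ge0. Qed.

(** Along the shifts the character contributes powers of [psi h0 ku]. Replacing [F] at the [I]
    shifted points by [F h k] costs at most [I eps] each, against stationary sums of size at most
    [2]. *)
Let point_bound h k : box (2 * H) (2 * K) h k ->
  cabs (\sum_(i < I) G (h + (i : nat)%:Z * h0%:Z) (k + (i : nat)%:Z * ku)) <= inner h (k - u%:Z * h).
Proof.
move=> /andP[hH kK].
have [p_D p1] := psiP.
have bx (i : 'I_I) : box (3 * H) (3 * K) (h + (i : nat)%:Z * h0%:Z) (k + (i : nat)%:Z * ku).
  have := stepH i; have := stepK i; move: (_ * ku) (_ * h0%:Z) => a b.
  by clear -hH kK; rewrite /box => ? ?; apply/andP; split; lia.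
have lt (i : 'I_I) : lat (X + u) (h + (i : nat)%:Z * h0%:Z) (k + (i : nat)%:Z * ku) = lat X h (k - u%:Z * h).
  by rewrite latD ?latM // -[in LHS](subrK (u%:Z * h) k) lat_shear.
have dt (i : 'I_I) : ((h + (i : nat)%:Z * h0%:Z) * ku != (k + (i : nat)%:Z * ku) * h0%:Z) =
    (h * k0 != (k - u%:Z * h) * h0%:Z).
  rewrite -subr_eq0 -[in RHS]subr_eq0; congr (_ != _).
  by rewrite /ku; ring.
rewrite /inner; case: ifPn => [/andP[l d]|ld]; last first.
  by rewrite big1 ?cabs0 // => i _; rewrite /G lt dt bx /= (negPf ld).
have rd : ~~ (r%:Z %| h * k0 - (k - u%:Z * h) * h0%:Z)%Z.
  apply: det_ndvd => //; rewrite /box hH /=.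
  have : (`|(u%:Z * h)%R| <= K)%N.
    rewrite abszM /=; apply: leq_trans HK; rewrite mulnAC mulnC; apply: leq_mul => //.
    by apply: ltnW.
  by clear -kK; move: (u%:Z * h) => a ?; lia.
have eS (i : 'I_I) : S (h + (i : nat)%:Z * h0%:Z) (k + (i : nat)%:Z * ku) =
   S (h + (i : nat)%:Z * h0%:Z) (k - u%:Z * h + (i : nat)%:Z * k0 + u%:Z * (h + (i : nat)%:Z * h0%:Z)).
  by congr S; rewrite /ku; ring.
have S2 (i : 'I_I) : cabs (S (h + (i : nat)%:Z * h0%:Z) (k + (i : nat)%:Z * ku)) <= 2.
  apply: cabs_stationary_le2 => //; apply: contra rd => /andP[r1 r2].
  have -> : h * k0 - (k - u%:Z * h) * h0%:Z =
    (h + (i : nat)%:Z * h0%:Z) * ku - (k + (i : nat)%:Z * ku) * h0%:Z by rewrite /ku; ring.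
  by rewrite rpredB // dvdz_mulr.
have -> : \sum_(i < I) G (h + (i : nat)%:Z * h0%:Z) (k + (i : nat)%:Z * ku) =
  F h k * psi h k * (\sum_(i < I) psi h0%:Z ku ^+ i * S (h + (i : nat)%:Z * h0%:Z) (k + (i : nat)%:Z * ku)) +
  \sum_(i < I) (F (h + (i : nat)%:Z * h0%:Z) (k + (i : nat)%:Z * ku) - F h k) *
    (psi (h + (i : nat)%:Z * h0%:Z) (k + (i : nat)%:Z * ku) *
    S (h + (i : nat)%:Z * h0%:Z) (k + (i : nat)%:Z * ku)).
  rewrite mulr_sumr -big_split /=; apply: eq_bigr => i _.
  by rewrite /G lt dt bx l d /= psi_pow; ring.
apply: le_trans (cabsD _ _) _; apply: lerD.
  rewrite !cabsM p1 mulr1 (eq_bigr _ (fun i _ => congr1 _ (eS i))).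
  by rewrite -[leRHS]mul1r; apply: ler_wpM2r => //; apply: cabs_ge0.
apply: le_trans (cabs_sum _ _ _) _.
apply: (@le_trans _ _ (\sum_(i < I) I%:R * eps * 2)); last first.
  by rewrite sumr_const card_ord -[leLHS]mulr_natr le_eqVlt; apply/orP; left; apply/eqP; ring.
apply: ler_sum => i _; rewrite !cabsM p1 mul1r.
apply: ler_pM => //; try exact: cabs_ge0.
apply: le_trans (FL _ _ _ _) _.
have iI : (i <= I)%N by apply: ltnW.
rewrite /eps [leRHS]mulrDr; apply: lerD.
  rewrite mulrCA; apply: ler_wpM2l => //; rewrite -natrM -pmulrn ler_nat abszM /=.
  exact: leq_mul.
rewrite mulrCA; apply: ler_wpM2l => //; rewrite -natrM -natrM -pmulrn ler_nat abszM /=.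
exact: leq_mul.
Qed.

Let shift_bound h k :
  cabs (\sum_(i < I) G (h + (i : nat)%:Z * h0%:Z) (k + (i : nat)%:Z * ku)) <=
  (if box (2 * H) (2 * K) h k then inner h (k - u%:Z * h) else 0) +
  \sum_(i < I) tail (h + (i : nat)%:Z * h0%:Z) (k + (i : nat)%:Z * ku).
Proof.
have [p_D p1] := psiP.
have t0 h' k' : 0 <= tail h' k' by rewrite /tail; case: ifP => // _; rewrite mulr_ge0 // cabs_ge0.
case: ifPn => [b|nb].
  by apply: le_trans (point_bound b) _; rewrite lerDl; apply: sumr_ge0.
rewrite add0r; apply: le_trans (cabs_sum _ _ _) _; apply: ler_sum => i _.
rewrite /G; case: ifP => [/and3P[l b _]|_]; last by rewrite cabs0.
rewrite /tail l b /= ifT; first by rewrite !cabsM p1 mulr1.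
apply: contra nb => /andP[].
have := stepH i; have := stepK i; move: (_ * ku) (_ * h0%:Z) => a b'.
by clear; rewrite /box => ? ? ? ?; apply/andP; split; lia.
Qed.

(** Points off the line are averaged over [I] translates by multiples of [(h0, ku)]. A translate of
    a point outside the doubled box can contribute only outside [H] by [K], and [lattice_tail] pays
    for it. *)
Lemma short_vector_bound : cabs (lattice_sum (X + u) psi) <=
  18 * H%:R / h0%:R + lattice_tail (X + u) +
  I%:R^-1 * zsum (2 * H) (fun h => zsum (3 * K) (fun k => inner h k)).
Proof.
have [p_D p1] := psiP.
have inner0 h k : 0 <= inner h k.
  by rewrite /inner; case: ifP => // _; rewrite addr_ge0 ?cabs_ge0 // mulr_ge0 // mulr_ge0 // exprn_ge0.
have t0 h' k' : 0 <= tail h' k' by rewrite /tail; case: ifP => // _; rewrite mulr_ge0 // cabs_ge0.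
have bz (V : nmodType) (f : int -> int -> V) :
   zz (fun h k => if box (3 * H) (3 * K) h k then f h k else 0) =
   zsum (3 * H) (fun h => zsum (3 * K) (f h)).
  rewrite /zz (@zsum_widen _ (3 * H)); [|by clear; lia|]; last first.
    by move=> h hH; apply: zsum0 => k _; rewrite /box leqNgt hH.
  apply: eq_zsum => h hH; rewrite (@zsum_widen _ (3 * K)); [|by clear; lia|]; last first.
    by move=> k kK; rewrite /box [(`|k| <= _)%N]leqNgt kK andbF.
  by apply: eq_zsum => k kK; rewrite /box hH kK.
pose P h k : R[i] := if [&& lat (X + u) h k, (h != 0) || (k != 0) & h * ku == k * h0%:Z]
  then F h k * psi h k * S h k else 0.
have E : lattice_sum (X + u) psi = zsum (3 * H) (fun h => zsum (3 * K) (P h)) + zz G.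
  have -> : zz G = zz (fun h k => if box (3 * H) (3 * K) h k then
      (if lat (X + u) h k && (h * ku != k * h0%:Z) then F h k * psi h k * S h k else 0) else 0).
    apply: eq_zsum => h _; apply: eq_zsum => k _; rewrite /G.
    by case: (lat _ _ _); case: (box _ _ _ _); case: (_ != _).
  rewrite bz -zsum_split; apply: eq_zsum => h _; rewrite -zsum_split; apply: eq_zsum => k _.
  rewrite /P; case: (lat _ _ _) => /=; last by rewrite addr0.
  case: (boolP ((h != 0) || (k != 0))) => /= hk; last first.
    by move: hk; rewrite negb_or !negbK => /andP[/eqP -> /eqP ->]; rewrite !mul0r eqxx addr0.
  by case: eqP => _ /=; rewrite ?addr0 ?add0r.
rewrite E; apply: le_trans (cabsD _ _) _; rewrite -addrA; apply: lerD.
  apply: le_trans parallel_part; apply: le_trans (cabs_zsum _ _) _.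
  apply: ler_zsum => h _; apply: le_trans (cabs_zsum _ _) _; apply: ler_zsum => k _.
  rewrite /P; case: ifP => _; last by rewrite cabs0.
  rewrite !cabsM p1 mulr1 -[leRHS]mul1r; apply: ler_wpM2r => //; exact: cabs_ge0.
have GI : I%:R * zz G = zz (fun h k => \sum_(i < I) G (h + (i : nat)%:Z * h0%:Z) (k + (i : nat)%:Z * ku)).
  rewrite mulr_natl -[in LHS](card_ord I) -sumr_const.
  rewrite (eq_bigr (fun i : 'I_I => zz (fun h k => G (h + (i : nat)%:Z * h0%:Z) (k + (i : nat)%:Z * ku)))).
    by rewrite /zz zsum_exchange; apply: eq_zsum => h _; rewrite zsum_exchange.
  move=> i _; rewrite zz_shift // => h k nb; by rewrite /G (negPf nb) /= andbF.
have TI : zz (fun h k => \sum_(i < I) tail (h + (i : nat)%:Z * h0%:Z) (k + (i : nat)%:Z * ku)) =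
    I%:R * lattice_tail (X + u).
  have -> : lattice_tail (X + u) = zz tail.
    rewrite /lattice_tail -bz; apply: eq_zsum => h _; apply: eq_zsum => k _; rewrite /tail.
    by case: (lat _ _ _); case: (box _ _ _ _).
  rewrite mulr_natl -[in RHS](card_ord I) -sumr_const.
  rewrite [RHS](eq_bigr (fun i : 'I_I => zz (fun h k => tail (h + (i : nat)%:Z * h0%:Z) (k + (i : nat)%:Z * ku)))).
    by rewrite /zz zsum_exchange; apply: eq_zsum => h _; rewrite zsum_exchange.
  by move=> i _; rewrite zz_shift // => h k nb; rewrite /tail (negPf nb) andbF.
have IR : 0 < I%:R :> R by rewrite ltr0n.
rewrite -(ler_pM2l IR) mulrDr mulVKf ?gt_eqF // -TI.
rewrite -[X in X * _]cabs_nat -cabsM GI.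
apply: le_trans (cabs_zsum _ _) _.
apply: (@le_trans _ _ (zz (fun h k => (if box (2 * H) (2 * K) h k then inner h (k - u%:Z * h) else 0) +
  \sum_(i < I) tail (h + (i : nat)%:Z * h0%:Z) (k + (i : nat)%:Z * ku)))).
  apply: ler_zsum => h _; apply: le_trans (cabs_zsum _ _) _; apply: ler_zsum => k _.
  exact: shift_bound.
have -> : forall f g : int -> int -> R, zz (fun h k => f h k + g h k) = zz g + zz f.
  move=> f g; rewrite /zz addrC -zsum_split; apply: eq_zsum => h _; exact: zsum_split.
rewrite lerD2l /zz (@zsum_widen _ (2 * H)); [|by clear; lia|]; last first.
  by move=> h hH; apply: zsum0 => k _; rewrite /box leqNgt hH.
apply: ler_zsum => h hH.
have uh : (`|(u%:Z * h)%R| <= K)%N.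
  rewrite abszM /=; apply: leq_trans HK; rewrite mulnAC mulnC; apply: leq_mul => //.
  exact: ltnW.
rewrite -(@zsum_shift _ (2 * K) _ (u%:Z * h)); last 2 first.
- by clear -uh; lia.
- by move=> k kK; rewrite /box [(`|k| <= _)%N]leqNgt kK andbF.
have Z3 : (3 * K <= 4 * K)%N by clear; lia.
apply: (@le_trans _ _ (zsum (4 * K) (fun k => if (`|k| <= 3 * K)%N then inner h k else 0))).
  apply: ler_zsum => k _; case: ifP => [/andP[_ kK]|_]; last by case: ifP.
  rewrite addrK ifT //; clear -kK uh; move: (u%:Z * h) kK uh => a; lia.
rewrite (zsum_widen Z3); last by move=> k kK; rewrite leqNgt kK.
by rewrite le_eqVlt; apply/orP; left; apply/eqP; apply: eq_zsum => k ->.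
Qed.

End ShortVector.

Let r0 : (0 < r)%N := prime_gt0 pr.
Let r20 : (0 < r ^ 2)%N. Proof. by rewrite expn_gt0 r0. Qed.

Let HleK : (2 * H <= K)%N.
Proof. by apply: leq_trans HK; rewrite leq_mul2r leq_pmulr // orbT. Qed.

Let H0leK0 : (H0 <= K0)%N.
Proof. by apply: leq_trans HK0; rewrite leq_pmull. Qed.

Let count_lattice (Z : nat) (h : int) (h0 : h != 0) :
  (\sum_(X < n) zsum Z (fun k => lat X h k : nat) <= `|h| + 2 * Z)%N.
Proof.
rewrite zsum_exchange.
have g0 : (0 < gcdn `|h| n)%N by rewrite gcdn_gt0 n0 orbT.
apply: (@leq_trans (zsum Z (fun k => gcdn `|h| n * ((gcdn `|h| n)%:Z %| k)%Z)%N)).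
  apply: leq_sum => a _.
  by rewrite -big_mkcond /= sum1_card; exact: card_linear_roots.
apply: leq_trans (zsum_dvd_le _ g0) _.
by rewrite leq_add2r dvdn_leq ?dvdn_gcdl // lt0n absz_eq0.
Qed.

Let count_box :
  (\sum_(X < n) zsum (2 * H) (fun h => zsum (3 * K) (fun k => (lat X h k && (h != 0)) : nat))
   <= 28 * H * K)%N.
Proof.
rewrite zsum_exchange zsum_split0.
rewrite big1 ?add0n; last first.
  by move=> X _; apply: zsum0 => k _; rewrite eqxx andbF.
apply: (@leq_trans (\sum_(1 <= h < (2 * H).+1) (7 * K + 7 * K))%N); last first.
  by rewrite sum_nat_const_nat subn1 /=; clear; lia.
rewrite [leqLHS]big_nat [leqRHS]big_nat; apply: leq_sum => h /andP[h1 hH].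
have B1 (h' : int) : h' != 0 -> (`|h'| <= 2 * H)%N ->
    (\sum_(X < n) zsum (3 * K) (fun k => (lat X h' k && (h' != 0)) : nat) <= 7 * K)%N.
  move=> hn hH'.
  rewrite (eq_bigr (fun X : 'I_n => zsum (3 * K) (fun k => lat X h' k : nat))); last first.
    by move=> X _; apply: eq_zsum => k _; rewrite hn andbT.
  apply: leq_trans (count_lattice _ hn) _.
  by clear -hH' HleK; lia.
by apply: leq_add; apply: B1; clear -h1 hH; lia.
Qed.

(** A given [h] is the first coordinate of the chosen vector for at most [h + 2 K0 <= 3 K0] residues
    [X]. *)
Let sum_inv_minimal (v : nat -> nat * int) :
  (forall X, [/\ (0 < (v X).1 <= H0)%N, (`|(v X).2| <= K0)%N & lat X (v X).1%:Z (v X).2]) ->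
  \sum_(X < n) (v X).1%:R^-1 <= 3 * K0%:R * harm R H0 :> R.
Proof.
move=> vP.
apply: (@le_trans _ _ (\sum_(X < n) \sum_(1 <= h < H0.+1)
   h%:R^-1 * (zsum K0 (fun k => lat X h%:Z k : nat))%:R)).
  apply: ler_sum => X _; have [/andP[v1 vH] vK vl] := vP X.
  rewrite (bigD1_seq (v X).1) ?iota_uniq //=; last by rewrite mem_index_iota v1 ltnS.
  apply: ler_wpDr; first by apply: sumr_ge0 => h _; rewrite mulr_ge0 // invr_ge0.
  rewrite ler_peMr ?invr_ge0 // ler1n.
  have aP : (`|((v X).2 + K0%:Z)%R| < (2 * K0).+1)%N by clear -vK; lia.
  rewrite /zsum (bigD1 (Ordinal aP)) //=.
  have -> : `|((v X).2 + K0%:Z)%R|%N%:Z - K0%:Z = (v X).2 by clear -vK; lia.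
  by rewrite vl.
rewrite exchange_big /= /harm mulr_sumr big_nat [leRHS]big_nat; apply: ler_sum => h /andP[h1 hH].
rewrite -mulr_sumr mulrC; apply: ler_wpM2r; first by rewrite invr_ge0.
rewrite -natr_sum -natrM ler_nat; apply: leq_trans (count_lattice _ _) _.
  by clear -h1; lia.
by clear -hH H0leK0; move: hH; rewrite absz_nat; lia.
Qed.

(** As [X] runs over all residues, it may be replaced by [X + u] and the result averaged over
    [u < r ^ 2]; for fixed [X] and [(h, k)] the sum over [u] is the one in [sum_shift_average]. The
    choice [I = m ^ 4] makes its fourth root a multiple of [I ^ (3 / 4) = m ^ 3], with
    [6 ^ 4 >= 720], and division by [I] leaves [6 / m]. *)
Lemma sum_lattice_sum (psi : nat -> int -> int -> R[i]) :
  (forall X, additive_character (psi X)) ->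
  \sum_(X < n | coprime X n) cabs (lattice_sum X (psi X)) <=
    28 * H%:R * K%:R * (6 / m%:R + 2 * m%:R ^+ 4 * eps) + 54 * H%:R * K0%:R * harm R H0 +
    \sum_(X < n | coprime X n) lattice_tail X.
Proof.
move=> psiP.
have [v vP] := choice (fun X => minimal_vector X n0 H00 nHK).
have latE X h k : lat (X %% n) h k = lat X h k.
  have e : X%:Z = (X %/ n)%N%:Z * n%:Z + (X %% n)%N%:Z by rewrite -PoszM -PoszD -divn_eq.
  rewrite /lat [in RHS]e.
  have -> : k - h * ((X %/ n)%N%:Z * n%:Z + (X %% n)%N%:Z) =
    k - h * (X %% n)%N%:Z + (- (h * (X %/ n)%N%:Z)) * n%:Z by ring.
  by rewrite [in RHS]rpredDr // dvdz_mull.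
have per X chi : lattice_sum (X %% n) chi = lattice_sum X chi.
  by apply: eq_zsum => h _; apply: eq_zsum => k _; rewrite latE.
have pert X : lattice_tail (X %% n) = lattice_tail X.
  by apply: eq_zsum => h _; apply: eq_zsum => k _; rewrite latE.
have r2R : 0 < (r ^ 2)%N%:R :> R by rewrite ltr0n.
have mR : 0 < m%:R :> R by rewrite ltr0n.
have eps0 : 0 <= eps by rewrite /eps addr_ge0 // !mulr_ge0.
have IE : I%:R = m%:R ^+ 4 :> R by rewrite /I natrX.
rewrite -(ler_pM2l r2R).
have shift (f : nat -> R) : (forall X, f (X %% n)%N = f X) -> (r ^ 2)%N%:R * \sum_(X < n) f X =
    \sum_(X < n) \sum_(u < r ^ 2) f (X + u)%N.
  move=> fp; rewrite exchange_big /= mulr_natl -[in LHS](card_ord (r ^ 2)) -sumr_const.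
  apply: eq_bigr => u _; rewrite -(sum_shift_mod u f n0).
  by apply: eq_bigr => X _; rewrite fp.
pose f X := if coprime X n then cabs (lattice_sum X (psi (X %% n)%N)) else 0.
pose tl X := if coprime X n then lattice_tail X else 0.
have tl0 X : 0 <= tl X.
  rewrite /tl; case: ifP => // _; apply: zsum_ge0 => h _; apply: zsum_ge0 => k _.
  by case: ifP => // _; rewrite mulr_ge0 // cabs_ge0.
have -> : \sum_(X < n | coprime X n) cabs (lattice_sum X (psi X)) = \sum_(X < n) f X.
  by rewrite big_mkcond; apply: eq_bigr => X _; rewrite /f modn_small.
have -> : \sum_(X < n | coprime X n) lattice_tail X = \sum_(X < n) tl X.
  by rewrite big_mkcond.
rewrite (shift f); last by move=> X; rewrite /f modn_mod per coprime_modl.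
rewrite mulrDr (shift tl); last by move=> X; rewrite /tl coprime_modl pert.
pose inner (X : nat) (u : nat) h k := if lat X h k && (h * (v X).2 != k * (v X).1%:Z) then
  cabs (\sum_(i < I) psi ((X + u) %% n)%N (v X).1%:Z ((v X).2 + u%:Z * (v X).1%:Z) ^+ i *
    S (h + (i : nat)%:Z * (v X).1%:Z) (k + (i : nat)%:Z * (v X).2 + u%:Z * (h + (i : nat)%:Z * (v X).1%:Z)))
  + 2 * I%:R ^+ 2 * eps else 0.
apply: (@le_trans _ _ (\sum_(X < n) \sum_(u < r ^ 2)
  (18 * H%:R / (v X).1%:R + tl (X + u)%N +
   I%:R^-1 * zsum (2 * H) (fun h => zsum (3 * K) (fun k => inner X u h k))))).
  apply: ler_sum => X _; apply: ler_sum => u _.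
  have [/andP[v1 vH] vK vl vm] := vP X.
  rewrite /f /tl; case: ifP => _; first exact: short_vector_bound.
  rewrite addr0 addr_ge0 ?divr_ge0 ?mulr_ge0 // ?invr_ge0 //.
  apply: zsum_ge0 => h _; apply: zsum_ge0 => k _; rewrite /inner; case: ifP => // _.
  by rewrite addr_ge0 ?cabs_ge0 // mulr_ge0 // mulr_ge0 // exprn_ge0.
rewrite (eq_bigr (fun X : 'I_n => (r ^ 2)%N%:R * (18 * H%:R / (v X).1%:R) +
  \sum_(u < r ^ 2) tl (X + u)%N + I%:R^-1 * \sum_(u < r ^ 2)
  zsum (2 * H) (fun h => zsum (3 * K) (fun k => inner X u h k)))); last first.
  move=> X _; rewrite big_split big_split /= sumr_const card_ord -[_ *+ (r ^ 2)]mulr_natl.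
  by rewrite mulr_sumr.
rewrite big_split big_split /= [leLHS]addrAC lerD2r.
rewrite -mulr_sumr -mulr_sumr [leRHS]mulrDr [leRHS]addrC; apply: lerD.
  apply: ler_wpM2l; first exact: ltW.
  apply: (@le_trans _ _ (18 * H%:R * (3 * K0%:R * harm R H0))); last first.
    by rewrite le_eqVlt; apply/orP; left; apply/eqP; ring.
  apply: ler_wpM2l; first by rewrite mulr_ge0.
  by apply: sum_inv_minimal => X; have [] := vP X.
have IR : 0 < I%:R :> R by rewrite IE exprn_gt0.
rewrite -mulr_sumr -(ler_pM2l IR) mulVKf ?gt_eqF //.
set c4 := 6 * m%:R ^+ 3 * r%:R ^+ 2 + (r ^ 2)%N%:R * (2 * I%:R ^+ 2 * eps).
apply: (@le_trans _ _ (c4 * (28 * H * K)%N%:R)); last first.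
  rewrite le_eqVlt; apply/orP; left; apply/eqP.
  rewrite /c4 IE !natrM; move: (eps) => e; field; exact: lt0r_neq0.
have c40 : 0 <= c4.
  by rewrite /c4 addr_ge0 // !mulr_ge0 // ?exprn_ge0 // ?mulr_ge0 // exprn_ge0.
apply: (@le_trans _ _ (c4 * (\sum_(X < n) zsum (2 * H) (fun h => zsum (3 * K)
   (fun k => (lat X h k && (h != 0)) : nat)))%N%:R)); last first.
  by apply: ler_wpM2l => //; rewrite ler_nat count_box.
rewrite natr_sum mulr_sumr; apply: ler_sum => X _.
rewrite zsum_exchange natr_zsum -zsumZ; apply: ler_zsum => h hH.
rewrite zsum_exchange natr_zsum -zsumZ; apply: ler_zsum => k kK.
have [/andP[v1 vH] vK vl vm] := vP X.
rewrite /inner; case: (boolP (lat X h k && (h * (v X).2 != k * (v X).1%:Z))) => [/andP[l d]|_]; last first.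
  by rewrite big1 // mulr_ge0.
(* A lattice point with [h = 0] has [n | k] and [|k| <= 3 K < n], so it is the origin, which the
   determinant condition excludes. *)
have hn : h != 0.
  apply: contra d => /eqP e; move: l; rewrite e /lat mul0r subr0 mul0r => nk.
  have -> : k = 0; last by rewrite mul0r.
  apply/eqP; rewrite -absz_eq0 -leqn0 leqNgt; apply/negP => k0.
  by have := dvdn_leq k0 nk; rewrite leqNgt (leq_ltn_trans kK Kn).
rewrite l hn mulr1 big_split /= sumr_const card_ord -[_ *+ _]mulr_natl lerD2r.
have bb : box (2 * H) (3 * K) h k by rewrite /box hH.
have rd : ~~ (r%:Z %| h * (v X).2 - k * (v X).1%:Z)%Z by apply: (@det_ndvd X (v X).1).
have I0' : (0 < I)%N by rewrite expn_gt0 m0.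
(* The character may change with [u] in any manner; [sum_shift_average] asks only that it contribute
   powers of one unimodular number. *)
pose w u := psi ((X + u) %% n)%N (v X).1%:Z ((v X).2 + u%:Z * (v X).1%:Z).
have := sum_shift_average (w := w) pr I0' Ir cr rd.
set s := \sum_(u < _) _ => /(_ _) s4.
have s0 : 0 <= s by apply: sumr_ge0 => u _; apply: cabs_ge0.
have {}s4 : s ^+ 4 <= 720 * I%:R ^+ 3 * r%:R ^+ 8.
  by apply: s4 => u; have [_] := psiP ((X + u) %% n)%N; apply.
rewrite -(@ler_pXn2r _ 4) ?nnegrE ?mulr_ge0 ?exprn_ge0 //.
apply: le_trans s4 _.
have -> : (6 * m%:R ^+ 3 * r%:R ^+ 2) ^+ 4 = 1296 * I%:R ^+ 3 * r%:R ^+ 8 :> R.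
  by rewrite IE; ring.
apply: ler_wpM2r; first by rewrite exprn_ge0.
by apply: ler_wpM2r; [rewrite exprn_ge0 // ltW | rewrite ler_nat].
Qed.

End LatticeBound.

(** * The box count and its Fourier expansion *)

Lemma dvdz_subn (a b q : nat) : (q%:Z %| a%:Z - b%:Z)%Z = (a == b %[mod q])%N.
Proof. by rewrite -eqz_mod_dvd !modz_nat eqz_nat. Qed.

Lemma ord_dvdz_inj q (x y : 'I_q) : (q%:Z %| x%:Z - y%:Z)%Z -> x = y.
Proof. by rewrite dvdz_subn !modn_small // => /eqP/val_inj. Qed.

Section Fourier.
Variable R : realType.

Lemma kloosterman_dvd_count (q d : nat) : (0 < q)%N ->
  (\sum_(y < q | coprime y q) (q%:Z %| ((invm q y)%:Z - d%:Z)%R)%Z = coprime d q)%N.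
Proof.
move=> q0.
have E (y : 'I_q) : coprime y q -> (q%:Z %| (invm q y)%:Z - d%:Z)%Z = (q%:Z %| y%:Z * d%:Z - 1)%Z.
  move=> cy; have iy := invmP cy.
  apply/idP/idP => H.
    have -> : y%:Z * d%:Z - 1 = (y%:Z * (invm q y)%:Z - 1) - y%:Z * ((invm q y)%:Z - d%:Z) by ring.
    by rewrite rpredB // dvdz_mull.
  apply: (@dvdz_inv_unique q%:Z y%:Z) => //.
rewrite (eq_bigr (fun y : 'I_q => (q%:Z %| y%:Z * d%:Z - 1)%Z : nat)); last by move=> y /E ->.
have cdv (y : nat) : (q%:Z %| y%:Z * d%:Z - 1)%Z -> coprime y q && coprime d q.
  move=> H; rewrite -coprimeMl /coprime -dvdn1.
  have : ((gcdn (y * d) q)%:Z %| (y * d)%N%:Z - (y%:Z * d%:Z - 1))%Z.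
    rewrite rpredB //; first by rewrite dvdzE dvdn_gcdl.
    by apply: dvdz_trans H; rewrite dvdzE dvdn_gcdr.
  by have -> : (y * d)%N%:Z - (y%:Z * d%:Z - 1) = 1 by [rewrite PoszM; ring]; rewrite dvdzE.
have [cd|ncd] := boolP (coprime d q); last first.
  by rewrite big1 // => y _; case: (boolP (_ %| _)%Z) => // /cdv; rewrite (negPf ncd) andbF.
have id := invmP cd.
pose y0 : 'I_q := Ordinal (ltn_pmod (invm q d) q0).
have y0E : (q%:Z %| (invm q d)%:Z - y0%:Z)%Z.
  by rewrite dvdz_subn /= modn_mod.
have dy : (q%:Z %| y0%:Z * d%:Z - 1)%Z.
  have -> : y0%:Z * d%:Z - 1 = (d%:Z * (invm q d)%:Z - 1) - d%:Z * ((invm q d)%:Z - y0%:Z) by ring.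
  by rewrite rpredB // dvdz_mull.
rewrite (bigD1 y0) /=; last by have /andP[] := cdv y0 dy.
rewrite dy big1 // => y /andP[_ yy0]; apply/eqP; rewrite eqb0.
apply: contra yy0 => H.
have {}H : (q%:Z %| y%:Z - y0%:Z)%Z.
  apply: (@dvdz_inv_unique q%:Z d%:Z); by rewrite mulrC.
by apply/eqP; exact: ord_dvdz_inj.
Qed.

Variables (P1 P2 : finType) (d : P1 -> nat) (e : P2 -> nat) (q : nat).
Hypothesis q0 : (0 < q)%N.
Let g1 (k : int) : R[i] := \sum_p ee R q (- (k * (d p)%:Z)).
Let g2 (h : int) : R[i] := \sum_p ee R q (- (h * (e p)%:Z)).

Let qC : (q%:R : R[i]) != 0. Proof. by rewrite pnatr_eq0 -lt0n. Qed.

(** The congruence says that some unit [y] is congruent to [z] and has inverse [x]. Both conditions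
    are detected by characters, and summing over [y] produces the Kloosterman sum. *)
Let unit_expand (x z : nat) : ((q%:Z %| x%:Z * z%:Z - 1)%Z%:R : R[i]) =
  q%:R^-2 * \sum_(h < q) \sum_(k < q) kloosterman R q 1 h%:Z k%:Z *
    (ee R q (- (h%:Z * z%:Z)) * ee R q (- (k%:Z * x%:Z))).
Proof.
have -> : \sum_(h < q) \sum_(k < q) kloosterman R q 1 h%:Z k%:Z *
    (ee R q (- (h%:Z * z%:Z)) * ee R q (- (k%:Z * x%:Z))) =
  \sum_(y < q | coprime y q) (\sum_(h < q) ee R q (h%:Z * (y%:Z - z%:Z))) *
    (\sum_(k < q) ee R q (k%:Z * ((invm q y)%:Z - x%:Z))).
  rewrite /kloosterman.
  under eq_bigr => h _ do (under eq_bigr => k _ do rewrite mulr_suml; rewrite exchange_big).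
  rewrite exchange_big; apply: eq_bigr => y _ /=.
  rewrite mulr_suml; apply: eq_bigr => h _; rewrite mulr_sumr; apply: eq_bigr => k _.
  by rewrite -!eeD; congr (ee _ _ _); ring.
have E (y : 'I_q) : coprime y q -> (\sum_(h < q) ee R q (h%:Z * (y%:Z - z%:Z))) *
    (\sum_(k < q) ee R q (k%:Z * ((invm q y)%:Z - x%:Z))) =
    q%:R ^+ 2 * ((q%:Z %| y%:Z - z%:Z)%Z && (q%:Z %| x%:Z * z%:Z - 1)%Z)%:R.
  move=> cy; rewrite !sum_ee //; have iy := invmP cy.
  case: (boolP (q%:Z %| y%:Z - z%:Z)%Z) => yz /=; last by rewrite mul0r mulr0.
  have -> : (q%:Z %| (invm q y)%:Z - x%:Z)%Z = (q%:Z %| x%:Z * z%:Z - 1)%Z.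
    apply/idP/idP => H.
      have -> : x%:Z * z%:Z - 1 = (y%:Z * (invm q y)%:Z - 1) - y%:Z * ((invm q y)%:Z - x%:Z) -
         x%:Z * (y%:Z - z%:Z) by ring.
      by apply: rpredB; [apply: rpredB => //|]; exact: dvdz_mull.
    apply: (@dvdz_inv_unique q%:Z y%:Z) => //.
    have -> : y%:Z * x%:Z - 1 = (x%:Z * z%:Z - 1) + x%:Z * (y%:Z - z%:Z) by ring.
    by rewrite rpredD // dvdz_mull.
  by case: (_ %| _)%Z; rewrite ?mulr0 // mulr1 expr2.
rewrite (eq_bigr _ E) -mulr_sumr mulrA mulVf ?expf_neq0 // mul1r.
case: (boolP (q%:Z %| x%:Z * z%:Z - 1)%Z) => H; last first.
  by rewrite big1 // => y _; rewrite andbF.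
have y0E : (q%:Z %| (z %% q)%N%:Z - z%:Z)%Z.
  by rewrite dvdz_subn modn_mod.
rewrite (bigD1 (Ordinal (ltn_pmod z q0))) /= ?y0E; last first.
  rewrite coprime_modl /coprime -dvdn1.
  have : ((gcdn z q)%:Z %| x%:Z * z%:Z - (x%:Z * z%:Z - 1))%Z.
    rewrite rpredB //; first by rewrite dvdz_mull // dvdzE dvdn_gcdl.
    by apply: dvdz_trans H; rewrite dvdzE dvdn_gcdr.
  by have -> : x%:Z * z%:Z - (x%:Z * z%:Z - 1) = 1 by [ring]; rewrite dvdzE.
rewrite big1 ?addr0 // => y /andP[_ yy0].
rewrite andbT; case: (boolP (_ %| _)%Z) => // yz; case/negP: yy0.
apply/eqP; apply: ord_dvdz_inj => /=.
have -> : y%:Z - (z %% q)%N%:Z = (y%:Z - z%:Z) - ((z %% q)%N%:Z - z%:Z) by ring.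
by rewrite rpredB.
Qed.

(** The frequency [h = 0] is the expected count: there the sum over all [k] restores the indicator
    that [d p] is invertible. *)
Lemma inverse_pairs_fourier :
  ((\sum_p1 \sum_p2 (q%:Z %| ((d p1)%:Z * (e p2)%:Z - 1)%R)%Z)%N%:R : R[i]) =
  #|P2|%:R / q%:R * (\sum_p coprime (d p) q)%N%:R +
  q%:R^-2 * \sum_(h < q | h != 0 :> nat) \sum_(k < q)
    kloosterman R q 1 h%:Z k%:Z * (g2 h%:Z * g1 k%:Z).
Proof.
rewrite natr_sum.
under eq_bigr do rewrite natr_sum.
under eq_bigr => p1 _ do (under eq_bigr => p2 _ do rewrite unit_expand; rewrite -mulr_sumr).
rewrite -mulr_sumr.
have -> : \sum_i \sum_i0 \sum_(h < q) \sum_(k < q) kloosterman R q 1 h%:Z k%:Z *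
    (ee R q (- (h%:Z * (e i0)%:Z)) * ee R q (- (k%:Z * (d i)%:Z))) =
  \sum_(h < q) \sum_(k < q) kloosterman R q 1 h%:Z k%:Z * (g2 h%:Z * g1 k%:Z).
  under eq_bigr do rewrite exchange_big /=.
  rewrite exchange_big /=; apply: eq_bigr => h _.
  under eq_bigr do rewrite exchange_big /=.
  rewrite exchange_big /=; apply: eq_bigr => k _.
  under eq_bigr do rewrite -mulr_sumr.
  rewrite -mulr_sumr; congr (_ * _).
  rewrite /g2 /g1 mulr_suml exchange_big /=; apply: eq_bigr => p2 _.
  by rewrite mulr_sumr.
rewrite (bigD1 (Ordinal q0)) //= mulrDr; congr (_ + _).
have g20 : g2 0 = #|P2|%:R.
  rewrite /g2 (eq_bigr (fun=> 1)) ?sumr_const // => p _.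
  by rewrite mul0r oppr0 ee0.
rewrite g20.
have -> : \sum_(k < q) kloosterman R q 1 0 k%:Z * (#|P2|%:R * g1 k%:Z) =
   #|P2|%:R * (q%:R * (\sum_p coprime (d p) q)%N%:R).
  rewrite (eq_bigr (fun k : 'I_q => #|P2|%:R * (kloosterman R q 1 0 k%:Z * g1 k%:Z))); last by move=> k _; ring.
  rewrite -mulr_sumr; congr (_ * _).
  rewrite /kloosterman /g1 natr_sum mulr_sumr.
  transitivity (\sum_(k < q) \sum_p \sum_(y < q | coprime y q)
     ee R q (1 * (0 * y%:Z + k%:Z * (invm q y)%:Z)) * ee R q (- (k%:Z * (d p)%:Z))).
    apply: eq_bigr => k _; rewrite mulr_sumr; apply: eq_bigr => p _.
    by rewrite mulr_suml.
  rewrite exchange_big /=; apply: eq_bigr => p _; rewrite exchange_big /=.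
  rewrite -(kloosterman_dvd_count (d p) q0) natr_sum mulr_sumr; apply: eq_bigr => y _.
  rewrite (eq_bigr (fun k : 'I_q => ee R q (k%:Z * ((invm q y)%:Z - (d p)%:Z)))).
    by rewrite sum_ee //; case: ifP; rewrite ?mulr1 ?mulr0.
  by move=> k _; rewrite -eeD; congr (ee _ _ _); ring.
by field.
Qed.

End Fourier.

(** * Fourier transforms of double windows *)

Section Weights.
Variable R : realType.
Variables (q J M : nat).
Hypothesis q0 : (0 < q)%N.

Definition mean_ee (N : nat) (h : int) : R[i] := N%:R^-1 * \sum_(m < N) ee R q (m%:Z * - h).

Lemma cabs_natV n : cabs (n%:R^-1 : R[i]) = n%:R^-1.
Proof.
have [->|n0] := posnP n; first by rewrite !invr0 cabs0.
have nC : (n%:R : R[i]) != 0 by rewrite pnatr_eq0 -lt0n.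
have nR : (n%:R : R) != 0 by rewrite pnatr_eq0 -lt0n.
by apply: (mulfI nR); rewrite -[in LHS]cabs_nat -cabsM !mulfV // cabs1.
Qed.

Lemma cabs_mean_le1 N h : cabs (mean_ee N h) <= 1.
Proof.
rewrite cabsM cabs_natV; have [->|N0] := posnP N; first by rewrite invr0 mul0r.
rewrite ler_pdivrMl ?ltr0n // mulr1.
by apply: le_trans (cabs_ee_sum_le _ _ _ _) _; rewrite ler_nat card_ord.
Qed.

Lemma cabs_mean_le N h : (0 < N)%N -> h != 0 -> (2 * `|h| <= q)%N ->
  cabs (mean_ee N h) <= q%:R / (N%:R * `|h|%N%:R).
Proof.
move=> N0 h0 hq; rewrite cabsM cabs_natV.
rewrite invfM mulrCA; apply: ler_wpM2l; first by rewrite invr_ge0.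
have := @cabs_geometric R q (- h) N q0; rewrite oppr_eq0 abszN => H.
by apply: le_trans (H _ _) _ => //; rewrite normrN natr_absz.
Qed.

Lemma mean_lipschitz N h h' : cabs (mean_ee N (h + h') - mean_ee N h) <=
  8 * N%:R / q%:R * `|h'|%:~R.
Proof.
rewrite /mean_ee -mulrBr cabsM cabs_natV -sumrB.
have [->|N0] := posnP N; first by rewrite invr0 mul0r mulr0 !mul0r.
rewrite ler_pdivrMl ?ltr0n //.
apply: le_trans (cabs_sum _ _ _) _.
apply: (@le_trans _ _ (\sum_(m < N) (8 * N%:R / q%:R * `|h'|%:~R))); last first.
  by rewrite sumr_const card_ord [leRHS]mulr_natl.
apply: ler_sum => m _.
have -> : ee R q (m%:Z * - (h + h')) - ee R q (m%:Z * - h) =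
   ee R q (m%:Z * - h) * (ee R q (m%:Z * - h') - 1).
  by rewrite mulrBr mulr1 -eeD; congr (ee _ _ _ - _); ring.
rewrite cabsM cabs_ee mul1r; apply: le_trans (cabs_ee_sub1_le _ _ q0) _.
rewrite -!mulrA; apply: ler_wpM2l => //; rewrite mulrC mulrCA.
apply: ler_wpM2l; first by rewrite invr_ge0.
rewrite mulrN normrN normrM rmorphM /=.
apply: ler_wpM2r; first by rewrite ler0z.
by rewrite -[leLHS]/(m%:R) ler_nat ltnW.
Qed.

(** Normalised transform of the convolution of intervals of lengths [J] and [M]. Its decay is
    quadratic in [h], so the frequency sums lose only logarithms. *)
Definition smooth (h : int) : R[i] := mean_ee J h * mean_ee M h.

Lemma smooth_le1 h : cabs (smooth h) <= 1.
Proof.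
rewrite cabsM; rewrite -[leRHS]mulr1; apply: ler_pM; rewrite ?cabs_ge0 //; exact: cabs_mean_le1.
Qed.

Lemma smooth_le h : (0 < M)%N -> h != 0 -> (2 * `|h| <= q)%N ->
  cabs (smooth h) <= q%:R / (M%:R * `|h|%N%:R).
Proof.
move=> M0 h0 hq; rewrite cabsM -[leRHS]mul1r; apply: ler_pM; rewrite ?cabs_ge0 //.
  exact: cabs_mean_le1.
exact: cabs_mean_le.
Qed.

Lemma smooth_le2 h : (0 < J)%N -> (0 < M)%N -> h != 0 -> (2 * `|h| <= q)%N ->
  cabs (smooth h) <= q%:R / (J%:R * `|h|%N%:R) * (q%:R / (M%:R * `|h|%N%:R)).
Proof.
by move=> J0 M0 h0 hq; rewrite cabsM; apply: ler_pM; rewrite ?cabs_ge0 // cabs_mean_le.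
Qed.

Lemma smooth_lipschitz h h' : cabs (smooth (h + h') - smooth h) <=
  8 * (J + M)%N%:R / q%:R * `|h'|%:~R.
Proof.
have -> : smooth (h + h') - smooth h = (mean_ee J (h + h') - mean_ee J h) * mean_ee M (h + h') +
  mean_ee J h * (mean_ee M (h + h') - mean_ee M h) by rewrite /smooth; ring.
have -> : 8 * (J + M)%N%:R / q%:R * `|h'|%:~R = 8 * J%:R / q%:R * `|h'|%:~R +
  8 * M%:R / q%:R * `|h'|%:~R :> R by rewrite natrD; ring.
apply: le_trans (cabsD _ _) _.
rewrite (cabsM (mean_ee J _ - _)) (cabsM (mean_ee J h)); apply: lerD.
  rewrite -[leRHS]mulr1; apply: ler_pM; rewrite ?cabs_ge0 ?mean_lipschitz //; exact: cabs_mean_le1.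
rewrite -[leRHS]mul1r; apply: ler_pM; rewrite ?cabs_ge0 ?mean_lipschitz //; exact: cabs_mean_le1.
Qed.

Lemma sum_pairs_ee (a : nat) (h : int) : (0 < J)%N -> (0 < M)%N ->
  \sum_(p : 'I_J * 'I_M) ee R q (- (h * (a + p.1 + p.2)%N%:Z)) =
  (J%:R * M%:R) * (ee R q (- (h * a%:Z)) * smooth h).
Proof.
move=> J0 M0; have JC : (J%:R : R[i]) != 0 by rewrite pnatr_eq0 -lt0n.
have MC : (M%:R : R[i]) != 0 by rewrite pnatr_eq0 -lt0n.
have -> : (J%:R * M%:R) * (ee R q (- (h * a%:Z)) * smooth h) = ee R q (- (h * a%:Z)) *
  ((\sum_(m < J) ee R q (m%:Z * - h)) * (\sum_(m < M) ee R q (m%:Z * - h))).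
  by rewrite /smooth /mean_ee; field; rewrite JC MC.
rewrite big_distrlr /= mulr_sumr.
rewrite -(pair_big predT predT (fun (i : 'I_J) (j : 'I_M) => ee R q (- (h * (a + i + j)%N%:Z)))) /=.
apply: eq_bigr => i _; rewrite mulr_sumr; apply: eq_bigr => j _.
by rewrite -!eeD; congr (ee _ _ _); rewrite !PoszD; ring.
Qed.

End Weights.

Section CenteredResidues.

Definition cen (q h : nat) : int := if (2 * h <= q)%N then h%:Z else h%:Z - q%:Z.

Lemma cen_le q h : (h <= q)%N -> (2 * `|cen q h| <= q)%N.
Proof. by move=> hq; rewrite /cen; case: (leqP (2 * h)%N q) => //; lia. Qed.

Lemma cen_dvd q h : (q%:Z %| cen q h - h%:Z)%Z.
Proof. by rewrite /cen; case: (leqP (2 * h)%N q) => _; rewrite ?subrr // addrAC subrr sub0r rpredN. Qed.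

Lemma cen_eq0 q h : (h < q)%N -> (cen q h == 0) = (h == 0)%N.
Proof. by move=> hq; rewrite /cen; case: (leqP (2 * h)%N q); lia. Qed.

Lemma sum_cen_le (R : numDomainType) q (f : int -> R) : (forall h, 0 <= f h) ->
  \sum_(h < q | h != 0 :> nat) f (cen q h) <= \sum_(1 <= t < q) (f t%:Z + f (- t%:Z)).
Proof.
move=> f0; rewrite -(big_mkord (fun h => h != 0%N) (fun h => f (cen q h))).
have -> : \sum_(0 <= h < q | h != 0%N) f (cen q h) = \sum_(1 <= h < q) f (cen q h).
  have [->|q0] := posnP q; first by rewrite !big_geq.
  rewrite big_ltn_cond //= big_nat_cond [RHS]big_nat; apply: eq_bigl => h.
  by case: h => // h; rewrite andbT.
rewrite big_split /=.
have -> : \sum_(1 <= t < q) f (- t%:Z) = \sum_(1 <= t < q) f (t%:Z - q%:Z).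
  rewrite big_nat_rev /=; apply: eq_big_nat => t /andP[t1 tq]; congr f; lia.
rewrite -big_split /= big_nat [leRHS]big_nat; apply: ler_sum => h _.
by rewrite /cen; case: (leqP (2 * h)%N q) => _; rewrite ?lerDl ?lerDr.
Qed.

Lemma zsum_cen (V : nmodType) q Z (f : int -> V) : (2 * Z < q)%N ->
  \sum_(h < q | (`|cen q h| <= Z)%N) f (cen q h) = zsum Z f.
Proof.
move=> Zq; rewrite zsum_split0.
rewrite -(big_mkord (fun h => (`|cen q h| <= Z)%N) (fun h => f (cen q h))).
rewrite big_ltn_cond; last by lia.
have c0 : cen q 0 = 0 by [].
rewrite c0 /=; congr (_ + _).
rewrite (@big_cat_nat _ _ _ Z.+1) /=; [|lia..].
rewrite (@big_cat_nat _ _ _ (q - Z) Z.+1) /=; [|lia..].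
rewrite big_split /=; congr (_ + _).
  rewrite big_nat_cond [RHS]big_nat; apply: eq_big => h.
    by rewrite /cen; case: (leqP (2 * h)%N q); lia.
  by move=> /andP[/andP[h1 hZ] _]; rewrite /cen; case: (leqP (2 * h)%N q) => //; lia.
rewrite [X in X + _]big_nat_cond [X in X + _]big_pred0; last first.
  by move=> h; rewrite /cen; case: (leqP (2 * h)%N q); lia.
rewrite add0r big_nat_cond (eq_bigl (fun h => (q - Z <= h < q)%N)); last first.
  by move=> h; rewrite /cen; case: (leqP (2 * h)%N q); lia.
rewrite -big_nat.
rewrite -{1}(add0n (q - Z)%N) big_addn (_ : (q - (q - Z))%N = Z); last by lia.
rewrite big_nat_rev /= add0n [RHS]big_add1 /=; apply: eq_big_nat => h /andP[_ hZ].
by congr f; rewrite /cen; case: ifP; lia.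
Qed.

End CenteredResidues.

Lemma sum_inv_dvd (R : realType) g Q : (0 < g)%N ->
  \sum_(1 <= t < Q) (g %| t)%N%:R / t%:R <= harm R Q / g%:R :> R.
Proof.
move=> g0.
have gR : 0 < g%:R :> R by rewrite ltr0n.
rewrite /harm mulr_suml.
have [->|Q0] := posnP Q; first by rewrite big_geq // sumr_ge0 // => i _; rewrite divr_ge0 // invr_ge0.
apply: (@le_trans _ _ (\sum_(1 <= t < Q) \sum_(1 <= k < Q.+1) (t == k * g)%N%:R * (k%:R^-1 / g%:R))).
  rewrite big_nat [leRHS]big_nat; apply: ler_sum => t /andP[t1 tQ].
  have [/dvdnP[k ek]|_] := boolP (g %| t)%N; last first.
    by rewrite mul0r; apply: sumr_ge0 => k _; rewrite mulr_ge0 // divr_ge0 // invr_ge0.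
  have k0 : (0 < k)%N by move: t1; rewrite ek muln_gt0 => /andP[].
  have kQ : (k <= Q)%N by apply: leq_trans (ltnW tQ); rewrite ek leq_pmulr.
  rewrite (bigD1_seq k) ?iota_uniq //=; last by rewrite mem_index_iota k0 ltnS.
  rewrite ek eqxx !mul1r natrM invfM.
  apply: ler_wpDr => //; apply: sumr_ge0 => i _; rewrite mulr_ge0 // divr_ge0 // invr_ge0 //.
rewrite exchange_big /=; apply: ler_sum => k _.
rewrite -mulr_suml -[leRHS]mul1r; apply: ler_wpM2r; first by rewrite divr_ge0 // invr_ge0.
rewrite -natr_sum -[leRHS]/(1%:R) ler_nat.
rewrite -big_mkcond /=; apply: leq_trans (_ : (\sum_(t <- index_iota 1 Q | t == k * g) 1 <= 1)%N); first by [].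
by rewrite sum1_count -[count _ _]/(count_mem (k * g)%N (iota 1 (Q - 1))) count_uniq_mem ?iota_uniq ?leq_b1.
Qed.

Lemma harm_ge0 (R : realType) n : 0 <= harm R n.
Proof. by apply: sumr_ge0 => i _; rewrite invr_ge0. Qed.

(** A stationary point [x] enters a lattice sum through [X = x ^ 2] and through its character.
    Keeping, for each [X], one root that carries at least the average replaces the sum over squares
    by a sum over all units [X], which the shifts [X + u] require; nonnegativity allows the
    enlargement. *)
Lemma select_max (R : realType) (n C : nat) (V : nat -> 'I_n -> R) : (0 < n)%N ->
  (forall X x, 0 <= V X x) ->
  (forall X, #|[pred x : 'I_n | coprime x n && (x ^ 2 %% n == X)%N]| <= C)%N ->
  exists s : nat -> 'I_n, \sum_(x < n | coprime x n) V (x ^ 2 %% n)%N x <=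
    C%:R * \sum_(X < n | coprime X n) V X (s X).
Proof.
move=> n0 V0 cC.
have H X : exists s : 'I_n, \sum_(x < n | coprime x n && (x ^ 2 %% n == X)%N) V X x <= C%:R * V X s.
  apply: contrapT => /forallNP H.
  pose x0 : 'I_n := Ordinal n0.
  have S0 : 0 < \sum_(x < n | coprime x n && (x ^ 2 %% n == X)%N) V X x.
    have /negP := H x0; rewrite -ltNge; apply: le_lt_trans; by rewrite mulr_ge0.
  set S := \sum_(x < n | _) _ in S0 H.
  have : C%:R * S < C%:R * S; last by rewrite ltxx.
  have [P0|] := posnP #|[pred x : 'I_n | coprime x n && (x ^ 2 %% n == X)%N]|.
    by move: S0; rewrite /S big_pred0 ?ltxx //; exact: card0_eq.
  move=> Ppos; apply: (@lt_le_trans _ _ (\sum_(x < n | coprime x n && (x ^ 2 %% n == X)%N) S)).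
    rewrite {1}/S mulr_sumr; apply: ltr_sum; last by move=> x _; rewrite ltNge; apply/negP.
    have [x xP] := card_gt0P Ppos; apply/seq.hasP; exists x => //; exact: mem_index_enum.
  rewrite sumr_const -[leLHS]mulr_natl; apply: ler_wpM2r; first exact: ltW.
  by rewrite ler_nat; exact: cC.
have [s sP] := choice H.
exists s; rewrite mulr_sumr.
rewrite (partition_big (fun x : 'I_n => Ordinal (ltn_pmod (x ^ 2) n0)) (fun X : 'I_n => coprime X n)) /=; last first.
  by move=> x; rewrite coprime_modl; apply: coprimeXl.
apply: ler_sum => X _; apply: le_trans (sP X).
rewrite le_eqVlt; apply/orP; left; apply/eqP.
by apply: eq_big => [x|x /andP[_ /eqP <-]]; rewrite // -val_eqE.
Qed.

Lemma gcdn_coprime_mul h m n : coprime m n -> gcdn h (m * n) = (gcdn h m * gcdn h n)%N.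
Proof.
move=> cmn; apply/eqP; rewrite eqn_dvd; apply/andP; split; last first.
  rewrite dvdn_gcd Gauss_dvd ?dvdn_gcdl ?dvdn_mul ?dvdn_gcdr //.
  by apply: (coprime_dvdl (dvdn_gcdr _ _)); apply: (coprime_dvdr (dvdn_gcdr _ _)).
have -> : (gcdn h m * gcdn h n = gcdn (gcdn h m * h) (gcdn h m * n))%N by rewrite muln_gcdr.
rewrite dvdn_gcd; apply/andP; split; first by rewrite dvdn_mull // dvdn_gcdl.
by rewrite muln_gcdl dvdn_gcd dvdn_gcdr andbT dvdn_mulr // dvdn_gcdl.
Qed.

Section KloostermanBounds.
Variable R : realType.

Lemma kloosterman_congr q (h h' k k' : int) : (0 < q)%N -> (q%:Z %| h - h')%Z -> (q%:Z %| k - k')%Z ->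
  kloosterman R q 1 h k = kloosterman R q 1 h' k'.
Proof.
move=> q0 hh kk; apply: eq_bigr => y _; apply: ee_congr => //.
set v := (invm q y)%:Z.
have -> : 1 * (h * y%:Z + k * v) - 1 * (h' * y%:Z + k' * v) = (h - h') * y%:Z + (k - k') * v by ring.
by rewrite rpredD // dvdz_mulr.
Qed.

(** Bounds the number of roots of [h x ^ 2 = k] modulo [b], apart from the factor
    [2 * 2 ^ omega b]. *)
Definition gcd_weight (b : nat) (h k : int) : R :=
  (gcdn `|h| b * ((gcdn `|h| b)%:Z %| k)%Z)%N%:R.

Lemma cabs_stationary_gcd n (c h k : int) : (0 < n)%N ->
  cabs (stationary R n c h k) <= (2 * 2 ^ omega n)%N%:R * gcd_weight n h k.
Proof.
move=> n0; apply: le_trans (cabs_ee_sum_le _ _ _ _) _.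
by rewrite /gcd_weight -natrM ler_nat mulnA; apply: card_quadratic_roots.
Qed.

Lemma cabs_kloosterman_gcd b (h k : int) : (0 < b)%N ->
  cabs (kloosterman R (b ^ 2) 1 h k) <= b%:R * ((2 * 2 ^ omega b)%N%:R * gcd_weight b h k).
Proof.
move=> b0; have c1 : coprimez 1 b by rewrite /coprimez /gcdz /= gcd1n.
rewrite kloosterman_square // cabsM cabs_nat; apply: ler_wpM2l => //.
exact: cabs_stationary_gcd.
Qed.

(** With [k = 0] a stationary unit satisfies [h x ^ 2 = 0] modulo [b], hence [b | h]. *)
Lemma cabs_kloosterman0 b (h : int) : (0 < b)%N ->
  cabs (kloosterman R (b ^ 2) 1 h 0) <= b%:R ^+ 2 * (b%:Z %| h)%Z%:R.
Proof.
move=> b0; have c1 : coprimez 1 b by rewrite /coprimez /gcdz /= gcd1n.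
rewrite kloosterman_square // cabsM cabs_nat expr2 -mulrA; apply: ler_wpM2l => //.
have [bh|nbh] := boolP (b%:Z %| h)%Z; first by rewrite mulr1; apply: cabs_stationary_le.
rewrite mulr0 /stationary big_pred0 ?cabs0 // => x.
apply/negbTE; apply: contra nbh => /andP[cx]; rewrite sub0r rpredN mulrC Gauss_dvdzr //.
by rewrite coprimezE abszX /= coprime_sym coprimeXl.
Qed.

Lemma gcd_weight_ge0 b h k : 0 <= gcd_weight b h k. Proof. by []. Qed.

Lemma gcd_weight_mul n r h k : coprime n r -> gcd_weight n h k * gcd_weight r h k = gcd_weight (n * r) h k.
Proof.
move=> nr; rewrite /gcd_weight -natrM gcdn_coprime_mul // mulnACA; congr (_ * _)%N%:R.
rewrite !dvdzE !absz_nat /= Gauss_dvd; last first.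
  by apply: (coprime_dvdl (dvdn_gcdr _ _)); apply: (coprime_dvdr (dvdn_gcdr _ _)).
by do 2!case: (_ %| _)%N.
Qed.

(** The weight [g] is offset by the density [1 / g] of the [k] divisible by [g]. *)
Lemma sum_gcd_weight b Q : (0 < b)%N ->
  \sum_(1 <= h < Q) \sum_(1 <= k < Q) gcd_weight b h%:Z k%:Z / (h%:R * k%:R) <= harm R Q ^+ 2.
Proof.
move=> b0; apply: (@le_trans _ _ (\sum_(1 <= h < Q) h%:R^-1 * harm R Q)).
  apply: ler_sum => h _; set g := gcdn h b.
  have g0 : (0 < g)%N by rewrite gcdn_gt0 b0 orbT.
  rewrite (eq_bigr (fun k => h%:R^-1 * (g%:R * ((g %| k)%N%:R / k%:R)))); last first.
    by move=> k _; rewrite /gcd_weight natrM invfM /=; ring.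
  rewrite -mulr_sumr; apply: ler_wpM2l; first by rewrite invr_ge0.
  rewrite -mulr_sumr -ler_pdivlMl ?ltr0n // mulrC; exact: sum_inv_dvd.
rewrite -mulr_suml expr2; apply: ler_wpM2r; first exact: harm_ge0.
have [->|Q0] := posnP Q; first by rewrite big_geq // harm_ge0.
rewrite /harm [leRHS]big_nat_recr //=; apply: ler_wpDr => //; by rewrite invr_ge0.
Qed.

End KloostermanBounds.

(** * The Fourier error for one smoothed box *)

Section BoxEstimate.
Variable R : realType.
Variables (n r m H K H0 K0 : nat).
Hypothesis n0 : (0 < n)%N.
Hypothesis pr : prime r.
Hypothesis nr : coprime n r.
Hypothesis m0 : (0 < m)%N.
Hypothesis Ir : (m ^ 4 <= r)%N.
Hypothesis H00 : (0 < H0)%N.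
Hypothesis nHK : (n <= H0 * K0)%N.
Hypothesis HK0 : (r ^ 2 * H0 <= K0)%N.
Hypothesis IH : (m ^ 4 * H0 <= H)%N.
Hypothesis IK : (2 * m ^ 4 * K0 <= K)%N.
Hypothesis HK : (2 * r ^ 2 * H <= K)%N.
Hypothesis detn : (2 * H * K0 + 3 * K * H0 < n * r)%N.
Hypothesis Kn : (3 * K < n)%N.
Variables (a1 J1 M1 a2 J2 M2 : nat).
Hypothesis J10 : (0 < J1)%N.
Hypothesis M10 : (0 < M1)%N.
Hypothesis J20 : (0 < J2)%N.
Hypothesis M20 : (0 < M2)%N.
Let b := (n * r)%N.
Let q := (b ^ 2)%N.
Let A : R := 8 * (J2 + M2)%N%:R / q%:R.
Let B : R := 8 * (J1 + M1)%N%:R / q%:R.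
Let eps := A * H0%:R + B * (2 * K0%:R).
(** Extra decay from the short windows [J1], [J2] once a frequency leaves [H] by [K]; [T] bounds the
    sum of all such frequencies with their gcd weights. *)
Let delta : R := q%:R / (J1%:R * K%:R) + q%:R / (J2%:R * H%:R).
Let D : R := q%:R ^+ 2 / (M1%:R * M2%:R) * delta.
Let T : R := D * (4 * harm R q ^+ 2).
Let F h k := smooth R q J2 M2 h * smooth R q J1 M1 k.

Let r0 : (0 < r)%N := prime_gt0 pr.
Let b0 : (0 < b)%N. Proof. by rewrite muln_gt0 n0. Qed.
Let q0 : (0 < q)%N. Proof. by rewrite expn_gt0 b0. Qed.
Let H_0 : (0 < H)%N. Proof. by apply: leq_trans IH; rewrite muln_gt0 expn_gt0 m0. Qed.
Let K_0 : (0 < K)%N. Proof. by apply: leq_trans HK; rewrite !muln_gt0 r0 H_0. Qed.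
Let HleK : (H <= K)%N.
Proof. by apply: leq_trans HK; rewrite leq_pmull // !muln_gt0 r0. Qed.
Let qlarge : (2 * (3 * K) < q)%N.
Proof.
have nq : (4 * n <= q)%N.
  rewrite /q /b expnMn mulnC leq_mul //; first by rewrite -{1}(expn1 n) leq_pexp2l.
  by rewrite (leq_exp2r 2 r (e := 2)) // prime_gt1.
by clear -nq Kn n0; lia.
Qed.
Let qlargeH : (2 * (3 * H) < q)%N.
Proof. by apply: leq_ltn_trans qlarge; rewrite !leq_mul2l HleK !orbT. Qed.
Let D0 : 0 <= D. Proof. by rewrite /D /delta mulr_ge0 ?divr_ge0 ?addr_ge0 ?divr_ge0 ?mulr_ge0 // exprn_ge0. Qed.

Let F_le h k : h != 0 -> k != 0 -> (2 * `|h| <= q)%N -> (2 * `|k| <= q)%N ->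
  ~~ ((`|h| <= H)%N && (`|k| <= K)%N) -> cabs (F h k) <= D / (`|h|%N%:R * `|k|%N%:R).
Proof.
move=> h0 k0 hq kq; have := smooth_le R J2 q0 M20 h0 hq; have := smooth_le R J1 q0 M10 k0 kq.
have := smooth_le2 R q0 J20 M20 h0 hq; have := smooth_le2 R q0 J10 M10 k0 kq.
have h1 : 0 < `|h|%N%:R :> R by rewrite ltr0n lt0n absz_eq0.
have k1 : 0 < `|k|%N%:R :> R by rewrite ltr0n lt0n absz_eq0.
have c1 := cabs_ge0 (smooth R q J2 M2 h); have c2 := cabs_ge0 (smooth R q J1 M1 k).
have qR : 0 < q%:R :> R by rewrite ltr0n.
have J1R : 0 < J1%:R :> R by rewrite ltr0n.
have M1R : 0 < M1%:R :> R by rewrite ltr0n.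
have J2R : 0 < J2%:R :> R by rewrite ltr0n.
have M2R : 0 < M2%:R :> R by rewrite ltr0n.
have HR : 0 < H%:R :> R by rewrite ltr0n.
have KR : 0 < K%:R :> R by rewrite ltr0n.
rewrite /F (cabsM (smooth _ _ _ _ _) (smooth _ _ _ _ _)).
move=> k22 h22 k11 h11; rewrite negb_and -!ltnNge => /orP[hH|kK].
  apply: le_trans (ler_pM c1 c2 h22 k11) _.
  apply: (@le_trans _ _ (q%:R / (J2%:R * H%:R) * (q%:R / (M2%:R * `|h|%N%:R)) * (q%:R / (M1%:R * `|k|%N%:R)))).
    apply: ler_wpM2r; first by rewrite divr_ge0 // mulr_ge0 // ltW.
    apply: ler_wpM2r; first by rewrite divr_ge0 // mulr_ge0 // ltW.
    apply: ler_wpM2l; first exact: ltW.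
    rewrite lef_pV2 ?posrE ?mulr_gt0 // ler_pM2l // ler_nat; exact: ltnW.
  have -> : D / (`|h|%N%:R * `|k|%N%:R) = q%:R / (J2%:R * H%:R) * (q%:R / (M2%:R * `|h|%N%:R)) * (q%:R / (M1%:R * `|k|%N%:R)) + q%:R / (J1%:R * K%:R) * (q%:R / (M2%:R * `|h|%N%:R)) * (q%:R / (M1%:R * `|k|%N%:R)).
    by rewrite /D /delta; field; rewrite !gt_eqF.
  by rewrite lerDl !mulr_ge0 ?divr_ge0 ?mulr_ge0 // ?invr_ge0 ?mulr_ge0 // ltW.
apply: le_trans (ler_pM c1 c2 h11 k22) _.
apply: (@le_trans _ _ ((q%:R / (M2%:R * `|h|%N%:R)) * (q%:R / (J1%:R * K%:R) * (q%:R / (M1%:R * `|k|%N%:R))))).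
  apply: ler_wpM2l; first by rewrite divr_ge0 // mulr_ge0 // ltW.
  apply: ler_wpM2r; first by rewrite divr_ge0 // mulr_ge0 // ltW.
  apply: ler_wpM2l; first exact: ltW.
  rewrite lef_pV2 ?posrE ?mulr_gt0 // ler_pM2l // ler_nat; exact: ltnW.
have -> : D / (`|h|%N%:R * `|k|%N%:R) = q%:R / (M2%:R * `|h|%N%:R) * (q%:R / (J1%:R * K%:R) * (q%:R / (M1%:R * `|k|%N%:R))) + q%:R / (J2%:R * H%:R) * (q%:R / (M2%:R * `|h|%N%:R)) * (q%:R / (M1%:R * `|k|%N%:R)).
  by rewrite /D /delta; field; rewrite !gt_eqF.
by rewrite lerDl !mulr_ge0 ?divr_ge0 ?mulr_ge0 // ?invr_ge0 ?mulr_ge0 // ltW.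
Qed.

Let ss (f : int -> R) : R := \sum_(1 <= t < q) (f t%:Z + f (- t%:Z)).
Let wt (h k : int) : R := D * (gcd_weight R b h k / (`|h|%N%:R * `|k|%N%:R)).

Let wt0 h k : 0 <= wt h k.
Proof. by rewrite /wt mulr_ge0 // divr_ge0 ?gcd_weight_ge0 // mulr_ge0. Qed.

Let ss_wt : ss (fun h => ss (wt h)) <= T.
Proof.
have wN1 h k : wt (- h) k = wt h k by rewrite /wt /gcd_weight !abszN.
have wN2 h k : wt h (- k) = wt h k by rewrite /wt /gcd_weight !abszN rpredN.
rewrite /ss /T; apply: le_trans (ler_wpM2l D0 (ler_wpM2l _ (sum_gcd_weight R q b0))); last by [].
rewrite !mulr_sumr; apply: ler_sum => h _; rewrite !mulr_sumr -big_split /=; apply: ler_sum => k _.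
by rewrite !wN1 !wN2 /wt !absz_nat; lra.
Qed.

Let zsum_ss Z f : (Z < q)%N -> (forall h, 0 <= f h) -> f 0 = 0 -> zsum Z f <= ss f.
Proof.
move=> Zq f0 f00; rewrite zsum_split0 f00 add0r /ss (@big_cat_nat _ _ _ Z.+1 1 q) //=.
by apply: ler_wpDr => //; apply: sumr_ge0 => h _; rewrite addr_ge0.
Qed.

Let ss_le f g : (forall h, f h <= g h) -> ss f <= ss g.
Proof. by move=> fg; apply: ler_sum => h _; apply: lerD. Qed.

Let ss_ge0 f : (forall h, 0 <= f h) -> 0 <= ss f.
Proof. by move=> f0; apply: sumr_ge0 => h _; rewrite addr_ge0. Qed.

Section Tail.
Variable c2 : int.

Lemma tail_sum : \sum_(X < n | coprime X n) lattice_tail n r H K c2 F X <= 4 * T.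
Proof.
pose g (h k : int) : R := if (h != 0) && (k != 0) then 4 * wt h k else 0.
have g0 h k : 0 <= g h k by rewrite /g; case: ifP => // _; rewrite mulr_ge0.
apply: (@le_trans _ _ (zsum (3 * H) (fun h => zsum (3 * K) (g h)))).
  rewrite zsum_exchange; apply: ler_zsum => h hH.
  rewrite zsum_exchange; apply: ler_zsum => k kK.
  have Hn : (3 * H < n)%N by apply: leq_ltn_trans Kn; rewrite leq_mul2l HleK.
  have small (Z : nat) (x : int) : (`|x| <= Z)%N -> (Z < n)%N -> (n%:Z %| x)%Z -> x = 0.
    move=> xZ Zn nx; apply/eqP; rewrite -absz_eq0 -leqn0 leqNgt; apply/negP => x0.
    by have := dvdn_leq x0 nx; rewrite leqNgt (leq_ltn_trans xZ Zn).
  have [nb|bx] := boolP (~~ ((`|h| <= H)%N && (`|k| <= K)%N)); last first.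
    rewrite big1 ?g0 // => X _; rewrite andbF //.
  rewrite /g; have [h0|h0] /= := eqVneq h 0.
    rewrite big1 // => X _; case: ifP => // /andP[]; rewrite h0 mul0r subr0 => nk _.
    by move: nb; rewrite h0 (small _ _ kK Kn nk).
  have [k0|k0] /= := eqVneq k 0.
    rewrite big1 // => X cX; case: ifP => // /andP[]; rewrite k0 sub0r rpredN mulrC Gauss_dvdzr => [nh _|].
      by move: nb; rewrite k0 (small _ _ hH Hn nh).
    by rewrite coprimezE /= coprime_sym.
  apply: (@le_trans _ _ (gcd_weight R n h k * (cabs (F h k) * cabs (stationary R r c2 h k)))).
    rewrite -big_mkcondr /= sumr_const -[leLHS]mulr_natl; apply: ler_wpM2r.
      by rewrite mulr_ge0 ?cabs_ge0.
    rewrite ler_nat; apply: leq_trans (card_linear_roots h k n0).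
    by apply: subset_leq_card; apply/fintype.subsetP => X; rewrite !inE => /and3P[_ l _].
  have hq : (2 * `|h| <= q)%N by apply: leq_trans (ltnW qlargeH); rewrite leq_mul2l hH.
  have kq : (2 * `|k| <= q)%N by apply: leq_trans (ltnW qlarge); rewrite leq_mul2l kK.
  have Fl := F_le h0 k0 hq kq nb.
  have Sl := cabs_stationary_gcd R c2 h k r0.
  have or : omega r = 1%N by rewrite /omega primes_prime.
  rewrite or in Sl.
  rewrite /wt /b -(gcd_weight_mul R h k nr).
  apply: le_trans (ler_wpM2l (gcd_weight_ge0 R n h k) (ler_pM (cabs_ge0 _) (cabs_ge0 _) Fl Sl)) _.
  by rewrite le_eqVlt; apply/orP; left; apply/eqP; ring.
apply: le_trans (zsum_ss _ _ _) _.
- by apply: leq_ltn_trans qlargeH; rewrite leq_pmull.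
- by move=> h; apply: zsum_ge0.
- by apply: zsum0 => k _; rewrite /g eqxx.
apply: (@le_trans _ _ (ss (fun h => 4 * ss (wt h)))); last first.
  rewrite /ss (eq_bigr (fun t => 4 * (ss (wt t%:Z) + ss (wt (- t%:Z))))) => [|t _]; last by rewrite mulrDr.
  by rewrite -mulr_sumr; apply: ler_wpM2l => //; exact: ss_wt.
apply: ss_le => h; apply: le_trans (zsum_ss _ _ _) _ => //.
- by apply: leq_ltn_trans qlarge; rewrite leq_pmull.
- by rewrite /g eqxx andbF.
rewrite [leRHS]mulr_sumr; apply: ler_sum => t _.
by rewrite mulrDr; apply: lerD; rewrite /g; case: ifP => // _; rewrite mulr_ge0.
Qed.

End Tail.

Let c1 : int := (invm (n ^ 2) (r ^ 2))%:Z.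
Let c2 : int := (invm (r ^ 2) (n ^ 2))%:Z.
Let co2 : coprime (r ^ 2) (n ^ 2). Proof. by rewrite coprimeXl // coprimeXr // coprime_sym. Qed.
Let c1P : ((n ^ 2)%N%:Z %| (r ^ 2)%N%:Z * c1 - 1)%Z. Proof. exact: invmP. Qed.
Let c2P : ((r ^ 2)%N%:Z %| (n ^ 2)%N%:Z * c2 - 1)%Z.
Proof. by apply: invmP; rewrite coprime_sym. Qed.

Let unit_of_inv (p : nat) (x c : int) : (p%:Z ^+ 2 %| x * c - 1)%Z -> coprimez c p.
Proof.
move=> hx; rewrite coprimezE /coprime -dvdn1 /=.
suff : (gcdz c p %| 1)%Z by rewrite dvdzE.
have d1 : (gcdz c p %| x * c)%Z by rewrite dvdz_mull // dvdz_gcdl.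
have d2 : (gcdz c p %| x * c - 1)%Z.
  by apply: dvdz_trans hx; rewrite expr2 dvdz_mull // dvdz_gcdr.
have -> : 1 = x * c - (x * c - 1) :> int by ring.
by rewrite rpredB.
Qed.

Let c1n : coprimez c1 n.
Proof. by apply: (@unit_of_inv _ (r ^ 2)%N%:Z); have := c1P; rewrite !PoszM expr2. Qed.

Let c2r' : coprimez c2 r.
Proof. by apply: (@unit_of_inv _ (n ^ 2)%N%:Z); have := c2P; rewrite !PoszM expr2. Qed.

Let c2r : ~~ (r%:Z %| c2)%Z.
Proof.
by have := c2r'; rewrite coprimezE /= coprime_sym prime_coprime // dvdzE.
Qed.

Let psi (x : 'I_n) (h k : int) : R[i] :=
  ee R (n ^ 2) (c1 * (h * x%:Z + k * (invm (n ^ 2) x)%:Z)) * (ee R q (- (h * a2%:Z)) * ee R q (- (k * a1%:Z))).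

Let psi_char x : additive_character (psi x).
Proof.
split=> [h k h' k'|h k]; last by rewrite /psi !cabsM !cabs_ee !mulr1.
rewrite /psi; set i := (invm (n ^ 2) x)%:Z.
have -> : c1 * ((h + h') * x%:Z + (k + k') * i) = c1 * (h * x%:Z + k * i) + c1 * (h' * x%:Z + k' * i) by ring.
have -> : - ((h + h') * a2%:Z) = - (h * a2%:Z) + - (h' * a2%:Z) by ring.
have -> : - ((k + k') * a1%:Z) = - (k * a1%:Z) + - (k' * a1%:Z) by ring.
by rewrite !eeD; ring.
Qed.

Let F1 h k : cabs (F h k) <= 1.
Proof.
rewrite /F (cabsM (smooth _ _ _ _ _) (smooth _ _ _ _ _)) -[leRHS]mulr1.
by apply: ler_pM; rewrite ?cabs_ge0 //; exact: smooth_le1.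
Qed.

Let FL h k h' k' : cabs (F (h + h') (k + k') - F h k) <= A * `|h'|%:~R + B * `|k'|%:~R.
Proof.
have -> : F (h + h') (k + k') - F h k =
  (smooth R q J2 M2 (h + h') - smooth R q J2 M2 h) * smooth R q J1 M1 (k + k') +
  smooth R q J2 M2 h * (smooth R q J1 M1 (k + k') - smooth R q J1 M1 k) by rewrite /F; ring.
apply: le_trans (cabsD _ _) _.
rewrite (cabsM (smooth _ _ _ _ _ - _)) (cabsM (smooth _ _ _ _ h)); apply: lerD.
  rewrite -[leRHS]mulr1; apply: ler_pM; rewrite ?cabs_ge0 //; last exact: smooth_le1.
  exact: smooth_lipschitz.
rewrite -[leRHS]mul1r; apply: ler_pM; rewrite ?cabs_ge0 //; first exact: smooth_le1.
exact: smooth_lipschitz.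
Qed.

Let W (h k : int) : R[i] := kloosterman R q 1 h k * (ee R q (- (h * a2%:Z)) * ee R q (- (k * a1%:Z)) * F h k).

Let cabsW h k : cabs (W h k) = cabs (kloosterman R q 1 h k) * cabs (F h k).
Proof.
rewrite /W (cabsM (kloosterman _ _ _ _ _)) (cabsM (ee _ _ _ * _)) (cabsM (ee _ _ _)).
by rewrite !cabs_ee !mul1r.
Qed.

(** The factor modulo [n ^ 2] is opened into its stationary points [x], each of which places
    [(h, k)] in the lattice of [x ^ 2]. The factor modulo [r ^ 2] stays a stationary sum, to be
    averaged. *)
Let W_lattice h k : W h k = b%:R * \sum_(x < n | coprime x n)
  (if (n%:Z %| k - h * (x ^ 2 %% n)%N%:Z)%Z then F h k * psi x h k * stationary R r c2 h k else 0).
Proof.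
have eq : kloosterman R q 1 h k = kloosterman R (n ^ 2 * r ^ 2) 1 h k by rewrite -expnMn.
rewrite /W eq (@kloosterman_crt R (n ^ 2) (r ^ 2) c1 c2) //; last 3 first.
- by rewrite coprime_sym.
- by rewrite expn_gt0 n0.
- by rewrite expn_gt0 r0.
rewrite !kloosterman_square // natrM {1}/stationary.
rewrite -big_mkcondr /=.
have e (x : 'I_n) : (n%:Z %| k - h * (x ^ 2 %% n)%N%:Z)%Z = (n%:Z %| k - h * x%:Z ^+ 2)%Z.
  have -> : k - h * (x ^ 2 %% n)%N%:Z = k - h * x%:Z ^+ 2 + h * (((x : nat) ^ 2)%N%:Z - (x ^ 2 %% n)%N%:Z).
    by rewrite PoszM; ring.
  by rewrite rpredDr // dvdz_mull // dvdz_subn modn_mod.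
under [X in _ = _ * X]eq_bigl do rewrite e.
set s := stationary R r c2 h k; set t := _ * F h k.
transitivity (n%:R * r%:R * \sum_(x < n | coprime x n && (n%:Z %| k - h * x%:Z ^+ 2)%Z)
  ee R (n ^ 2) (c1 * (h * x%:Z + k * (invm (n ^ 2) x)%:Z)) * (s * t)).
  by rewrite -mulr_suml; ring.
congr (_ * _); apply: eq_bigr => x _.
by rewrite /psi /t; ring.
Qed.

Let W_sum : zsum (3 * H) (fun h => zsum (3 * K) (fun k => if (h != 0) && (k != 0) then W h k else 0)) =
  b%:R * \sum_(x < n | coprime x n) lattice_sum n r H K c2 F (x ^ 2 %% n) (psi x).
Proof.
rewrite zsum_exchange -zsumZ; apply: eq_zsum => h hH.
rewrite zsum_exchange -zsumZ; apply: eq_zsum => k kK.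
have Hn : (3 * H < n)%N by apply: leq_ltn_trans Kn; rewrite leq_mul2l HleK.
have small (Z : nat) (x : int) : (`|x| <= Z)%N -> (Z < n)%N -> (n%:Z %| x)%Z -> x = 0.
  move=> xZ Zn nx; apply/eqP; rewrite -absz_eq0 -leqn0 leqNgt; apply/negP => x0.
  by have := dvdn_leq x0 nx; rewrite leqNgt (leq_ltn_trans xZ Zn).
case: ifPn => hk.
  rewrite W_lattice; congr (_ * _); apply: eq_bigr => x _.
  by have /andP[-> _] := hk; rewrite andbT.
rewrite big1 ?mulr0 // => x cx; case: ifP => // /andP[l nz]; exfalso.
move: hk; rewrite negb_and !negbK => /orP[/eqP h0|/eqP k0].
  move: l; rewrite h0 mul0r subr0 => nk; move: nz.
  by rewrite h0 (small _ _ kK Kn nk).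
move: l nz; rewrite k0 sub0r rpredN mulrC Gauss_dvdzr => [nh|].
  by rewrite (small _ _ hH Hn nh).
by rewrite coprimezE /= coprime_sym coprime_modl coprimeXl.
Qed.

Let core : R := 28 * H%:R * K%:R * (6 / m%:R + 2 * m%:R ^+ 4 * eps) + 54 * H%:R * K0%:R * harm R H0 + 4 * T.
Let om : R := (2 * 2 ^ omega b)%N%:R.

Let box_part : cabs (\sum_(x < n | coprime x n) lattice_sum n r H K c2 F (x ^ 2 %% n) (psi x)) <= om * core.
Proof.
apply: le_trans (cabs_sum _ _ _) _.
have V0 X (x : 'I_n) : 0 <= cabs (lattice_sum n r H K c2 F X (psi x)) by exact: cabs_ge0.
have card X : (#|[pred x : 'I_n | coprime x n && (x ^ 2 %% n == X)%N]| <= 2 * 2 ^ omega b)%N.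
  apply: leq_trans (_ : _ <= 2 * 2 ^ omega n * gcdn `|1%:Z| n * ((gcdn `|1%:Z| n)%:Z %| X%:Z)%Z)%N _; last first.
    rewrite gcd1n muln1 dvd1z muln1 leq_mul2l /= leq_exp2l // omega_dvd //.
    by rewrite dvdn_mulr.
  apply: leq_trans (card_quadratic_roots 1 X%:Z n0).
  apply: subset_leq_card; apply/fintype.subsetP => x; rewrite !inE => /andP[-> /eqP e] /=.
  rewrite mul1r -[X in (X ^+ 2)]/(x%:Z) (_ : x%:Z ^+ 2 = (x ^ 2)%N%:Z); last by rewrite PoszM expr2.
  by rewrite dvdz_subn -e modn_mod.
have [s sP] := select_max n0 V0 card.
apply: le_trans sP _; apply: ler_wpM2l => //.
apply: le_trans (sum_lattice_sum n0 pr nr c2r m0 Ir H00 nHK HK0 IH IK HK detn Kn _ _ F1 FL (fun X => psi_char (s X))) _.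
- by rewrite /A divr_ge0 // mulr_ge0.
- by rewrite /B divr_ge0 // mulr_ge0.
by rewrite lerD2l; exact: tail_sum.
Qed.

Let W_le h k : h != 0 -> k != 0 -> (2 * `|h| <= q)%N -> (2 * `|k| <= q)%N ->
  ~~ ((`|h| <= 3 * H)%N && (`|k| <= 3 * K)%N) -> cabs (W h k) <= b%:R * om * wt h k.
Proof.
move=> h0 k0 hq kq nb.
have {}nb : ~~ ((`|h| <= H)%N && (`|k| <= K)%N).
  apply: contra nb => /andP[hH kK]; apply/andP; split.
    by apply: leq_trans hH _; rewrite leq_pmull.
  by apply: leq_trans kK _; rewrite leq_pmull.
rewrite cabsW.
apply: le_trans (ler_pM (cabs_ge0 _) (cabs_ge0 _) (cabs_kloosterman_gcd R h k b0) (F_le h0 k0 hq kq nb)) _.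
by rewrite /wt /om le_eqVlt; apply/orP; left; apply/eqP; ring.
Qed.

Let nonbox_part : \sum_(h < q) \sum_(k < q) (if [&& cen q h != 0, cen q k != 0 &
    ~~ ((`|cen q h| <= 3 * H)%N && (`|cen q k| <= 3 * K)%N)] then cabs (W (cen q h) (cen q k)) else 0)
  <= b%:R * om * T.
Proof.
have bo : 0 <= b%:R * om by rewrite mulr_ge0.
have kk (h : int) : \sum_(k < q | k != 0 :> nat) wt h (cen q k) <= ss (wt h).
  by apply: sum_cen_le.
apply: le_trans (ler_wpM2l bo ss_wt).
apply: le_trans (ler_wpM2l bo (sum_cen_le q (fun h => ss_ge0 (wt0 h)))).
rewrite mulr_sumr [leRHS]big_mkcond /=; apply: ler_sum => h _.
have c0 : (cen q h == 0) = (h == 0 :> nat) by apply: cen_eq0.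
case: (eqVneq (h : nat) 0%N) => h0 /=.
  by rewrite big1 // => k _; rewrite c0 h0 eqxx.
apply: le_trans (ler_wpM2l bo (kk _)); rewrite mulr_sumr [leRHS]big_mkcond /=; apply: ler_sum => k _.
have c0' : (cen q k == 0) = (k == 0 :> nat) by apply: cen_eq0.
rewrite c0 c0' h0 /=; case: (eqVneq (k : nat) 0%N) => k0 //=.
case: ifP => [nb|_]; last by rewrite mulr_ge0.
by apply: W_le; rewrite ?c0 ?c0' ?cen_le // ltnW.
Qed.

Let zero_part : \sum_(h < q | h != 0 :> nat) cabs (W (cen q h) 0) <= b%:R * (2 * q%:R * harm R q / M2%:R).
Proof.
pose f (h : int) : R := b%:R ^+ 2 * (b%:Z %| h)%Z%:R * (q%:R / (M2%:R * `|h|%N%:R)).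
have f0 h : 0 <= f h by rewrite /f !mulr_ge0 // ?exprn_ge0 // invr_ge0 mulr_ge0.
apply: (@le_trans _ _ (\sum_(h < q | h != 0 :> nat) f (cen q h))).
  apply: ler_sum => h h0.
  have c0 : cen q h != 0 by rewrite cen_eq0.
  have ch : (2 * `|cen q h| <= q)%N by rewrite cen_le // ltnW.
  rewrite cabsW.
  apply: ler_pM; rewrite ?cabs_ge0 //; first exact: cabs_kloosterman0.
  rewrite /F (cabsM (smooth _ _ _ _ _) (smooth _ _ _ _ _)) -[leRHS]mulr1.
  by apply: ler_pM; rewrite ?cabs_ge0 //; [apply: smooth_le | exact: smooth_le1].
apply: le_trans (sum_cen_le _ f0) _.
rewrite (eq_bigr (fun t => (2 * b%:R ^+ 2 * q%:R / M2%:R) * ((b %| t)%N%:R / t%:R))); last first.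
  move=> t _; rewrite /f !abszN !dvdzE /= abszN /= invfM; ring.
rewrite -mulr_sumr.
have bR : 0 < b%:R :> R by rewrite ltr0n.
have MR : 0 < M2%:R :> R by rewrite ltr0n.
apply: le_trans (ler_wpM2l _ (sum_inv_dvd R q b0)) _.
  by rewrite divr_ge0 // mulr_ge0 // mulr_ge0 // exprn_ge0.
by rewrite le_eqVlt; apply/orP; left; apply/eqP; field; rewrite !gt_eqF.
Qed.

(** The frequencies [h != 0] are divided into [k = 0], the box [3 H] by [3 K] with [k != 0], and the
    rest. The three summands of the bound correspond to them in this order. *)
Lemma box_estimate :
  `|(\sum_(p1 : 'I_J1 * 'I_M1) \sum_(p2 : 'I_J2 * 'I_M2)
      (q%:Z %| ((a1 + p1.1 + p1.2)%N%:Z * (a2 + p2.1 + p2.2)%N%:Z - 1)%R)%Z)%N%:R -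
    J2%:R * M2%:R / q%:R * (\sum_(p : 'I_J1 * 'I_M1) coprime (a1 + p.1 + p.2) b)%N%:R| <=
  J1%:R * M1%:R * (J2%:R * M2%:R) / q%:R ^+ 2 *
    (b%:R * (2 * q%:R * harm R q / M2%:R + om * core + om * T)).
Proof.
have qR : 0 < q%:R :> R by rewrite ltr0n.
have four := @inverse_pairs_fourier R _ _ (fun p : 'I_J1 * 'I_M1 => a1 + p.1 + p.2)%N
  (fun p : 'I_J2 * 'I_M2 => a2 + p.1 + p.2)%N q q0.
set cnt := (\sum_p1 _)%N in four *.
have cq (p : 'I_J1 * 'I_M1) : coprime (a1 + p.1 + p.2) q = coprime (a1 + p.1 + p.2) b.
  by rewrite coprime_pexpr.
rewrite (eq_bigr _ (fun p _ => congr1 nat_of_bool (cq p))) in four.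
set mn := (\sum_p _)%N in four *.
rewrite card_prod !card_ord in four.
pose C0 : R[i] := J1%:R * M1%:R * (J2%:R * M2%:R).
have E : \sum_(h < q | h != 0 :> nat) \sum_(k < q) kloosterman R q 1 h%:Z k%:Z *
   ((\sum_(p : 'I_J2 * 'I_M2) ee R q (- (h%:Z * (a2 + p.1 + p.2)%N%:Z))) *
    (\sum_(p : 'I_J1 * 'I_M1) ee R q (- (k%:Z * (a1 + p.1 + p.2)%N%:Z)))) =
   C0 * \sum_(h < q | h != 0 :> nat) \sum_(k < q) W (cen q h) (cen q k).
  rewrite mulr_sumr; apply: eq_bigr => h _; rewrite mulr_sumr; apply: eq_bigr => k _.
  have pe (P : finType) (e : P -> nat) (x : 'I_q) : \sum_p ee R q (- (x%:Z * (e p)%:Z)) =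
      \sum_p ee R q (- (cen q x * (e p)%:Z)).
    apply: eq_bigr => p _; apply: ee_congr => //.
    have -> : - (x%:Z * (e p)%:Z) - - (cen q x * (e p)%:Z) = (cen q x - x%:Z) * (e p)%:Z by ring.
    by rewrite dvdz_mulr // cen_dvd.
  rewrite (@kloosterman_congr R q h%:Z (cen q h) k%:Z (cen q k)) //; last 2 first.
  - by rewrite -rpredN opprB cen_dvd.
  - by rewrite -rpredN opprB cen_dvd.
  rewrite pe (pe _ (fun p : 'I_J1 * 'I_M1 => a1 + p.1 + p.2)%N) !sum_pairs_ee //.
  by rewrite /W /F /C0; ring.
rewrite E in four.
have -> : `|cnt%:R - J2%:R * M2%:R / q%:R * mn%:R| = cabs (q%:R^-2 * (C0 * \sum_(h < q | h != 0 :> nat) \sum_(k < q) W (cen q h) (cen q k))).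
  have rn x : (x%:R : R)%:C%C = x%:R by rewrite rmorph_nat.
  have gen (x y z w : R) : (x * y / z * w)%:C%C = x%:C%C * y%:C%C / z%:C%C * w%:C%C.
    by rewrite !rmorphM fmorphV.
  rewrite -cabs_real; congr cabs; rewrite rmorphB /= gen.
  rewrite (rn cnt) (rn J2) (rn M2) (rn q) (rn mn) four (natrM _ J2 M2).
  by rewrite addrAC subrr add0r.
have cC0 : cabs C0 = J1%:R * M1%:R * (J2%:R * M2%:R) by rewrite /C0 !cabsM !cabs_nat.
rewrite cabsM (cabsM C0) cC0 [leLHS]mulrA.
have -> : cabs (q%:R^-2 : R[i]) = q%:R^-2.
  by rewrite -exprVn expr2 cabsM cabs_natV -exprVn expr2.
have -> : q%:R ^- 2 * (J1%:R * M1%:R * (J2%:R * M2%:R)) = J1%:R * M1%:R * (J2%:R * M2%:R) / q%:R ^+ 2 :> R by rewrite mulrC.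
apply: ler_wpM2l; first by rewrite divr_ge0 ?mulr_ge0 // exprn_ge0.
have E2 : \sum_(h < q | h != 0 :> nat) \sum_(k < q) W (cen q h) (cen q k) =
    \sum_(h < q | h != 0 :> nat) W (cen q h) 0 + (b%:R * (\sum_(x < n | coprime x n) lattice_sum n r H K c2 F (x ^ 2 %% n) (psi x)) +
   \sum_(h < q) \sum_(k < q) (if [&& cen q h != 0, cen q k != 0 &
    ~~ ((`|cen q h| <= 3 * H)%N && (`|cen q k| <= 3 * K)%N)] then W (cen q h) (cen q k) else 0)).
  rewrite -W_sum.
  rewrite -(@zsum_cen _ q (3 * H)) // big_mkcond [X in X + _]big_mkcond [X in _ + (X + _)]big_mkcond.
  rewrite -big_split -big_split /=; apply: eq_bigr => h _.
  have c0 : (cen q h == 0) = (h == 0 :> nat) by apply: cen_eq0.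
  rewrite -(@zsum_cen _ q (3 * K)) // (bigD1 (Ordinal q0)) //=.
  have -> : cen q 0 = 0 by [].
  case: (eqVneq (h : nat) 0%N) => h0 /=.
    rewrite add0r; have -> : cen q h = 0 by apply/eqP; rewrite c0 h0.
    rewrite [X in _ = _ + X]big1; last by move=> k _.
    by rewrite addr0 /= big1.
  congr (_ + _); rewrite c0 h0 /=.
  rewrite [\sum_(h1 < q | (`|cen q h1| <= 3 * K)%N) _]big_mkcond /=.
  have -> : (if (`|cen q h| <= 3 * H)%N then \sum_(i < q) (if (`|cen q i| <= 3 * K)%N then
      (if cen q i != 0 then W (cen q h) (cen q i) else 0) else 0) else 0) =
    \sum_(i < q) (if (`|cen q h| <= 3 * H)%N then (if (`|cen q i| <= 3 * K)%N then
      (if cen q i != 0 then W (cen q h) (cen q i) else 0) else 0) else 0).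
    by case: ifP => // _; rewrite big1.
  rewrite -big_split big_mkcond /=; apply: eq_bigr => k _.
  have c0' : (cen q k == 0) = (k == 0 :> nat) by apply: cen_eq0.
  rewrite c0' -val_eqE /=; case: (_ == _) => /=; first by rewrite !if_same add0r.
  by case: (_ <= _)%N => /=; case: (_ <= _)%N; rewrite ?addr0 ?add0r.
rewrite E2; apply: le_trans (cabsD _ _) _.
rewrite (mulrDr b%:R _ (om * T)) (mulrDr b%:R _ (om * core)) -addrA; apply: lerD.
  by apply: le_trans (cabs_sum _ _ _) _; exact: zero_part.
apply: le_trans (cabsD _ _) _; apply: lerD.
  by rewrite cabsM cabs_nat; apply: ler_wpM2l => //; exact: box_part.
apply: le_trans (cabs_sum _ _ _) _; rewrite mulrA; apply: le_trans nonbox_part.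
apply: ler_sum => h _; apply: le_trans (cabs_sum _ _ _) _; apply: ler_sum => k _.
by case: ifP => _; rewrite ?cabs0.
Qed.

End BoxEstimate.

Lemma harm_le (R : realType) m n : (m <= n)%N -> harm R m <= harm R n.
Proof.
move=> mn; rewrite /harm (@big_cat_nat _ _ _ m.+1 1 n.+1) //= lerDl.
by apply: sumr_ge0 => i _; rewrite invr_ge0.
Qed.

(** * Choice of the frequency box and of the short vectors *)

Section ParameterChoice.
Variable R : realType.
Variables (N L La m rho n r : nat).
Hypothesis n0 : (0 < n)%N.
Hypothesis pr : prime r.
Hypothesis nr : coprime n r.
Hypothesis L32 : (32 <= L)%N.
Hypothesis hLa : (L ^ 23 <= La)%N.
Hypothesis hm : (L ^ 16 * La ^ 2 <= m)%N.
Hypothesis hrho : (m ^ 5 * (La * L ^ 2) <= rho)%N.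
Hypothesis hr : (4 * rho ^ 2 <= r)%N.
Let b := (n * r)%N.
Let q := (b ^ 2)%N.
Hypothesis bN : (b <= N)%N.
Hypothesis Nb : (N <= b * L ^ 6)%N.
Variables (a1 J1 M1 a2 J2 M2 : nat).
Hypothesis J10 : (0 < J1)%N.
Hypothesis J20 : (0 < J2)%N.
Hypothesis JM1 : (J1 <= M1)%N.
Hypothesis JM2 : (J2 <= M2)%N.
Hypothesis h1 : (M1 * M2 * L <= 8 * N * q)%N.
Hypothesis h2 : (N * q <= 32 * L ^ 2 * J1 * M2)%N.
Hypothesis h3 : (M2 <= 8 * L * J2)%N.
Hypothesis h5 : (M2 * r ^ 2 <= q)%N.
Hypothesis h6 : (r ^ 3 * q ^ 2 <= b * M2 ^ 2)%N.
Hypothesis h7 : (16 * M1 * L ^ 4 <= N * b)%N.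
Hypothesis h8 : harm R q <= L%:R ^+ 2.
Hypothesis hom : (2 ^ omega b <= L ^ 10)%N.

(** [H] is about the dual length [q / M2] enlarged by [La], and [H K] is about [b La ^ 2 L]. The
    ratios [rho = H / H0] and [kappa = K / K0] count the available steps of the short vector. Both
    must exceed [m ^ 4], while [kappa] must stay below a fraction of [r], so that determinants
    remain below [n r]; up to rounding, [kappa rho = r La ^ 2 L]. *)
Let H0 := (q * La %/ (M2 * rho))%N.
Let K0 := (n %/ H0).+1.
Let kappa := (r * La ^ 2 * L %/ rho).+1.
Let H := (rho * H0)%N.
Let K := (kappa * K0)%N.

Let r0 : (0 < r)%N := prime_gt0 pr.
Let L0 : (0 < L)%N. Proof. by apply: leq_trans L32. Qed.
Let La0 : (0 < La)%N. Proof. by apply: leq_trans hLa; rewrite expn_gt0 L0. Qed.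
Let m0 : (0 < m)%N. Proof. by apply: leq_trans hm; rewrite muln_gt0 !expn_gt0 L0 La0. Qed.
Let rho0 : (0 < rho)%N. Proof. by apply: leq_trans hrho; rewrite !(muln_gt0 (_ ^ _)) muln_gt0 !expn_gt0 m0 La0 L0. Qed.
Let M20 : (0 < M2)%N. Proof. exact: leq_trans JM2. Qed.
Let M10 : (0 < M1)%N. Proof. exact: leq_trans JM1. Qed.
Let b0 : (0 < b)%N. Proof. by rewrite muln_gt0 n0. Qed.
Let q0 : (0 < q)%N. Proof. by rewrite expn_gt0 b0. Qed.
Let L2 : (64 <= L ^ 2)%N.
Proof. by apply: (@leq_trans (32 * 32)) => //; rewrite -mulnn leq_mul. Qed.
Let mrho : (64 * m ^ 5 <= rho)%N.
Proof.
apply: leq_trans hrho; rewrite mulnC leq_mul2l; apply/orP; right.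
by apply: leq_trans L2 _; rewrite leq_pmull.
Qed.
Let m4rho : (2 * m ^ 4 <= rho)%N.
Proof. by apply: leq_trans mrho; rewrite leq_mul // leq_pexp2l. Qed.
Let rhor : (4 * rho <= r)%N.
Proof. by apply: leq_trans hr; rewrite leq_mul2l /= -{1}(expn1 rho) leq_pexp2l. Qed.
Let m4r : (m ^ 4 <= r)%N.
Proof. by apply: leq_trans rhor; apply: (leq_trans (leq_pmull (m ^ 4) (isT : (0 < 2)%N))); apply: (leq_trans m4rho); rewrite leq_pmull. Qed.
Let Lam : (La ^ 2 * L * 48 <= rho)%N.
Proof.
apply: leq_trans mrho; rewrite mulnC leq_mul //.
apply: (@leq_trans m); last by rewrite -{1}(expn1 m) leq_pexp2l.
apply: leq_trans hm; rewrite mulnC leq_mul // -{1}(expn1 L).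
by rewrite leq_pexp2l.
Qed.

Let H0_lower : (q * La <= 2 * (M2 * rho * H0))%N.
Proof.
have Mr : (0 < M2 * rho)%N by rewrite muln_gt0 M20.
have le1 : (M2 * rho <= q * La)%N.
  apply: leq_trans (leq_pmulr q La0).
  apply: leq_trans h5; rewrite leq_mul2l; apply/orP; right.
  apply: (leq_trans _ (leq_pexp2l r0 (isT : (1 <= 2)%N))); rewrite expn1.
  by apply: leq_trans rhor; rewrite leq_pmull.
have H00 : (0 < H0)%N by rewrite divn_gt0.
have := ltn_ceil (q * La) Mr; rewrite -/H0 => lt.
apply: leq_trans (ltnW lt) _; rewrite mulnC mulnCA leq_mul2l.
by move: H00; case: (H0) => [//|h] _; apply/orP; right; lia.
Qed.

Let H0_upper : (M2 * rho * H0 <= q * La)%N.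
Proof. by rewrite mulnC leq_trunc_div. Qed.

Let H00 : (0 < H0)%N.
Proof. by have := H0_lower; case: (H0) => [|//]; rewrite !muln0 leqn0 muln_eq0 -!leqn0 leqNgt q0 leqNgt La0. Qed.

Let nHK : (n <= H0 * K0)%N. Proof. by rewrite /K0 mulnC; apply: ltnW; exact: ltn_ceil. Qed.

Let kappa_lower : (r * La ^ 2 * L <= kappa * rho)%N.
Proof. by apply: ltnW; exact: ltn_ceil. Qed.

Let kappa_upper : (kappa * rho <= 2 * (r * La ^ 2 * L))%N.
Proof.
have rl : (rho <= r * La ^ 2 * L)%N.
  by apply: leq_trans (_ : r <= _)%N; [apply: leq_trans rhor; rewrite leq_pmull | rewrite -mulnA leq_pmulr // muln_gt0 expn_gt0 La0].
rewrite /kappa mulSn.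
by have := leq_trunc_div (r * La ^ 2 * L) rho; move: (_ %/ _ * _)%N rl; clear; lia.
Qed.

Let kappa_r : (24 * kappa <= r)%N.
Proof.
rewrite -(leq_pmul2r rho0) -mulnA; apply: leq_trans (leq_mul (leqnn 24) kappa_upper) _.
have -> : (24 * (2 * (r * La ^ 2 * L)) = r * (La ^ 2 * L * 48))%N by lia.
by rewrite leq_mul2l Lam orbT.
Qed.

Let kappa_rho : (2 * rho <= kappa)%N.
Proof.
rewrite -(leq_pmul2r rho0); apply: leq_trans kappa_lower.
apply: leq_trans (_ : r <= _)%N; last by rewrite -mulnA leq_pmulr // muln_gt0 expn_gt0 La0.
by apply: leq_trans hr; rewrite -mulnA leq_mul.
Qed.

Let H0_large : (24 * kappa < H0 * 2)%N.
Proof.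
apply: leq_ltn_trans kappa_r _.
have : (M2 * rho * r < M2 * rho * (H0 * 2))%N; last by rewrite ltn_pmul2l // muln_gt0 M20.
apply: (@leq_trans (q * La)); last first.
  by apply: leq_trans H0_lower _; rewrite mulnCA [(2 * _)%N]mulnC -mulnA mulnC leq_mul //; lia.
apply: (@leq_trans (M2 * r ^ 2)).
  have -> : (M2 * rho * r < M2 * r ^ 2)%N = (M2 * r * rho < M2 * r * r)%N by congr (_ < _)%N; lia.
  have M2r : (0 < M2 * r)%N by rewrite muln_gt0 M20.
  by rewrite ltn_pmul2l //; apply: leq_trans rhor; exact: ltn_Pmull.
by apply: leq_trans h5 _; rewrite leq_pmulr.
Qed.

Let rH0n : (r ^ 2 * H0 ^ 2 <= n)%N.
Proof.
have Larho : (La <= rho)%N.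
  apply: leq_trans hrho; apply: (@leq_trans (La * L ^ 2)); first by rewrite leq_pmulr // expn_gt0 L0.
  by rewrite leq_pmull // expn_gt0 m0.
have M2H0 : (M2 * H0 <= q)%N.
  rewrite -(leq_pmul2r rho0); apply: (@leq_trans (q * La)).
    by apply: leq_trans H0_upper; lia.
  by rewrite leq_mul.
have MM : (0 < r * M2 ^ 2)%N by rewrite muln_gt0 r0 expn_gt0 M20.
rewrite -(leq_pmul2r MM).
apply: (@leq_trans (r ^ 3 * q ^ 2)).
  have -> : (r ^ 2 * H0 ^ 2 * (r * M2 ^ 2) = r ^ 3 * (M2 * H0) ^ 2)%N by rewrite !expnMn; lia.
  by rewrite leq_mul // leq_exp2r.
by apply: leq_trans h6 _; rewrite /b mulnA.
Qed.

Let HK0 : (r ^ 2 * H0 <= K0)%N.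
Proof.
apply: ltnW; rewrite ltnS leq_divRL // -mulnA -[(H0 * H0)%N]/(H0 ^ 2)%N.
exact: rH0n.
Qed.

Let K0_upper : (H0 * K0 <= 2 * n)%N.
Proof.
have : (H0 <= n)%N.
  apply: leq_trans rH0n; apply: (@leq_trans (H0 ^ 2)); last by rewrite leq_pmull // expn_gt0 r0.
  by rewrite -{1}(expn1 H0) leq_pexp2l.
have := leq_trunc_div n H0; rewrite /K0 mulnS [(H0 * _)%N]mulnC; clear; lia.
Qed.

Let IH : (m ^ 4 * H0 <= H)%N.
Proof. by rewrite leq_mul2r; apply/orP; right; apply: leq_trans m4rho; rewrite leq_pmull. Qed.

Let IK : (2 * m ^ 4 * K0 <= K)%N.
Proof. by rewrite leq_mul2r; apply/orP; right; apply: leq_trans m4rho _; apply: leq_trans kappa_rho; rewrite leq_pmull. Qed.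

Let HKle : (2 * r ^ 2 * H <= K)%N.
Proof.
have -> : (2 * r ^ 2 * H = 2 * rho * (r ^ 2 * H0))%N by rewrite /H; lia.
by rewrite leq_mul.
Qed.

Let detn : (2 * H * K0 + 3 * K * H0 < n * r)%N.
Proof.
have -> : (2 * H * K0 + 3 * K * H0 = (2 * rho + 3 * kappa) * (H0 * K0))%N by rewrite /H /K; lia.
apply: leq_ltn_trans (leq_mul (leqnn _) K0_upper) _.
rewrite mulnCA mulnA mulnC ltn_pmul2l //.
by move: kappa_r kappa_rho rhor r0; clear; lia.
Qed.

Let Kn : (3 * K < n)%N.
Proof.
rewrite -(ltn_pmul2l H00).
have -> : (H0 * (3 * K) = 3 * kappa * (H0 * K0))%N by rewrite /K; lia.
apply: leq_ltn_trans (leq_mul (leqnn _) K0_upper) _.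
by rewrite mulnA ltn_pmul2r //; move: H0_large; clear; lia.
Qed.

Let eps : R := 8 * (J2 + M2)%N%:R / q%:R * H0%:R + 8 * (J1 + M1)%N%:R / q%:R * (2 * K0%:R).
Let delta : R := q%:R / (J1%:R * K%:R) + q%:R / (J2%:R * H%:R).
Let om : R := (2 * 2 ^ omega b)%N%:R.

Let posR (x : nat) : (0 < x)%N -> 0 < x%:R :> R. Proof. by rewrite ltr0n. Qed.
Let H_0 : (0 < H)%N. Proof. by rewrite muln_gt0 rho0. Qed.
Let K_0 : (0 < K)%N. Proof. by rewrite muln_gt0. Qed.
Let N0 : (0 < N)%N. Proof. exact: leq_trans bN. Qed.
Let qE : q%:R = b%:R * b%:R :> R. Proof. by rewrite /q -mulnn natrM. Qed.
Let LR : 32 <= L%:R :> R. Proof. by rewrite ler_nat. Qed.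
Let LR0 : 0 < L%:R :> R. Proof. exact: posR. Qed.

Let delta_le : delta <= 48 * L%:R / La%:R.
Proof.
have J1R := posR J10.
have J2R := posR J20.
have HR := posR H_0.
have KR := posR K_0.
have LaR := posR La0.
have qR := posR q0.
have A1 : q%:R / (J2%:R * H%:R) <= 16 * L%:R / La%:R :> R.
  rewrite ler_pdivrMr ?mulr_gt0 // mulrAC ler_pdivlMr // -!natrM ler_nat.
  apply: leq_trans H0_lower _; rewrite -mulnA -/H.
  have -> : (2 * (M2 * H) = M2 * (2 * H))%N by clear; lia.
  by apply: leq_trans (leq_mul h3 (leqnn _)) _; clear; lia.
have A2 : q%:R / (J1%:R * K%:R) <= 32 * L%:R / La%:R :> R.
  rewrite ler_pdivrMr ?mulr_gt0 // mulrAC ler_pdivlMr // -!natrM ler_nat.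
  have MH : (0 < M2 * rho * H0)%N by rewrite !(muln_gt0 (_ * _)) muln_gt0 M20 rho0.
  have X0 : (0 < q * La * L)%N by rewrite (muln_gt0 (q * La)) (muln_gt0 q) q0 La0.
  rewrite -(leq_pmul2r X0).
  apply: (@leq_trans (32 * L ^ 2 * J1 * M2 * (kappa * rho) * (H0 * K0))); last first.
    have -> : (32 * L ^ 2 * J1 * M2 * (kappa * rho) * (H0 * K0) = 32 * L * (J1 * K) * L * (M2 * rho * H0))%N by rewrite /K; clear; lia.
    apply: leq_trans (leq_mul (leqnn _) H0_upper) _; clear; lia.
  apply: leq_trans (_ : N * q * (r * La ^ 2 * L) * n <= _)%N; last first.
    by apply: leq_mul => //; apply: leq_mul.
  have -> : (N * q * (r * La ^ 2 * L) * n = q * La * L * (N * b * La))%N by rewrite /b; clear; lia.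
  have -> : (q * La * (q * La * L) = q * La * L * (b * b * La))%N by rewrite {3}/q; clear; lia.
  by rewrite leq_mul2l; apply/orP; right; rewrite leq_mul // leq_mul.
rewrite /delta; apply: le_trans (lerD A2 A1) _.
by rewrite -mulrDl -mulrDl; apply: ler_wpM2r; [rewrite invr_ge0 ltW | lra].
Qed.

Let MMq : M1%:R * M2%:R / q%:R <= 8 * N%:R / L%:R :> R.
Proof.
rewrite ler_pdivrMr ?posR // mulrAC ler_pdivlMr // -!natrM ler_nat.
exact: h1.
Qed.

Let eps_le : 2 * m%:R ^+ 5 * eps <= 1.
Proof.
have mR := posR m0.
have rhoR := posR rho0.
have LaR := posR La0.
have qR := posR q0.
have rR := posR r0.
have H0R := posR H00.
have M2R := posR M20.
have E1 : 8 * (J2 + M2)%N%:R / q%:R * H0%:R <= 16 * La%:R / rho%:R :> R.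
  rewrite [leLHS]mulrAC ler_pdivrMr // [leRHS]mulrAC ler_pdivlMr // -!natrM ler_nat.
  apply: (@leq_trans (16 * (M2 * rho * H0))).
    have : (8 * (J2 + M2) <= 16 * M2)%N by move: JM2; clear; lia.
    by move=> /leq_mul -/(_ (H0 * rho) (H0 * rho) (leqnn _))%N; clear; lia.
  by apply: leq_trans (leq_mul (leqnn _) H0_upper) _; clear; lia.
have E2 : 8 * (J1 + M1)%N%:R / q%:R * (2 * K0%:R) <= 32 * rho%:R / r%:R :> R.
  rewrite [leLHS]mulrAC ler_pdivrMr // [leRHS]mulrAC ler_pdivlMr // -!natrM ler_nat.
  apply: (@leq_trans (32 * (M1 * K0 * r))).
    have : (8 * (J1 + M1) <= 16 * M1)%N by move: JM1; clear; lia.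
    by move=> /leq_mul -/(_ (2 * K0 * r) (2 * K0 * r) (leqnn _))%N; clear; lia.
  rewrite -[X in (_ <= X)%N]mulnA leq_mul2l; apply/orP; right.
  have X0 : (0 < q * La * L)%N by rewrite (muln_gt0 (q * La)) (muln_gt0 q) q0 La0.
  rewrite -(leq_pmul2r X0).
  apply: (@leq_trans (2 * (M2 * rho * H0) * L * (M1 * K0 * r))).
    by rewrite mulnC leq_mul // leq_mul.
  have -> : (2 * (M2 * rho * H0) * L * (M1 * K0 * r) = (M1 * M2 * L) * (2 * rho * r) * (H0 * K0))%N by clear; lia.
  apply: leq_trans (leq_mul (leq_mul h1 (leqnn _)) K0_upper) _.
  have -> : (8 * N * q * (2 * rho * r) * (2 * n) = (rho * q) * (32 * (N * b)))%N by rewrite /b; clear; lia.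
  have -> : (rho * q * (q * La * L) = rho * q * (q * (La * L)))%N by clear; lia.
  rewrite leq_mul2l; apply/orP; right.
  apply: (@leq_trans (32 * (b * L ^ 6 * b))); first by rewrite leq_mul2l leq_mul2r Nb !orbT.
  have -> : (32 * (b * L ^ 6 * b) = q * (32 * L ^ 6))%N by rewrite /q; clear; lia.
  rewrite leq_mul2l; apply/orP; right.
  apply: (@leq_trans (L * L ^ 6)); first by rewrite leq_mul2r L32 orbT.
  rewrite -expnS; apply: (@leq_trans La); last by rewrite leq_pmulr.
  by apply: leq_trans hLa; rewrite leq_pexp2l.
have E3 : 2 * m%:R ^+ 5 * (16 * La%:R / rho%:R) <= 1 / 2 :> R.
  rewrite mulrA ler_pdivrMr //; apply: (@le_trans _ _ ((m ^ 5 * (La * L ^ 2))%N%:R / 2)); last first.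
    by rewrite mul1r [leRHS]mulrC; apply: ler_wpM2r; rewrite ?invr_ge0 ?ler_nat.
  rewrite ler_pdivlMr // -natrX -!natrM ler_nat.
  have := L2; move: (m ^ 5)%N (L ^ 2)%N => x y; clear; nia.
have E4 : 2 * m%:R ^+ 5 * (32 * rho%:R / r%:R) <= 1 / 2 :> R.
  rewrite mulrA ler_pdivrMr // -natrX; apply: (@le_trans _ _ ((4 * rho ^ 2)%N%:R / 2)); last first.
    by rewrite mul1r [leRHS]mulrC; apply: ler_wpM2r; rewrite ?invr_ge0 ?ler_nat.
  rewrite ler_pdivlMr // -!natrM ler_nat.
  have := mrho; move: (m ^ 5)%N => x; clear; nia.
have m5 : 0 <= 2 * m%:R ^+ 5 :> R by rewrite mulr_ge0 // exprn_ge0.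
apply: le_trans (ler_wpM2l m5 (lerD E1 E2)) _.
rewrite mulrDr; apply: le_trans (lerD E3 E4) _; lra.
Qed.

Let D : R := q%:R ^+ 2 / (M1%:R * M2%:R) * delta.
Let T : R := D * (4 * harm R q ^+ 2).
Let core : R := 28 * H%:R * K%:R * (6 / m%:R + 2 * m%:R ^+ 4 * eps) + 54 * H%:R * K0%:R * harm R H0 + 4 * T.

Let omL : om <= 2 * L%:R ^+ 10.
Proof. by rewrite /om -natrX -natrM ler_nat leq_mul2l hom orbT. Qed.

Let lX k : (32 : R) ^+ k <= L%:R ^+ k.
Proof. by rewrite lerXn2r ?nnegrE // ltW. Qed.

Let harm_H0 : harm R H0 <= L%:R ^+ 2.
Proof.
apply: le_trans h8; apply: harm_le.
have Hn : (H0 <= n)%N.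
  apply: leq_trans rH0n; apply: (@leq_trans (H0 ^ 2)); last by rewrite leq_pmull // expn_gt0 r0.
  by rewrite -{1}(expn1 H0) leq_pexp2l.
apply: leq_trans Hn _; apply: (@leq_trans b); first by rewrite leq_pmulr.
by rewrite -{1}(expn1 b) leq_pexp2l.
Qed.

(** Four pieces, each at most an eighth of the bound: the frequencies [k = 0]; the averaged lattice
    sums, where [1 / m] beats [La ^ 2] and powers of [L]; the points parallel to short vectors,
    where [rho / r] is small; and the outer frequencies, where [1 / La] beats powers of [L]. *)
Lemma parameter_error : M1%:R * M2%:R / q%:R ^+ 2 *
   (b%:R * (2 * q%:R * harm R q / M2%:R + om * core + om * T)) <= N%:R / L%:R ^+ 2.
Proof.
have mR := posR m0. have rhoR := posR rho0. have LaR := posR La0. have qR := posR q0.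
have rR := posR r0. have M1R := posR M10. have M2R := posR M20. have bR := posR b0. have NR := posR N0.
have nR := posR n0. have H0R := posR H00.
have hq := harm_ge0 R q. have hH := harm_ge0 R H0.
have om0 : 0 <= om by [].
have bq : b%:R / q%:R = b%:R^-1 :> R by rewrite qE; field; exact: lt0r_neq0.
have -> : M1%:R * M2%:R / q%:R ^+ 2 *
   (b%:R * (2 * q%:R * harm R q / M2%:R + om * core + om * T)) =
   2 * M1%:R * harm R q * (b%:R / q%:R) +
   (M1%:R * M2%:R / q%:R) * (b%:R / q%:R * (H%:R * K%:R)) * (om * (28 * (6 / m%:R + 2 * m%:R ^+ 4 * eps))) +
   (M1%:R * M2%:R / q%:R) * (b%:R / q%:R * (H%:R * K0%:R)) * (om * (54 * harm R H0)) +
   b%:R * om * (20 * harm R q ^+ 2) * delta.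
  rewrite /core /T /D; move: (eps) (delta) (harm R q) (harm R H0) (om) => e d x y z.
  by field; rewrite !gt_eqF.
rewrite bq.
set l : R := L%:R; have l0 : 0 < l := LR0.
have Nl0 : 0 <= N%:R / l ^+ 2 by rewrite divr_ge0 ?exprn_ge0 // ltW.
have P1 : 2 * M1%:R * harm R q * b%:R^-1 <= 8^-1 * (N%:R / l ^+ 2).
  rewrite ler_pdivrMr //.
  have -> : 8^-1 * (N%:R / l ^+ 2) * b%:R = N%:R * b%:R / (8 * l ^+ 2).
    by field; rewrite gt_eqF.
  rewrite ler_pdivlMr ?mulr_gt0 ?exprn_gt0 //.
  apply: (@le_trans _ _ (2 * M1%:R * l ^+ 2 * (8 * l ^+ 2))).
    by apply: ler_wpM2r; [rewrite mulr_ge0 // exprn_ge0 // ltW | apply: ler_wpM2l => //; rewrite mulr_ge0].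
  have : 16 * M1%:R * l ^+ 4 <= N%:R * b%:R :> R by rewrite -natrX -!natrM ler_nat.
  apply: le_trans; rewrite le_eqVlt; apply/orP; left; apply/eqP; ring.
have HKb : b%:R^-1 * (H%:R * K%:R) <= 4 * La%:R ^+ 2 * l.
  rewrite mulrC ler_pdivrMr // -natrX -!natrM ler_nat.
  apply: (@leq_trans (kappa * rho * (H0 * K0))); first by rewrite /H /K; clear; lia.
  apply: leq_trans (leq_mul kappa_upper K0_upper) _.
  by rewrite /b; clear; lia.
have HK0b : b%:R^-1 * (H%:R * K0%:R) <= 2 * rho%:R / r%:R :> R.
  rewrite [leLHS]mulrC ler_pdivrMr // [leRHS]mulrAC ler_pdivlMr // -!natrM ler_nat /H.
  apply: (@leq_trans (rho * (H0 * K0) * r)); first by clear; lia.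
  by rewrite /b; apply: leq_trans (leq_mul (leq_mul (leqnn _) K0_upper) (leqnn _)) _; clear; lia.
have e0 : 0 <= eps by rewrite /eps addr_ge0 // mulr_ge0 // ?divr_ge0 ?mulr_ge0.
have me : 6 / m%:R + 2 * m%:R ^+ 4 * eps <= 7 / m%:R.
  rewrite ler_pdivlMr // mulrDl mulfVK ?gt_eqF //.
  have -> : 2 * m%:R ^+ 4 * eps * m%:R = 2 * m%:R ^+ 5 * eps by ring.
  by have := eps_le; lra.
have P2 : (M1%:R * M2%:R / q%:R) * (b%:R^-1 * (H%:R * K%:R)) * (om * (28 * (6 / m%:R + 2 * m%:R ^+ 4 * eps)))
   <= 8^-1 * (N%:R / l ^+ 2).
  apply: (@le_trans _ _ ((8 * N%:R / l) * (4 * La%:R ^+ 2 * l) * ((2 * l ^+ 10) * (28 * (7 / m%:R))))).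
    apply: ler_pM.
    - by rewrite mulr_ge0 // ?divr_ge0 ?mulr_ge0 ?invr_ge0.
    - by rewrite mulr_ge0 // mulr_ge0 // addr_ge0 ?divr_ge0 ?mulr_ge0 ?exprn_ge0.
    - by apply: ler_pM; rewrite ?divr_ge0 ?mulr_ge0 ?invr_ge0.
    by apply: ler_pM; rewrite ?mulr_ge0 ?addr_ge0 ?divr_ge0 ?mulr_ge0 ?exprn_ge0 // ler_wpM2l.
  have -> : (8 * N%:R / l) * (4 * La%:R ^+ 2 * l) * ((2 * l ^+ 10) * (28 * (7 / m%:R))) =
    8^-1 * (N%:R / l ^+ 2) * ((8 * 4 * 2 * 28 * 7 * 8) * (La%:R ^+ 2 * l ^+ 12) / m%:R).
    by field; rewrite !gt_eqF.
  rewrite -[leRHS]mulr1; apply: ler_wpM2l; first by rewrite mulr_ge0 // invr_ge0.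
  rewrite ler_pdivrMr // mul1r; apply: (@le_trans _ _ (L ^ 16 * La ^ 2)%N%:R); last by rewrite ler_nat.
  rewrite natrM !natrX -/l (_ : l ^+ 16 = l ^+ 4 * l ^+ 12); last by rewrite -exprD.
  have -> : l ^+ 4 * l ^+ 12 * La%:R ^+ 2 = l ^+ 4 * (La%:R ^+ 2 * l ^+ 12) by ring.
  apply: ler_wpM2r.
    by rewrite mulr_ge0 // exprn_ge0 // ltW.
  by apply: le_trans (lX 4); rewrite !exprS expr0; lra.
have P3 : (M1%:R * M2%:R / q%:R) * (b%:R^-1 * (H%:R * K0%:R)) * (om * (54 * harm R H0))
   <= 8^-1 * (N%:R / l ^+ 2).
  apply: (@le_trans _ _ ((8 * N%:R / l) * (2 * rho%:R / r%:R) * ((2 * l ^+ 10) * (54 * l ^+ 2)))).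
    apply: ler_pM.
    - by rewrite mulr_ge0 // ?divr_ge0 ?mulr_ge0 ?invr_ge0.
    - by rewrite mulr_ge0 // mulr_ge0.
    - by apply: ler_pM; rewrite ?divr_ge0 ?mulr_ge0 ?invr_ge0.
    by apply: ler_pM; rewrite ?mulr_ge0 // ler_wpM2l.
  have -> : (8 * N%:R / l) * (2 * rho%:R / r%:R) * ((2 * l ^+ 10) * (54 * l ^+ 2)) =
    8^-1 * (N%:R / l ^+ 2) * ((8 * 8 * 4 * 54) * l ^+ 13 * rho%:R / r%:R).
    by field; rewrite !gt_eqF.
  rewrite -[leRHS]mulr1; apply: ler_wpM2l; first by rewrite mulr_ge0 // invr_ge0.
  rewrite ler_pdivrMr // mul1r; apply: (@le_trans _ _ (4 * rho ^ 2)%N%:R); last by rewrite ler_nat.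
  rewrite natrM natrX expr2 mulrA; apply: ler_wpM2r => //.
  apply: (@le_trans _ _ (64 * L ^ 16)%N%:R).
    rewrite natrM natrX -/l (_ : l ^+ 16 = l ^+ 3 * l ^+ 13); last by rewrite -exprD.
    rewrite [leRHS]mulrA; apply: ler_wpM2r; first by rewrite exprn_ge0 // ltW.
    by have := lX 3; rewrite -/l !exprS expr0; lra.
  have : (64 * L ^ 16 <= rho)%N.
    apply: leq_trans mrho; rewrite leq_mul2l; apply/orP; right.
    apply: (@leq_trans m); last by rewrite -{1}(expn1 m) leq_pexp2l.
    by apply: leq_trans hm; rewrite leq_pmulr // expn_gt0 La0.
  rewrite -(ler_nat R) => /le_trans; apply; move: rhoR; lra.
have P4 : b%:R * om * (20 * harm R q ^+ 2) * delta <= 8^-1 * (N%:R / l ^+ 2).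
  apply: (@le_trans _ _ (N%:R * (2 * l ^+ 10) * (20 * (l ^+ 2) ^+ 2) * (48 * l / La%:R))).
    apply: ler_pM => //.
    - by rewrite mulr_ge0 ?mulr_ge0 // exprn_ge0.
    - by rewrite /delta addr_ge0 // divr_ge0 // mulr_ge0.
    - apply: ler_pM; rewrite ?mulr_ge0 ?exprn_ge0 //.
        by apply: ler_pM => //; rewrite ler_nat.
      by apply: ler_wpM2l => //; rewrite lerXn2r ?nnegrE // exprn_ge0 // ltW.
  have -> : N%:R * (2 * l ^+ 10) * (20 * (l ^+ 2) ^+ 2) * (48 * l / La%:R) =
    8^-1 * (N%:R / l ^+ 2) * ((8 * 2 * 20 * 48) * l ^+ 17 / La%:R).
    by field; rewrite !gt_eqF.
  rewrite -[leRHS]mulr1; apply: ler_wpM2l; first by rewrite mulr_ge0 // invr_ge0.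
  rewrite ler_pdivrMr // mul1r; apply: (@le_trans _ _ (L ^ 23)%N%:R); last by rewrite ler_nat.
  rewrite natrX -/l (_ : l ^+ 23 = l ^+ 6 * l ^+ 17); last by rewrite -exprD.
  apply: ler_wpM2r; first by rewrite exprn_ge0 // ltW.
  by apply: le_trans (lX 6); rewrite !exprS expr0; lra.
by move: P1 P2 P3 P4 Nl0; lra.
Qed.

Lemma box_count :
  `|(\sum_(p1 : 'I_J1 * 'I_M1) \sum_(p2 : 'I_J2 * 'I_M2)
      (q%:Z %| ((a1 + p1.1 + p1.2)%N%:Z * (a2 + p2.1 + p2.2)%N%:Z - 1)%R)%Z)%N%:R -
    J2%:R * M2%:R / q%:R * (\sum_(p : 'I_J1 * 'I_M1) coprime (a1 + p.1 + p.2) b)%N%:R| <=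
  J1%:R * J2%:R * (N%:R / L%:R ^+ 2) :> R.
Proof.
apply: le_trans (box_estimate R n0 pr nr m0 m4r H00 nHK HK0 IH IK HKle detn Kn a1 a2 J10 M10 J20 M20) _.
have -> : forall x : R, J1%:R * M1%:R * (J2%:R * M2%:R) / q%:R ^+ 2 * x = J1%:R * J2%:R *
  (M1%:R * M2%:R / q%:R ^+ 2 * x) by move=> x; ring.
apply: ler_wpM2l; first by rewrite mulr_ge0.
exact: parameter_error.
Qed.

End ParameterChoice.

(** * Lattice points in small boxes *)

Section PairsInBox.

Lemma count_spaced (S M : nat) (W : int -> bool) : (0 < M)%N ->
  (forall s s', W s -> W s' -> (M%:Z %| s - s')%Z) -> (zsum S (fun s => W s : nat) <= (2 * S) %/ M + 1)%N.
Proof.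
move=> M0 sp; rewrite addn1 /zsum.
have -> : (\sum_(m < (2 * S).+1) W (m%:Z - S%:Z)%R = #|[pred m : 'I_(2 * S).+1 | W (m%:Z - S%:Z)%R]|)%N.
  by rewrite -sum1_card [RHS]big_mkcond; apply: eq_bigr => m _; rewrite inE; case: (W _).
have qP (m : 'I_(2 * S).+1) : (m %/ M < ((2 * S) %/ M).+1)%N.
  by rewrite ltnS leq_div2r // -ltnS.
rewrite -(card_in_imset (f := fun m : 'I_(2 * S).+1 => Ordinal (qP m))).
  by apply: leq_trans (max_card _) _; rewrite card_ord.
move=> x y; rewrite !inE => Wx Wy [] e; apply/val_inj => /=.
have := sp _ _ Wx Wy; have -> : x%:Z - S%:Z - (y%:Z - S%:Z) = x%:Z - y%:Z by ring.
by rewrite dvdz_subn (divn_eq x M) (divn_eq y M) e => /eqP; rewrite !modnMDl !modn_mod => ->.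
Qed.

Lemma sum_gcdn_le T n : (0 < n)%N -> (\sum_(1 <= t < T.+1) gcdn t n <= T * size (divisors n))%N.
Proof.
move=> n0; apply: (@leq_trans (\sum_(1 <= t < T.+1) \sum_(g <- divisors n) g * (g %| t))%N).
  apply: leq_sum => t _.
  have gd : gcdn t n \in divisors n by rewrite -dvdn_divisors ?dvdn_gcdr.
  by rewrite (bigD1_seq (gcdn t n)) ?divisors_uniq //= dvdn_gcdl muln1 leq_addr.
rewrite exchange_big /= -sum1_size big_distrr /= big_seq [leqRHS]big_seq; apply: leq_sum => g gn.
have g0 : (0 < g)%N by apply: (dvdn_gt0 n0); rewrite dvdn_divisors.
rewrite -big_distrr /= muln1.
have -> : (\sum_(1 <= t < T.+1) (g %| t) = T %/ g)%N.
  elim: T => [|T IHT]; first by rewrite big_geq // div0n.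
  by rewrite big_nat_recr //= IHT divnS // addnC.
by rewrite mulnC leq_trunc_div.
Qed.

Variables (b1 b2 T S : nat).
Hypothesis b10 : (0 < b1)%N.
Hypothesis b20 : (0 < b2)%N.
Hypothesis co : coprime b1 b2.
Let b := (b1 * b2)%N.
(** Two pairs with the same [d = x] modulo [b] differ by [b (t, s)], and subtracting their
    congruences modulo [b ^ 2] gives [x ^ 2 s + t = 0] modulo [b]. *)
Let W (n x : nat) (t s : int) : bool := coprime x n && (n%:Z %| x%:Z ^+ 2 * s + t)%Z.

Let b0 : (0 < b)%N. Proof. by rewrite muln_gt0 b10. Qed.

Let W_mod n x t s : W n (x %% n) t s = W n x t s.
Proof.
rewrite /W coprime_modl; congr (_ && _).
have -> : x%:Z ^+ 2 * s + t = ((x %% n)%N%:Z ^+ 2 * s + t) + (x%:Z - (x %% n)%N%:Z) * ((x%:Z + (x %% n)%N%:Z) * s) by ring.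
by rewrite [in RHS]rpredDr // dvdz_mulr // dvdz_subn modn_mod.
Qed.

Let coprimez_sqr (x n : nat) : coprime x n -> coprimez n%:Z (x%:Z ^+ 2).
Proof. by move=> cx; rewrite coprimezE abszX /= coprime_sym coprimeXl. Qed.

Let gcd_eq x t s : W b2 x t s -> gcdn `|s| b2 = gcdn `|t| b2.
Proof.
move=> /andP[cx d]; apply/eqP; rewrite eqn_dvd !dvdn_gcd !dvdn_gcdr !andbT.
have D (g : nat) : (g %| b2)%N -> (g%:Z %| s)%Z = (g%:Z %| t)%Z.
  move=> gb; have cg : coprimez g%:Z (x%:Z ^+ 2) by apply: coprimez_sqr; apply: coprime_dvdr cx.
  have gd : (g%:Z %| x%:Z ^+ 2 * s + t)%Z by apply: dvdz_trans d; rewrite dvdzE.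
  rewrite -(Gauss_dvdzr s cg); apply/idP/idP => h.
    by have -> : t = (x%:Z ^+ 2 * s + t) - x%:Z ^+ 2 * s by [ring]; rewrite rpredB.
  by have -> : x%:Z ^+ 2 * s = (x%:Z ^+ 2 * s + t) - t by [ring]; rewrite rpredB.
have := D _ (dvdn_gcdr `|s| b2); have := D _ (dvdn_gcdr `|t| b2); rewrite !dvdzE /= !dvdn_gcdl.
by move=> -> <-.
Qed.

Let fixed_t (t : int) : t != 0 ->
  (\sum_(x < b) zsum S (fun s => W b x t s : nat) <= 2 * 2 ^ omega b2 * (2 * S + b1 * gcdn `|t| b2))%N.
Proof.
move=> t0; set g := gcdn _ _.
have g0 : (0 < g)%N by rewrite gcdn_gt0 b20 orbT.
rewrite zsum_exchange.
have E s : (\sum_(x < b) (W b x t s : nat) = \sum_(x1 < b1) \sum_(x2 < b2) (W b1 x1 t s * W b2 x2 t s))%N.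
  rewrite -(sum_crt (fun x1 x2 => W b1 x1 t s * W b2 x2 t s)%N co b10 b20); apply: eq_bigr => x _.
  rewrite !W_mod mulnb; congr nat_of_bool.
  by rewrite /W coprimeMr !dvdzE Gauss_dvd // andbACA.
rewrite (eq_zsum (g := fun s => \sum_(x1 < b1) \sum_(x2 < b2) (W b1 x1 t s * W b2 x2 t s))%N); last by move=> s _; exact: E.
have F s x1 : (\sum_(x2 < b2) (W b1 x1 t s * W b2 x2 t s) <= 2 * 2 ^ omega b2 * g * (W b1 x1 t s && (g%:Z %| s)%Z))%N.
  rewrite -big_distrr /= mulnC; case: (W b1 x1 t s); last by rewrite muln0 andFb muln0.
  rewrite muln1 andTb.
  have [x2 Wx2|none] := pickP (fun x2 : 'I_b2 => W b2 x2 t s); last first.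
    by rewrite big1 // => x2 _; rewrite none.
  have gs := gcd_eq Wx2.
  have -> : (g%:Z %| s)%Z by rewrite dvdzE /= /g -gs dvdn_gcdl.
  rewrite muln1.
  apply: leq_trans (leq_trans (card_quadratic_roots (- s) t b20) _); last first.
    by rewrite abszN gs -/g -[leqRHS]muln1 leq_mul2l leq_b1 orbT.
  rewrite -sum1_card [leqRHS]big_mkcond; apply: leq_sum => x _; rewrite inE /W.
  by have -> : t - - s * (x : nat)%:Z ^+ 2 = (x : nat)%:Z ^+ 2 * s + t by [ring]; case: (_ && _).
apply: (@leq_trans (\sum_(x1 < b1) 2 * 2 ^ omega b2 * g * zsum S (fun s => (W b1 x1 t s && (g%:Z %| s)%Z) : nat))%N).
  rewrite -zsum_exchange; apply: leq_sum => x1 _; rewrite /zsum big_distrr; apply: leq_sum => m _; exact: F.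
apply: (@leq_trans (\sum_(x1 < b1) 2 * 2 ^ omega b2 * g * ((2 * S) %/ (b1 * g) + 1))%N).
  apply: leq_sum => x1 _; rewrite leq_mul2l; apply/orP; right.
  apply: count_spaced; first by rewrite muln_gt0 b10.
  move=> s s' /andP[/andP[cx d] gs] /andP[/andP[_ d'] gs'].
  have cg : coprime b1 g by apply: coprime_dvdr co; apply: dvdn_gcdr.
  rewrite dvdzE /= Gauss_dvd //; apply/andP; split.
    have : (b1%:Z %| x1%:Z ^+ 2 * (s - s'))%Z.
      by have -> : x1%:Z ^+ 2 * (s - s') = (x1%:Z ^+ 2 * s + t) - (x1%:Z ^+ 2 * s' + t) by [ring]; rewrite rpredB.
    by rewrite Gauss_dvdzr ?dvdzE //; apply: coprimez_sqr.
  by have : (g%:Z %| s - s')%Z by rewrite rpredB.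
rewrite sum_nat_const card_ord; move: (2 * 2 ^ omega b2)%N => k.
have := leq_trunc_div (2 * S) (b1 * g); move: (_ %/ _)%N => w wS.
apply: (@leq_trans (k * (w * (b1 * g) + b1 * g))); first by clear; lia.
by rewrite leq_mul2l leq_add2r wS orbT.
Qed.

(** In each class of [d] modulo [b] a reference pair is fixed and the others are recorded by their
    displacement. The displacements with [t = 0] contribute [b + 2 S]; the others are counted by
    [fixed_t], with [sum_gcdn_le] for the sum of [gcdn t b2]. *)
Lemma pairs_in_box (P : seq (nat * nat)) : uniq P ->
  (forall p, p \in P -> ((b ^ 2)%N%:Z %| p.1%:Z * p.2%:Z - 1)%Z) ->
  (forall p p', p \in P -> p' \in P -> (`|p.1%:Z - p'.1%:Z| < b * T.+1)%N /\ (`|p.2%:Z - p'.2%:Z| < b * S.+1)%N) ->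
  (size P <= b + 2 * S + 2 * 2 ^ omega b2 * (4 * T * S + 2 * b1 * T * size (divisors b2)))%N.
Proof.
move=> uP Pd Pc.
have cop p : p \in P -> coprime p.1 b.
  move=> /Pd H; rewrite /coprime -dvdn1.
  have : ((gcdn p.1 b)%:Z %| p.1%:Z * p.2%:Z - (p.1%:Z * p.2%:Z - 1))%Z.
    rewrite rpredB //; first by rewrite dvdz_mulr // dvdzE dvdn_gcdl.
    apply: dvdz_trans H; rewrite dvdzE /=; apply: dvdn_trans (dvdn_gcdr _ _) _.
    by rewrite -mulnn dvdn_mulr.
  by have -> : p.1%:Z * p.2%:Z - (p.1%:Z * p.2%:Z - 1) = 1 by [ring]; rewrite dvdzE.
have classes : (size P = \sum_(x < b) count (fun p : nat * nat => p.1 %% b == x)%N P)%N.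
  rewrite (eq_bigr (fun x : 'I_b => \sum_(p <- P) (p.1 %% b == x)%N : nat)); last first.
    by move=> x _; rewrite -sum1_count big_mkcond; apply: eq_bigr => p _; case: (_ == _).
  rewrite exchange_big /= -sum1_size; apply: eq_bigr => p _.
  rewrite (bigD1 (Ordinal (ltn_pmod p.1 b0))) //= eqxx big1 // => x xp.
  by rewrite eq_sym -[(_ == _)]/(x == Ordinal (ltn_pmod p.1 b0)) (negPf xp).
have class_le (x : 'I_b) : (count (fun p : nat * nat => p.1 %% b == x)%N P <=
    zsum T (fun t => zsum S (fun s => W b x t s : nat)))%N.
  rewrite -size_filter; set Q := seq.filter _ P.
  have uQ : uniq Q by apply: filter_uniq.
  have QP p : p \in Q -> (p.1 %% b)%N = x /\ p \in P by rewrite mem_filter => /andP[/eqP].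
  have [->//|] := eqVneq Q [::].
  case eQ : Q => [//|p0 Q'] _; rewrite -eQ.
  have p0Q : p0 \in Q by rewrite eQ mem_head.
  have [x0 P0] := QP _ p0Q.
  pose t (p : nat * nat) := ((p.1%:Z - p0.1%:Z) %/ b%:Z)%Z.
  pose s (p : nat * nat) := ((p.2%:Z - p0.2%:Z) %/ b%:Z)%Z.
  have dd p : p \in Q -> (b%:Z %| p.1%:Z - p0.1%:Z)%Z.
    by move=> /QP[xp _]; rewrite dvdz_subn xp x0.
  have b_b2 (z : int) : ((b ^ 2)%N%:Z %| z)%Z -> (b%:Z %| z)%Z.
    by apply: dvdz_trans; rewrite dvdzE /= -mulnn dvdn_mulr.
  have ee p : p \in Q -> (b%:Z %| p.2%:Z - p0.2%:Z)%Z.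
    move=> pQ; have [_ pP] := QP _ pQ; apply: (@dvdz_inv_unique b%:Z p0.1%:Z).
      have -> : p0.1%:Z * p.2%:Z - 1 = (p.1%:Z * p.2%:Z - 1) - (p.1%:Z - p0.1%:Z) * p.2%:Z by ring.
      by rewrite rpredB //; [apply: b_b2; exact: Pd | rewrite dvdz_mulr // dd].
    by apply: b_b2; exact: Pd.
  have tE p : p \in Q -> p.1%:Z - p0.1%:Z = t p * b%:Z by move=> pQ; rewrite /t divzK // dd.
  have sE p : p \in Q -> p.2%:Z - p0.2%:Z = s p * b%:Z by move=> pQ; rewrite /s divzK // ee.
  have tT p : p \in Q -> (`|t p| <= T)%N.
    move=> pQ; have [_ pP] := QP _ pQ; have [+ _] := Pc _ _ pP P0.
    by rewrite (tE _ pQ) abszM /= mulnC ltn_pmul2l.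
  have sS p : p \in Q -> (`|s p| <= S)%N.
    move=> pQ; have [_ pP] := QP _ pQ; have [_ +] := Pc _ _ pP P0.
    by rewrite (sE _ pQ) abszM /= mulnC ltn_pmul2l.
  have WQ p : p \in Q -> W b x (t p) (s p).
    move=> pQ; have [xp pP] := QP _ pQ.
    have cx : coprime x b by rewrite -x0 coprime_modl cop.
    rewrite /W cx /=.
    have bz : b%:Z != 0 by have := b0; case: (b).
    have h : (b%:Z %| p0.1%:Z * s p + p0.2%:Z * t p)%Z.
      have H : ((b ^ 2)%N%:Z %| (p.1%:Z * p.2%:Z - 1) - (p0.1%:Z * p0.2%:Z - 1))%Z by rewrite rpredB // Pd.
      have e : (p.1%:Z * p.2%:Z - 1) - (p0.1%:Z * p0.2%:Z - 1) =
         b%:Z * (p0.1%:Z * s p + p0.2%:Z * t p + b%:Z * (t p * s p)).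
        have -> : p.1%:Z = p0.1%:Z + t p * b%:Z by rewrite -(tE _ pQ); ring.
        have -> : p.2%:Z = p0.2%:Z + s p * b%:Z by rewrite -(sE _ pQ); ring.
        by ring.
      rewrite e -mulnn PoszM dvdz_mul2l // in H.
      by rewrite -(rpredDr _ (dvdz_mulr (t p * s p) (dvdzz b%:Z))).
    have h1 : (b%:Z %| p0.1%:Z ^+ 2 * s p + t p)%Z.
      have -> : p0.1%:Z ^+ 2 * s p + t p = p0.1%:Z * (p0.1%:Z * s p + p0.2%:Z * t p) -
        (p0.1%:Z * p0.2%:Z - 1) * t p by ring.
      by rewrite rpredB //; [apply: dvdz_mull | apply: dvdz_mulr; apply: b_b2; exact: Pd].
    have -> : (x : nat)%:Z ^+ 2 * s p + t p = (p0.1%:Z ^+ 2 * s p + t p) +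
        ((x : nat)%:Z - p0.1%:Z) * (((x : nat)%:Z + p0.1%:Z) * s p) by ring.
    by rewrite rpredD // dvdz_mulr // dvdz_subn -x0 modn_mod.
  have tP p : (p \in Q) -> (`|(t p + T%:Z)%R| < (2 * T).+1)%N by move=> /tT; clear; lia.
  have sP p : (p \in Q) -> (`|(s p + S%:Z)%R| < (2 * S).+1)%N by move=> /sS; clear; lia.
  pose f p : 'I_(2 * T).+1 * 'I_(2 * S).+1 := (inord `|(t p + T%:Z)%R|, inord `|(s p + S%:Z)%R|).
  have f1 p : p \in Q -> (f p).1%:Z - T%:Z = t p.
    by move=> pQ; rewrite /f /= inordK ?tP //; have := tT _ pQ; clear; lia.
  have f2 p : p \in Q -> (f p).2%:Z - S%:Z = s p.
    by move=> pQ; rewrite /f /= inordK ?sP //; have := sS _ pQ; clear; lia.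
  have uf : uniq (map f Q).
    rewrite map_inj_in_uniq // => p p' pQ p'Q e.
    have et : t p = t p' by rewrite -f1 // -[RHS]f1 // e.
    have es : s p = s p' by rewrite -f2 // -[RHS]f2 // e.
    have := tE _ pQ; have := tE _ p'Q; have := sE _ pQ; have := sE _ p'Q.
    rewrite et es => <- h2 <- h1; case: (p) (p') h1 h2 => [a a'] [c c'] /= h1 h2.
    by congr (_, _); [move: h1 | move: h2]; clear; lia.
  rewrite -(size_map f) -(card_uniqP uf).
  have -> : zsum T (fun t => zsum S (fun s => W b x t s : nat)) =
     #|[pred m : 'I_(2 * T).+1 * 'I_(2 * S).+1 | W b x (m.1%:Z - T%:Z) (m.2%:Z - S%:Z)]|.
    rewrite -sum1_card [RHS]big_mkcond /zsum pair_big /=; apply: eq_bigr => m _.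
    by rewrite inE; case: (W _ _ _ _).
  apply: subset_leq_card; apply/fintype.subsetP => m /mapP[p pQ ->]; rewrite inE f1 // f2 //.
  exact: WQ.
rewrite classes; apply: leq_trans (leq_sum _ (fun x _ => class_le x)) _.
rewrite (zsum_exchange T (index_enum 'I_b) xpredT (fun (x : 'I_b) t => zsum S (fun s => W b x t s : nat))).
rewrite zsum_split0; apply: leq_add.
  apply: leq_trans (zsum_dvd_le S b0).
  rewrite zsum_exchange; apply: leq_sum => m _.
  move: (m%:Z - S%:Z)%R => s'.
  apply: (@leq_trans (\sum_(x < b) (b%:Z %| s')%Z)%N); last by rewrite sum_nat_const card_ord.
  apply: leq_sum => x _; rewrite /W addr0; case: (boolP (coprime x b)) => //= cx.
  by rewrite Gauss_dvdzr //; apply: coprimez_sqr.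
apply: (@leq_trans (\sum_(1 <= t < T.+1) 2 * 2 ^ omega b2 * (2 * (2 * S + b1 * gcdn t b2)))%N).
  rewrite [leqLHS]big_nat [leqRHS]big_nat; apply: leq_sum => t /andP[t1 _].
  have n1 : t%:Z != 0 :> int by rewrite -lt0n.
  have n2 : - t%:Z != 0 :> int by rewrite oppr_eq0.
  by have := leq_add (fixed_t n1) (fixed_t n2); rewrite abszN absz_nat addnn -mul2n mulnCA.
rewrite -big_distrr /= leq_mul2l; apply/orP; right.
rewrite -big_distrr /= big_split /= -big_distrr /= sum_nat_const_nat subn1 /=.
rewrite -(big_distrr b1) /=.
have := leq_mul (leqnn (2 * b1)) (sum_gcdn_le T b20).
by move: (\sum_(1 <= t < T.+1) _)%N (size _) => x y; clear; lia.
Qed.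

End PairsInBox.

(** * Sums of multiplicative functions *)

Section Chebyshev.
Variable R : realType.

Lemma ln_nat_prime_powers V n : (0 < n <= V)%N -> ln (n%:R : R) =
  \sum_(p < V.+1 | prime p) \sum_(1 <= k < V.+1) (p ^ k %| n)%N%:R * ln (p%:R : R).
Proof.
move=> /andP[n0 nV].
have E p : prime p -> (logn p n = \sum_(1 <= k < V.+1) (p ^ k %| n))%N.
  move=> pp; rewrite logn_count_dvd // [RHS](@big_cat_nat _ _ _ n) //=; last by rewrite ltnW.
  rewrite [X in _ = (_ + X)%N]big_nat [X in _ = (_ + X)%N]big1 ?addn0 // => k /andP[nk _].
  apply/eqP; rewrite eqb0; apply/negP => /(dvdn_leq n0); apply/negP; rewrite -ltnNge.
  by apply: leq_ltn_trans nk _; apply: ltn_expl; apply: prime_gt1.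
transitivity (\sum_(p < V.+1 | prime p) (logn p n)%:R * ln (p%:R : R)); last first.
  by apply: eq_bigr => p pp; rewrite E // natr_sum mulr_suml.
have {1}-> : n = (\prod_(p < V.+1 | prime p) p ^ logn p n)%N.
  rewrite -{1}(partnT n0) (widen_partn _ nV) big_mkord [RHS]big_mkcond.
  apply: eq_big => // p _; case: ifP => // np; by rewrite lognE np.
suff [] : (0 < \prod_(p < V.+1 | prime p) p ^ logn p n)%N /\
  ln ((\prod_(p < V.+1 | prime p) p ^ logn p n)%N%:R : R) =
  \sum_(p < V.+1 | prime p) (logn p n)%:R * ln p%:R by [].
elim/big_rec2: _ => [|p x y pp [y0 e]]; first by rewrite ln1.
have p0 := prime_gt0 pp.
have pl : (0 < p ^ logn p n)%N by rewrite expn_gt0 p0.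
split; first by rewrite muln_gt0 pl.
by rewrite natrM lnM ?posrE ?ltr0n // natrX lnXn ?ltr0n // e mulr_natl.
Qed.

(** Chebyshev's function at [x]; [V] merely bounds the ranges of primes and exponents, so that sums
    for different [x] can be compared term by term. *)
Definition psi (V x : nat) : R :=
  \sum_(p < V.+1 | prime p) \sum_(1 <= k < V.+1) (p ^ k <= x)%N%:R * ln (p%:R : R).

Let ln_ge0n n : 0 <= ln (n%:R : R).
Proof. by have [->|n0] := posnP n; [rewrite ln0 | rewrite ln_ge0 // ler1n]. Qed.

Lemma count_dvd d n : (0 < d)%N -> (\sum_(1 <= m < n.+1) (d %| m) = n %/ d)%N.
Proof.
move=> d0; elim: n => [|n IHn]; first by rewrite big_geq // div0n.
by rewrite big_nat_recr //= IHn divnS // addnC.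
Qed.

Lemma ln_fact V n : (n <= V)%N -> ln (n`!%:R : R) =
  \sum_(p < V.+1 | prime p) \sum_(1 <= k < V.+1) (n %/ p ^ k)%N%:R * ln (p%:R : R).
Proof.
move=> nV; transitivity (\sum_(1 <= m < n.+1) ln (m%:R : R)).
  elim: n {nV} => [|n IHn]; first by rewrite fact0 ln1 big_geq.
  by rewrite big_nat_recr //= -IHn factS natrM lnM ?posrE ?ltr0n ?fact_gt0 // addrC.
rewrite big_nat (eq_bigr (fun m => \sum_(p < V.+1 | prime p) \sum_(1 <= k < V.+1) (p ^ k %| m)%N%:R * ln (p%:R : R))); last first.
  move=> m /andP[m1 mn]; rewrite (@ln_nat_prime_powers V) // m1; exact: leq_trans nV.
rewrite -big_nat exchange_big; apply: eq_bigr => p pp /=.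
rewrite exchange_big; apply: eq_bigr => k _ /=.
rewrite -mulr_suml; congr (_ * _).
by rewrite -natr_sum count_dvd // expn_gt0 prime_gt0.
Qed.

(** The central binomial coefficient is at most [4 ^ n]. For a prime power [d], its logarithm
    carries the weight [floor (2 n / d) - 2 floor (n / d)], which is never negative and equals [1]
    for [n < d <= 2 n]. *)
Lemma psi_double V n : (2 * n <= V)%N -> psi V (2 * n) <= psi V n + 2 * n%:R.
Proof.
move=> nV.
have bC : ln ('C(2 * n, n)%:R : R) <= 2 * n%:R.
  have c0 : (0 < 'C(2 * n, n))%N by rewrite bin_gt0 leq_pmull.
  have c4 : ('C(2 * n, n) <= 2 ^ (2 * n))%N.
    have -> : (2 ^ (2 * n) = \sum_(i < (2 * n).+1) 'C(2 * n, i))%N.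
      by have := expnDn 1 1 (2 * n); rewrite addn1 => ->; apply: eq_bigr => i _; rewrite !exp1n !muln1.
    have nP : (n < (2 * n).+1)%N by rewrite ltnS leq_pmull.
    by rewrite (bigD1 (Ordinal nP)) //= leq_addr.
  apply: (@le_trans _ _ (ln ((2 ^ (2 * n))%N%:R : R))).
    by rewrite ler_ln ?posrE ?ltr0n ?expn_gt0 // ler_nat.
  rewrite natrX lnXn // -[leLHS]mulr_natl (natrM _ 2 n) -[leRHS]mulr1; apply: ler_wpM2l; first by rewrite mulr_ge0.
  by apply: (@le_ln1Dx R 1); lra.
have fC : ln ((2 * n)`!%:R : R) = ln ('C(2 * n, n)%:R : R) + 2 * ln (n`!%:R : R).
  have e : ((2 * n)`! = 'C(2 * n, n) * (n`! * n`!))%N.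
    by rewrite -(bin_fact (_ : n <= 2 * n)%N) ?leq_pmull // (_ : 2 * n - n = n)%N //; lia.
  rewrite e !natrM !lnM ?posrE ?mulr_gt0 ?ltr0n ?fact_gt0 ?bin_gt0 ?leq_pmull //; ring.
have nV' : (n <= V)%N by lia.
have : psi V (2 * n) - psi V n <= ln ('C(2 * n, n)%:R : R); last by lra.
have -> : ln ('C(2 * n, n)%:R : R) = ln ((2 * n)`!%:R : R) - 2 * ln (n`!%:R : R) by rewrite fC; ring.
rewrite (ln_fact nV) (ln_fact nV') /psi mulr_sumr -!sumrB; apply: ler_sum => p pp.
rewrite mulr_sumr -!sumrB; apply: ler_sum => k _.
rewrite mulrA -!mulrBl; apply: ler_wpM2r => //.
have d0 : (0 < p ^ k)%N by rewrite expn_gt0 prime_gt0.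
set d := (p ^ k)%N in d0 *.
have : ((d <= 2 * n) + 2 * (n %/ d) <= 2 * n %/ d + (d <= n))%N.
  have e := divn_eq (2 * n) d; have e' := divn_eq n d.
  have l1 := ltn_pmod (2 * n) d0; have l2 := ltn_pmod n d0.
  move: (2 * n %/ d)%N (2 * n %% d)%N (n %/ d)%N (n %% d)%N e e' l1 l2 => a a' c c' e e' l1 l2.
  have ca : (2 * c <= a)%N by rewrite -ltnS -(ltn_pmul2r d0); clear -e e' l1 l2; lia.
  have c0 : (n < d)%N -> c = 0%N.
    by move=> nd; case: (posnP c) => // cp; have := leq_pmull d cp; clear -nd e'; lia.
  have a0 : (d <= 2 * n)%N -> (0 < a)%N.
    by move=> dn; rewrite lt0n; apply/negP => /eqP a0; move: e l1; rewrite a0; clear -dn; lia.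
  clear -ca c0 a0; case: (leqP d (2 * n)) a0 => h1 a0; case: (leqP d n) c0 => h2 c0 /=; try lia.
rewrite -(ler_nat R) (natrD _ (d <= 2 * n)%N) (natrD _ (2 * n %/ d)%N) natrM; lra.
Qed.

Lemma psi_mono V x y : (x <= y)%N -> psi V x <= psi V y.
Proof.
move=> xy; apply: ler_sum => p _; apply: ler_sum => k _; apply: ler_wpM2r => //.
rewrite ler_nat; case: (leqP (p ^ k)%N x) => //= h; by rewrite (leq_trans h xy).
Qed.

Lemma psi_le V x : (x < V)%N -> psi V x <= 4 * x%:R.
Proof.
elim/ltn_ind: x => x IHx xV.
have [x1|x1] := leqP x 1.
  apply: (@le_trans _ _ 0); last by rewrite mulr_ge0.
  rewrite /psi big1 // => p pp; rewrite big_nat big1 // => k /andP[k1 _].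
  have : (x < p ^ k)%N by apply: leq_ltn_trans x1 _; rewrite -(exp1n k) ltn_exp2r // prime_gt1.
  by rewrite ltnNge => /negPf ->; rewrite mul0r.
pose n := ((x.+1) %/ 2)%N.
have xn : (x <= 2 * n)%N by rewrite /n; have := divn_eq x.+1 2; have := ltn_pmod x.+1 (isT : (0 < 2)%N); lia.
have nx : (2 * n <= x.+1)%N by rewrite /n mulnC leq_trunc_div.
apply: le_trans (psi_mono _ xn) _; apply: le_trans (psi_double _) _; first by lia.
have nlt : (n < x)%N by lia.
have := IHx n nlt (ltn_trans nlt xV).
have : 6 * n%:R <= 4 * x%:R :> R by rewrite -!natrM ler_nat; clear -nx x1; lia.
lra.
Qed.

(* The logarithmic method for upper bounds of sums of multiplicative functions. *)
Lemma sum_ln_le (V : nat) (F : nat -> R) : (forall n, 0 <= F n) ->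
  (forall p k m, prime p -> (0 < m)%N -> F (p ^ k * m)%N <= 2 * F m) -> (0 < V)%N ->
  (\sum_(1 <= n < V.+1) F n) * ln (V%:R : R) <= 9 * V%:R * \sum_(1 <= n < V.+1) F n / n%:R.
Proof.
move=> F0 F2 V0.
have A1 : \sum_(1 <= n < V.+1) F n * ln (V%:R / n%:R) <= V%:R * \sum_(1 <= n < V.+1) F n / n%:R.
  rewrite mulr_sumr big_nat [leRHS]big_nat; apply: ler_sum => n /andP[n1 nV].
  rewrite mulrCA; apply: ler_wpM2l => //; apply: ltW; apply: ln_sublinear.
  by rewrite divr_gt0 // ltr0n.
have A2 : \sum_(1 <= n < V.+1) F n * ln (n%:R : R) <= 8 * V%:R * \sum_(1 <= n < V.+1) F n / n%:R.
  pose W := V.+1.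
  have -> : \sum_(1 <= n < V.+1) F n * ln (n%:R : R) =
     \sum_(p < W.+1 | prime p) \sum_(1 <= k < W.+1) ln (p%:R : R) * \sum_(1 <= n < V.+1) (p ^ k %| n)%N%:R * F n.
    rewrite big_nat (eq_bigr (fun n => \sum_(p < W.+1 | prime p) \sum_(1 <= k < W.+1) ln (p%:R : R) * ((p ^ k %| n)%N%:R * F n))).
      rewrite -big_nat exchange_big; apply: eq_bigr => p _; rewrite exchange_big; apply: eq_bigr => k _ /=.
      by rewrite mulr_sumr.
    move=> n /andP[n1 nV]; rewrite (@ln_nat_prime_powers W); last by rewrite n1 ltnW // ltnW.
    rewrite mulr_sumr; apply: eq_bigr => p _; rewrite mulr_sumr; apply: eq_bigr => k _; ring.
  have B (p : 'I_W.+1) k : prime p -> \sum_(1 <= n < V.+1) (p ^ k %| n)%N%:R * F n <=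
      2 * \sum_(1 <= m < V.+1) (p ^ k * m <= V)%N%:R * F m.
    move=> pp; have d0 : (0 < p ^ k)%N by rewrite expn_gt0 prime_gt0.
    rewrite mulr_sumr.
    apply: (@le_trans _ _ (\sum_(1 <= n < V.+1) \sum_(1 <= m < V.+1) (n == p ^ k * m)%N%:R * (2 * ((p ^ k * m <= V)%N%:R * F m)))).
      rewrite big_nat [leRHS]big_nat; apply: ler_sum => n /andP[n1 nV].
      have T0 i : 0 <= (n == p ^ k * i)%N%:R * (2 * ((p ^ k * i <= V)%N%:R * F i)).
        by rewrite !mulr_ge0.
      have [/dvdnP[m e]|_] := boolP (p ^ k %| n)%N; last by rewrite mul0r sumr_ge0.
      have m0 : (0 < m)%N by move: n1; rewrite e muln_gt0 => /andP[].
      have mV : (m <= V)%N by apply: leq_trans (_ : n <= V)%N; rewrite // e leq_pmulr.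
      rewrite (bigD1_seq m) ?iota_uniq //=; last by rewrite mem_index_iota m0 ltnS.
      apply: ler_wpDr; first by apply: sumr_ge0.
      rewrite mulnC in e; rewrite -e eqxx (_ : (n <= V)%N) ?mul1r //.
      by rewrite e; apply: F2.
    rewrite exchange_big /=; apply: ler_sum => m _.
    rewrite -mulr_suml; rewrite -[leRHS]mul1r; apply: ler_wpM2r; first by rewrite !mulr_ge0.
    rewrite -natr_sum -[leRHS]/(1%:R) ler_nat -big_mkcond /= sum1_count.
    by rewrite -[count _ _]/(count_mem (p ^ k * m)%N (iota 1 (V.+1 - 1))) count_uniq_mem ?iota_uniq ?leq_b1.
  apply: (@le_trans _ _ (\sum_(p < W.+1 | prime p) \sum_(1 <= k < W.+1) ln (p%:R : R) *
      (2 * \sum_(1 <= m < V.+1) (p ^ k * m <= V)%N%:R * F m))).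
    apply: ler_sum => p pp; apply: ler_sum => k _; apply: ler_wpM2l => //; exact: B.
  have -> : \sum_(p < W.+1 | prime p) \sum_(1 <= k < W.+1) ln (p%:R : R) *
      (2 * \sum_(1 <= m < V.+1) (p ^ k * m <= V)%N%:R * F m) =
      \sum_(1 <= m < V.+1) 2 * F m * \sum_(p < W.+1 | prime p) \sum_(1 <= k < W.+1) (p ^ k * m <= V)%N%:R * ln (p%:R : R).
    rewrite (eq_bigr (fun p : 'I_W.+1 => \sum_(1 <= m < V.+1) \sum_(1 <= k < W.+1) 2 * F m * ((p ^ k * m <= V)%N%:R * ln (p%:R : R)))).
      rewrite exchange_big /=; apply: eq_bigr => m _; rewrite mulr_sumr; apply: eq_bigr => p _.
      by rewrite mulr_sumr.
    move=> p _; rewrite exchange_big /=; apply: eq_bigr => k _; rewrite !mulr_sumr; apply: eq_bigr => m _; ring.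
  rewrite mulr_sumr big_nat [leRHS]big_nat; apply: ler_sum => m /andP[m1 mV].
  have -> : \sum_(p < W.+1 | prime p) \sum_(1 <= k < W.+1) (p ^ k * m <= V)%N%:R * ln (p%:R : R) = psi W (V %/ m).
    by apply: eq_bigr => p _; apply: eq_bigr => k _; rewrite leq_divRL.
  have mR : 0 < m%:R :> R by rewrite ltr0n.
  apply: le_trans (ler_wpM2l _ (psi_le _)) _; first by rewrite mulr_ge0.
    by rewrite ltnS leq_div.
  have : (V %/ m)%N%:R <= V%:R / m%:R :> R by rewrite ler_pdivlMr // -natrM ler_nat leq_trunc_div.
  move=> /(ler_wpM2l (mulr_ge0 (ler0n R 8) (F0 m))); set x := (V %/ m)%N%:R; lra.
have -> : (\sum_(1 <= n < V.+1) F n) * ln (V%:R : R) =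
   \sum_(1 <= n < V.+1) F n * ln (V%:R / n%:R) + \sum_(1 <= n < V.+1) F n * ln (n%:R : R).
  rewrite mulr_suml -big_split /= big_nat [RHS]big_nat; apply: eq_bigr => n /andP[n1 _].
  by rewrite ln_div ?posrE ?ltr0n // mulrBr subrK.
by apply: le_trans (lerD A1 A2) _; lra.
Qed.

End Chebyshev.

Definition smooth_nat y n := all (fun p => p < y)%N (primes n).
Definition rough_nat z n := all (fun p => z <= p)%N (primes n).
Definition avoids y z n := all (fun p => ~~ (y <= p < z)%N) (primes n).
(** The part of [2 ^ omega n] due to the primes from [w] on: the loss that remains once smaller
    primes are moved into [b1]. *)
Definition rough_pow w n : nat := (2 ^ count (fun p => w <= p)%N (primes n))%N.
Definition recip_sum (R : realType) (A : pred nat) V : R := \sum_(1 <= d < V.+1 | A d) d%:R^-1.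

Section Arithmetic.

Lemma omega_pmul p k m : prime p -> (0 < k)%N -> (0 < m)%N -> ~~ (p %| m)%N ->
  perm_eq (primes (p ^ k * m)) (p :: primes m).
Proof.
move=> pp k0 m0 pm; apply: uniq_perm; rewrite /= ?primes_uniq //.
  by rewrite mem_primes pp m0 pm.
have pk0 : (0 < p ^ k)%N by rewrite expn_gt0 prime_gt0.
by move=> x; rewrite primesM // primesX // primes_prime // !inE.
Qed.

Lemma two_pow_omega_le n : (0 < n)%N -> (2 ^ omega n <= size (divisors n))%N.
Proof.
elim/ltn_ind: n => n IH n0.
have [n1|n1] := leqP n 1.
  have -> : n = 1%N by lia.
  by [].
pose p := pdiv n; have pp : prime p by apply: pdiv_prime.
have pn : (p %| n)%N by apply: pdiv_dvd.
have [k k0 [m]] : exists2 k, (0 < k)%N & exists2 m, (n = p ^ k * m)%N & ~~ (p %| m)%N.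
  exists (logn p n); first by rewrite logn_gt0 mem_primes pp n0.
  exists (n %/ p ^ logn p n)%N; first by rewrite mulnC divnK // pfactor_dvdnn.
  by have [m cm e] := pfactor_coprime pp n0; rewrite {1}e mulnK ?expn_gt0 ?prime_gt0 // -prime_coprime.
move=> en pm; have m0 : (0 < m)%N by move: n0; rewrite en muln_gt0 => /andP[].
have pk : (1 < p ^ k)%N by rewrite -(exp1n k) ltn_exp2r // prime_gt1.
have mn : (m < n)%N by rewrite en ltn_Pmull.
rewrite /omega en (perm_size (omega_pmul pp k0 m0 pm)) /= expnS.
apply: leq_trans (leq_mul (leqnn 2) (IH m mn m0)) _.
rewrite mul2n -addnn -{2}(size_map (muln (p ^ k)) (divisors m)) -size_cat.
apply: uniq_leq_size.
  rewrite cat_uniq divisors_uniq map_inj_in_uniq ?divisors_uniq ?andbT; last first.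
    by move=> x y _ _ /eqP; rewrite eqn_pmul2l ?expn_gt0 ?prime_gt0 // => /eqP.
  apply/seq.hasPn => x /mapP[y _ ->]; rewrite -dvdn_divisors //.
  apply: contra pm; apply: dvdn_trans; rewrite dvdn_mulr //; exact: dvdn_exp.
move=> x; rewrite mem_cat -dvdn_divisors // -dvdn_divisors; last by rewrite muln_gt0 expn_gt0 prime_gt0.
move=> /orP[xm|/mapP[y ym ->]]; first by rewrite dvdn_mull.
by rewrite dvdn_mul // dvdn_divisors.
Qed.

Lemma size_divisors_mul d m : (0 < d)%N -> (0 < m)%N ->
  (size (divisors (d * m)) <= size (divisors d) * size (divisors m))%N.
Proof.
move=> d0 m0; rewrite -(size_allpairs pair).
pose f e := (gcdn e d, e %/ gcdn e d)%N.
have dm0 : (0 < d * m)%N by rewrite muln_gt0 d0.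
rewrite -(size_map f (divisors (d * m))); apply: uniq_leq_size.
  rewrite map_inj_in_uniq ?divisors_uniq // => x y _ _ [] e1 e2.
  by rewrite -[LHS](divnK (dvdn_gcdl x d)) e2 e1 divnK // dvdn_gcdl.
move=> z /mapP[e]; rewrite -dvdn_divisors // => ed ->.
apply/allpairsP; exists (f e); split => //=; rewrite -dvdn_divisors ?dvdn_gcdr //.
set g := gcdn e d.
have g0 : (0 < g)%N by rewrite gcdn_gt0 d0 orbT.
rewrite -(dvdn_pmul2r g0) divnK ?dvdn_gcdl //.
by rewrite /g muln_gcdr dvdn_gcd dvdn_mull // mulnC.
Qed.

Lemma rough_pow_mul w p k m : prime p -> (0 < m)%N -> (rough_pow w (p ^ k * m) <= 2 * rough_pow w m)%N.
Proof.
move=> pp m0; rewrite /rough_pow -expnS leq_exp2l //.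
rewrite -!size_filter -[X in (_ <= X)%N]/(size (p :: [seq i <- primes m | (w <= i)%N])).
apply: uniq_leq_size; first by rewrite filter_uniq // primes_uniq.
move=> x; rewrite mem_filter inE => /andP[wx]; have [->|k0] := posnP k.
  by rewrite mul1n mem_filter wx => ->; rewrite orbT.
have pk0 : (0 < p ^ k)%N by rewrite expn_gt0 prime_gt0.
by rewrite primesM // primesX // primes_prime // inE mem_filter wx.
Qed.

Lemma rough_pow_le w n : (0 < n)%N ->
  (rough_pow w n <= count (fun d => rough_nat w d) (divisors n))%N.
Proof.
move=> n0; pose pi : nat_pred := [pred p | w <= p]%N.
have -> : rough_pow w n = (2 ^ omega n`_pi)%N.
  by rewrite /rough_pow /omega primes_part size_filter.
apply: leq_trans (two_pow_omega_le (part_gt0 pi n)) _.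
rewrite -size_filter; apply: uniq_leq_size; first exact: divisors_uniq.
move=> d; rewrite -dvdn_divisors ?part_gt0 // => dp; rewrite mem_filter -dvdn_divisors //.
rewrite (dvdn_trans dp (dvdn_part pi n)) andbT.
have d0 : (0 < d)%N by apply: dvdn_gt0 dp; exact: part_gt0.
apply/seq.allP => p; rewrite mem_primes => /and3P[pp _ pd].
have : p \in primes n`_pi by rewrite mem_primes pp part_gt0 (dvdn_trans pd dp).
by rewrite primes_part mem_filter => /andP[].
Qed.

Lemma all_primes_dvd (A : pred nat) d n : (0 < n)%N -> (d %| n)%N -> all A (primes n) -> all A (primes d).
Proof.
move=> n0 dn /seq.allP H; apply/seq.allP => p; rewrite mem_primes => /and3P[pp d0 pd].
by apply: H; rewrite mem_primes pp n0 (dvdn_trans pd dn).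
Qed.

End Arithmetic.

(** * Reciprocal sums over smooth and rough numbers *)

Section ReciprocalSums.
Variable R : realType.

Lemma recip_sum_ge0 A V : 0 <= recip_sum R A V.
Proof. by apply: sumr_ge0 => d _; rewrite invr_ge0. Qed.

Lemma recip_sum_mul_le (A B : pred nat) V W :
  (forall d k d' k', A d -> B k -> A d' -> B k' -> (0 < d)%N -> (0 < k)%N -> (d * k = d' * k')%N -> d = d') ->
  recip_sum R A V * recip_sum R B W <= harm R (V * W).
Proof.
move=> uq; rewrite /recip_sum mulr_suml.
apply: (@le_trans _ _ (\sum_(1 <= d < V.+1 | A d) \sum_(1 <= k < W.+1 | B k)
   \sum_(1 <= n < (V * W).+1) (n == d * k)%N%:R / n%:R)).
  rewrite big_nat_cond [leRHS]big_nat_cond; apply: ler_sum => d /andP[/andP[d1 dV] _].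
  rewrite mulr_sumr big_nat_cond [leRHS]big_nat_cond; apply: ler_sum => k /andP[/andP[k1 kW] _].
  rewrite (bigD1_seq (d * k)%N) ?iota_uniq //=; last first.
    by rewrite mem_index_iota muln_gt0 d1 k1 ltnS leq_mul.
  rewrite eqxx natrM invfM mul1r; apply: ler_wpDr => //.
  by apply: sumr_ge0 => n _; rewrite divr_ge0.
have -> : \sum_(1 <= d < V.+1 | A d) \sum_(1 <= k < W.+1 | B k)
   \sum_(1 <= n < (V * W).+1) (n == d * k)%N%:R / n%:R =
   \sum_(1 <= n < (V * W).+1) (\sum_(1 <= d < V.+1 | A d) \sum_(1 <= k < W.+1 | B k) (n == d * k))%N%:R / n%:R :> R.
  under eq_bigr do rewrite exchange_big /=.
  rewrite exchange_big /=; apply: eq_bigr => n _.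
  rewrite natr_sum mulr_suml; apply: eq_bigr => d _; rewrite natr_sum mulr_suml; exact: eq_bigr.
rewrite /harm big_nat [leRHS]big_nat; apply: ler_sum => n /andP[n1 _].
rewrite -[leRHS]mul1r; apply: ler_wpM2r; first by rewrite invr_ge0.
rewrite -[leRHS]/(1%:R) ler_nat.
pose Q d := [&& A d, d %| n & B (n %/ d)]%N.
apply: (@leq_trans (count Q (index_iota 1 V.+1))).
  rewrite -sum1_count big_nat_cond [leqRHS]big_nat_cond big_mkcondr [leqRHS]big_mkcondr.
  apply: leq_sum => d /andP[d1 _]; rewrite /Q; case: (A d) => //=.
  have k0 k : (n == d * k)%N = (d %| n)%N && (k == n %/ d)%N.
    apply/eqP/andP => [->|[/dvdnP[j ej] /eqP ->]]; first by rewrite dvdn_mulr // mulKn.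
    by rewrite ej mulnK // mulnC.
  rewrite (eq_bigr (fun k => (d %| n)%N && (k == n %/ d)%N : nat)); last by move=> k _; rewrite k0.
  case: (d %| n)%N => /=; last by rewrite big1.
  rewrite -big_mkcondr /= big_mkcond /=.
  apply: (@leq_trans (\sum_(1 <= k < W.+1) (if (k == n %/ d)%N then (B (n %/ d) : nat) else 0%N))).
    by apply: leq_sum => k _; case: eqP => [->|]; rewrite ?andbT ?andbF //; case: (B _).
  rewrite -big_mkcond /=; case: (B _) => /=; last by rewrite big1.
  rewrite sum1_count -[count _ _]/(count_mem (n %/ d)%N (iota 1 (W.+1 - 1))).
  by rewrite count_uniq_mem ?iota_uniq ?leq_b1.
rewrite -size_filter; case e : (seq.filter Q _) => [//|d0 s].
rewrite -e -[X in (_ <= X)%N]/(size [:: d0]); apply: uniq_leq_size; first by rewrite filter_uniq ?iota_uniq.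
have : d0 \in seq.filter Q (index_iota 1 V.+1) by rewrite e mem_head.
rewrite mem_filter mem_index_iota => /andP[/and3P[A0 dn0 B0] /andP[d01 _]].
move=> d; rewrite mem_filter mem_index_iota inE => /andP[/and3P[Ad dn Bd] /andP[d1 _]].
apply/eqP; apply: (uq d (n %/ d)%N d0 (n %/ d0)%N) => //; first by rewrite divn_gt0 // dvdn_leq.
by rewrite ![(_ * (n %/ _))%N]mulnC !divnK.
Qed.

Lemma recip_sum_le_mul (A B : pred nat) V (c : nat -> nat) :
  (forall n, (0 < n <= V)%N -> (c n <= count (fun d => A d && B (n %/ d)%N) (divisors n))%N) ->
  \sum_(1 <= n < V.+1) (c n)%:R / n%:R <= recip_sum R A V * recip_sum R B V.
Proof.
move=> cP; rewrite /recip_sum mulr_suml.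
apply: (@le_trans _ _ (\sum_(1 <= n < V.+1) \sum_(1 <= d < V.+1 | A d) \sum_(1 <= k < V.+1 | B k)
    (n == d * k)%N%:R / (d%:R * k%:R))).
  rewrite big_nat [leRHS]big_nat; apply: ler_sum => n nV; have /andP[n1 nV'] := nV.
  rewrite ler_pdivrMr ?ltr0n // mulr_suml.
  rewrite (eq_bigr (fun d => (\sum_(1 <= k < V.+1 | B k) (n == d * k))%N%:R)); last first.
    move=> d _; rewrite natr_sum mulr_suml; apply: eq_bigr => k _.
    have [e|_] := eqVneq n (d * k)%N; last by rewrite !mul0r.
    by rewrite e natrM mulfVK // -natrM pnatr_eq0 -lt0n -e.
  rewrite -natr_sum ler_nat; apply: leq_trans (cP n nV) _.
  rewrite -sum1_count big_mkcond /=.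
  apply: (@leq_trans (\sum_(1 <= d < V.+1) (d %| n) * (A d && B (n %/ d)%N))%N).
    rewrite -[leqLHS]big_mkcond /= sum1_count -size_filter.
    have -> : (\sum_(1 <= d < V.+1) (d %| n) * (A d && B (n %/ d)%N))%N =
       size [seq d <- index_iota 1 V.+1 | (d %| n)%N && (A d && B (n %/ d)%N)].
      rewrite size_filter -sum1_count [RHS]big_mkcond; apply: eq_bigr => d _; by case: (d %| n)%N; case: (A d && _).
    apply: uniq_leq_size; first by rewrite filter_uniq ?divisors_uniq.
    move=> d; rewrite !mem_filter -dvdn_divisors // mem_index_iota => /andP[-> dn].
    by rewrite dn (dvdn_gt0 n1 dn) /= ltnS (leq_trans (dvdn_leq n1 dn)).
  rewrite [leqRHS]big_mkcond big_nat [leqRHS]big_nat; apply: leq_sum => d /andP[d1 dV].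
  case: (A d) => /=; last by rewrite muln0.
  have [dn|] := boolP (d %| n)%N => //; case Bn : (B _) => //; rewrite muln1.
  have k0 : (0 < n %/ d)%N by rewrite divn_gt0 // dvdn_leq.
  rewrite big_mkcond (bigD1_seq (n %/ d)%N) ?iota_uniq //=.
    by rewrite Bn mulnC divnK // eqxx.
  by rewrite mem_index_iota k0 ltnS (leq_trans (leq_div n d)).
rewrite exchange_big /=; apply: ler_sum => d _.
rewrite exchange_big mulr_sumr /=; apply: ler_sum => k _.
rewrite -mulr_suml invfM -[leRHS]mul1r; apply: ler_wpM2r; first by rewrite mulr_ge0 // invr_ge0.
rewrite -natr_sum -[leRHS]/(1%:R) ler_nat -big_mkcond /= sum1_count.
by rewrite -[count _ _]/(count_mem (d * k)%N (iota 1 (V.+1 - 1))) count_uniq_mem ?iota_uniq ?leq_b1.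
Qed.

(** The product of a [z]-rough integer and an integer below [z] determines both factors, the first
    being its rough part. Hence the rough sum is at most a quotient of harmonic sums, an elementary
    substitute for an upper bound sieve. *)
Lemma rough_recip_le z V : recip_sum R (rough_nat z) V * harm R z.-1 <= harm R (V * z.-1).
Proof.
have [->|z0] := posnP z.
  by rewrite /= muln0 /harm big_geq // mulr0.
have -> : harm R z.-1 = recip_sum R (fun k => k < z)%N z.-1.
  rewrite /harm /recip_sum big_nat [RHS]big_nat_cond; apply: eq_bigl => k.
  by rewrite prednK // -andbA andbb.
apply: recip_sum_mul_le => d k d' k' Ad Bk Ad' Bk' d0 k0 e.
have dk0 : (0 < d * k)%N by rewrite muln_gt0 d0.
have k'0 : (0 < k')%N by move: dk0; rewrite e muln_gt0 => /andP[].
have d'0 : (0 < d')%N by move: dk0; rewrite e muln_gt0 => /andP[].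
pose pi : nat_pred := [pred p | z <= p]%N.
have H x y : rough_nat z x -> (0 < y < z)%N -> (0 < x)%N -> ((x * y)`_pi = x)%N.
  move=> rx /andP[y0 yz] x0; rewrite partnM //.
  have -> : (y`_pi = 1)%N.
    apply/eqP; rewrite partn_eq1 //; apply/pnatP => // p pp py; rewrite !inE -ltnNge.
    by apply: leq_ltn_trans (dvdn_leq y0 py) yz.
  rewrite muln1 part_pnat_id //; apply/pnatP => // p pp px; rewrite inE.
  by have /seq.allP := rx; apply; rewrite mem_primes pp x0.
by rewrite -(H d k) ?k0 // -(H d' k') ?k'0 // e.
Qed.

Lemma avoids_recip_le y z V : recip_sum R (avoids y z) V <=
  recip_sum R (smooth_nat y) V * recip_sum R (rough_nat z) V.
Proof.
have -> : recip_sum R (avoids y z) V = \sum_(1 <= n < V.+1) (avoids y z n : nat)%:R / n%:R.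
  by rewrite /recip_sum big_mkcond; apply: eq_bigr => n _; case: (avoids _ _ _); rewrite ?mul1r ?mul0r.
apply: recip_sum_le_mul => n /andP[n0 _].
case: (boolP (avoids y z n)) => // av; rewrite -has_count; apply/seq.hasP.
pose pi : nat_pred := [pred p | p < y]%N.
exists (n`_pi)%N; first by rewrite -dvdn_divisors // dvdn_part.
have e : (n %/ n`_pi = n`_pi^')%N by rewrite -{1}(partnC pi n0) mulKn // part_gt0.
rewrite e; apply/andP; split; apply/seq.allP => p; rewrite primes_part mem_filter => /andP[ppi pn] //.
have /seq.allP/(_ _ pn) := av; move: ppi; rewrite !inE -leqNgt => ->.
by rewrite /= -leqNgt.
Qed.

Lemma rough_pow_recip_le w (B : pred nat) V :
  (forall d n, (0 < n)%N -> (d %| n)%N -> B n -> B (n %/ d)%N) ->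
  \sum_(1 <= n < V.+1) (rough_pow w n * B n)%N%:R / n%:R <=
  recip_sum R (rough_nat w) V * recip_sum R B V.
Proof.
move=> BP; apply: recip_sum_le_mul => n /andP[n0 _].
case Bn : (B n); last by rewrite muln0.
rewrite muln1; apply: leq_trans (rough_pow_le w n0) _.
rewrite -!size_filter; apply: uniq_leq_size; first by rewrite filter_uniq ?divisors_uniq.
move=> d; rewrite !mem_filter -dvdn_divisors // => /andP[-> dn].
by rewrite dn (BP d n).
Qed.

Lemma smooth_step n V : recip_sum R (smooth_nat n.+1) V <=
  (if prime n then n%:R / (n%:R - 1) else 1) * recip_sum R (smooth_nat n) V.
Proof.
have sub m : (0 < m)%N -> smooth_nat n.+1 m -> ~~ (prime n && (n %| m)%N) -> smooth_nat n m.
  move=> m0 /seq.allP H nn; apply/seq.allP => p pm; have := H _ pm; rewrite ltnS leq_eqVlt => /orP[/eqP e|//].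
  by move: pm nn; rewrite mem_primes m0 e => /andP[-> ->].
case: ifP => pn; last first.
  rewrite mul1r /recip_sum big_nat_cond [leRHS]big_nat_cond big_mkcondr [leRHS]big_mkcondr.
  apply: ler_sum => m /andP[m1 _]; case: ifP => sm; last by case: ifP => // _; rewrite invr_ge0.
  by rewrite (sub m) // pn.
have n1 := prime_gt1 pn.
have nR : 1 < n%:R :> R by rewrite ltr1n.
set S1 := recip_sum R (smooth_nat n.+1) V; set S0 := recip_sum R (smooth_nat n) V.
suff H : S1 <= S0 + n%:R^-1 * S1.
  rewrite mulrAC ler_pdivlMr ?subr_gt0 //.
  have : n%:R * S1 <= n%:R * (S0 + n%:R^-1 * S1) by rewrite ler_wpM2l.
  by rewrite [leRHS]mulrDr mulVKf ?gt_eqF // ?(lt_trans ltr01) //; lra.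
have e : S1 = \sum_(1 <= m < V.+1 | smooth_nat n.+1 m && ~~ (n %| m)%N) m%:R^-1 +
   \sum_(1 <= m < V.+1 | smooth_nat n.+1 m && (n %| m)%N) m%:R^-1.
  by rewrite /S1 /recip_sum (bigID (fun m => n %| m)%N) /= addrC.
rewrite [leLHS]e.
apply: lerD.
  rewrite /S0 /recip_sum big_nat_cond [leRHS]big_nat_cond big_mkcondr [leRHS]big_mkcondr.
  apply: ler_sum => m /andP[m1 _]; case: ifP => [/andP[sm nm]|_]; last by case: ifP => // _; rewrite invr_ge0.
  by rewrite (sub m) // pn.
rewrite /S1 /recip_sum mulr_sumr.
apply: (@le_trans _ _ (\sum_(1 <= m < V.+1) \sum_(1 <= k < V.+1 | smooth_nat n.+1 k) (m == n * k)%N%:R / (n%:R * k%:R))).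
  rewrite big_nat_cond [leRHS]big_nat big_mkcondr; apply: ler_sum => m /andP[m1 mV].
  have t0 k : 0 <= (m == n * k)%N%:R / (n%:R * k%:R) :> R by rewrite divr_ge0 // mulr_ge0.
  case: ifP => [/andP[sm /dvdnP[k ek]]|_]; last by rewrite sumr_ge0.
  have k0 : (0 < k)%N by move: m1; rewrite ek muln_gt0 => /andP[].
  have sk : smooth_nat n.+1 k by apply: all_primes_dvd sm => //; rewrite ek dvdn_mulr.
  rewrite big_mkcond (bigD1_seq k) ?iota_uniq //=; last first.
    rewrite mem_index_iota k0 (leq_ltn_trans _ mV) // ek leq_pmulr //; exact: ltnW.
  rewrite mulnC in ek; rewrite sk -ek eqxx mul1r -natrM -ek.
  by apply: ler_wpDr => //; apply: sumr_ge0 => j _; case: ifP.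
rewrite exchange_big /=; apply: ler_sum => k _.
rewrite -mulr_suml invfM -[leRHS]mul1r; apply: ler_wpM2r; first by rewrite mulr_ge0 // invr_ge0.
rewrite -natr_sum -[leRHS]/(1%:R) ler_nat -big_mkcond /= sum1_count.
by rewrite -[count _ _]/(count_mem (n * k)%N (iota 1 (V.+1 - 1))) count_uniq_mem ?iota_uniq ?leq_b1.
Qed.

End ReciprocalSums.

Section HarmonicBounds.
Variable R : realType.

Let dyadic_step k : harm R (2 ^ k.+1).-1 = harm R (2 ^ k).-1 + \sum_(2 ^ k <= n < 2 ^ k.+1) n%:R^-1.
Proof.
have p k' : (0 < 2 ^ k')%N by rewrite expn_gt0.
rewrite /harm !prednK // (@big_cat_nat _ _ _ (2 ^ k)) //=; by rewrite leq_exp2l.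
Qed.

Let size_dyadic k : (2 ^ k.+1 - 2 ^ k = 2 ^ k)%N. Proof. by rewrite expnS mul2n -addnn addnK. Qed.

Lemma harm_pow2_ge k : k%:R / 2 <= harm R (2 ^ k).-1.
Proof.
elim: k => [|k IHk]; first by rewrite mul0r harm_ge0.
rewrite dyadic_step -natr1 mulrDl; apply: lerD => //.
apply: (@le_trans _ _ (\sum_(2 ^ k <= n < 2 ^ k.+1) (2 ^ k.+1)%N%:R^-1)).
  rewrite sumr_const_nat size_dyadic -[leRHS]mulr_natl expnS natrM invfM mulrCA mulfV ?mulr1 ?mul1r //.
  by rewrite pnatr_eq0 -lt0n expn_gt0.
rewrite big_nat [leRHS]big_nat; apply: ler_sum => n /andP[n1 n2].
have n0 : (0 < n)%N by apply: leq_trans n1; rewrite expn_gt0.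
by rewrite lef_pV2 ?posrE ?ltr0n ?expn_gt0 // ler_nat ltnW.
Qed.

Lemma harm_pow2_le k : harm R (2 ^ k).-1 <= k%:R.
Proof.
elim: k => [|k IHk]; first by rewrite /harm big_geq.
rewrite dyadic_step -natr1; apply: lerD => //.
apply: (@le_trans _ _ (\sum_(2 ^ k <= n < 2 ^ k.+1) (2 ^ k)%N%:R^-1)); last first.
  rewrite sumr_const_nat size_dyadic -[leLHS]mulr_natl mulfV //.
  by rewrite pnatr_eq0 -lt0n expn_gt0.
rewrite big_nat [leRHS]big_nat; apply: ler_sum => n /andP[n1 n2].
have n0 : (0 < n)%N by apply: leq_trans n1; rewrite expn_gt0.
by rewrite lef_pV2 ?posrE ?ltr0n ?expn_gt0 // ler_nat.
Qed.

Lemma harm_lt_pow2 n k : (n < 2 ^ k)%N -> harm R n <= k%:R.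
Proof.
move=> nk; apply: le_trans (harm_pow2_le k); apply: harm_le.
by rewrite -ltnS prednK // expn_gt0.
Qed.

Lemma ln2_ge : 1 / 2 <= ln (2 : R).
Proof.
rewrite -ler_expR lnK ?posrE //.
have h : 1 - 1 / 2 <= expR (- (1 / 2)) :> R by apply: expR_ge1Dx.
rewrite -[X in expR X]opprK expRN invf_ple ?posrE ?expR_gt0 //; lra.
Qed.

(** This form makes the dyadic Euler factors telescope. *)
Let expR_inv_le i : (0 < i)%N -> expR (32 / i%:R) <= ((i.+1)%:R / i%:R) ^+ 64 :> R.
Proof.
move=> i0; have iR : 1 <= i%:R :> R by rewrite ler1n.
have -> : 32 / i%:R = 64%:R * (1 / (2 * i%:R)) :> R by field; rewrite gt_eqF // (lt_le_trans ltr01).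
rewrite expRM_natl lerXn2r ?nnegrE ?expR_ge0 ?divr_ge0 //.
set x : R := 1 / (2 * i%:R).
have x0 : 0 <= x by rewrite divr_ge0 // mulr_ge0.
have x1 : x <= 1 / 2 by rewrite /x ler_pdivrMr ?mulr_gt0 // ?(lt_le_trans ltr01) //; lra.
have h : 1 - x <= expR (- x) by apply: expR_ge1Dx.
have -> : (i.+1)%:R / i%:R = 1 + 2 * x :> R.
  by rewrite /x -natr1; field; rewrite gt_eqF // (lt_le_trans ltr01).
rewrite -[X in expR X]opprK expRN invf_ple ?posrE ?expR_gt0 //; last by lra.
apply: le_trans h; rewrite -[leLHS]div1r ler_pdivrMr; last by lra.
nra.
Qed.

Let primes_dyadic i : (0 < i)%N ->
  (\sum_(2 ^ i <= n < 2 ^ i.+1) prime n)%N%:R * (2 / (2 ^ i)%N%:R) <= 32 / i%:R :> R.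
Proof.
move=> i0; have iR : 0 < i%:R :> R by rewrite ltr0n.
have pR : 0 < (2 ^ i)%N%:R :> R by rewrite ltr0n expn_gt0.
set x := (2 ^ i.+1).-1; set V := (2 ^ i.+1)%N.
have xV : (x < V)%N by rewrite /x prednK // expn_gt0.
have ps := @psi_le R V x xV.
have H : (\sum_(2 ^ i <= n < 2 ^ i.+1) prime n)%N%:R * (i%:R * ln 2) <= psi R V x.
  apply: (@le_trans _ _ (\sum_(2 ^ i <= n < 2 ^ i.+1 | prime n) ln (n%:R : R))).
    rewrite natr_sum mulr_suml [leRHS]big_mkcond [leLHS]big_nat [leRHS]big_nat; apply: ler_sum => n /andP[n1 _].
    case: ifP => _; last by rewrite mul0r.
    rewrite mul1r mulr_natl -lnXn // ler_ln ?posrE ?exprn_gt0 ?ltr0n //.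
      by rewrite -natrX ler_nat.
    by apply: leq_trans n1; rewrite expn_gt0.
  have V0 : (0 < V)%N by rewrite expn_gt0.
  apply: (@le_trans _ _ (\sum_(0 <= p < V.+1 | prime p) (p <= x)%N%:R * ln (p%:R : R))).
    rewrite [leRHS](@big_cat_nat _ _ _ (2 ^ i)) //=; last by rewrite ltnW // ltnS leq_exp2l.
    rewrite [X in _ <= _ + X](@big_cat_nat _ _ _ V) //=; last by rewrite leq_exp2l.
    rewrite -[leLHS]add0r; apply: lerD.
      by apply: sumr_ge0 => p pp; rewrite mulr_ge0 // ln_ge0 // ler1n prime_gt0.
    apply: ler_wpDr; first by apply: sumr_ge0 => p pp; rewrite mulr_ge0 // ln_ge0 // ler1n prime_gt0.
    rewrite big_nat_cond [leRHS]big_nat_cond; apply: ler_sum => p /andP[/andP[_ pV] _].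
    by rewrite (_ : (p <= x)%N) ?mul1r // -ltnS /x prednK.
  rewrite big_mkord /psi; apply: ler_sum => p pp.
  rewrite big_ltn // expn1; apply: ler_wpDr => //.
  by apply: sumr_ge0 => k _; rewrite mulr_ge0 // ln_ge0 // ler1n prime_gt0.
have l2 := ln2_ge.
set P := (\sum_(_ <= n < _) _)%N%:R in H *.
have P0 : 0 <= P :> R by [].
rewrite mulrA ler_pdivrMr // [leRHS]mulrAC ler_pdivlMr //.
have e : x%:R <= 2 * (2 ^ i)%N%:R :> R by rewrite -natrM -expnS ler_nat ltnW.
have : P * (i%:R * ln 2) <= 8 * (2 ^ i)%N%:R by move: H ps e; set y := psi _ _ _; lra.
have : P * i%:R * (1 / 2) <= P * i%:R * ln 2 by apply: ler_wpM2l => //; rewrite mulr_ge0.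
rewrite mulrA; move: (P * i%:R * ln 2) => y; lra.
Qed.

(** By Chebyshev's bound the primes in [[2 ^ i, 2 ^ (i + 1))] contribute at most [exp (32 / i)],
    hence at most [((i + 1) / i) ^ 64], to the Euler product. The exponent [64] is crude, but the
    later [i] is only of order [log log N]. *)
Lemma smooth_recip_le i V : (0 < i)%N -> recip_sum R (smooth_nat (2 ^ i)) V <= i%:R ^+ 64.
Proof.
have step a j : (1 < a)%N -> recip_sum R (smooth_nat (a + j)) V <=
   recip_sum R (smooth_nat a) V * expR ((\sum_(a <= n < a + j) prime n)%N%:R * (2 / a%:R)).
  move=> a1; elim: j => [|j IHj].
    by rewrite addn0 big_geq // mul0r expR0 mulr1.
  rewrite addnS; apply: le_trans (smooth_step _ _ _) _.
  rewrite [X in expR (X%:R * _)]big_nat_recr ?leq_addr //= [X in expR (X * _)]natrD [X in expR X]mulrDl expRD [leRHS]mulrA [leRHS]mulrC.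
  apply: ler_pM; [ | exact: recip_sum_ge0 | | exact: IHj].
    by case: ifP => // pn; rewrite divr_ge0 // subr_ge0 ler1n prime_gt0.
  case: ifP => pn; last by rewrite mul0r expR0.
  rewrite mul1r; apply: le_trans (expR_ge1Dx _).
  have aR : 2 <= a%:R :> R by rewrite ler_nat.
  have nR : a%:R <= (a + j)%N%:R :> R by rewrite ler_nat leq_addr.
  rewrite ler_pdivrMr; last by lra.
  set n := (a + j)%N%:R in nR *.
  have : 2 / a%:R * a%:R = 2 :> R by rewrite mulfVK // gt_eqF //; lra.
  have : 0 <= 2 / a%:R :> R by rewrite divr_ge0.
  move: (2 / a%:R) => t t0 ta; nra.
case: i => // i _; elim: i => [|i IHi].
  rewrite expr1n /recip_sum; apply: (@le_trans _ _ (\sum_(1 <= d < V.+1) (d == 1)%N%:R)).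
    rewrite big_nat_cond [leRHS]big_nat big_mkcondr; apply: ler_sum => d /andP[d1 _].
    case: ifP => // sd; have [->|d2] := eqVneq d 1%N; first by rewrite invr1.
    exfalso; have d3 : (1 < d)%N by rewrite ltn_neqAle eq_sym d2.
    have /seq.allP/(_ (pdiv d)) := sd; rewrite mem_primes pdiv_prime // d1 pdiv_dvd => /(_ isT).
    by rewrite ltnNge prime_gt1 ?pdiv_prime.
  rewrite -natr_sum -[leRHS]/(1%:R) ler_nat -big_mkcond /= sum1_count.
  by rewrite -[count _ _]/(count_mem 1%N (iota 1 (V.+1 - 1))) count_uniq_mem ?iota_uniq ?leq_b1.
have p2 : (1 < 2 ^ i.+1)%N by rewrite -(expn0 2) ltn_exp2l.
have := step (2 ^ i.+1)%N (2 ^ i.+1)%N p2; rewrite addnn -mul2n -expnS => /le_trans; apply.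
have iR : 0 < i.+1%:R :> R by rewrite ltr0n.
have -> : i.+2%:R ^+ 64 = i.+1%:R ^+ 64 * (i.+2%:R / i.+1%:R) ^+ 64 :> R.
  by rewrite -exprMn mulrC mulfVK // gt_eqF.
apply: ler_pM; rewrite ?recip_sum_ge0 ?expR_ge0 //.
apply: le_trans (expR_inv_le (isT : (0 < i.+1)%N)); rewrite ler_expR.
exact: primes_dyadic.
Qed.

End HarmonicBounds.

(** * Moments of the divisor function *)

Section DivisorMoments.
Variable R : realType.

Lemma sum_multiples (V : nmodType) d N (G : nat -> V) : (0 < d)%N ->
  \sum_(1 <= n < N.+1 | (d %| n)%N) G n = \sum_(1 <= m < (N %/ d).+1) G (d * m)%N.
Proof.
move=> d0; elim: N => [|N IHN]; first by rewrite div0n !big_geq.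
rewrite big_mkcond big_nat_recr //= -big_mkcond IHN divnS //; case: ifP => dN; last by rewrite addr0 add0n.
rewrite [RHS]big_nat_recr //=; congr (_ + G _).
by rewrite -[LHS](divnK dN) mulnC divnS // dN.
Qed.

Lemma divisor_sum_swap (V : nmodType) N (G : nat -> nat -> V) :
  \sum_(1 <= n < N.+1) \sum_(d <- divisors n) G d n =
  \sum_(1 <= d < N.+1) \sum_(1 <= m < (N %/ d).+1) G d (d * m)%N.
Proof.
transitivity (\sum_(1 <= n < N.+1) \sum_(1 <= d < N.+1 | (d %| n)%N) G d n).
  rewrite big_nat [RHS]big_nat; apply: eq_bigr => n /andP[n1 nN].
  rewrite -[RHS]big_filter; apply: perm_big; apply: uniq_perm; rewrite ?divisors_uniq ?filter_uniq ?iota_uniq //.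
  move=> d; rewrite mem_filter -dvdn_divisors // mem_index_iota.
  case dn : (d %| n)%N => //=.
  by rewrite (dvdn_gt0 n1 dn) ltnS (leq_trans (dvdn_leq n1 dn)).
rewrite (exchange_big_dep xpredT) //= big_nat [RHS]big_nat; apply: eq_bigr => d /andP[d1 _].
exact: sum_multiples.
Qed.

(** Induction on [k] for both sums at once: one factor [tau n] is written as a sum over [n = d m],
    and [tau (d m) <= tau d * tau m] separates the variables. The weighted bound gets squared, while
    the plain one is multiplied by the weighted one. *)
Lemma divisor_moments k N :
  \sum_(1 <= n < N.+1) (size (divisors n) ^ k)%N%:R <= N%:R * harm R N ^+ (2 ^ k).-1 /\
  \sum_(1 <= n < N.+1) (size (divisors n) ^ k)%N%:R / n%:R <= harm R N ^+ (2 ^ k).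
Proof.
elim: k N => [|k IHk] N.
  split; first by rewrite (eq_bigr (fun=> 1)) // sumr_const_nat subn1 /= expr0 mulr1.
  rewrite expn0 expr1 /harm le_eqVlt; apply/orP; left; apply/eqP; apply: eq_bigr => n _; by rewrite mul1r.
have sub d m : (0 < d)%N -> (0 < m)%N -> (size (divisors (d * m)) ^ k)%N%:R <=
   (size (divisors d) ^ k)%N%:R * (size (divisors m) ^ k)%N%:R :> R.
  move=> d0 m0; rewrite -natrM ler_nat -expnMn.
  by case: (k) => // k'; rewrite leq_exp2r //; exact: size_divisors_mul.
have hN d : harm R (N %/ d) <= harm R N by apply: harm_le; apply: leq_div.
have h0 := harm_ge0 R N.
have swap (g : nat -> R) : (forall n, 0 <= g n) ->
  \sum_(1 <= n < N.+1) (size (divisors n) ^ k.+1)%N%:R * g n <=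
  \sum_(1 <= d < N.+1) (size (divisors d) ^ k)%N%:R *
     \sum_(1 <= m < (N %/ d).+1) (size (divisors m) ^ k)%N%:R * g (d * m)%N.
  move=> g0; rewrite (eq_bigr (fun n => \sum_(d <- divisors n) (size (divisors n) ^ k)%N%:R * g n)); last first.
    by move=> n _; rewrite big_const_seq count_predT iter_addr_0 expnS natrM -mulrA mulr_natl.
  rewrite divisor_sum_swap big_nat [leRHS]big_nat; apply: ler_sum => d /andP[d1 _].
  rewrite mulr_sumr big_nat [leRHS]big_nat; apply: ler_sum => m /andP[m1 _].
  by rewrite mulrA; apply: ler_wpM2r => //; exact: sub.
have [IH1 IH2] := IHk N.
have e1 : ((2 ^ k.+1).-1 = (2 ^ k).-1 + 2 ^ k)%N.
  by rewrite expnS mul2n -addnn -!subn1 addnBAC // expn_gt0.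
split.
  have := swap (fun=> 1) (fun=> ler01); rewrite (eq_bigr (fun n => (size (divisors n) ^ k.+1)%N%:R)); last by move=> n _; rewrite mulr1.
  move/le_trans; apply.
  rewrite e1 exprD mulrA; apply: (@le_trans _ _ (\sum_(1 <= d < N.+1)
     (size (divisors d) ^ k)%N%:R / d%:R * (N%:R * harm R N ^+ (2 ^ k).-1))).
    rewrite big_nat [leRHS]big_nat; apply: ler_sum => d /andP[d1 _].
    rewrite -mulrA; apply: ler_wpM2l => //.
    rewrite (eq_bigr (fun n => (size (divisors n) ^ k)%N%:R)); last by move=> n _; rewrite mulr1.
    apply: le_trans (IHk (N %/ d)%N).1 _.
    rewrite mulrA; apply: ler_pM => //; rewrite ?exprn_ge0 ?harm_ge0 //.
      by rewrite mulrC ler_pdivlMr ?ltr0n // -natrM ler_nat leq_trunc_div.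
    by apply: lerXn2r; rewrite ?nnegrE ?harm_ge0.
  rewrite -mulr_suml mulrC; apply: ler_wpM2l => //.
  by rewrite mulr_ge0 // exprn_ge0.
apply: le_trans (swap (fun n => n%:R^-1) _) _; first by move=> n; rewrite invr_ge0.
rewrite expnS mul2n -addnn exprD.
apply: (@le_trans _ _ (\sum_(1 <= d < N.+1) (size (divisors d) ^ k)%N%:R / d%:R * harm R N ^+ (2 ^ k))).
  rewrite big_nat [leRHS]big_nat; apply: ler_sum => d /andP[d1 _].
  rewrite -mulrA; apply: ler_wpM2l => //.
  rewrite (eq_bigr (fun m => d%:R^-1 * ((size (divisors m) ^ k)%N%:R / m%:R))); last first.
    by move=> m _; rewrite natrM invfM mulrCA.
  rewrite -mulr_sumr; apply: ler_wpM2l; first by rewrite invr_ge0.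
  apply: le_trans (IHk (N %/ d)%N).2 _.
  by apply: lerXn2r; rewrite ?nnegrE ?harm_ge0.
by rewrite -mulr_suml; apply: ler_wpM2r => //; rewrite exprn_ge0.
Qed.

End DivisorMoments.

(** * Divisors of [a b ^ 2 + 1] for fixed [b] *)

Lemma sum_eqn m n k : (\sum_(m <= i < n) (i == k) = (m <= k < n))%N.
Proof.
transitivity (\sum_(m <= i < n | i == k) 1)%N; first by rewrite [RHS]big_mkcond.
rewrite sum1_count -[count _ _]/(count_mem k (index_iota m n)) count_uniq_mem ?iota_uniq //.
by rewrite mem_index_iota.
Qed.

(* [d * e = a * b ^ 2 + 1] for some [1 <= a <= N]. *)
Definition hit (N b d e : nat) : bool :=
  (1 < d * e <= N * b ^ 2 + 1)%N && (b ^ 2 %| d * e - 1)%N.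
Definition cnt (N b d : nat) : nat := (\sum_(1 <= a < N.+1) (d %| a * b ^ 2 + 1))%N.

Section Hits.
Variables (N b : nat).
Hypothesis b0 : (0 < b)%N.
Let q := (b ^ 2)%N.
Let q0 : (0 < q)%N. Proof. by rewrite expn_gt0 b0. Qed.

Lemma hitC d e : hit N b d e = hit N b e d.
Proof. by rewrite /hit mulnC. Qed.

Lemma hitE d e : hit N b d e = (\sum_(1 <= a < N.+1) (d * e == a * q + 1))%N :> nat.
Proof.
rewrite /hit -/q; case: (boolP (q %| d * e - 1)%N) => [/dvdnP[k hk]|nd]; last first.
  rewrite andbF big1 // => a _; case: eqP => // h; case/negP: nd.
  by rewrite h addnK dvdn_mull.
rewrite andbT; case: (ltnP 1 (d * e)) => h /=; last first.
  rewrite big_nat big1 // => a /andP[a1 _]; case: eqP => // h2; move: h; rewrite h2 addn1 ltnS leqn0.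
  by rewrite muln_eq0; move: a1 q0; case: (a); case: (q).
have hd : (d * e = k * q + 1)%N by rewrite -hk subnK // ltnW.
rewrite (eq_bigr (fun a => nat_of_bool (a == k))); last first.
  by move=> a _; rewrite hd eqn_add2r eqn_pmul2r // eq_sym.
rewrite sum_eqn hd leq_add2r leq_pmul2r // ltnS; move: h; rewrite hd.
by case: (k).
Qed.

Lemma sum_divisor_pairs d E W : (0 < d)%N -> (0 < W)%N -> (W < d * E.+1)%N ->
  (\sum_(1 <= e < E.+1) (d * e == W) = (d %| W))%N.
Proof.
move=> d0 W0 WE; case: (boolP (d %| W)%N) => [/dvdnP[k hk]|nd]; last first.
  by rewrite big1 // => e _; case: eqP => // h; case/negP: nd; rewrite -h dvdn_mulr.
rewrite (eq_bigr (fun e => nat_of_bool (e == k))); last first.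
  by move=> e _; rewrite hk mulnC eqn_pmul2r.
rewrite sum_eqn; move: WE W0; rewrite hk muln_gt0 mulnC ltn_pmul2l // => -> /andP[-> _].
by [].
Qed.

Lemma cntE d E : (0 < d)%N -> (N * q + 1 < d * E.+1)%N ->
  cnt N b d = (\sum_(1 <= e < E.+1) hit N b d e)%N.
Proof.
move=> d0 hE; rewrite (eq_bigr (fun e => \sum_(1 <= a < N.+1) (d * e == a * q + 1)))%N; last first.
  by move=> e _; rewrite hitE.
rewrite exchange_big /= /cnt big_nat [RHS]big_nat; apply: eq_bigr => a /andP[a1 aN].
rewrite sum_divisor_pairs ?addn1 //; apply: leq_ltn_trans hE; rewrite addn1 ltnS leq_mul2r.
by rewrite -ltnS aN orbT.
Qed.

Lemma size_divisors_sum n V : (0 < n < V)%N -> size (divisors n) = (\sum_(1 <= d < V) (d %| n))%N.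
Proof.
move=> /andP[n0 nV]; transitivity (\sum_(1 <= d < V | d %| n) 1)%N; last by rewrite big_mkcond.
rewrite sum1_count -size_filter; apply: perm_size; apply: uniq_perm.
- exact: divisors_uniq.
- by rewrite filter_uniq ?iota_uniq.
move=> d; rewrite mem_filter -dvdn_divisors // mem_index_iota.
case dn : (d %| n)%N => //=; by rewrite (dvdn_gt0 n0 dn) (leq_ltn_trans (dvdn_leq n0 dn)).
Qed.

Lemma divisor_sum_hits W : (N * q + 1 <= W)%N ->
  (\sum_(1 <= a < N.+1) size (divisors (a * q + 1)) =
   \sum_(1 <= d < W.+1) \sum_(1 <= e < W.+1) hit N b d e)%N.
Proof.
move=> hW; transitivity (\sum_(1 <= a < N.+1) \sum_(1 <= d < W.+1) (d %| a * q + 1))%N.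
  rewrite big_nat [RHS]big_nat; apply: eq_bigr => a /andP[a1 aN].
  apply: size_divisors_sum; rewrite addn1 ltnS /= -addn1; apply: leq_trans hW.
  by rewrite leq_add2r leq_mul2r -ltnS aN orbT.
rewrite exchange_big /= big_nat [RHS]big_nat; apply: eq_bigr => d /andP[d1 dW].
rewrite -/(cnt N b d) (@cntE d W) //; apply: leq_ltn_trans hW _.
by apply: leq_trans (ltnSn W) _; rewrite leq_pmull.
Qed.

(** Inclusion and exclusion for the square of pairs cut at [K] in both coordinates. Keeping both
    corners allows any cut, in particular [s b] with [s] the integer part of [sqrt N]. *)
Lemma hyperbola K W : (K <= W)%N -> (N * q + 1 <= W)%N ->
  (\sum_(1 <= a < N.+1) size (divisors (a * q + 1)) +
   \sum_(1 <= d < K.+1) \sum_(1 <= e < K.+1) hit N b d e =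
   2 * (\sum_(1 <= d < K.+1) cnt N b d) +
   \sum_(K.+1 <= d < W.+1) \sum_(K.+1 <= e < W.+1) hit N b d e)%N.
Proof.
move=> KW hW; rewrite (divisor_sum_hits hW).
have cut (F : nat -> nat) : (\sum_(1 <= d < W.+1) F d = \sum_(1 <= d < K.+1) F d + \sum_(K.+1 <= d < W.+1) F d)%N.
  by rewrite (@big_cat_nat _ _ _ K.+1).
have cutr (r : seq nat) : (\sum_(d <- r) \sum_(1 <= e < W.+1) hit N b d e =
   \sum_(d <- r) \sum_(1 <= e < K.+1) hit N b d e + \sum_(d <- r) \sum_(K.+1 <= e < W.+1) hit N b d e)%N.
  by rewrite -big_split; apply: eq_bigr => d _; apply: cut.
have -> : (\sum_(1 <= d < K.+1) cnt N b d = \sum_(1 <= d < K.+1) \sum_(1 <= e < W.+1) hit N b d e)%N.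
  rewrite big_nat [RHS]big_nat; apply: eq_bigr => d /andP[d1 dK].
  rewrite (@cntE d W) //; apply: leq_ltn_trans hW _.
  by apply: leq_trans (ltnSn W) _; rewrite leq_pmull.
rewrite cut !cutr.
have -> : (\sum_(K.+1 <= d < W.+1) \sum_(1 <= e < K.+1) hit N b d e =
  \sum_(1 <= d < K.+1) \sum_(K.+1 <= e < W.+1) hit N b d e)%N.
  by rewrite exchange_big; apply: eq_bigr => i _; apply: eq_bigr => j _; rewrite hitC.
clear; lia.
Qed.

Lemma hits_in_box b1 b2 T S d1 d2 e1 e2 : coprime b1 b2 -> (b = b1 * b2)%N ->
  (d2 <= d1 + b * T.+1)%N -> (e2 <= e1 + b * S.+1)%N ->
  (\sum_(d1 <= d < d2) \sum_(e1 <= e < e2) hit N b d e <=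
   b + 2 * S + 2 * 2 ^ omega b2 * (4 * T * S + 2 * b1 * T * size (divisors b2)))%N.
Proof.
move=> co hb hd he.
pose P := seq.filter (fun p : nat * nat => hit N b p.1 p.2)
  (allpairs pair (index_iota d1 d2) (index_iota e1 e2)).
have -> : (\sum_(d1 <= d < d2) \sum_(e1 <= e < e2) hit N b d e = size P)%N.
  rewrite size_filter -sum1_count big_mkcond big_flatten big_map /=.
  by apply: eq_bigr => d _; rewrite big_map [RHS]big_mkcond.
have b1b2 : (0 < b1)%N && (0 < b2)%N by rewrite -muln_gt0 -hb.
have /andP[b10 b20] := b1b2.
rewrite [X in (_ <= X + _ + _)%N]hb; apply: (pairs_in_box b10 b20 co).
- by apply: filter_uniq; apply: allpairs_uniq; rewrite ?iota_uniq // => -[? ?] [? ?].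
- move=> p; rewrite mem_filter => /andP[/andP[/andP[h1 _] h2] _].
  by rewrite -hb -PoszM subzn ?dvdzE // ltnW.
- move=> p p'; rewrite !mem_filter => /andP[_ /allpairsP[[ux uy] [u1 u2 ->]]] /andP[_ /allpairsP[[vx vy] [v1 v2 ->]]] /=.
  move: u1 u2 v1 v2; rewrite !mem_index_iota -hb.
  move: hd he; move: (b * T.+1)%N (b * S.+1)%N => x y; clear => /=.
  have aux (k l m i j : nat) : (l <= k + m)%N -> (k <= i < l)%N -> (k <= j < l)%N -> (`|i%:Z - j%:Z| < m)%N by lia.
  by move=> h1 h2 u1 u2 v1 v2; split; [apply: aux h1 u1 v1 | apply: aux h2 u2 v2].
Qed.

Lemma cnt_near (R : realType) d : (0 < d)%N ->
  `|(cnt N b d)%:R - N%:R / d%:R * (coprime d b)%:R| <= 1 :> R.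
Proof.
move=> d0; case: (boolP (coprime d b)) => co; last first.
  rewrite mulr0 subr0 /cnt big1 ?normr0 ?ler01 // => a _.
  case dv : (d %| _)%N => //; case/negP: co.
  rewrite /coprime -dvdn1 -(@dvdn_addr (a * b ^ 2)%N); last first.
    by rewrite dvdn_mull // -mulnn dvdn_mulr // dvdn_gcdr.
  exact: dvdn_trans (dvdn_gcdl _ _) dv.
have dR : 0 < d%:R :> R by rewrite ltr0n.
have [c hc] : exists c, forall a, (d %| a * b ^ 2 + 1)%N = (d %| a + c)%N.
  have cq : coprime d (b ^ 2) by rewrite coprimeXr.
  have [x hx] : exists x, (x * b ^ 2 = 1 %[mod d])%N.
    case: (@egcdnP (b ^ 2) d) => [|k j h2 _]; first by rewrite expn_gt0 b0.
    by exists k; rewrite h2 gcdnC (eqP cq) -modnDml modnMl add0n.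
  exists x => a; rewrite /dvdn.
  have -> : ((a * b ^ 2 + 1) %% d = ((a + x) * b ^ 2) %% d)%N by rewrite mulnDl -modnDmr -hx modnDmr.
  by rewrite -/(dvdn d _) Gauss_dvdl.
have -> : cnt N b d = ((N + c) %/ d - c %/ d)%N.
  rewrite -!(count_dvd _ d0) /cnt (eq_bigr (fun a => nat_of_bool (d %| a + c)%N)); last by move=> a _; rewrite hc.
  rewrite [in RHS](@big_cat_nat _ _ _ c.+1) //=; last by rewrite ltnS leq_addl.
  rewrite [RHS]addKn -[in RHS](add1n c) big_addn -addSn addnK.
  by apply: eq_bigr.
have h1 := divn_eq (N + c) d; have h2 := divn_eq c d.
have m1 := ltn_pmod (N + c) d0; have m2 := ltn_pmod c d0.
have le : (c %/ d <= (N + c) %/ d)%N by rewrite leq_div2r // leq_addl.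
have : (d%:R * ((N + c) %/ d - c %/ d)%N%:R - N%:R) = (c %% d)%N%:R - ((N + c) %% d)%N%:R :> R.
  rewrite natrB //.
  have : (N + c)%N%:R = ((N + c) %/ d)%N%:R * d%:R + ((N + c) %% d)%N%:R :> R by rewrite {1}h1 natrD natrM.
  have : c%:R = (c %/ d)%N%:R * d%:R + (c %% d)%N%:R :> R by rewrite {1}h2 natrD natrM.
  rewrite natrD; lra.
rewrite (_ : true%:R = 1 :> R) // mulr1.
have -> : ((N + c) %/ d - c %/ d)%N%:R - N%:R / d%:R =
  (d%:R * ((N + c) %/ d - c %/ d)%N%:R - N%:R) / d%:R :> R by field; rewrite gt_eqF.
move=> ->; rewrite normrM normfV (gtr0_norm dR) ler_pdivrMr // mul1r ler_norml.
have : (c %% d)%N%:R <= d%:R :> R by rewrite ler_nat ltnW.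
have : ((N + c) %% d)%N%:R <= d%:R :> R by rewrite ler_nat ltnW.
have : 0 <= (c %% d)%N%:R :> R by [].
have : 0 <= ((N + c) %% d)%N%:R :> R by [].
move: (c %% d)%N%:R ((N + c) %% d)%N%:R => x y *; apply/andP; split; lra.
Qed.

End Hits.

Section BoxBound.
Variables (N b b1 b2 s : nat).
Hypothesis b0 : (0 < b)%N.
Hypothesis co : coprime b1 b2.
Hypothesis hb : (b = b1 * b2)%N.
Hypothesis bN : (b <= N)%N.
Hypothesis sN : (s ^ 2 <= N < s.+1 ^ 2)%N.
Let q := (b ^ 2)%N.

(** What [hits_in_box] gives for sides with [T S <= 9 N] and [T <= 3 s]. It has the right order [N],
    up to [2 ^ omega b2], as soon as [b1] times the number of divisors of [b2] is at most [s]. *)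
Definition box_bound : nat := 
  (9 * N + 2 * 2 ^ omega b2 * (36 * N + 6 * b1 * s * size (divisors b2)))%N.

Let N0 : (0 < N)%N. Proof. exact: leq_trans bN. Qed.
Let s0 : (0 < s)%N.
Proof. by move: sN; case: (s) => // /andP[_]; rewrite exp1n ltnS leqNgt N0. Qed.
Let s_le : (s <= N)%N.
Proof. by case/andP: sN => h _; apply: leq_trans h; rewrite -mulnn leq_pmulr. Qed.
Let q0 : (0 < q)%N. Proof. by rewrite expn_gt0 b0. Qed.

Let general_box T S d1 d2 e1 e2 : (T <= s + 2)%N -> (S <= b + s + 2)%N -> (T * S <= 9 * N)%N ->
  (d2 <= d1 + b * T.+1)%N -> (e2 <= e1 + b * S.+1)%N ->
  (\sum_(d1 <= d < d2) \sum_(e1 <= e < e2) hit N b d e <= box_bound)%N.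
Proof.
move=> hT hS hTS hd he; apply: leq_trans (hits_in_box N b0 co hb hd he) _.
have S0 : (b + 2 * S <= 9 * N)%N.
  have : (1 <= s)%N := s0. clear -hS bN s_le; lia.
rewrite /box_bound leq_add // leq_mul2l; apply/orP; right; apply: leq_add.
  by rewrite -mulnA (_ : 36 = 4 * 9)%N // -mulnA leq_mul2l hTS orbT.
rewrite leq_mul2r; apply/orP; right.
rewrite (_ : 6 * b1 * s = 2 * b1 * (3 * s))%N; last by clear; lia.
rewrite leq_mul2l; apply/orP; right; clear -hT s0; lia.
Qed.

Lemma corner_low : (\sum_(1 <= d < (s * b).+1) \sum_(1 <= e < (s * b).+1) hit N b d e <= box_bound)%N.
Proof.
case/andP: sN => h1 _; apply: (@general_box s s).
- exact: leq_addr.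
- clear; lia.
- by rewrite mulnn (leq_trans h1) // leq_pmull.
- by rewrite add1n ltnS mulnC leq_mul2l leqnSn orbT.
- by rewrite add1n ltnS mulnC leq_mul2l leqnSn orbT.
Qed.

Lemma corner_high W :
  (\sum_((s * b).+1 <= d < W) \sum_((s * b).+1 <= e < W) hit N b d e <= box_bound)%N.
Proof.
(* The largest end that [general_box] admits with [T = s + 2]. With one coordinate from [D] on and
   the other above [s b], the product exceeds [(s + 1) ^ 2 b ^ 2], hence also [N b ^ 2 + 1]. *)
pose D := ((s * b).+1 + b * (s + 2).+1)%N.
have big x y : (0 < x)%N -> (0 < y)%N -> (D <= x)%N -> (s * b < y)%N -> hit N b x y = false.
  move=> x0 y0 xD yb; rewrite /hit; case: (leqP (x * y) (N * b ^ 2 + 1)) => h; rewrite ?andbF //.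
  exfalso; have h3 : (D * (s * b).+1 <= x * y)%N by apply: leq_mul.
  have := leq_trans h3 h; rewrite leqNgt => /negP; apply; rewrite /D.
  case/andP: sN => _ h2.
  apply: (@leq_ltn_trans (s.+1 ^ 2 * b ^ 2)).
    rewrite -addn1 in h2. apply: (@leq_trans ((N + 1) * b ^ 2)%N).
      by rewrite mulnDl mul1n leq_add2l.
    by rewrite leq_mul2r h2 orbT.
  rewrite -!mulnn; move: b0 s0; clear; nia.
have trim (F : nat -> nat) : (forall x, (0 < x)%N -> (D <= x)%N -> F x = 0%N) ->
   (\sum_((s * b).+1 <= d < W) F d <= \sum_((s * b).+1 <= d < D) F d)%N.
  move=> F0; case: (leqP W D) => WD.
    case: (leqP (s * b).+1 W) => h; last by rewrite big_geq // ltnW.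
    by rewrite [leqRHS](@big_cat_nat _ _ _ W) //= leq_addr.
  rewrite (@big_cat_nat _ _ _ D) ?leq_addr //=; last exact: ltnW.
  rewrite [X in (_ + X)%N]big_nat [X in (_ + X)%N]big1 ?addn0 // => x /andP[xD _]; apply: F0 => //.
  by apply: leq_trans xD; rewrite /D addSn.
apply: (@leq_trans (\sum_((s * b).+1 <= d < D) \sum_((s * b).+1 <= e < D) hit N b d e)).
  apply: leq_trans (trim _ _) _.
    move=> x x0 xD; rewrite big_nat big1 // => e /andP[e1 _]; rewrite big //.
    exact: leq_ltn_trans e1.
  rewrite [leqLHS]big_nat [leqRHS]big_nat; apply: leq_sum => d /andP[d1 _]; apply: trim => x x0 xD.
  rewrite hitC big //; exact: leq_ltn_trans d1.
apply: (@general_box (s + 2) (s + 2)) => //.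
- by rewrite -addnA leq_addl.
case/andP: sN => h1 _; apply: (@leq_trans (9 * s ^ 2)); last by rewrite leq_mul2l h1 orbT.
by rewrite -mulnn; move: s0; clear; nia.
Qed.

(** For [d > D] the cofactor is at most [E], so all hits lie in one box; its sides [D] and [E],
    measured in units of [b], have product at most [2 N]. *)
Lemma dyadic_box D D2 : (N <= D)%N -> (D <= s * b)%N -> (D2 <= 2 * D)%N ->
  (\sum_(D.+1 <= d < D2.+1) cnt N b d <= box_bound)%N.
Proof.
move=> ND Ds D2D; pose E := ((N * q + 1) %/ D.+1)%N.
have ED : (N * q + 1 < D.+1 * E.+1)%N by rewrite [X in (_ < X)%N]mulnC ltn_ceil.
have ED2 : (E * D.+1 <= N * q + 1)%N by apply: leq_trunc_div.
rewrite big_nat (eq_bigr (fun d => \sum_(1 <= e < E.+1) hit N b d e)%N); last first.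
  move=> d /andP[d1 d2]; apply: cntE => //; first exact: leq_ltn_trans d1.
  by apply: leq_trans ED _; rewrite leq_mul2r d1 orbT.
rewrite -big_nat; apply: (@general_box (D %/ b) (E %/ b)).
- by apply: leq_trans (leq_addr _ _); rewrite -(mulnK s b0) leq_div2r.
- have : (E %/ b <= b)%N.
    rewrite -ltnS ltn_divLR //; have : (E <= q)%N.
      rewrite -ltnS -(ltn_pmul2r (ltn0Sn D)); apply: leq_ltn_trans ED2 _.
      rewrite mulSn; move: ND; rewrite -(leq_pmul2r q0); lia.
    by move=> h; apply: leq_ltn_trans h _; rewrite /q -mulnn ltn_pmul2r.
  move=> h; apply: leq_trans h _; rewrite -addnA leq_addr //.
- apply: (@leq_trans (2 * N)); last by rewrite leq_mul2r orbT.
  rewrite -(leq_pmul2r q0); apply: (@leq_trans (N * q + 1)).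
    apply: leq_trans ED2; rewrite /q -mulnn.
    rewrite (_ : D %/ b * (E %/ b) * (b * b) = (E %/ b * b) * (D %/ b * b))%N; last by clear; lia.
    by apply: leq_mul; rewrite ?leq_trunc_div // (leq_trans (leq_trunc_div _ _)).
  rewrite mul2n -addnn mulnDl leq_add2l; by rewrite muln_gt0 N0.
- have := ltn_ceil D b0; move: D2D; rewrite (mulnC b); move: (_.+1 * b)%N; clear; lia.
- have := ltn_ceil E b0; rewrite (mulnC b); move: (_.+1 * b)%N; clear; lia.
Qed.

Lemma dyadic_boxes K D D2 : (N <= D)%N -> (D2 <= 2 ^ K * D)%N -> (D2 <= s * b)%N ->
  (\sum_(D.+1 <= d < D2.+1) cnt N b d <= K * box_bound)%N.
Proof.
elim: K D => [|K IHK] D ND hD hs; first by rewrite big_geq // -(mul1n D).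
case: (leqP D2 (2 * D)) => h.
  case: (leqP D2 D) => h2; first by rewrite big_geq.
  rewrite mulSn; apply: leq_trans (dyadic_box ND _ h) (leq_addr _ _).
  exact: leq_trans (ltnW h2) hs.
have D2' : (D <= 2 * D)%N by rewrite leq_pmull.
rewrite (@big_cat_nat _ _ _ (2 * D).+1) //; last by rewrite ltnW.
rewrite mulSn; apply: leq_add; first by apply: dyadic_box => //; apply: leq_trans hs; apply: leq_trans (ltnW h).
apply: IHK => //; first exact: leq_trans ND _.
by apply: leq_trans hD _; rewrite expnSr -mulnA.
Qed.

End BoxBound.

(** * Smoothing by shifted windows *)

Section Windows.
Variable F : nat -> nat.

Lemma sum_ord_shift c M : (\sum_(k < M) F (c + k) = \sum_(c <= d < c + M) F d)%N.
Proof.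
rewrite -(big_mkord xpredT (fun k => F (c + k))%N) -[in RHS](add0n c) big_addn add0n addKn.
by apply: eq_bigr => i _; rewrite addnC.
Qed.

Lemma sum_subrange x y x' y' : (x' <= x)%N -> (y <= y')%N ->
  (\sum_(x <= d < y) F d <= \sum_(x' <= d < y') F d)%N.
Proof.
move=> hx hy; case: (leqP x y) => xy; last by rewrite big_geq // ltnW.
rewrite [leqRHS](@big_cat_nat _ _ _ x) // ?(leq_trans xy) //=.
by rewrite [X in (_ <= _ + X)%N](@big_cat_nat _ _ _ y) //= addnCA leq_addr.
Qed.

(* Averages over shifted windows are smooth majorants and minorants of the
   sharp count. *)
Lemma windows_ge J M D : (J <= D.+1)%N ->
  (J * \sum_(D.+1 <= d < (D + M).+1) F d <= \sum_(p : 'I_J * 'I_(M + J)) F (D.+1 - J + p.1 + p.2))%N.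
Proof.
move=> JD; rewrite -(pair_bigA _ (fun (i : 'I_J) (k : 'I_(M + J)) => F (D.+1 - J + i + k)%N)) /=.
rewrite -[X in (X * _)%N](card_ord J) -sum_nat_const; apply: leq_sum => i _.
rewrite sum_ord_shift; apply: sum_subrange; have := ltn_ord i; lia.
Qed.

Lemma windows_le J M D : (J <= M)%N ->
  (\sum_(p : 'I_J * 'I_(M - J)) F (D.+1 + p.1 + p.2) <= J * \sum_(D.+1 <= d < (D + M).+1) F d)%N.
Proof.
move=> JM; rewrite -(pair_bigA _ (fun (i : 'I_J) (k : 'I_(M - J)) => F (D.+1 + i + k)%N)) /=.
rewrite -[X in (_ <= X * _)%N](card_ord J) -sum_nat_const; apply: leq_sum => i _.
rewrite sum_ord_shift; apply: sum_subrange; have := ltn_ord i; lia.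
Qed.

Hypothesis F1 : forall d, (F d <= 1)%N.

Let sum_le_size x y : (\sum_(x <= d < y) F d <= y - x)%N.
Proof. by rewrite -[leqRHS]muln1 -sum_nat_const_nat; apply: leq_sum => d _. Qed.

Lemma bounded_windows_le J M D : (J <= D.+1)%N ->
  (\sum_(p : 'I_J * 'I_(M + J)) F (D.+1 - J + p.1 + p.2) <=
   J * (\sum_(D.+1 <= d < (D + M).+1) F d + 2 * J))%N.
Proof.
move=> JD; rewrite -(pair_bigA _ (fun (i : 'I_J) (k : 'I_(M + J)) => F (D.+1 - J + i + k)%N)) /=.
rewrite -[X in (_ <= X * _)%N](card_ord J) -sum_nat_const; apply: leq_sum => i _.
rewrite sum_ord_shift; apply: (@leq_trans (\sum_(D.+1 - J <= d < (D + M).+1 + J) F d)).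
  by apply: sum_subrange; have := ltn_ord i; lia.
rewrite (@big_cat_nat _ _ _ D.+1) //=; [|lia|lia].
rewrite [X in (_ + X)%N](@big_cat_nat _ _ _ (D + M).+1) //=; [|lia|lia].
rewrite addnCA leq_add2l mul2n -addnn; apply: leq_add; apply: leq_trans (sum_le_size _ _) _; lia.
Qed.

Lemma bounded_windows_ge J M D : (J <= M)%N ->
  (J * \sum_(D.+1 <= d < (D + M).+1) F d <=
   \sum_(p : 'I_J * 'I_(M - J)) F (D.+1 + p.1 + p.2) + J * J)%N.
Proof.
move=> JM; rewrite -(pair_bigA _ (fun (i : 'I_J) (k : 'I_(M - J)) => F (D.+1 + i + k)%N)) /=.
have -> : (J * J = \sum_(i < J) J)%N by rewrite sum_nat_const card_ord.
rewrite -big_split -[X in (X * _ <= _)%N](card_ord J) -sum_nat_const; apply: leq_sum => i _ /=.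
have iJ := ltn_ord i.
rewrite sum_ord_shift (@big_cat_nat _ _ _ (D.+1 + i)) //=; [|lia|lia].
rewrite [X in (_ + X)%N](@big_cat_nat _ _ _ (D.+1 + i + (M - J))) //=; [|lia|lia].
rewrite addnCA leq_add2l; apply: leq_trans (leq_add (sum_le_size _ _) (sum_le_size _ _)) _; lia.
Qed.

End Windows.

Lemma div_sandwich x L : (0 < L)%N -> (L <= x)%N ->
  [/\ (x %/ L * L <= x)%N, (x <= 2 * (x %/ L * L))%N & (0 < x %/ L)%N].
Proof.
move=> L0 Lx; have y0 : (0 < x %/ L)%N by rewrite divn_gt0.
split=> //; first exact: leq_trunc_div.
apply: ltnW; apply: leq_trans (ltn_ceil x L0) _; rewrite mulSn mul2n -addnn leq_add2r.
by rewrite leq_pmull.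
Qed.

(** Translates the position [N r ^ 3 <= D <= s b / r ^ 3] of a block into the size hypotheses of
    [box_count]. The margins [r ^ 3] at the two ends yield the upper bound on [E' r ^ 2] and the
    lower bound on [E' ^ 2]. *)
Lemma box_size_conditions (N b s r L D M E K J1 J2 M' E' : nat) : (0 < b <= N)%N ->
  (s ^ 2 <= N)%N -> (N <= 4 * s ^ 2)%N -> (1 < L)%N -> (32 * L <= r)%N ->
  (N * r ^ 3 <= D)%N -> (D * r ^ 3 <= s * b)%N -> (D <= K <= 2 * D)%N ->
  (M * L <= D <= 2 * (M * L))%N -> (J1 * L <= M <= 2 * (J1 * L))%N ->
  (E * K <= N * b ^ 2 + 1 < E.+1 * K)%N -> (J2 * L <= E <= 2 * (J2 * L))%N ->
  (M <= 2 * M')%N -> (M' <= 2 * M)%N -> (E <= 2 * E')%N -> (E' <= 2 * E)%N -> (0 < E)%N ->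
  [/\ (M' * E' * L <= 8 * N * b ^ 2)%N, (N * b ^ 2 <= 32 * L ^ 2 * J1 * E')%N, (E' <= 8 * L * J2)%N,
      (E' * r ^ 2 <= b ^ 2)%N & (r ^ 3 * (b ^ 2) ^ 2 <= b * E' ^ 2)%N /\ (16 * M' * L ^ 4 <= N * b)%N].
Proof.
move=> /andP[b0 bN] s2N N4s L1 Lr ND Ds /andP[DK K2D] /andP[ML DM] /andP[JM MJ] /andP[EK KE] /andP[JE EJ] h1 h2 h3 h4 E0.
have N0 : (0 < N)%N by apply: leq_trans bN.
have L0 : (0 < L)%N by apply: ltn_trans L1.
have r0 : (0 < r)%N by apply: leq_trans Lr; rewrite muln_gt0.
have Nq0 : (0 < N * b ^ 2)%N by rewrite muln_gt0 N0 expn_gt0 b0.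
have D0 : (0 < D)%N by apply: leq_trans ND; rewrite muln_gt0 N0 expn_gt0 r0.
have ED : (E * D <= 2 * (N * b ^ 2))%N.
  apply: (@leq_trans (E * K)); first by rewrite leq_mul2l DK orbT.
  apply: leq_trans EK _; clear -Nq0; lia.
have NED : (N * b ^ 2 <= 4 * E * D)%N.
  apply: (@leq_trans (E.+1 * K)); first by apply: ltnW; apply: leq_ltn_trans KE; rewrite leq_addr.
  apply: (@leq_trans (2 * E * (2 * D))); last by (clear; lia).
  by apply: leq_mul => //; rewrite mul2n -addnn -addn1 leq_add2l.
have Er : (E * r ^ 3 <= 2 * b ^ 2)%N.
  rewrite -(leq_pmul2l N0) mulnCA [leqRHS]mulnCA; apply: leq_trans ED.
  by rewrite leq_mul2l ND orbT.
have sbr : (s * b * r ^ 3 <= 4 * E)%N.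
  have s0 : (0 < s)%N by move: N4s N0; case: (s) => //; lia.
  have sb0 : (0 < s * b)%N by rewrite muln_gt0 s0.
  rewrite -(leq_pmul2r sb0); apply: (@leq_trans (4 * E * D * r ^ 3)); last first.
    by rewrite -mulnA leq_mul2l Ds orbT.
  rewrite mulnAC leq_mul2r; apply/orP; right; apply: leq_trans NED.
  by rewrite mulnACA !mulnn leq_mul2r s2N orbT.
split.
- apply: (@leq_trans (4 * (M * L * E))).
    apply: (@leq_trans (2 * M * (2 * E) * L)); first by rewrite leq_mul2r leq_mul ?orbT.
    by clear; lia.
  apply: (@leq_trans (4 * (D * E))); first by rewrite leq_mul2l /= leq_mul2r ML orbT.
  rewrite (mulnC D) -mulnA; move: ED; clear; lia.
- apply: leq_trans NED _; apply: (@leq_trans (4 * (2 * E') * (2 * (2 * (J1 * L) * L)))).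
    apply: leq_mul; first by rewrite leq_mul2l.
    by apply: leq_trans DM _; rewrite leq_mul2l leq_mul2r MJ orbT.
  by rewrite -mulnn; clear; lia.
- apply: leq_trans h4 _; apply: (@leq_trans (2 * (2 * (J2 * L)))); first by rewrite leq_mul2l.
  clear; lia.
- have r4 : (4 <= r)%N by apply: leq_trans Lr; rewrite (leq_trans _ (leq_mul (leqnn 32) L1)).
  rewrite -(leq_pmul2r r0); apply: (@leq_trans (2 * E * r ^ 3)).
    by rewrite -mulnA -expnSr leq_mul2r h4 orbT.
  rewrite -mulnA; apply: (@leq_trans (2 * (2 * b ^ 2))); first by rewrite leq_mul2l.
  by rewrite mulnA mulnC leq_mul2l r4 orbT.
split.
- have h : (s * b * r ^ 3 <= 8 * E')%N.
    by apply: leq_trans sbr _; apply: (@leq_trans (4 * (2 * E'))); [rewrite leq_mul2l | rewrite mulnA].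
  have r64 : (256 <= r ^ 3)%N.
    apply: (@leq_trans (64 ^ 3)%N); first by [].
    by rewrite leq_exp2r //; apply: leq_trans Lr; rewrite (_ : 64 = 32 * 2)%N // leq_mul2l.
  have bb : (64 * b <= s ^ 2 * r ^ 3)%N.
    apply: (@leq_trans (s ^ 2 * 256)); last by rewrite leq_mul2l r64 orbT.
    move: bN N4s; clear; lia.
  rewrite -(leq_pmul2l (isT : 0 < 64)%N).
  have h' : ((s * b * r ^ 3) ^ 2 <= (8 * E') ^ 2)%N by rewrite leq_exp2r.
  apply: (@leq_trans (b * (8 * E') ^ 2)); last by rewrite expnMn; clear; lia.
  apply: (@leq_trans (b * (s * b * r ^ 3) ^ 2)); last by rewrite leq_mul2l h' orbT.
  rewrite (_ : 64 * (r ^ 3 * (b ^ 2) ^ 2) = b * (b ^ 2 * r ^ 3) * (64 * b))%N; last by rewrite -!mulnn; clear; lia.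
  rewrite (_ : b * (s * b * r ^ 3) ^ 2 = b * (b ^ 2 * r ^ 3) * (s ^ 2 * r ^ 3))%N; last by rewrite -!mulnn; clear; lia.
  by rewrite leq_mul2l bb orbT.
- apply: (@leq_trans (16 * (2 * M) * L ^ 4)); first by rewrite leq_mul2r leq_mul2l h2 !orbT.
  apply: (@leq_trans (D * r ^ 3)).
    rewrite expnS (_ : 16 * (2 * M) * (L * L ^ 3) = M * L * (32 * L ^ 3))%N; last by clear; lia.
    apply: leq_mul => //; apply: (@leq_trans ((32 * L) ^ 3)); last by rewrite leq_exp2r.
    by rewrite expnMn leq_mul2r orbT.
  apply: leq_trans Ds _; rewrite leq_mul2r; apply/orP; right.
  by apply: leq_trans s2N; case: (s) => // s'; rewrite -mulnn leq_pmulr.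
Qed.

(** All parameters become powers of [L]: [La = L ^ 24], then [m = L ^ 64] since [16 + 2 * 24 = 64],
    then [rho = L ^ 346] since [5 * 64 + 24 + 2 = 346]. The condition [4 rho ^ 2 <= r] is thus what
    is required of the prime factor [r]. *)
Lemma box_count_level (R : realType) (N L n r b a1 J1 M1 a2 J2 M2 : nat) :
  b = (n * r)%N -> (0 < n)%N -> prime r -> coprime n r -> (32 <= L)%N -> (4 * (L ^ 346) ^ 2 <= r)%N ->
  (b <= N)%N -> (N <= b * L ^ 6)%N -> (0 < J1)%N -> (0 < J2)%N -> (J1 <= M1)%N -> (J2 <= M2)%N ->
  (M1 * M2 * L <= 8 * N * b ^ 2)%N -> (N * b ^ 2 <= 32 * L ^ 2 * J1 * M2)%N -> (M2 <= 8 * L * J2)%N ->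
  (M2 * r ^ 2 <= b ^ 2)%N -> (r ^ 3 * (b ^ 2) ^ 2 <= b * M2 ^ 2)%N -> (16 * M1 * L ^ 4 <= N * b)%N ->
  harm R (b ^ 2) <= L%:R ^+ 2 -> (2 ^ omega b <= L ^ 10)%N ->
  `|(\sum_(p1 : 'I_J1 * 'I_M1) \sum_(p2 : 'I_J2 * 'I_M2)
      ((b ^ 2)%N%:Z %| ((a1 + p1.1 + p1.2)%N%:Z * (a2 + p2.1 + p2.2)%N%:Z - 1)%R)%Z)%N%:R -
    J2%:R * M2%:R / (b ^ 2)%N%:R * (\sum_(p : 'I_J1 * 'I_M1) coprime (a1 + p.1 + p.2) b)%N%:R| <=
  J1%:R * J2%:R * (N%:R / L%:R ^+ 2) :> R.
Proof.
move=> -> n0 pr nr L32 Lr.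
have P1 : (L ^ 23 <= L ^ 24)%N by rewrite leq_pexp2l // (leq_trans _ L32).
have P2 : (L ^ 16 * (L ^ 24) ^ 2 <= L ^ 64)%N by rewrite -expnM -expnD.
have P3 : ((L ^ 64) ^ 5 * (L ^ 24 * L ^ 2) <= L ^ 346)%N by rewrite -expnM -!expnD.
move=> h1 h2; exact: (@box_count R N L (L ^ 24) (L ^ 64) (L ^ 346) n r n0 pr nr L32 P1 P2 P3 Lr h1 h2 a1 J1 M1 a2 J2 M2).
Qed.

(** * Asymptotic count for a block of divisors *)

Section BoxAsymptotic.
Variable R : realType.
Variables (N s L n r b : nat).
Hypothesis n0 : (0 < n)%N.
Hypothesis pr : prime r.
Hypothesis nr : coprime n r.
Hypothesis hb : b = (n * r)%N.
Hypothesis L32 : (32 <= L)%N.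
Hypothesis Lr : (4 * (L ^ 346) ^ 2 <= r)%N.
Hypothesis bN : (b <= N)%N.
Hypothesis NbL : (N <= b * L ^ 6)%N.
Hypothesis sN : (s ^ 2 <= N < s.+1 ^ 2)%N.
Hypothesis hq : harm R (b ^ 2) <= L%:R ^+ 2.
Hypothesis hom : (2 ^ omega b <= L ^ 10)%N.
Let q := (b ^ 2)%N.

Let b0 : (0 < b)%N. Proof. by rewrite hb muln_gt0 n0 prime_gt0. Qed.
Let N0 : (0 < N)%N. Proof. exact: leq_trans bN. Qed.
Let s0 : (0 < s)%N.
Proof. by move: sN; case: (s) => // /andP[_]; rewrite exp1n ltnS leqNgt N0. Qed.
Let q0 : (0 < q)%N. Proof. by rewrite expn_gt0 b0. Qed.
Let N4s : (N <= 4 * s ^ 2)%N.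
Proof.
case/andP: sN => _ h; apply: ltnW; apply: leq_trans h _.
by rewrite (_ : 4 = 2 ^ 2)%N // -expnMn leq_exp2r // mul2n -addnn -addn1 leq_add2l.
Qed.
Let L0 : (0 < L)%N. Proof. exact: leq_trans L32. Qed.
Let Lr2 : (32 * L <= r)%N.
Proof.
apply: leq_trans Lr; rewrite -expnM (_ : 346 * 2 = 691.+1)%N // expnSr mulnA leq_mul2r; apply/orP; right.
apply: (@leq_trans (L ^ 691)); last by rewrite leq_pmull.
by apply: leq_trans L32 _; rewrite -{1}(expn1 L) leq_pexp2l.
Qed.

Let g (d e : nat) : bool := (q%:Z %| d%:Z * e%:Z - 1)%Z.

(** Periodicity in [e] lets the windows start at [q.+1 - J2], where [1 - J2] could be negative. *)
Let g_shift d e : g d (q + e) = g d e.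
Proof.
by rewrite /g PoszD mulrDr -addrA rpredDl // dvdz_mull.
Qed.


Variable D : nat.
Hypothesis ND : (N * r ^ 3 <= D)%N.
Hypothesis Ds : (D * r ^ 3 <= s * b)%N.
Let M := (D %/ L)%N.
Let J1 := (M %/ L)%N.

Let D_ge : (L ^ 6 <= D)%N.
Proof.
apply: leq_trans ND; apply: (@leq_trans (r ^ 3)); last by rewrite leq_pmull.
apply: leq_trans (leq_pexp2l _ (isT : 1 <= 3)%N); last exact: prime_gt0.
rewrite expn1; apply: leq_trans Lr; rewrite -expnM; apply: (@leq_trans (L ^ (346 * 2))); last by rewrite leq_pmull.
by rewrite leq_pexp2l.
Qed.

Let M_facts : [/\ (M * L <= D)%N, (D <= 2 * (M * L))%N & (L ^ 5 <= M)%N].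
Proof.
have [||m1 m2 m3] := @div_sandwich D L => //.
  by apply: leq_trans D_ge; rewrite -{1}(expn1 L) leq_pexp2l.
split=> //; rewrite /M -(mulnK (L ^ 5) L0); apply: leq_div2r; by rewrite -expnSr.
Qed.

Let J1_facts : [/\ (J1 * L <= M)%N, (M <= 2 * (J1 * L))%N & (0 < J1)%N].
Proof.
have [_ _ h] := M_facts; apply: div_sandwich => //.
by apply: leq_trans h; rewrite -{1}(expn1 L) leq_pexp2l.
Qed.

(** The hyperbolic condition [d e <= N q + 1] is replaced by a common threshold for [e]: the
    quotient of [N q + 1] by [D + 1] gives an upper bound for the block, the quotient by [D + M] a
    lower bound. *)
Let T E := (\sum_(D.+1 <= d < (D + M).+1) \sum_(1 <= e < E.+1) g d e)%N.
Let phi := (\sum_(D.+1 <= d < (D + M).+1) coprime d b)%N.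

Section Threshold.
Variable K : nat.
Hypothesis hK : (D <= K <= 2 * D)%N.
Hypothesis K0 : (0 < K)%N.
Let E := ((N * q + 1) %/ K)%N.
Let J2 := (E %/ L)%N.

Let E_ge : (L <= E)%N.
Proof.
rewrite -(mulnK L K0); apply: leq_div2r; apply: leq_trans (leq_addr _ _).
case/andP: hK => _ h; apply: leq_trans (leq_mul (leqnn L) h) _.
apply: (@leq_trans (D * r ^ 3)).
  rewrite mulnA mulnC leq_mul2l; apply/orP; right.
  apply: (@leq_trans r); last by rewrite -{1}(expn1 r) leq_pexp2l // prime_gt0.
  by apply: leq_trans Lr2; rewrite mulnC leq_mul2r orbT.
apply: leq_trans Ds _; apply: leq_mul; last by rewrite /q -mulnn leq_pmulr.
by case/andP: sN => h' _; apply: leq_trans h'; rewrite -mulnn leq_pmulr.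
Qed.

Let J2_facts := div_sandwich L0 E_ge.

Let E_facts : (E * K <= N * b ^ 2 + 1 < E.+1 * K)%N.
Proof. by rewrite leq_trunc_div ltn_ceil. Qed.

Let J2q : (J2 <= q)%N.
Proof.
have [h _ _] := J2_facts; apply: (@leq_trans E).
  by apply: leq_trans h; rewrite leq_pmulr.
rewrite -(leq_pmul2r K0); case/andP: E_facts => h1 _; apply: leq_trans h1 _.
case/andP: hK => h2 _.
apply: (@leq_trans (q * N.+1)); first by rewrite mulnC mulnS addnC leq_add2r.
rewrite leq_mul2l; apply/orP; right; apply: leq_trans h2; apply: leq_trans ND.
apply: (@leq_trans (N * 2)); first by rewrite muln2 -addnn -addn1 leq_add2l.
rewrite leq_mul2l; apply/orP; right.
by apply: leq_trans (prime_gt1 pr) _; rewrite -{1}(expn1 r) leq_pexp2l // prime_gt0.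
Qed.

Let count_box a1 M' a2 E' : (J1 <= M')%N -> (M <= 2 * M')%N -> (M' <= 2 * M)%N ->
  (J2 <= E')%N -> (E <= 2 * E')%N -> (E' <= 2 * E)%N ->
  `|(\sum_(p1 : 'I_J1 * 'I_M') \sum_(p2 : 'I_J2 * 'I_E') g (a1 + p1.1 + p1.2) (a2 + p2.1 + p2.2))%N%:R -
    J2%:R * E'%:R / q%:R * (\sum_(p : 'I_J1 * 'I_M') coprime (a1 + p.1 + p.2) b)%N%:R| <=
  J1%:R * J2%:R * (N%:R / L%:R ^+ 2) :> R.
Proof.
move=> hJ1 hM1 hM2 hJ2 hE1 hE2.
have [m1 m2 _] := M_facts; have [j1 j2 j3] := J1_facts; have [k1 k2 k3] := J2_facts.
have bN' : (0 < b <= N)%N by rewrite b0.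
have L1 : (1 < L)%N by apply: leq_trans L32.
have E0 : (0 < E)%N by apply: leq_trans E_ge.
case/andP: (sN) => s2 _.
have mm : (M * L <= D <= 2 * (M * L))%N by rewrite m1.
have jj : (J1 * L <= M <= 2 * (J1 * L))%N by rewrite j1.
have kk : (J2 * L <= E <= 2 * (J2 * L))%N by rewrite k1.
have [c1 c2 c3 c4 [c5 c6]] := box_size_conditions bN' s2 N4s L1 Lr2 ND Ds hK mm jj E_facts kk hM1 hM2 hE1 hE2 E0.
by apply: (box_count_level a1 a2 hb n0 pr nr).
Qed.

Lemma upper_count : (T E)%:R <= N%:R / L%:R ^+ 2 + (E + J2)%N%:R * (phi + 2 * J1)%N%:R / q%:R :> R.
Proof.
have [m1 m2 m3] := M_facts; have [j1 j2 j3] := J1_facts; have [k1 k2 k3] := J2_facts.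
have J1M : (J1 <= M)%N by apply: leq_trans j1; rewrite leq_pmulr.
have J2E : (J2 <= E)%N by apply: leq_trans k1; rewrite leq_pmulr.
have J1D : (J1 <= D.+1)%N.
  by apply: leq_trans J1M _; apply: leq_trans (leqnSn _); apply: leq_trans m1; rewrite leq_pmulr.
have := count_box (D.+1 - J1) (q.+1 - J2) (leq_addl M J1) _ _ (leq_addl E J2).
have e1 : (M <= 2 * (M + J1))%N by clear; lia.
have e2 : (M + J1 <= 2 * M)%N by rewrite mul2n -addnn leq_add2l.
have e3 : (E <= 2 * (E + J2))%N by clear; lia.
have e4 : (E + J2 <= 2 * E)%N by rewrite mul2n -addnn leq_add2l.
move=> /(_ e1 e2 e3 e4); set S := (\sum_(p1 : _) _)%N; set C := (\sum_(p : _) coprime _ _)%N => H.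
have TS : (J1 * (J2 * T E) <= S)%N.
  pose F d := (\sum_(p2 : 'I_J2 * 'I_(E + J2)) g d (q.+1 - J2 + p2.1 + p2.2))%N.
  apply: leq_trans (@windows_ge F J1 M D J1D); rewrite leq_mul2l; apply/orP; right.
  rewrite /T big_distrr /=; apply: leq_sum => d _.
  have := @windows_ge (g d) J2 E q; rewrite (leq_trans J2q (leqnSn q)) => /(_ isT).
  rewrite (_ : \sum_(q.+1 <= e < (q + E).+1) g d e = \sum_(1 <= e < E.+1) g d e)%N //.
  rewrite (_ : (q + E).+1 = E.+1 + q)%N; last by rewrite addnC.
  rewrite -[q.+1]add1n big_addn addnK.
  by apply: eq_bigr => e _; rewrite addnC g_shift.
have Cle : (C <= J1 * (phi + 2 * J1))%N.
  by apply: bounded_windows_le => // d; case: coprime.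
have J10 : 0 < J1%:R :> R by rewrite ltr0n.
have J20 : 0 < J2%:R :> R by rewrite ltr0n.
have qR : 0 < q%:R :> R by rewrite ltr0n.
have TSR : J1%:R * (J2%:R * (T E)%:R) <= S%:R :> R by rewrite -!natrM ler_nat.
have CR : C%:R <= J1%:R * (phi + 2 * J1)%N%:R :> R by rewrite -natrM ler_nat.
have JJ : 0 < J1%:R * J2%:R :> R by rewrite mulr_gt0.
rewrite -(ler_pM2l JJ) -[leLHS]mulrA; apply: le_trans TSR _.
move: H; rewrite ler_norml => /andP[_]; rewrite lerBlDr => /le_trans; apply.
rewrite [leRHS]mulrDr lerD2l.
apply: (@le_trans _ _ (J2%:R * (E + J2)%N%:R / q%:R * (J1%:R * (phi + 2 * J1)%N%:R))).
  by apply: ler_wpM2l => //; rewrite divr_ge0 // ?mulr_ge0.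
by rewrite le_eqVlt; apply/orP; left; apply/eqP; ring.
Qed.

Lemma lower_count : (E - J2)%N%:R * (phi%:R - J1%:R) / q%:R - N%:R / L%:R ^+ 2 <= (T E)%:R :> R.
Proof.
have [m1 m2 m3] := M_facts; have [j1 j2 j3] := J1_facts; have [k1 k2 k3] := J2_facts.
have J1M2 : (2 * J1 <= M)%N.
  by apply: leq_trans j1; rewrite mulnC leq_mul2l (leq_trans _ L32) ?orbT.
have J2E2 : (2 * J2 <= E)%N.
  by apply: leq_trans k1; rewrite mulnC leq_mul2l (leq_trans _ L32) ?orbT.
have J1M : (J1 <= M)%N by apply: leq_trans J1M2; rewrite leq_pmull.
have J2E : (J2 <= E)%N by apply: leq_trans J2E2; rewrite leq_pmull.
have f1 : (J1 <= M - J1)%N by move: J1M2; clear; lia.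
have e1 : (M <= 2 * (M - J1))%N by move: J1M2; clear; lia.
have e2 : (M - J1 <= 2 * M)%N by clear; lia.
have f2 : (J2 <= E - J2)%N by move: J2E2; clear; lia.
have e3 : (E <= 2 * (E - J2))%N by move: J2E2; clear; lia.
have e4 : (E - J2 <= 2 * E)%N by clear; lia.
have := count_box D.+1 q.+1 f1 e1 e2 f2 e3 e4.
set S := (\sum_(p1 : _) _)%N; set C := (\sum_(p : _) coprime _ _)%N => H.
have TS : (S <= J1 * (J2 * T E))%N.
  pose F d := (\sum_(p2 : 'I_J2 * 'I_(E - J2)) g d (q.+1 + p2.1 + p2.2))%N.
  apply: leq_trans (windows_le F D J1M) _; rewrite leq_mul2l; apply/orP; right.
  rewrite /T big_distrr /=; apply: leq_sum => d _.
  have := @windows_le (g d) J2 E q J2E.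
  rewrite (_ : \sum_(q.+1 <= e < (q + E).+1) g d e = \sum_(1 <= e < E.+1) g d e)%N //.
  rewrite (_ : (q + E).+1 = E.+1 + q)%N; last by rewrite addnC.
  rewrite -[q.+1]add1n big_addn addnK.
  by apply: eq_bigr => e _; rewrite addnC g_shift.
have Cle : (J1 * phi <= C + J1 * J1)%N.
  by apply: (@bounded_windows_ge (fun d => coprime d b)) => // d; case: coprime.
have J10 : 0 < J1%:R :> R by rewrite ltr0n.
have J20 : 0 < J2%:R :> R by rewrite ltr0n.
have qR : 0 < q%:R :> R by rewrite ltr0n.
have TSR : S%:R <= J1%:R * (J2%:R * (T E)%:R) :> R by rewrite -!natrM ler_nat.
have CR : J1%:R * phi%:R <= C%:R + J1%:R * J1%:R :> R by rewrite -!natrM -natrD ler_nat.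
have JJ : 0 < J1%:R * J2%:R :> R by rewrite mulr_gt0.
rewrite -(ler_pM2l JJ) -[leRHS]mulrA; apply: le_trans TSR.
move: H; rewrite ler_norml => /andP[H _]; rewrite [leLHS]mulrBr lerBlDr.
rewrite -subr_ge0 in H; apply: (@le_trans _ _ (J2%:R * (E - J2)%N%:R / q%:R * C%:R)); last first.
  by rewrite -subr_ge0; move: H; lra.
apply: (@le_trans _ _ (J2%:R * (E - J2)%N%:R / q%:R * (J1%:R * (phi%:R - J1%:R)))).
  by rewrite le_eqVlt; apply/orP; left; apply/eqP; ring.
by apply: ler_wpM2l; [rewrite divr_ge0 // ?mulr_ge0 | lra].
Qed.

End Threshold.

Let T_ge : (\sum_(D.+1 <= d < (D + M).+1) cnt N b d <= T ((N * q + 1) %/ D.+1))%N.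
Proof.
rewrite [leqLHS]big_nat [leqRHS]big_nat; apply: leq_sum => d /andP[d1 d2].
rewrite (@cntE N b b0 d ((N * q + 1) %/ D.+1)); last 2 first.
- exact: leq_ltn_trans d1.
- apply: leq_trans (ltn_ceil _ (ltn0Sn D)) _; by rewrite mulnC leq_mul2r d1 orbT.
apply: leq_sum => e _; case: (boolP (hit N b d e)) => // /andP[/andP[h _] dv].
by rewrite /g -PoszM subzn ?(ltnW h) // dvdzE /= dv.
Qed.

Let T_le : (T ((N * q + 1) %/ (D + M)) <= \sum_(D.+1 <= d < (D + M).+1) cnt N b d)%N.
Proof.
have D0 : (0 < D)%N by apply: leq_trans D_ge; rewrite expn_gt0 L0.
rewrite [leqLHS]big_nat [leqRHS]big_nat; apply: leq_sum => d /andP[d1 d2].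
set E := ((N * q + 1) %/ _)%N.
have d0 : (0 < d)%N by apply: leq_ltn_trans d1.
have EE : (E <= N * q + 1)%N by apply: leq_div.
rewrite (@cntE N b b0 d (N * q + 1)) //; last first.
  by apply: leq_trans (ltnSn _) _; rewrite leq_pmull.
apply: leq_trans (sum_subrange _ (leqnn 1) (EE : E.+1 <= (N * q + 1).+1)%N).
rewrite [leqLHS]big_nat [leqRHS]big_nat; apply: leq_sum => e /andP[e1 e2].
have de : (1 < d * e)%N by apply: leq_trans (_ : D.+1 * 1 <= _)%N; [rewrite muln1 | apply: leq_mul].
rewrite /hit /g -PoszM subzn ?(ltnW de) // dvdzE /= de /=.
rewrite (_ : d * e <= _)%N //.
apply: leq_trans (leq_trunc_div (N * q + 1) (D + M)); rewrite mulnC leq_mul //.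
Qed.

(** The main term of a block has size at most [N / L]. The Fourier error, the two smoothings, and
    the variation of [N / d] and of the threshold across the block each cost a multiple of
    [N / L ^ 2]. *)
Lemma box_asymptotic :
  `|\sum_(D.+1 <= d < (D + M).+1) ((cnt N b d)%:R - N%:R / d%:R * (coprime d b)%:R)| <=
  16 * N%:R / L%:R ^+ 2 :> R.
Proof.
have [m1 m2 m3] := M_facts; have [j1 j2 j3] := J1_facts.
have D0 : (0 < D)%N by apply: leq_trans D_ge; rewrite expn_gt0 L0.
have M0 : (0 < M)%N by apply: leq_trans m3; rewrite expn_gt0 L0.
have M_le_D : (M <= D)%N by apply: leq_trans m1; rewrite leq_pmulr.
rewrite sumrB -natr_sum.
set m := \sum_(_ <= d < _) (N%:R / d%:R * _).
have [m_ge m_le] : phi%:R * (N%:R / (D + M)%N%:R) <= m /\ m <= phi%:R * (N%:R / D%:R).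
  have inv_le x z : (0 < x)%N -> (x <= z)%N -> N%:R / z%:R <= N%:R / x%:R :> R.
    move=> x0 xz; apply: ler_wpM2l => //.
    by rewrite lef_pV2 ?posrE ?ltr0n ?ler_nat // (leq_trans x0).
  rewrite /phi natr_sum !mulr_suml; split; rewrite [leLHS]big_nat [leRHS]big_nat.
    apply: ler_sum => d /andP[d1 d2]; rewrite [leLHS]mulrC; apply: ler_wpM2r => //; apply: inv_le => //.
    exact: leq_ltn_trans d1.
  apply: ler_sum => d /andP[d1 d2]; rewrite [leRHS]mulrC; apply: ler_wpM2r => //; apply: inv_le => //.
  exact: ltnW.
have phiM : (phi <= M)%N.
  rewrite /phi; apply: (@leq_trans (\sum_(D.+1 <= d < (D + M).+1) 1)); first by apply: leq_sum => d _; case: coprime.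
  by rewrite sum_nat_const_nat muln1 subSS addKn.
have d0 : 0 < D%:R :> R by rewrite ltr0n.
have l1 : 1 <= L%:R :> R by rewrite ler1n.
have l0 : 0 < L%:R :> R by rewrite ltr0n.
have qR : 0 < q%:R :> R by rewrite ltr0n.
have NR : 1 <= N%:R :> R by rewrite ler1n.
(* Lengths are measured in units of [D]: the block has relative length [mu <= t], the smoothing
   window [i1 <= t ^ 2]. *)
pose t : R := L%:R^-1.
have t0 : 0 <= t by rewrite invr_ge0 ltW.
have t1 : t <= 1 by rewrite invf_le1.
pose y : R := phi%:R / D%:R; pose mu : R := M%:R / D%:R; pose i1 : R := J1%:R / D%:R.
have y0 : 0 <= y by rewrite divr_ge0.
have mu0 : 0 <= mu by rewrite divr_ge0.
have i10 : 0 <= i1 by rewrite divr_ge0.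
have mut : mu <= t.
  by rewrite /mu /t ler_pdivrMr // mulrC ler_pdivlMr // -natrM ler_nat.
have yt : y <= t.
  by apply: le_trans mut; rewrite /y /mu ler_pM2r ?invr_gt0 // ler_nat.
have i1t : i1 <= t ^+ 2.
  apply: (@le_trans _ _ (mu * t)); last by rewrite expr2; apply: ler_wpM2r.
  rewrite /i1 /mu mulrAC ler_pM2r ?invr_gt0 // ler_pdivlMr // -natrM ler_nat //.
have DL : (D * L <= N * q)%N.
  apply: (@leq_trans (s * b)); last first.
    apply: leq_mul; last by rewrite /q -mulnn leq_pmulr.
    by case/andP: sN => h' _; apply: leq_trans h'; rewrite -mulnn leq_pmulr.
  apply: leq_trans Ds; rewrite leq_mul2l; apply/orP; right.
  apply: (@leq_trans r); last by rewrite -{1}(expn1 r) leq_pexp2l // prime_gt0.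
  by apply: leq_trans Lr2; rewrite leq_pmull.
have lam : N%:R / L%:R ^+ 2 = N%:R * t ^+ 2 :> R by rewrite /t exprVn.
have mge : y * N%:R * (1 - mu) <= m.
  apply: le_trans m_ge; rewrite natrD /y /mu -!mulrA; apply: ler_wpM2l => //.
  rewrite mulrCA; apply: ler_wpM2l => //.
  rewrite -[leRHS]mul1r ler_pdivlMr; last by rewrite ltr_pwDl.
  rewrite -subr_ge0.
  have -> : 1 - D%:R^-1 * (1 - M%:R / D%:R) * (D%:R + M%:R) = (M%:R / D%:R) ^+ 2 :> R.
    by field; rewrite gt_eqF.
  by rewrite exprn_ge0.
have mle : m <= y * N%:R.
  by apply: le_trans m_le _; rewrite le_eqVlt; apply/orP; left; apply/eqP; rewrite /y; ring.
rewrite -mulrA lam ler_norml; apply/andP; split.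
- pose K := (D + M)%N; pose E := ((N * q + 1) %/ K)%N; pose J2 := (E %/ L)%N.
  have hK : (D <= K <= 2 * D)%N by rewrite leq_addr mul2n -addnn leq_add2l.
  have K0 : (0 < K)%N by rewrite addn_gt0 D0.
  have EK : (E * K <= N * q + 1)%N := leq_trunc_div _ _.
  have KE : (N * q + 1 < E.+1 * K)%N := ltn_ceil _ K0.
  have J2E : (J2 * L <= E)%N := leq_trunc_div _ _.
  have J2E' : (J2 <= E)%N by apply: leq_div.
  have H := lower_count hK K0; rewrite -/E -/J2 lam in H.
  have cT : (T E)%:R <= (\sum_(D.+1 <= i < (D + M).+1) cnt N b i)%N%:R :> R by rewrite ler_nat.
  pose z : R := E%:R / q%:R * D%:R; pose w : R := J2%:R / q%:R * D%:R.
  have z0 : 0 <= z by rewrite mulr_ge0 ?divr_ge0.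
  have w0 : 0 <= w by rewrite mulr_ge0 ?divr_ge0.
  have KR : 0 < K%:R :> R by rewrite ltr0n.
  have z2 : z <= 2 * N%:R.
    rewrite /z mulrAC ler_pdivrMr // -!natrM ler_nat; apply: (@leq_trans (E * K)).
      by rewrite leq_mul2l leq_addr orbT.
    apply: leq_trans EK _; rewrite -mulnA mul2n -addnn leq_add2l muln_gt0 N0 //.
  have wz : w <= t * z.
    rewrite /w /z mulrA ler_pM2r // mulrA ler_pM2r ?invr_gt0 // mulrC ler_pdivlMr // -natrM ler_nat //.
  have zN : N%:R * (1 - mu) - N%:R * t <= z.
    have KEr : N%:R * q%:R <= (E%:R + 1) * K%:R :> R.
      by rewrite natr1 -!natrM ler_nat; apply: ltnW; apply: leq_ltn_trans KE; rewrite leq_addr.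
    have DLr : D%:R * L%:R <= N%:R * q%:R :> R by rewrite -!natrM ler_nat.
    have v : D%:R / q%:R <= N%:R * t by rewrite /t ler_pdivrMr // mulrAC ler_pdivlMr.
    have h1 : N%:R * (1 - mu) <= (E%:R + 1) / q%:R * D%:R.
      rewrite mulrAC ler_pdivlMr //.
      apply: (@le_trans _ _ ((1 - mu) * ((E%:R + 1) * K%:R))).
        rewrite [leLHS]mulrAC [leLHS]mulrC; apply: ler_wpM2l => //.
        by rewrite subr_ge0 (le_trans mut).
      rewrite [leLHS]mulrCA; apply: ler_wpM2l; first by rewrite addr_ge0.
      rewrite /K natrD -subr_ge0.
      have -> : D%:R - (1 - mu) * (D%:R + M%:R) = M%:R ^+ 2 / D%:R :> R.
        by rewrite /mu; field; rewrite gt_eqF.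
      by rewrite divr_ge0 // exprn_ge0.
    have : (E%:R + 1) / q%:R * D%:R = z + D%:R / q%:R :> R by rewrite /z; ring.
    by move=> h2; rewrite h2 in h1; lra.
  have e : (E - J2)%N%:R * (phi%:R - J1%:R) / q%:R = (z - w) * (y - i1) :> R.
    by rewrite natrB // /z /w /y /i1; field; rewrite !gt_eqF.
  rewrite e in H; apply: le_trans (_ : (T E)%:R - m <= _); last by rewrite lerB.
  have p1 : z * i1 <= 2 * N%:R * t ^+ 2 by apply: ler_pM.
  have p2 : w * y <= 2 * N%:R * t ^+ 2.
    apply: le_trans (ler_pM w0 y0 wz yt) _.
    have -> : t * z * t = z * t ^+ 2 by ring.
    by apply: ler_wpM2r => //; rewrite exprn_ge0.
  have p3 : 0 <= w * i1 by apply: mulr_ge0.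
  have p4 : y * (N%:R * (1 - mu) - N%:R * t) <= z * y by rewrite mulrC; apply: ler_wpM2r.
  have p5 : y * (N%:R * mu) <= N%:R * t ^+ 2.
    have -> : N%:R * t ^+ 2 = t * (N%:R * t) by ring.
    by apply: ler_pM => //; [rewrite mulr_ge0 | rewrite ler_wpM2l].
  have p6 : y * (N%:R * t) <= N%:R * t ^+ 2.
    have -> : N%:R * t ^+ 2 = t * (N%:R * t) by ring.
    by apply: ler_wpM2r => //; rewrite mulr_ge0.
  have NT : 0 <= N%:R * t ^+ 2 by rewrite mulr_ge0 // exprn_ge0.
  move: H mle p1 p2 p3 p4 p5 p6 NT; lra.
- pose K := D.+1; pose E := ((N * q + 1) %/ K)%N; pose J2 := (E %/ L)%N.
  have hK : (D <= K <= 2 * D)%N by rewrite /K leqnSn mul2n -addnn -addn1 leq_add2l.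
  have K0 : (0 < K)%N by [].
  have EK : (E * K <= N * q + 1)%N := leq_trunc_div _ _.
  have J2E : (J2 * L <= E)%N := leq_trunc_div _ _.
  have H := upper_count hK K0; rewrite -/E -/J2 lam in H.
  have cT : (\sum_(D.+1 <= i < (D + M).+1) cnt N b i)%N%:R <= (T E)%:R :> R by rewrite ler_nat.
  pose z : R := E%:R / q%:R * D%:R; pose w : R := J2%:R / q%:R * D%:R.
  have z0 : 0 <= z by rewrite mulr_ge0 ?divr_ge0.
  have w0 : 0 <= w by rewrite mulr_ge0 ?divr_ge0.
  have ED : (E * D <= N * q + 1)%N by apply: leq_trans EK; rewrite leq_mul2l leqnSn orbT.
  have z2 : z <= 2 * N%:R.
    rewrite /z mulrAC ler_pdivrMr // -!natrM ler_nat.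
    apply: leq_trans ED _; rewrite -mulnA mul2n -addnn leq_add2l muln_gt0 N0 //.
  have wz : w <= t * z.
    rewrite /w /z mulrA ler_pM2r // mulrA ler_pM2r ?invr_gt0 // mulrC ler_pdivlMr // -natrM ler_nat //.
  have zN : z <= N%:R + N%:R * t.
    apply: (@le_trans _ _ (N%:R + q%:R^-1)).
      rewrite /z mulrAC ler_pdivrMr // mulrDl mulVf ?gt_eqF // -!natrM natr1 ler_nat.
      by apply: leq_trans ED _; rewrite addn1.
    rewrite lerD2l /t ler_pdivlMr // mulrC ler_pdivrMr // -natrM ler_nat.
    by apply: leq_trans DL; rewrite leq_pmull.
  have e : (E + J2)%N%:R * (phi + 2 * J1)%N%:R / q%:R = (z + w) * (y + 2 * i1) :> R.
    by rewrite (natrD _ E J2) (natrD _ phi (2 * J1)%N) (natrM _ 2 J1) /z /w /y /i1; field; rewrite !gt_eqF.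
  rewrite e in H; apply: le_trans (_ : (T E)%:R - m <= _); first by rewrite lerB.
  have p1 : z * i1 <= 2 * N%:R * t ^+ 2 by apply: ler_pM.
  have p2 : w * y <= 2 * N%:R * t ^+ 2.
    apply: le_trans (ler_pM w0 y0 wz yt) _.
    have -> : t * z * t = z * t ^+ 2 by ring.
    by apply: ler_wpM2r => //; rewrite exprn_ge0.
  have p3 : w * i1 <= 2 * N%:R * t ^+ 2.
    apply: le_trans p1; apply: ler_wpM2r => //; apply: le_trans wz _.
    by rewrite -[leRHS]mul1r; apply: ler_wpM2r.
  have p4 : z * y <= y * (N%:R + N%:R * t) by rewrite mulrC; apply: ler_wpM2l.
  have p5 : y * (N%:R * mu) <= N%:R * t ^+ 2.
    have -> : N%:R * t ^+ 2 = t * (N%:R * t) by ring.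
    by apply: ler_pM => //; [rewrite mulr_ge0 | rewrite ler_wpM2l].
  have p6 : y * (N%:R * t) <= N%:R * t ^+ 2.
    have -> : N%:R * t ^+ 2 = t * (N%:R * t) by ring.
    by apply: ler_wpM2r => //; rewrite mulr_ge0.
  have NT : 0 <= N%:R * t ^+ 2 by rewrite mulr_ge0 // exprn_ge0.
  have H' : (T E)%:R <= N%:R * t ^+ 2 + (z * y + 2 * (z * i1) + w * y + 2 * (w * i1)).
    by apply: le_trans H _; rewrite le_eqVlt; apply/orP; left; apply/eqP; ring.
  move: H' mge p1 p2 p3 p4 p5 p6 NT; lra.
Qed.

End BoxAsymptotic.

Lemma sum_inv_block_le (R : realType) D D2 : (0 < D)%N -> (D2 <= 2 * D)%N ->
  \sum_(D.+1 <= d < D2.+1) d%:R^-1 <= 1 :> R.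
Proof.
move=> D0 h; have dR : 0 < D%:R :> R by rewrite ltr0n.
apply: (@le_trans _ _ (\sum_(D.+1 <= d < D2.+1) D%:R^-1)).
  rewrite [leLHS]big_nat [leRHS]big_nat; apply: ler_sum => d /andP[d1 _].
  by rewrite lef_pV2 ?posrE ?ltr0n ?ler_nat ?(leq_ltn_trans _ d1) // ltnW.
rewrite sumr_const_nat -[leLHS]mulr_natl ler_pdivrMr // mul1r ler_nat subSS.
by rewrite leq_subLR addnn -mul2n.
Qed.

Lemma sum_inv_dyadic_le (R : realType) K D D2 : (0 < D)%N -> (D2 <= 2 ^ K * D)%N ->
  \sum_(D.+1 <= d < D2.+1) d%:R^-1 <= K%:R :> R.
Proof.
elim: K D => [|K IHK] D D0 h; first by rewrite big_geq // -(mul1n D).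
case: (leqP D2 (2 * D)) => h2.
  by apply: le_trans (sum_inv_block_le R D0 h2) _; rewrite ler1n.
have D2' : (D <= 2 * D)%N by rewrite leq_pmull.
rewrite (@big_cat_nat _ _ _ (2 * D).+1) //; last by rewrite ltnW.
rewrite -nat1r; apply: lerD; first exact: sum_inv_block_le.
by apply: IHK; [rewrite muln_gt0 D0 | apply: leq_trans h _; rewrite expnSr -mulnA].
Qed.

(** * The error for a single modulus [b] *)

Section PerModulus.
Variable R : realType.
Variables (N s b b1 b2 : nat).
Hypothesis b0 : (0 < b)%N.
Hypothesis co : coprime b1 b2.
Hypothesis hb : (b = b1 * b2)%N.
Hypothesis bN : (b <= N)%N.
Hypothesis sN : (s ^ 2 <= N < s.+1 ^ 2)%N.
Let U := box_bound N b1 b2 s.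
Let x d : R := (cnt N b d)%:R - N%:R / d%:R * (coprime d b)%:R.
Let N0 : (0 < N)%N. Proof. exact: leq_trans bN. Qed.

Let split_at D D1 D2 : (D <= D1)%N -> (D1 <= D2)%N ->
  `|\sum_(D.+1 <= d < D2.+1) x d| <= `|\sum_(D.+1 <= d < D1.+1) x d| + `|\sum_(D1.+1 <= d < D2.+1) x d|.
Proof. by move=> h1 h2; rewrite (@big_cat_nat _ _ _ D1.+1) //=; apply: ler_normD. Qed.

Let initial D : (D <= N)%N -> `|\sum_(1 <= d < D.+1) x d| <= N%:R.
Proof.
move=> DN; apply: le_trans (ler_norm_sum _ _ _) _.
apply: (@le_trans _ _ (\sum_(1 <= d < D.+1) 1)); last by rewrite sumr_const_nat subn1 ler_nat.
rewrite [leLHS]big_nat [leRHS]big_nat; apply: ler_sum => d /andP[d1 _].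
exact: cnt_near.
Qed.

Let stretch K D D2 : (N <= D)%N -> (D2 <= 2 ^ K * D)%N -> (D2 <= s * b)%N ->
  `|\sum_(D.+1 <= d < D2.+1) x d| <= K%:R * (U%:R + N%:R).
Proof.
move=> ND h hs; rewrite sumrB -natr_sum mulrDr; apply: le_trans (ler_normB _ _) _.
apply: lerD; first by rewrite ger0_norm // -natrM ler_nat; apply: dyadic_boxes.
rewrite ger0_norm; last by apply: sumr_ge0 => d _; rewrite mulr_ge0 // mulr_ge0 // invr_ge0.
apply: (@le_trans _ _ (\sum_(D.+1 <= d < D2.+1) N%:R * d%:R^-1)).
  apply: ler_sum => d _; rewrite -[leRHS]mulr1; apply: ler_wpM2l; first by rewrite mulr_ge0 // invr_ge0.
  by rewrite -[leRHS]/(1%:R) ler_nat; case: coprime.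
rewrite -mulr_sumr mulrC; apply: ler_wpM2r => //; apply: sum_inv_dyadic_le => //.
exact: leq_trans ND.
Qed.

Lemma crude_error K : (s * b <= 2 ^ K * N)%N ->
  `|\sum_(1 <= d < (s * b).+1) x d| <= N%:R + K%:R * (U%:R + N%:R).
Proof.
move=> h; case: (leqP (s * b) N) => h2.
  by apply: le_trans (initial h2) _; rewrite lerDl mulr_ge0 // addr_ge0.
apply: le_trans (split_at (leq0n N) (ltnW h2)) _.
by apply: lerD; [apply: initial | apply: stretch].
Qed.

Variables (L n r k : nat).
Hypothesis n0 : (0 < n)%N.
Hypothesis pr : prime r.
Hypothesis nr : coprime n r.
Hypothesis hbr : b = (n * r)%N.
Hypothesis L32 : (32 <= L)%N.
Hypothesis Lr : (4 * (L ^ 346) ^ 2 <= r)%N.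
Hypothesis rk : (r <= 2 ^ k)%N.
Hypothesis NbL : (N <= b * L ^ 6)%N.
Hypothesis hN : harm R (N ^ 2) <= 2 * L%:R.
Hypothesis hom : (2 ^ omega b <= L ^ 10)%N.

Let hq : harm R (b ^ 2) <= L%:R ^+ 2.
Proof.
apply: le_trans (harm_le R (_ : _ <= N ^ 2)%N) _; first by rewrite leq_exp2r.
apply: le_trans hN _; rewrite expr2; apply: ler_wpM2r => //.
by rewrite ler_nat (leq_trans _ L32).
Qed.

Let Dhi := ((s * b) %/ r ^ 3)%N.
Let r0 : (0 < r ^ 3)%N. Proof. by rewrite expn_gt0 prime_gt0. Qed.
Let r2 : (2 <= r ^ 3)%N.
Proof. by apply: leq_trans (prime_gt1 pr) _; rewrite -{1}(expn1 r) leq_pexp2l // prime_gt0. Qed.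

(** Consecutive blocks are glued until [Dhi] is passed. Each error [16 N / L ^ 2] is charged to the
    sum of [1 / d] over its block, which is at least [1 / (3 L)]; so the total is [48 N / L] times a
    harmonic sum, however many blocks there are. *)
Let chain j D : (Dhi - D < j)%N -> (N * r ^ 3 <= D)%N -> (D <= Dhi)%N ->
  exists D', [/\ (Dhi < D')%N, (D' <= s * b)%N, (D <= D')%N &
    `|\sum_(D.+1 <= d < D'.+1) x d| <= 48 * (N%:R / L%:R) * \sum_(D.+1 <= d < D'.+1) d%:R^-1].
Proof.
elim: j D => // j IHj D hj ND hD.
have D_r : (D * r ^ 3 <= s * b)%N by rewrite -leq_divRL.
have box := box_asymptotic n0 pr nr hbr L32 Lr bN NbL sN hq hom ND D_r.
have L0 : (0 < L)%N by apply: leq_trans L32.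
have LD : (L <= D)%N.
  apply: leq_trans ND; apply: (@leq_trans r); last first.
    by apply: leq_trans (leq_pmull _ N0); rewrite -{1}(expn1 r) leq_pexp2l // prime_gt0.
  apply: leq_trans Lr; rewrite -expnM; apply: leq_trans (leq_pmull _ _) => //.
  by rewrite -{1}(expn1 L) leq_pexp2l.
have [m1 m2 m3] := div_sandwich L0 LD.
set M := (D %/ L)%N in box m1 m2 m3.
have D0 : (0 < D)%N by apply: leq_trans LD.
have lR : 0 < L%:R :> R by rewrite ltr0n.
have inv_sum : (3 * L%:R)^-1 <= \sum_(D.+1 <= d < (D + M).+1) d%:R^-1 :> R.
  apply: (@le_trans _ _ (\sum_(D.+1 <= d < (D + M).+1) (D + M)%N%:R^-1)); last first.
    rewrite [leLHS]big_nat [leRHS]big_nat; apply: ler_sum => d /andP[d1 d2].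
    by rewrite lef_pV2 ?posrE ?ltr0n ?ler_nat ?addn_gt0 ?D0 ?(leq_ltn_trans _ d1).
  rewrite sumr_const_nat subSS addKn -[leRHS]mulr_natl ler_pdivlMr ?ltr0n ?addn_gt0 ?D0 //.
  rewrite mulrC ler_pdivrMr ?mulr_gt0 // -!natrM ler_nat.
  apply: (@leq_trans (2 * (M * L) + M * L)); last by clear; lia.
  by apply: leq_add => //; rewrite leq_pmulr.
have step : `|\sum_(D.+1 <= d < (D + M).+1) x d| <=
    48 * (N%:R / L%:R) * \sum_(D.+1 <= d < (D + M).+1) d%:R^-1.
  apply: le_trans box _; apply: (@le_trans _ _ (48 * (N%:R / L%:R) * (3 * L%:R)^-1)).
    by rewrite le_eqVlt; apply/orP; left; apply/eqP; field; rewrite gt_eqF.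
  by apply: ler_wpM2l => //; rewrite mulr_ge0 // divr_ge0.
case: (leqP (D + M) Dhi) => h; last first.
  exists (D + M)%N; split=> //; last exact: leq_addr.
  apply: (@leq_trans (2 * D)).
    by rewrite mul2n -addnn leq_add2l; apply: leq_trans m1; rewrite leq_pmulr.
  apply: leq_trans D_r; by rewrite mulnC leq_mul2l r2 orbT.
have [||D' [h1 h2 h3 h4]] := IHj _ _ _ h.
- by move: hj h m3; clear; lia.
- by apply: leq_trans ND (leq_addr _ _).
exists D'; split=> //; first by apply: leq_trans h3; apply: leq_addr.
apply: le_trans (split_at (leq_addr M D) h3) _.
rewrite [X in _ <= _ * X](@big_cat_nat _ _ _ (D + M).+1) //=; last by rewrite ltnS leq_addr.
by rewrite mulrDr; apply: lerD.
Qed.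


(* The trivial estimate for [d <= N], dyadic boxes for [N < d <= N r ^ 3] and for the
   last [O(log r)] intervals, box asymptotics in between. *)
Lemma good_error : `|\sum_(1 <= d < (s * b).+1) x d| <= 97 * N%:R + (6 * k)%N%:R * (U%:R + N%:R).
Proof.
have rk3 : (r ^ 3 <= 2 ^ (3 * k))%N by rewrite mulnC expnM leq_exp2r.
case: (leqP (N * r ^ 3) Dhi) => h; last first.
  apply: le_trans (@crude_error (6 * k) _) _.
    have : (s * b < N * r ^ 3 * r ^ 3)%N.
      apply: leq_trans (ltn_ceil (s * b) r0) _; by rewrite leq_mul2r h orbT.
    move=> /ltnW/leq_trans; apply; rewrite -mulnA mulnC leq_mul2r; apply/orP; right.
    by rewrite (_ : 6 * k = 3 * k + 3 * k)%N; [rewrite expnD leq_mul | clear; lia].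
  by rewrite lerD2r -{1}(mul1r N%:R); apply: ler_wpM2r => //; lra.
have [D' [h1 h2 h3 h4]] := chain (ltnSn _) (leqnn _) h.
have N1 : (N <= N * r ^ 3)%N by rewrite leq_pmulr.
have e1 := split_at (leq0n N) (leq_trans N1 (leq_trans h3 h2)).
have e2 := split_at N1 (leq_trans h3 h2).
have e3 := split_at h3 h2.
have f1 := initial (leqnn N).
have f2 : `|\sum_(N.+1 <= d < (N * r ^ 3).+1) x d| <= (3 * k)%N%:R * (U%:R + N%:R).
  by apply: stretch => //; [rewrite mulnC leq_mul2r rk3 orbT | apply: leq_trans h3 h2].
have f3 : `|\sum_(D'.+1 <= d < (s * b).+1) x d| <= (3 * k)%N%:R * (U%:R + N%:R).
  apply: stretch => //; first exact: leq_trans N1 h3.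
  apply: ltnW; apply: leq_trans (ltn_ceil (s * b) r0) _; rewrite mulnC; exact: leq_mul.
have f4 : 48 * (N%:R / L%:R) * \sum_((N * r ^ 3).+1 <= d < D'.+1) d%:R^-1 <= 96 * N%:R :> R.
  have lR : 0 < L%:R :> R by rewrite ltr0n (leq_trans _ L32).
  have : \sum_((N * r ^ 3).+1 <= d < D'.+1) d%:R^-1 <= 2 * L%:R :> R.
    apply: le_trans hN; apply: le_trans (harm_le R (_ : D' <= _)%N); last first.
      apply: leq_trans h2 _; rewrite -mulnn; apply: leq_mul => //.
      case/andP: sN => h' _; apply: leq_trans h'; case: (s) => // s'; by rewrite -mulnn leq_pmulr.
    rewrite /harm [leRHS](@big_cat_nat _ _ _ (N * r ^ 3).+1) //= lerDr.
    by apply: sumr_ge0 => d _; rewrite invr_ge0.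
  move=> hh; apply: (@le_trans _ _ (48 * (N%:R / L%:R) * (2 * L%:R))).
    by apply: ler_wpM2l => //; rewrite mulr_ge0 // divr_ge0.
  by rewrite le_eqVlt; apply/orP; left; apply/eqP; field; rewrite gt_eqF.
rewrite (_ : (6 * k)%N%:R = 2 * (3 * k)%N%:R :> R); last by rewrite -natrM; congr (_%:R); clear; lia.
move: e1 e2 e3 f1 f2 f3 f4 h4; move: (U%:R + N%:R) => y; lra.
Qed.

End PerModulus.

(** Every prime power [p ^ e] exactly dividing [b] with [p < w] is at most [w]: this is clear for
    [e = 1], and for [e >= 2] the power of [p] with exponent [floor (e / 2)] is below [y], while its
    cube is at least [p ^ e]. *)
Lemma smooth_part_le (y w b : nat) : (0 < b)%N -> (y ^ 3 <= w)%N ->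
  (forall m, (y <= m)%N -> ~~ (m ^ 2 %| b)%N) ->
  (b`_[pred p | (p < w)%N] <= w ^ omega b)%N.
Proof.
move=> b0 yw sq.
have pw p : prime p -> (p < w)%N -> (p ^ logn p b <= w)%N.
  move=> pp pltw; set e := logn p b; have p0 := prime_gt0 pp.
  have dv : ((p ^ e./2) ^ 2 %| b)%N.
    rewrite -expnM; apply: dvdn_trans (pfactor_dvdnn p b); apply: dvdn_exp2l.
    by rewrite -/e muln2 -[leqRHS]odd_double_half leq_addl.
  case: (posnP e./2) => h.
    have : (e <= 1)%N by rewrite -[leqLHS]odd_double_half h addn0 leq_b1.
    by move=> e1; apply: leq_trans (ltnW pltw); rewrite -{2}(expn1 p) leq_pexp2l.
  have py : (p ^ e./2 < y)%N.
    by rewrite ltnNge; apply/negP => /sq; rewrite dv.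
  apply: leq_trans yw; apply: (@leq_trans ((p ^ e./2) ^ 3)); last by rewrite leq_exp2r // ltnW.
  rewrite -expnM leq_pexp2l // -[leqLHS]odd_double_half -muln2 (_ : 3 = 1 + 2)%N // mulnDr muln1 leq_add2r.
  by apply: leq_trans h; apply: leq_b1.
have w0 : (0 < w)%N.
  case: (posnP w) => // w0; move: yw; rewrite w0 leqn0 expn_eq0 => /andP[/eqP y0 _].
  by have := sq 1%N; rewrite y0 exp1n dvd1n => /(_ isT).
rewrite /partn; apply: (@leq_trans (\prod_(0 <= p < b.+1 | p \in primes b) w)).
  rewrite big_mkcond [leqRHS]big_mkcond; apply: leq_prod => p _; rewrite inE.
  case: (boolP (p \in primes b)) => pb; last first.
    case: ifP => // _; rewrite (_ : logn p b = 0)%N //.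
    by move: pb; rewrite mem_primes lognE b0 /= => /negbTE->.
  have pp : prime p by move: pb; rewrite mem_primes => /and3P[].
  case: ifP => pltw; first exact: pw.
  by [].
rewrite -big_filter big_const_seq count_predT iter_muln_1; apply: leq_pexp2l => //.
apply: uniq_leq_size; first by rewrite filter_uniq ?iota_uniq.
by move=> p; rewrite mem_filter => /andP[].
Qed.

(** * Summation over [b] *)

Section RoughSums.
Variable R : realType.
Variables (N l k0 : nat).
Hypothesis lN : (2 ^ l <= N < 2 ^ l.+1)%N.
Hypothesis l0 : (0 < l)%N.
Hypothesis k00 : (0 < k0 <= l)%N.

Let N0 : (0 < N)%N. Proof. by case/andP: lN => h _; apply: leq_trans h; rewrite expn_gt0. Qed.

Lemma ln_pow2_ge : l%:R / 2 <= ln (N%:R : R).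
Proof.
apply: (@le_trans _ _ (ln ((2 : R) ^+ l))); last first.
  rewrite ler_ln ?posrE ?exprn_gt0 ?ltr0n // -natrX ler_nat; by case/andP: lN.
rewrite lnXn // -[leRHS]mulr_natl; apply: ler_wpM2l => //; have := ln2_ge R; lra.
Qed.

Lemma harm_le_log : harm R N <= 2 * l%:R.
Proof.
apply: le_trans (harm_lt_pow2 R (proj2 (andP lN))) _; rewrite -natrM ler_nat.
by rewrite mul2n -addnn -addn1 leq_add2l.
Qed.

Lemma rough_recip_pow2_le k : (0 < k <= l)%N ->
  recip_sum R (rough_nat (2 ^ k)) N <= 6 * l%:R / k%:R.
Proof.
move=> /andP[k0' kl]; have kR : 0 < k%:R :> R by rewrite ltr0n.
have h1 := rough_recip_le R (2 ^ k) N.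
have h2 := harm_pow2_ge R k.
have h3 : harm R (N * (2 ^ k).-1) <= 3 * l%:R.
  apply: (@le_trans _ _ (l.+1 + k)%N%:R).
    apply: harm_lt_pow2; rewrite expnD; case/andP: lN => _ h.
    apply: (@leq_ltn_trans (N * 2 ^ k)); first by rewrite leq_mul2l leq_pred orbT.
    by rewrite ltn_pmul2r // expn_gt0.
  by rewrite -natrM ler_nat; move: kl l0; clear; lia.
have r0 := recip_sum_ge0 R (rough_nat (2 ^ k)) N.
rewrite ler_pdivlMr //.
have : recip_sum R (rough_nat (2 ^ k)) N * (k%:R / 2) <= 3 * l%:R.
  by apply: le_trans h3; apply: le_trans h1; apply: ler_wpM2l.
by rewrite mulrA; lra.
Qed.

Let f n := rough_pow (2 ^ k0) n.

(** By [sum_ln_le] and [ln N >= l / 2] the sum is at most [18 N / l] times its version weighted by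
    [1 / n]. The latter is bounded by a rough sum of size [6 l / k0] times the sum over [B], whence
    [18 * 6 = 108]. *)
Let main_sum (B : pred nat) (c : R) : (forall d n, (0 < n)%N -> (d %| n)%N -> B n -> B (n %/ d)%N) ->
  (forall d n, (0 < n)%N -> (d %| n)%N -> B n -> B d) ->
  recip_sum R B N <= c ->
  \sum_(1 <= n < N.+1) (f n * B n)%N%:R <= 108 * N%:R * c / k0%:R.
Proof.
case/andP: k00 => k1 k2 B1 B2 hc.
have lR : 0 < l%:R :> R by rewrite ltr0n.
have kR : 0 < k0%:R :> R by rewrite ltr0n.
pose F n : R := (f n * B n)%N%:R.
pose F' n : R := if (0 < n)%N then F n else 0.
have F0 n : 0 <= F' n by rewrite /F'; case: ifP.
have F2 p k m : prime p -> (0 < m)%N -> F' (p ^ k * m)%N <= 2 * F' m.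
  move=> pp m0; have pm : (0 < p ^ k * m)%N by rewrite muln_gt0 expn_gt0 prime_gt0.
  rewrite /F' m0 pm /F -natrM ler_nat mulnA; apply: leq_mul; first exact: rough_pow_mul.
  case Bpm : (B (p ^ k * m)%N) => //; by rewrite (B2 m _ pm _ Bpm) // dvdn_mull.
have H := sum_ln_le F0 F2 N0.
have e1 : \sum_(1 <= n < N.+1) F' n = \sum_(1 <= n < N.+1) F n.
  by rewrite big_nat [RHS]big_nat; apply: eq_bigr => n /andP[n1 _]; rewrite /F' n1.
have e2 : \sum_(1 <= n < N.+1) F' n / n%:R = \sum_(1 <= n < N.+1) F n / n%:R.
  by rewrite big_nat [RHS]big_nat; apply: eq_bigr => n /andP[n1 _]; rewrite /F' n1.
rewrite e1 e2 in H; set S := \sum_(1 <= n < N.+1) F n in H *.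
have S0 : 0 <= S by apply: sumr_ge0.
have c0 : 0 <= c by apply: le_trans hc; apply: recip_sum_ge0.
have H2 : \sum_(1 <= n < N.+1) F n / n%:R <= 6 * l%:R / k0%:R * c.
  apply: le_trans (rough_pow_recip_le R (2 ^ k0) N B1) _.
  by apply: ler_pM => //; rewrite ?recip_sum_ge0 // rough_recip_pow2_le.
have H3 : S * (l%:R / 2) <= 9 * N%:R * (6 * l%:R / k0%:R * c).
  apply: (@le_trans _ _ (S * ln N%:R)); first by apply: ler_wpM2l => //; exact: ln_pow2_ge.
  by apply: le_trans H _; apply: ler_wpM2l => //; rewrite mulr_ge0.
have lh : 0 < l%:R / 2 :> R by rewrite divr_gt0.
rewrite -(ler_pM2r lh); apply: le_trans H3 _.
by rewrite le_eqVlt; apply/orP; left; apply/eqP; field; rewrite gt_eqF.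
Qed.

Lemma rough_pow_sum_le : \sum_(1 <= n < N.+1) (f n)%:R <= 216 * N%:R * l%:R / k0%:R :> R.
Proof.
have := @main_sum xpredT (2 * l%:R); rewrite (eq_bigr (fun n => (f n)%:R)); last by move=> n _; rewrite muln1.
move=> H; apply: le_trans (H _ _ _) _ => //; first exact: harm_le_log.
by rewrite le_eqVlt; apply/orP; left; apply/eqP; ring.
Qed.

Lemma rough_pow_avoids_sum_le i k : (0 < i)%N -> (0 < k <= l)%N ->
  \sum_(1 <= n < N.+1) (f n * avoids (2 ^ i) (2 ^ k) n)%N%:R <=
  648 * N%:R * l%:R * i%:R ^+ 64 / k0%:R / k%:R :> R.
Proof.
move=> i0 kl; apply: le_trans (@main_sum (avoids (2 ^ i) (2 ^ k)) (i%:R ^+ 64 * (6 * l%:R / k%:R)) _ _ _) _.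
- move=> d n n0 dn; apply: all_primes_dvd => //; by rewrite -{2}(divnK dn) dvdn_mulr.
- by move=> d n n0 dn; apply: all_primes_dvd.
- apply: le_trans (avoids_recip_le _ _ _ _) _.
  by apply: ler_pM; rewrite ?recip_sum_ge0 //; [exact: smooth_recip_le | exact: rough_recip_pow2_le].
by rewrite le_eqVlt; apply/orP; left; apply/eqP; ring.
Qed.

End RoughSums.

Definition modulus_error (R : realType) (N s b : nat) : R :=
  \sum_(1 <= d < (s * b).+1) ((cnt N b d)%:R - N%:R / d%:R * (coprime d b)%:R).

Lemma size_divisors_le d n : (0 < n)%N -> (d %| n)%N -> (size (divisors d) <= size (divisors n))%N.
Proof.
move=> n0 dn; apply: uniq_leq_size; first exact: divisors_uniq.
by move=> e; rewrite -!dvdn_divisors ?(dvdn_gt0 n0 dn) // => /dvdn_trans; apply.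
Qed.

Lemma size_divisors_gt0 n : (0 < n)%N -> (0 < size (divisors n))%N.
Proof. by move=> n0; rewrite -has_predT; apply/seq.hasP; exists n => //; rewrite -dvdn_divisors. Qed.

Lemma sum_inv_sqr_tail (R : realType) m j : (0 < m)%N ->
  \sum_(m <= n < m + j) (n%:R ^+ 2)^-1 <= 2 / m%:R :> R.
Proof.
(* Telescoping, from [1 / x ^ 2 <= 2 / x - 2 / (x + 1)] for [x >= 1]. *)
move=> m0; apply: (@le_trans _ _ (2 / m%:R - 2 / (m + j)%N%:R)); last by rewrite gerBl divr_ge0.
elim: j => [|j IHj]; first by rewrite addn0 big_geq // subrr.
rewrite addnS big_nat_recr ?leq_addr //=.
have M : 1 <= (m + j)%N%:R :> R by rewrite ler1n addn_gt0 m0.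
apply: (@le_trans _ _ (2 / m%:R - 2 / (m + j)%N%:R + ((m + j)%N%:R ^+ 2)^-1)); first exact: lerD.
rewrite -addrA lerD2l -[(m + j).+1%:R]natr1; move: (m + j)%N%:R M => x x1.
rewrite -subr_ge0 (_ : _ - _ = (x - 1) / (x ^+ 2 * (x + 1))).
  by rewrite divr_ge0 ?subr_ge0 // mulr_ge0 ?exprn_ge0 //; lra.
by field; apply/andP; split; rewrite gt_eqF //; lra.
Qed.

(** The upper limit is chosen to satisfy both demands of [hyperbola]: it is at least [s b] and at
    least [N b ^ 2 + 1]. *)
Definition corner (N s b : nat) : nat :=
  (\sum_(1 <= d < (s * b).+1) \sum_(1 <= e < (s * b).+1) hit N b d e +
   \sum_((s * b).+1 <= d < (s * b + (N * b ^ 2 + 1)).+1)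
     \sum_((s * b).+1 <= e < (s * b + (N * b ^ 2 + 1)).+1) hit N b d e)%N.

(** * The errors summed over all moduli *)

Section TotalError.
Variable R : realType.
Variables (N s l L u k0 t : nat).
Hypothesis lN : (2 ^ l <= N < 2 ^ l.+1)%N.
Hypothesis sN : (s ^ 2 <= N < s.+1 ^ 2)%N.
Hypothesis hL : L = (l + 40)%N.
Hypothesis Lu : (L < 2 ^ u)%N.
Hypothesis k0l : (40 * u * k0 <= l <= 80 * u * k0)%N.
Hypothesis uk : (2100 * u <= k0)%N.
Hypothesis t0 : (0 < t)%N.
Hypothesis tl : (t ^ 5 <= l < t.+1 ^ 5)%N.

(** As [L < 2 ^ u], a prime [r >= y] meets the requirement [4 L ^ 692 <= r] of [box_count_level].
    The threshold [w = 2 ^ k0] lies roughly between [N ^ (1 / (80 u))] and [N ^ (1 / (40 u))], and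
    [2100 u <= k0] means [y ^ 3 <= w]. *)
Let y := (2 ^ (700 * u))%N.
Let w := (2 ^ k0)%N.
Let f := rough_pow w.
Let tau n := size (divisors n).
Let err b := `|modulus_error R N s b|.

Let N0 : (0 < N)%N. Proof. by case/andP: lN => h _; apply: leq_trans h; rewrite expn_gt0. Qed.
Let u0 : (0 < u)%N. Proof. by move: Lu; case: (u) => //; rewrite hL expn0 addnS. Qed.
Let l0 : (0 < l)%N.
Proof. by case/andP: tl => h _; apply: leq_trans h; rewrite expn_gt0 t0. Qed.
Let L32 : (32 <= L)%N. Proof. by rewrite hL; apply: leq_trans (leq_addl _ _). Qed.
Let k00 : (0 < k0)%N. Proof. by apply: leq_trans uk; rewrite muln_gt0 u0. Qed.
Let k0_le : (k0 <= l)%N.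
Proof. by case/andP: k0l => h _; apply: leq_trans h; rewrite leq_pmull // muln_gt0 u0. Qed.
Let lL : (l <= L)%N. Proof. by rewrite hL leq_addr. Qed.

Let Lpow j : (L ^ j <= 2 ^ (u * j))%N.
Proof. by rewrite expnM; case: j => // j; rewrite leq_exp2r // ltnW. Qed.

Let sb b : (b <= N)%N -> (s * b <= 2 ^ l.+1 * N)%N.
Proof.
move=> bN; apply: leq_mul => //; case/andP: lN => _ h; apply: leq_trans (ltnW h).
by case/andP: sN => h' _; apply: leq_trans h'; case: (s) => // s'; rewrite -mulnn leq_pmulr.
Qed.

Let crude_bound b : (0 < b <= N)%N -> (box_bound N 1 b s <= 93 * (N * tau b ^ 2))%N.
Proof.
move=> /andP[b0 bN]; have tau1 : (1 <= tau b)%N := size_divisors_gt0 b0.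
have sN' : (s <= N)%N.
  by case/andP: sN => h' _; apply: leq_trans h'; case: (s) => // s'; rewrite -mulnn leq_pmulr.
have omt : (2 ^ omega b <= tau b)%N by apply: two_pow_omega_le.
rewrite /box_bound muln1.
apply: (@leq_trans (9 * (N * tau b ^ 2) + 2 * tau b * (36 * N * tau b + 6 * N * tau b))); last first.
  by rewrite -mulnn; clear; lia.
apply: leq_add; first by rewrite leq_mul2l /= leq_pmulr // expn_gt0 tau1.
apply: leq_mul; first by rewrite leq_mul2l omt orbT.
by apply: leq_add; [rewrite leq_pmulr | rewrite leq_mul2r leq_mul2l sN' !orbT].
Qed.

(** Valid for every [b], by taking [b1 = 1]; exceptional moduli are rare enough to afford the lost
    factor [l] and the square of [tau]. *)
Let crude b : (0 < b <= N)%N -> err b <= 190 * N%:R * l%:R * (tau b ^ 2)%N%:R.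
Proof.
move=> /andP[b0 bN].
apply: le_trans (crude_error R b0 (coprime1n b) (esym (mul1n b)) bN sN (sb bN)) _.
set U := box_bound _ _ _ _.
have tau1 : (1 <= tau b)%N := size_divisors_gt0 b0.
have UT : (U <= 93 * (N * tau b ^ 2))%N by apply: crude_bound; rewrite b0.
have UR : U%:R <= 93 * (N%:R * (tau b ^ 2)%N%:R) :> R by rewrite -!natrM ler_nat.
have T1 : 1 <= (tau b ^ 2)%N%:R :> R by rewrite ler1n expn_gt0 tau1.
have NT : N%:R <= N%:R * (tau b ^ 2)%N%:R :> R by rewrite -[leLHS]mulr1; apply: ler_wpM2l.
have l1 : 1 <= l%:R :> R by rewrite ler1n.
rewrite -natr1.
set x := N%:R * (tau b ^ 2)%N%:R in UR NT *.
have x0 : 0 <= x by apply: mulr_ge0.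
apply: (@le_trans _ _ (x * l%:R + (2 * l%:R) * (94 * x))).
  apply: lerD; first by apply: le_trans NT _; rewrite -[leLHS]mulr1; apply: ler_wpM2l.
  apply: ler_pM; [by apply: addr_ge0 | by apply: addr_ge0 | lra | lra].
have : 0 <= x * l%:R by apply: mulr_ge0.
have -> : 190 * N%:R * l%:R * (tau b ^ 2)%N%:R = 190 * (x * l%:R) :> R by rewrite /x; ring.
by rewrite mulrCA mulrA -mulrA; lra.
Qed.

(** The three kinds of exceptional moduli. Excluding [many] and [square] keeps the [w]-smooth part
    of [b] small; excluding [square] also ensures that a prime factor [r >= y] divides [b] only
    once. *)
Let small b := (b * L ^ 6 < N)%N.
Let many b := (L ^ 10 < tau b)%N.
Let square b := has (fun m => m ^ 2 %| b)%N (index_iota y N.+1).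
Let good b := [&& ~~ small b, ~~ many b & ~~ square b].

(** Here [b1] is the [w]-smooth part of [b], at most [2 ^ (10 u k0)] because [omega b <= 10 u], and
    [tau b2 <= 2 ^ (10 u)]. The square of [b1 * tau b2] is then at most [2 ^ (40 u k0) <= N], so
    [b1 * tau b2 <= s]. *)
Let good_parts b : (0 < b <= N)%N -> good b ->
  exists b1 b2, [/\ coprime b1 b2, b = (b1 * b2)%N & (box_bound N b1 b2 s <= 93 * (f b * N))%N].
Proof.
move=> /andP[b0 bN] /and3P[g1 g2 g3].
pose pi : nat_pred := [pred p | (p < w)%N].
exists (b`_pi)%N, (b`_pi^')%N; split; first exact: coprime_partC.
  by rewrite partnC.
have e : (2 ^ omega b`_pi^' = f b)%N.
  rewrite /f /rough_pow /omega primes_part size_filter; congr (2 ^ _)%N.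
  by apply: eq_count => p; rewrite !inE -leqNgt.
have f1 : (0 < f b)%N by rewrite /f /rough_pow expn_gt0.
have sq m : (y <= m)%N -> ~~ (m ^ 2 %| b)%N.
  move=> ym; apply/negP => mb; move/seq.hasP: g3; case; exists m => //.
  rewrite mem_index_iota ym ltnS; apply: leq_trans bN; apply: leq_trans (dvdn_leq b0 mb).
  by case: (m) => // m'; rewrite -mulnn leq_pmulr.
have y3 : (y ^ 3 <= w)%N.
  rewrite /y /w -expnM leq_pexp2l //; apply: leq_trans uk; clear; lia.
have b1w := smooth_part_le b0 y3 sq.
rewrite /many -leqNgt in g2.
have om : (2 ^ omega b <= 2 ^ (u * 10))%N.
  by apply: leq_trans (Lpow 10); apply: leq_trans g2; apply: two_pow_omega_le.
rewrite leq_exp2l // in om.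
have b1 : (b`_pi <= 2 ^ (k0 * (u * 10)))%N.
  apply: leq_trans b1w _; rewrite /w -expnM leq_pexp2l // leq_mul2l om orbT //.
have t2 : (tau b`_pi^' <= 2 ^ (u * 10))%N.
  by apply: leq_trans (Lpow 10); apply: leq_trans g2; apply: size_divisors_le => //; apply: dvdn_part.
have bts : (b`_pi * tau b`_pi^' <= s)%N.
  rewrite -ltnS -(ltn_exp2r _ _ (isT : 0 < 2)%N); case/andP: sN => _; apply: leq_ltn_trans.
  case/andP: lN => h _; apply: leq_trans h.
  apply: (@leq_trans ((2 ^ (k0 * (u * 10)) * 2 ^ (u * 10)) ^ 2)); first by rewrite leq_exp2r // leq_mul.
  rewrite -expnD -expnM leq_pexp2l //; case/andP: k0l => h _; apply: leq_trans h.
  have : (u <= k0 * u)%N by rewrite leq_pmull.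
  rewrite (_ : 40 * u * k0 = 40 * (k0 * u))%N; last by rewrite -mulnA (mulnC u).
  rewrite mulnA; move: (k0 * u)%N; clear; lia.
rewrite /box_bound e.
apply: (@leq_trans (9 * (f b * N) + 2 * f b * (36 * N + 6 * N))); last by clear; lia.
apply: leq_add; first by rewrite leq_mul2l /= leq_pmull.
rewrite leq_mul2l; apply/orP; right; rewrite leq_add2l.
rewrite (_ : 6 * _ * s * _ = 6 * (b`_pi * tau b`_pi^' * s))%N; last by rewrite /tau; clear; lia.
rewrite leq_mul2l /=; case/andP: sN => h _; apply: leq_trans h; rewrite -mulnn leq_mul2r bts orbT //.
Qed.

Let hN : harm R (N ^ 2) <= 2 * L%:R.
Proof.
apply: (@le_trans _ _ (l.+1 * 2)%N%:R).
  apply: harm_lt_pow2; rewrite expnM ltn_exp2r //; by case/andP: lN.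
by rewrite -natrM ler_nat hL; clear; lia.
Qed.

(* A prime factor [r < 2 ^ k] of [b] leaves [O(k)] dyadic intervals to the crude
   bound. *)
Let level b k : (0 < b <= N)%N -> good b -> ~~ avoids y (2 ^ k) b ->
  err b <= 97 * N%:R + 564 * k%:R * (f b * N)%N%:R.
Proof.
move=> hb gb av; have [b1 [b2 [co b12 Ub]]] := good_parts hb gb.
case/andP: (hb) => b0 bN; case/and3P: gb => g1 g2 g3.
have [r] : exists2 r, r \in primes b & (y <= r < 2 ^ k)%N.
  move: av; rewrite /avoids -has_predC => /seq.hasP[r rb]; rewrite /= negbK => h; by exists r.
rewrite mem_primes => /and3P[pr _ rb] /andP[yr rk].
rewrite /many -leqNgt in g2; rewrite /small -leqNgt in g1.
pose n := (b %/ r)%N.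
have bnr : b = (n * r)%N by rewrite divnK.
have n0 : (0 < n)%N by rewrite divn_gt0 ?prime_gt0 // dvdn_leq.
have nr : coprime n r.
  rewrite coprime_sym prime_coprime //; apply/negP => rn; move/seq.hasP: g3; case; exists r.
    by rewrite mem_index_iota yr ltnS (leq_trans _ bN) // dvdn_leq.
  by rewrite bnr -mulnn dvdn_mul.
have Lr : (4 * (L ^ 346) ^ 2 <= r)%N.
  apply: leq_trans yr; rewrite -expnM; apply: (@leq_trans (2 ^ 2 * 2 ^ (u * (346 * 2)))).
    by rewrite leq_mul2l Lpow orbT.
  by rewrite -expnD leq_pexp2l //; move: u0; clear; lia.
have hom : (2 ^ omega b <= L ^ 10)%N by apply: leq_trans g2; apply: two_pow_omega_le.
apply: le_trans (good_error b0 co b12 bN sN n0 pr nr bnr L32 Lr (ltnW rk) g1 hN hom) _.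
rewrite lerD2l natrM (_ : 564 = 6 * 94 :> R); last by ring.
rewrite -!mulrA; apply: ler_wpM2l => //; rewrite mulrCA; apply: ler_wpM2l => //.
rewrite -natrD -natrM ler_nat; have : (N <= f b * N)%N by rewrite leq_pmull // /f /rough_pow expn_gt0.
by move: Ub; move: (f b * N)%N (box_bound _ _ _ _); clear; lia.
Qed.

(* As [l] is about [t ^ 5] and the [b] without prime factors in [[y, 2 ^ k)] have
   density about [1 / k], the three ranges of least prime factors cost [t ^ 2],
   [t ^ 4 / t ^ 2] and [t ^ 5 / t ^ 4]. *)
Let k1 := (t ^ 2)%N.
Let k2 := (t ^ 4)%N.
Let av k b : nat := avoids y (2 ^ k) b.

Let good_err b : (0 < b <= N)%N -> good b ->
  err b <= 97 * N%:R + 564 * N%:R * (k1%:R * (f b)%:R + k2%:R * (f b * av k1 b)%N%:R + 2 * l%:R * (f b * av k2 b)%N%:R).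
Proof.
move=> hb gb; have NR : 0 <= N%:R :> R by [].
case: (boolP (avoids y (2 ^ k1) b)) => a1; last first.
  apply: le_trans (level hb gb a1) _; rewrite lerD2l natrM.
  rewrite (_ : 564 * k1%:R * ((f b)%:R * N%:R) = 564 * N%:R * (k1%:R * (f b)%:R)); last by ring.
  by apply: ler_wpM2l; rewrite ?mulr_ge0 // -addrA lerDl addr_ge0 // mulr_ge0 // mulr_ge0.
case: (boolP (avoids y (2 ^ k2) b)) => a2; last first.
  apply: le_trans (level hb gb a2) _; rewrite lerD2l natrM.
  rewrite (_ : 564 * k2%:R * ((f b)%:R * N%:R) = 564 * N%:R * (k2%:R * (f b)%:R)); last by ring.
  apply: ler_wpM2l; rewrite ?mulr_ge0 // /av a1 muln1 addrAC lerDr addr_ge0 // mulr_ge0 // mulr_ge0 //.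
have [b1 [b2 [co b12 Ub]]] := good_parts hb gb.
case/andP: (hb) => b0 bN.
apply: le_trans (crude_error R b0 co b12 bN sN (sb bN)) _.
have f1 : (1 <= f b)%N by rewrite /f /rough_pow expn_gt0.
have U' : (box_bound N b1 b2 s)%:R + N%:R <= 94 * (N%:R * (f b)%:R) :> R.
  rewrite -natrD -!natrM ler_nat; have : (N <= N * f b)%N by rewrite leq_pmulr.
  by move: Ub; rewrite (mulnC (f b)); move: (N * f b)%N (box_bound _ _ _ _); clear; lia.
have NF : 0 <= N%:R * (f b)%:R :> R by apply: mulr_ge0.
apply: lerD; first by move: NR; lra.
rewrite /av a1 a2 !muln1.
apply: (@le_trans _ _ (2 * l%:R * (94 * (N%:R * (f b)%:R)))).
  apply: ler_pM => //; first by apply: addr_ge0.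
  by rewrite -natrM ler_nat; move: l0; clear; lia.
rewrite (_ : 564 * _ * _ = 564 * (k1%:R * (N%:R * (f b)%:R)) + 564 * (k2%:R * (N%:R * (f b)%:R)) +
   12 * l%:R * (94 * (N%:R * (f b)%:R))); last by ring.
have p1 : 0 <= k1%:R * (N%:R * (f b)%:R) :> R by apply: mulr_ge0.
have p2 : 0 <= k2%:R * (N%:R * (f b)%:R) :> R by apply: mulr_ge0.
have p3 : 0 <= l%:R * (94 * (N%:R * (f b)%:R)) :> R by rewrite mulr_ge0 // mulr_ge0.
by move: p1 p2 p3; lra.
Qed.

Let lR : 0 < l%:R :> R. Proof. by rewrite ltr0n. Qed.
Let tR : 1 <= t%:R :> R. Proof. by rewrite ler1n. Qed.
Let uR : 1 <= u%:R :> R. Proof. by rewrite ler1n. Qed.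
Let kR : 0 < k0%:R :> R. Proof. by rewrite ltr0n. Qed.

Let lk : l%:R / k0%:R <= 80 * u%:R :> R.
Proof. by rewrite ler_pdivrMr // -!natrM ler_nat; case/andP: k0l. Qed.

Let l_t5 : l%:R <= 32 * t%:R ^+ 5 :> R.
Proof.
rewrite -natrX -natrM ler_nat; case/andP: tl => _ h; apply: ltnW; apply: leq_trans h _.
rewrite (_ : 32 = 2 ^ 5)%N // -expnMn leq_exp2r // mul2n -addnn -addn1 leq_add2l //.
Qed.

Let k1l : (0 < k1 <= l)%N.
Proof.
rewrite expn_gt0 t0; case/andP: tl => h _; apply: leq_trans h; by rewrite leq_pexp2l.
Qed.
Let k2l : (0 < k2 <= l)%N.
Proof.
rewrite expn_gt0 t0; case/andP: tl => h _; apply: leq_trans h; by rewrite leq_pexp2l.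
Qed.

(** The power [u ^ 65] combines [l / k0 <= 80 u] with the exponent [64] of [smooth_recip_le], taken
    at [700 u], which also produces [c]. *)
Lemma good_total (c : R) : c = 700 ^+ 64 -> \sum_(1 <= b < N.+1 | good b) err b <=
  N%:R ^+ 2 * (97 + 564 * ((216 * 80) + (648 * 80 * 65) * c) * (u%:R ^+ 65 * t%:R ^+ 2)).
Proof.
move=> hc.
have kk : (0 < k0 <= l)%N by rewrite k00.
have S1 := rough_pow_sum_le R lN l0 kk.
have i0 : (0 < 700 * u)%N by rewrite muln_gt0 u0.
have S2 := rough_pow_avoids_sum_le R lN l0 kk i0 k1l.
have S3 := rough_pow_avoids_sum_le R lN l0 kk i0 k2l.
have t2 : 0 < t%:R ^+ 2 :> R by rewrite exprn_gt0 // (lt_le_trans ltr01).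
have c0 : 0 <= c by rewrite hc exprn_ge0.
have cu : ((700 * u)%N%:R : R) ^+ 64 = c * u%:R ^+ 64 by rewrite hc natrM exprMn.
rewrite cu in S2 S3.
apply: (@le_trans _ _ (\sum_(1 <= b < N.+1) (97 * N%:R + 564 * N%:R * (k1%:R * (f b)%:R +
   k2%:R * (f b * av k1 b)%N%:R + 2 * l%:R * (f b * av k2 b)%N%:R)))).
  rewrite big_mkcond [leLHS]big_nat [leRHS]big_nat; apply: ler_sum => b /andP[b1 bN].
  case: ifP => gb; first by apply: good_err => //; rewrite b1.
  have nn n m : 0 <= n%:R * m%:R :> R by apply: mulr_ge0.
  apply: addr_ge0; first by apply: mulr_ge0.
  apply: mulr_ge0; first by apply: mulr_ge0.
  apply: addr_ge0; first by apply: addr_ge0; apply: nn.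
  by apply: mulr_ge0 => //; apply: mulr_ge0.
rewrite big_split /= sumr_const_nat subn1 -mulr_sumr !big_split /= -!mulr_sumr.
have p1 : k1%:R * (\sum_(1 <= n < N.+1) (f n)%:R) <= N%:R * ((216 * 80) * (u%:R * t%:R ^+ 2)) :> R.
  apply: (@le_trans _ _ (k1%:R * (216 * N%:R * (80 * u%:R)))).
    apply: ler_wpM2l => //; apply: le_trans S1 _; rewrite -mulrA; apply: ler_wpM2l => //.
    by rewrite mulr_ge0.
  by rewrite /k1 natrX le_eqVlt; apply/orP; left; apply/eqP; ring.
have cu0 : 0 <= c * u%:R ^+ 64 by rewrite mulr_ge0 // exprn_ge0.
have p2 : k2%:R * (\sum_(1 <= n < N.+1) (f n * av k1 n)%N%:R) <= N%:R * ((648 * 80) * c * (u%:R ^+ 65 * t%:R ^+ 2)) :> R.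
  apply: (@le_trans _ _ (k2%:R * (648 * N%:R * (80 * u%:R) * (c * u%:R ^+ 64) / k1%:R))).
    apply: ler_wpM2l => //; apply: le_trans S2 _.
    rewrite ler_pM2r ?invr_gt0 ?ltr0n; last by case/andP: k1l.
    rewrite [leLHS]mulrAC; apply: ler_wpM2r => //; rewrite -[leLHS]mulrA; apply: ler_wpM2l => //.
    by rewrite mulr_ge0.
  rewrite /k1 /k2 !natrX le_eqVlt; apply/orP; left; apply/eqP.
  by rewrite (exprS u%:R 64); move: (u%:R ^+ 64) => U; field; rewrite gt_eqF // (lt_le_trans ltr01).
have p3 : 2 * l%:R * (\sum_(1 <= n < N.+1) (f n * av k2 n)%N%:R) <= N%:R * ((648 * 80 * 64) * c * (u%:R ^+ 65 * t%:R ^+ 2)) :> R.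
  apply: (@le_trans _ _ (64 * t%:R ^+ 5 * (648 * N%:R * (80 * u%:R) * (c * u%:R ^+ 64) / k2%:R))).
    apply: ler_pM => //; [by rewrite mulr_ge0 | by apply: sumr_ge0 | by move: l_t5; lra | ].
    apply: le_trans S3 _.
    rewrite ler_pM2r ?invr_gt0 ?ltr0n; last by case/andP: k2l.
    rewrite [leLHS]mulrAC; apply: ler_wpM2r => //; rewrite -[leLHS]mulrA; apply: ler_wpM2l => //.
    by rewrite mulr_ge0.
  apply: (@le_trans _ _ (N%:R * ((648 * 80 * 64) * c * (u%:R ^+ 65 * t%:R)))).
    rewrite /k2 natrX le_eqVlt; apply/orP; left; apply/eqP.
    by rewrite (exprS u%:R 64); move: (u%:R ^+ 64) => U; field; rewrite gt_eqF // (lt_le_trans ltr01).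
  apply: ler_wpM2l => //; apply: ler_wpM2l.
    by apply: mulr_ge0 => //; rewrite mulr_ge0 // mulr_ge0.
  apply: ler_wpM2l; first by rewrite exprn_ge0.
  by rewrite expr2 -[leLHS]mulr1; apply: ler_wpM2l => //; apply: le_trans tR.
have p4 : N%:R * ((216 * 80) * (u%:R * t%:R ^+ 2)) <= N%:R * ((216 * 80) * (u%:R ^+ 65 * t%:R ^+ 2)) :> R.
  apply: ler_wpM2l => //; apply: ler_wpM2l; first by rewrite mulr_ge0.
  apply: ler_wpM2r; first exact: ltW.
  by rewrite exprS -[leLHS]mulr1; apply: ler_wpM2l; rewrite ?exprn_ege1.
have e : N%:R ^+ 2 * (97 + 564 * ((216 * 80) + (648 * 80 * 65) * c) * (u%:R ^+ 65 * t%:R ^+ 2)) =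
  97 * N%:R * N%:R + 564 * N%:R * (N%:R * ((216 * 80) * (u%:R ^+ 65 * t%:R ^+ 2)) +
   N%:R * ((648 * 80) * c * (u%:R ^+ 65 * t%:R ^+ 2)) + N%:R * ((648 * 80 * 64) * c * (u%:R ^+ 65 * t%:R ^+ 2))).
  by move: (u%:R ^+ 65) => U; ring.
rewrite e; apply: lerD; first by rewrite -[leLHS]mulr_natr.
apply: ler_wpM2l; first by rewrite mulr_ge0.
by apply: lerD => //; apply: lerD => //; apply: le_trans p1 p4.
Qed.

Let T2 b : R := (tau b ^ 2)%N%:R.
Let harm_l : harm R N <= 2 * l%:R. Proof. exact: harm_le_log lN l0. Qed.
Let LR : l%:R <= L%:R :> R. Proof. by rewrite ler_nat. Qed.
Let L1 : 1 <= L%:R :> R. Proof. by rewrite ler1n (leq_trans _ L32). Qed.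
Let LX j k : (j <= k)%N -> l%:R ^+ j <= L%:R ^+ k :> R.
Proof.
move=> jk; apply: (@le_trans _ _ (L%:R ^+ j)); first by rewrite lerXn2r ?nnegrE.
by rewrite ler_weXn2l.
Qed.
Let LX0 k : 0 < L%:R ^+ k :> R. Proof. by rewrite exprn_gt0 // (lt_le_trans ltr01). Qed.

(** The second moment of [tau] costs [l ^ 3]; with the additional [l] this is absorbed by the
    shortening of the range by [L ^ 6]. *)
Let small_total : l%:R * (\sum_(1 <= b < N.+1 | small b) T2 b) <= 8 * N%:R.
Proof.
pose V := (N %/ L ^ 6)%N.
have VN : (V <= N)%N by apply: leq_div.
have : \sum_(1 <= b < N.+1 | small b) T2 b <= \sum_(1 <= b < V.+1) T2 b.
  rewrite (@big_cat_nat _ _ _ V.+1) //=.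
  rewrite [X in _ + X <= _]big_nat_cond [X in _ + X <= _]big1 ?addr0; last first.
    move=> b /andP[/andP[Vb _]]; rewrite /small ltnNge; case/negP.
    apply: ltnW; apply: leq_trans (ltn_ceil _ _) (_ : V.+1 * _ <= _)%N; last by rewrite leq_mul2r Vb orbT.
    by rewrite expn_gt0 (leq_trans _ L32).
  by rewrite big_mkcond; apply: ler_sum => b _; case: ifP.
have := (divisor_moments R 2 V).1.
set S := \sum_(1 <= b < V.+1) _ => S1 S2.
have S3 : S <= V%:R * (2 * l%:R) ^+ 3.
  apply: le_trans S1 _; apply: ler_wpM2l => //; apply: lerXn2r; rewrite ?nnegrE ?harm_ge0 ?mulr_ge0 //.
  exact: le_trans (harm_le R VN) harm_l.
apply: (@le_trans _ _ (l%:R * (V%:R * (2 * l%:R) ^+ 3))).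
  by apply: ler_wpM2l => //; apply: le_trans S2 _.
apply: (@le_trans _ _ (8 * (V%:R * l%:R ^+ 4))).
  by rewrite le_eqVlt; apply/orP; left; apply/eqP; ring.
apply: ler_wpM2l => //; apply: (@le_trans _ _ (V%:R * L%:R ^+ 6)); first by apply: ler_wpM2l => //; exact: LX.
by rewrite -natrX -natrM ler_nat leq_trunc_div.
Qed.

(** Rankin's device: the factor [tau b / L ^ 10], larger than [1] here, leads to the third moment,
    which costs only [l ^ 7]. *)
Let many_total : l%:R * (\sum_(1 <= b < N.+1 | many b) T2 b) <= 128 * N%:R.
Proof.
have h : L%:R ^+ 10 * \sum_(1 <= b < N.+1 | many b) T2 b <= \sum_(1 <= b < N.+1) (tau b ^ 3)%N%:R.
  rewrite mulr_sumr big_mkcond; apply: ler_sum => b _; case: ifP => // mb.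
  rewrite /T2 -natrX -natrM ler_nat (expnSr _ 2) mulnC leq_mul2l; apply/orP; right; exact: ltnW.
have S1 := (divisor_moments R 3 N).1.
have S3 : N%:R * harm R N ^+ (2 ^ 3).-1 <= N%:R * (2 * l%:R) ^+ 7.
  by apply: ler_wpM2l => //; apply: lerXn2r; rewrite ?nnegrE ?harm_ge0 ?mulr_ge0.
rewrite -(ler_pM2l (LX0 10)) mulrCA; apply: (@le_trans _ _ (l%:R * (N%:R * (2 * l%:R) ^+ 7))).
  by apply: ler_wpM2l => //; apply: le_trans h _; apply: le_trans S1 S3.
rewrite (_ : l%:R * _ = 128 * N%:R * l%:R ^+ 8); last by ring.
rewrite [leRHS]mulrC; apply: ler_wpM2l; first by rewrite mulr_ge0.
exact: LX.
Qed.

(** Multiples of some [m ^ 2] with [m >= y] have density at most [2 / y], and [y >= L ^ 21] beats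
    both the bound [L ^ 20] for [tau b ^ 2] and the factor [l]. *)
Let square_total : l%:R * (\sum_(1 <= b < N.+1 | ~~ many b && square b) T2 b) <= 2 * N%:R.
Proof.
have y0 : (0 < y)%N by rewrite /y expn_gt0.
have yR : 0 < y%:R :> R by rewrite ltr0n.
have h1 : (\sum_(1 <= b < N.+1) square b <= \sum_(y <= m < N.+1) N %/ m ^ 2)%N.
  apply: (@leq_trans (\sum_(1 <= b < N.+1) \sum_(y <= m < N.+1) (m ^ 2 %| b))).
    apply: leq_sum => b _; rewrite /square; case: (boolP (has _ _)) => // /seq.hasP[m mi mb].
    by rewrite (big_rem m) //= mb.
  rewrite exchange_big /= [leqLHS]big_nat [leqRHS]big_nat; apply: leq_sum => m /andP[my _].
  by rewrite count_dvd // expn_gt0 (leq_trans y0 my).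
have h2 : (\sum_(y <= m < N.+1) N %/ m ^ 2)%N%:R <= N%:R * (2 / y%:R) :> R.
  case: (leqP y N.+1) => yN; last by rewrite big_geq; [rewrite mulr_ge0 // divr_ge0 | exact: ltnW].
  have := sum_inv_sqr_tail R (N.+1 - y) y0; rewrite subnKC // => hs.
  apply: le_trans (ler_wpM2l (ler0n R N) hs); rewrite natr_sum mulr_sumr [leLHS]big_nat [leRHS]big_nat.
  apply: ler_sum => m /andP[my _]; have m0 : (0 < m)%N by apply: leq_trans my.
  rewrite ler_pdivlMr ?exprn_gt0 ?ltr0n // -natrX -natrM ler_nat; exact: leq_trunc_div.
have h3 : \sum_(1 <= b < N.+1 | ~~ many b && square b) T2 b <= L%:R ^+ 20 * (N%:R * (2 / y%:R)).
  apply: (@le_trans _ _ (L%:R ^+ 20 * (\sum_(1 <= b < N.+1) square b)%N%:R)); last first.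
    apply: ler_wpM2l; first exact: ltW.
    by apply: le_trans h2; rewrite ler_nat.
  rewrite natr_sum mulr_sumr big_mkcond; apply: ler_sum => b _.
  case: ifP => [/andP[mb ->]|_]; last by rewrite mulr_ge0 // ltW.
  rewrite mulr1 /T2 -natrX ler_nat (_ : 20 = 10 * 2)%N // expnM leq_exp2r //.
  by rewrite leqNgt.
have Ly : L%:R ^+ 21 <= y%:R :> R.
  rewrite -natrX ler_nat; apply: leq_trans (Lpow 21) _; rewrite /y leq_pexp2l // mulnC leq_mul2r orbT //.
apply: (@le_trans _ _ (L%:R * (L%:R ^+ 20 * (N%:R * (2 / y%:R))))).
  by apply: ler_pM => //; apply: sumr_ge0.
rewrite (_ : _ * _ = 2 * N%:R * (L%:R ^+ 21 / y%:R)); last by ring.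
rewrite -[leRHS]mulr1; apply: ler_wpM2l; first by rewrite mulr_ge0.
by rewrite ler_pdivrMr // mul1r.
Qed.

Let bad_sum : l%:R * (\sum_(1 <= b < N.+1 | ~~ good b) T2 b) <= 138 * N%:R.
Proof.
have h : \sum_(1 <= b < N.+1 | ~~ good b) T2 b <= \sum_(1 <= b < N.+1 | small b) T2 b +
   \sum_(1 <= b < N.+1 | many b) T2 b + \sum_(1 <= b < N.+1 | ~~ many b && square b) T2 b.
  rewrite big_mkcond [X in X + _ + _]big_mkcond [X in _ + X + _]big_mkcond [X in _ + _ + X]big_mkcond -!big_split.
  apply: ler_sum => b _ /=; have T0 : 0 <= T2 b by [].
  by rewrite /good; case: (small b); case: (many b); case: (square b) => /=; move: T0; lra.
apply: le_trans (ler_wpM2l (ltW lR) h) _; rewrite !mulrDr.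
by move: small_total many_total square_total; lra.
Qed.

Lemma bad_total : \sum_(1 <= b < N.+1 | ~~ good b) err b <= (190 * 138) * N%:R ^+ 2.
Proof.
apply: (@le_trans _ _ (190 * N%:R * (l%:R * \sum_(1 <= b < N.+1 | ~~ good b) T2 b))).
  rewrite !mulr_sumr big_nat_cond [leRHS]big_nat_cond; apply: ler_sum => b /andP[/andP[b1 bN] _].
  by rewrite mulrA; apply: crude; rewrite b1.
rewrite (_ : (190 * 138) * N%:R ^+ 2 = 190 * N%:R * (138 * N%:R)); last by ring.
by apply: ler_wpM2l; first by rewrite mulr_ge0.
Qed.

Lemma total_error (c : R) : c = 700 ^+ 64 -> \sum_(1 <= b < N.+1) err b <= 
  ((97 + 190 * 138) + 564 * ((216 * 80) + (648 * 80 * 65) * c)) * (N%:R ^+ 2 * (u%:R ^+ 65 * t%:R ^+ 2)).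
Proof.
move=> hc; rewrite (bigID good) /=; apply: le_trans (lerD (good_total hc) bad_total) _.
have X1 : 1 <= u%:R ^+ 65 * t%:R ^+ 2 :> R.
  by rewrite -!natrX -natrM ler1n muln_gt0 !expn_gt0 u0 t0.
have N2 : 0 <= N%:R ^+ 2 :> R by rewrite exprn_ge0.
move: (u%:R ^+ 65 * t%:R ^+ 2) X1 => X X1.
have : N%:R ^+ 2 * 1 <= N%:R ^+ 2 * X by apply: ler_wpM2l.
by move: (N%:R ^+ 2) => Y; lra.
Qed.

Let corner_le b b1 b2 : (0 < b <= N)%N -> coprime b1 b2 -> b = (b1 * b2)%N ->
  (corner N s b <= 2 * box_bound N b1 b2 s)%N.
Proof.
move=> /andP[b0 bN] co hb; rewrite /corner mul2n -addnn; apply: leq_add.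
  exact: (corner_low b0 co hb bN sN).
exact: (corner_high b0 co hb bN sN).
Qed.

(** Each corner is a single box, so a good modulus costs a multiple of [N f b] with no factor
    counting intervals, and [f] has average [O(u)]. *)
Lemma corner_total : \sum_(1 <= b < N.+1) (corner N s b)%:R <=
  (186 * 216 * 80 + 190 * 138) * (N%:R ^+ 2 * (u%:R ^+ 65 * t%:R ^+ 2)) :> R.
Proof.
have u64 : u%:R <= u%:R ^+ 65 * t%:R ^+ 2 :> R.
  rewrite -[leLHS]mulr1; apply: ler_pM => //; last by rewrite exprn_ege1.
  by rewrite exprS -[leLHS]mulr1; apply: ler_wpM2l; rewrite ?exprn_ege1.
have X1 : 1 <= u%:R ^+ 65 * t%:R ^+ 2 :> R by apply: le_trans u64.
have G : \sum_(1 <= b < N.+1 | good b) (corner N s b)%:R <= 186 * N%:R * \sum_(1 <= b < N.+1) (f b)%:R :> R.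
  rewrite mulr_sumr big_mkcond [leLHS]big_nat [leRHS]big_nat; apply: ler_sum => b /andP[b1 bN].
  case: ifP => gb; last by apply: mulr_ge0 => //; apply: mulr_ge0.
  have hb : (0 < b <= N)%N by rewrite b1.
  have [c1 [c2 [co b12 Ub]]] := good_parts hb gb.
  rewrite -!natrM ler_nat; apply: leq_trans (corner_le hb co b12) _.
  by move: Ub; rewrite -(mulnA 186) (mulnC N); move: (f b * N)%N (box_bound _ _ _ _); clear; lia.
have B : \sum_(1 <= b < N.+1 | ~~ good b) (corner N s b)%:R <= 190 * N%:R * (138 * N%:R) :> R.
  apply: (@le_trans _ _ (190 * N%:R * (l%:R * \sum_(1 <= b < N.+1 | ~~ good b) T2 b))); last first.
    by apply: ler_wpM2l; first by rewrite mulr_ge0.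
  rewrite !mulr_sumr big_nat_cond [leRHS]big_nat_cond; apply: ler_sum => b /andP[/andP[b1 bN] _].
  have hb : (0 < b <= N)%N by rewrite b1.
  have := leq_trans (corner_le hb (coprime1n b) (esym (mul1n b))) (leq_mul (leqnn 2) (crude_bound hb)).
  rewrite /T2 -!natrM ler_nat => /leq_trans; apply.
  rewrite (_ : 190 * N * (l * tau b ^ 2) = 190 * l * (N * tau b ^ 2))%N; last by clear; lia.
  rewrite mulnA leq_mul2r; apply/orP; right; by move: l0; clear; lia.
rewrite (bigID good) /=; apply: le_trans (lerD G B) _.
have kk : (0 < k0 <= l)%N by rewrite k00.
have S1 := rough_pow_sum_le R lN l0 kk.
have S1' : \sum_(1 <= b < N.+1) (f b)%:R <= 216 * N%:R * (80 * u%:R) :> R.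
  apply: le_trans S1 _; rewrite -mulrA; apply: ler_wpM2l => //; by rewrite mulr_ge0.
have S2 : 186 * N%:R * \sum_(1 <= b < N.+1) (f b)%:R <= 186 * N%:R * (216 * N%:R * (80 * u%:R)) :> R.
  by apply: ler_wpM2l => //; rewrite mulr_ge0.
have N2 : 0 <= N%:R ^+ 2 :> R by rewrite exprn_ge0.
move: (u%:R ^+ 65 * t%:R ^+ 2) u64 X1 => X uX X1.
have e1 : N%:R ^+ 2 * 1 <= N%:R ^+ 2 * X by apply: ler_wpM2l.
have e2 : N%:R ^+ 2 * u%:R <= N%:R ^+ 2 * X by apply: ler_wpM2l.
rewrite (_ : 186 * N%:R * (216 * N%:R * (80 * u%:R)) = (186 * 216 * 80) * (N%:R ^+ 2 * u%:R)) in S2; last by ring.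
rewrite (_ : 190 * N%:R * (138 * N%:R) = (190 * 138) * (N%:R ^+ 2 * 1)); last by ring.
have g1 : 0 <= 186 * 216 * 80 :> R by rewrite mulr_ge0 // mulr_ge0.
have g2 : 0 <= 190 * 138 :> R by rewrite mulr_ge0.
move: (186 * 216 * 80) (190 * 138) g1 g2 S2 => g h g0 h0 S2.
rewrite [leRHS]mulrDl; apply: lerD; last exact: ler_wpM2l.
by apply: le_trans S2 _; apply: ler_wpM2l.
Qed.

End TotalError.

(** * The main term *)

Section Moebius.
Variable R : realType.

Definition squarefull_at n := has (fun p => p ^ 2 %| n)%N (primes n).
Definition moebius n : R := if squarefull_at n then 0 else (-1) ^+ omega n.

Lemma squarefull_atP n : (0 < n)%N ->
  reflect (exists2 p, prime p & (p ^ 2 %| n)%N) (squarefull_at n).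
Proof.
move=> n0; apply: (iffP idP) => [/seq.hasP[p]|[p pp pn]].
  by rewrite mem_primes => /andP[pp _] pn; exists p.
apply/seq.hasP; exists p => //; rewrite mem_primes pp n0 /=.
by apply: dvdn_trans pn; rewrite -mulnn dvdn_mulr.
Qed.

Lemma moebius_pmul p m : prime p -> (0 < m)%N ->
  moebius (p * m) = if (p %| m)%N then 0 else - moebius m.
Proof.
move=> pp m0; have pm0 : (0 < p * m)%N by rewrite muln_gt0 prime_gt0.
rewrite /moebius; case: ifP => [|sf].
  case: (boolP (p %| m)%N) => // npm /(squarefull_atP pm0)[r pr rpm].
  suff -> : squarefull_at m by rewrite oppr0.
  apply/(squarefull_atP m0); exists r => //.
  have [e|rp] := eqVneq r p.
    by move: rpm; rewrite e -mulnn dvdn_pmul2l ?prime_gt0 // (negbTE npm).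
  move: rpm; rewrite Gauss_dvdr // coprimeXl // prime_coprime // dvdn_prime2 //.
case: (boolP (p %| m)%N) => pm.
  by case/negP: sf; apply/(squarefull_atP pm0); exists p; rewrite // -mulnn dvdn_pmul2l ?prime_gt0.
case: ifP => [/(squarefull_atP m0)[r pr rm]|_].
  by case/negP: sf; apply/(squarefull_atP pm0); exists r => //; apply: dvdn_mull.
by have := @omega_pmul p 1 m pp isT m0 pm; rewrite expn1 /omega => /perm_size ->; rewrite exprS mulN1r.
Qed.

Lemma moebius_le1 n : `|moebius n| <= 1.
Proof. by rewrite /moebius; case: ifP; rewrite ?normr0 ?ler01 // normrX normrN1 expr1n. Qed.

(** With [p] the least prime factor of [n], the divisors [g] prime to [p] cancel against the
    divisors [p g]; those divisible by [p ^ 2] contribute zero. *)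
Lemma sum_moebius V n : (0 < n <= V)%N ->
  \sum_(1 <= g < V.+1 | (g %| n)%N) moebius g = (n == 1)%N%:R.
Proof.
move=> /andP[n0 nV].
have -> : \sum_(1 <= g < V.+1 | (g %| n)%N) moebius g = \sum_(1 <= g < n.+1 | (g %| n)%N) moebius g.
  rewrite (@big_cat_nat _ _ _ n.+1) //= [X in _ + X]big_nat_cond [X in _ + X]big1 ?addr0 //.
  by move=> g /andP[/andP[ng _]] /(dvdn_leq n0); rewrite leqNgt ng.
have [->|n1] := eqVneq n 1%N; first by rewrite big_mkcond big_nat1 dvdnn /moebius /= expr0.
have n2 : (1 < n)%N by rewrite ltn_neqAle eq_sym n1.
set p := pdiv n; have pp : prime p := pdiv_prime n2; have pn : (p %| n)%N := pdiv_dvd n.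
have p0 := prime_gt0 pp.
rewrite (bigID (fun g => p %| g)%N) /=.
pose F g := if (g %| n %/ p)%N && ~~ (p %| g)%N then moebius g else 0.
have -> : \sum_(1 <= g < n.+1 | (g %| n)%N && (p %| g)%N) moebius g = - \sum_(1 <= g < (n %/ p).+1) F g.
  rewrite (eq_bigl (fun g => (p %| g)%N && (g %| n)%N)); last by move=> g; rewrite andbC.
  rewrite big_mkcondr sum_multiples // -sumrN big_nat [RHS]big_nat; apply: eq_bigr => m /andP[m1 _].
  rewrite -{1}(divnK pn) [(n %/ p * p)%N]mulnC dvdn_pmul2l // /F moebius_pmul //.
  by case: (_ %| _)%N; case: (_ %| _)%N; rewrite /= ?oppr0.
have -> : \sum_(1 <= g < n.+1 | (g %| n)%N && ~~ (p %| g)%N) moebius g = \sum_(1 <= g < n.+1) F g.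
  rewrite big_mkcond; apply: eq_bigr => g _; rewrite /F.
  case: (boolP (p %| g)%N) => pg; first by rewrite !andbF.
  rewrite -{1}(divnK pn) Gauss_dvdl // coprime_sym prime_coprime //.
rewrite [X in _ + X](@big_cat_nat _ _ _ (n %/ p).+1) //=; last by rewrite ltnS leq_div.
rewrite addrA addNr add0r big_nat big1 // => g /andP[ng _]; rewrite /F.
case: ifP => // /andP[gn _]; exfalso; move: ng; rewrite ltnNge; case/negP.
by apply: dvdn_leq gn; rewrite divn_gt0 // dvdn_leq.
Qed.

End Moebius.

Section LogBounds.
Variable R : realType.

Lemma ln_succ n : (0 < n)%N -> (n.+1)%:R^-1 <= ln (n.+1%:R : R) - ln n%:R <= n%:R^-1.
Proof.
move=> n0; have nR : 0 < n%:R :> R by rewrite ltr0n.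
have mR : 0 < n.+1%:R :> R by rewrite ltr0n.
apply/andP; split.
  rewrite -[leRHS]opprB lerNr -ln_div ?posrE //.
  have -> : n%:R / n.+1%:R = 1 + - n.+1%:R^-1 :> R.
    by rewrite -[X in X / _](addrK 1) natr1 mulrBl mulfV ?gt_eqF // mul1r.
  apply: le_ln1Dx; rewrite ltrN2 invf_lt1 // ltr1n //.
rewrite -ln_div ?posrE // -natr1 mulrDl mulfV ?gt_eqF // mul1r; apply: le_ln1Dx.
by apply: lt_trans (_ : 0 < _); rewrite ?invr_gt0 // ltrN10.
Qed.

Lemma harm_bounds n : (0 < n)%N -> ln (n%:R : R) <= harm R n <= 1 + ln n%:R.
Proof.
case: n => // n _; elim: n => [|n /andP[h1 h2]].
  by rewrite /harm big_nat1 ln1 invr1 addr0 lexx ler01.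
have -> : harm R n.+2 = harm R n.+1 + n.+2%:R^-1 by rewrite /harm big_nat_recr.
have /andP[s1 s2] := ln_succ (ltn0Sn n).
apply/andP; split; last by move: h2 s1; move: (n.+2%:R^-1) (ln n.+1%:R) (ln n.+2%:R) => x a b; lra.
suff : ln (n.+2%:R : R) <= harm R n.+1 by move=> h; apply: le_trans h _; rewrite lerDl invr_ge0.
elim: (n) => [|m IH].
  by rewrite /harm big_nat1 invr1; apply: le_trans (_ : ln (1 + 1) <= 1); [rewrite -natr1 | apply: le_ln1Dx; lra].
have -> : harm R m.+2 = harm R m.+1 + m.+2%:R^-1 by rewrite /harm big_nat_recr.
have /andP[_ s3] := ln_succ (ltn0Sn m.+1); move: IH s3; move: (m.+2%:R^-1) (ln m.+2%:R) (ln m.+3%:R) => x a b; lra.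
Qed.

Lemma sum_ln_bounds x : (0 < x)%N ->
  x%:R * ln (x%:R : R) - x%:R <= \sum_(1 <= b < x.+1) ln (b%:R : R) <= x%:R * ln x%:R.
Proof.
case: x => // x _; elim: x => [|x /andP[h1 h2]].
  by rewrite big_nat1 ln1 mulr0 sub0r lexx andbT lerN10.
have xR : 0 < x.+1%:R :> R by rewrite ltr0n.
have /andP[s1 s2] := ln_succ (ltn0Sn x).
rewrite big_nat_recr //= -[x.+2%:R]natr1.
rewrite -[x.+2%:R]natr1 in s1 s2.
have : x.+1%:R * (ln (x.+1%:R + 1) - ln x.+1%:R) <= 1 :> R.
  by rewrite -[leRHS](@mulfV _ x.+1%:R) ?gt_eqF //; apply: ler_wpM2l => //; exact: ltW.
have : 0 <= x.+1%:R * (ln (x.+1%:R + 1) - ln x.+1%:R) :> R.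
  apply: mulr_ge0; first exact: ltW.
  apply: le_trans s1; rewrite invr_ge0; lra.
move: h1 h2; rewrite mulrBr mulrDl mul1r.
by move=> *; apply/andP; split; lra.
Qed.

Lemma sum_ln_sqr_le V : \sum_(1 <= g < V.+1) ln (g%:R : R) / g%:R ^+ 2 <= 4.
Proof.
(* A telescoping majorant: the subtracted function is modelled on the tail integral
   [(ln x + 1) / x], with slack that makes its decrement dominate each term. *)
suff : \sum_(1 <= g < V.+1) ln (g%:R : R) / g%:R ^+ 2 <= 4 - (2 * ln (V.+1%:R : R) + 4) / V.+1%:R.
  move/le_trans; apply; rewrite gerBl divr_ge0 // addr_ge0 // mulr_ge0 // ln_ge0 // ler1n //.
elim: V => [|V IHV]; first by rewrite big_geq // ln1 mulr0 add0r divr1 subrr.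
rewrite big_nat_recr //=; apply: le_trans (lerD IHV (lexx _)) _.
have /andP[_ s2] := ln_succ (ltn0Sn V).
rewrite -[V.+2%:R]natr1 in s2 *.
have x1 : 1 <= V.+1%:R :> R by rewrite ler1n.
have l0 : 0 <= ln (V.+1%:R : R) by apply: ln_ge0.
move: (V.+1%:R : R) (ln (V.+1%:R + 1)) (ln V.+1%:R) x1 l0 s2 => x m l x1 l0 s2.
have x0 : 0 < x by lra.
rewrite -addrA lerD2l -subr_ge0.
have h : (2 * m + 4) / (x + 1) <= (2 * l + 2 / x + 4) / (x + 1).
  by rewrite ler_pM2r ?invr_gt0; [lra | lra].
apply: (@le_trans _ _ (- ((2 * l + 2 / x + 4) / (x + 1)) + (2 * l + 4) / x - l / x ^+ 2)); last by lra.
have -> : - ((2 * l + 2 / x + 4) / (x + 1)) + (2 * l + 4) / x - l / x ^+ 2 =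
   (l * (x - 1) + 2 * x) / (x ^+ 2 * (x + 1)).
  by field; apply/andP; split; rewrite gt_eqF //; lra.
by rewrite divr_ge0 // ?mulr_ge0 ?exprn_ge0 ?addr_ge0 ?mulr_ge0 //; lra.
Qed.

End LogBounds.

Lemma zeta2_bounds (R : realType) m :
  \sum_(1 <= n < m.+1) (n%:R ^+ 2)^-1 <= zeta (2 : R) <=
  \sum_(1 <= n < m.+1) (n%:R ^+ 2)^-1 + 2 / m.+1%:R.
Proof.
pose u N : R := \sum_(1 <= n < N) (n%:R ^+ 2)^-1.
have -> : zeta (2 : R) = limn u.
  rewrite /zeta; congr (limn _); apply/funext => N; apply: eq_bigr => n _.
  by rewrite powRN powR_mulrn.
have le_tail N : u N <= u m.+1 + 2 / m.+1%:R.
  case: (leqP N m.+1) => h.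
    apply: (@le_trans _ _ (u m.+1)); last by rewrite lerDl divr_ge0.
    case: (posnP N) => [->|N0]; first by rewrite [leLHS]/u big_geq // sumr_ge0 // => n _; rewrite invr_ge0 exprn_ge0.
    rewrite /u [leRHS](@big_cat_nat _ _ _ N) //= lerDl sumr_ge0 // => n _; by rewrite invr_ge0 exprn_ge0.
  rewrite /u (@big_cat_nat _ _ _ m.+1) //=; last exact: ltnW.
  by rewrite lerD2l -(subnKC (ltnW h)); apply: sum_inv_sqr_tail.
have nd : nondecreasing_seq u.
  apply/nondecreasing_seqP => N; case: N => [|N]; first by rewrite /u !big_geq.
  by rewrite /u [leRHS]big_nat_recr //= lerDl invr_ge0 exprn_ge0.
have cu : cvgn u.
  apply: nondecreasing_is_cvgn => //; exists (u m.+1 + 2 / m.+1%:R) => _ [N _ <-]; exact: le_tail.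
apply/andP; split; first exact: nondecreasing_cvgn_le.
by apply: limr_le => //; apply: nearW.
Qed.

(** * The harmonic sum over coprime pairs *)

Section CoprimeSum.
Variable R : realType.
Variables (s V : nat).
Hypothesis s0 : (0 < s)%N.
Hypothesis V0 : (0 < V)%N.
Let mu := moebius R.
Let F x : R := \sum_(1 <= b < x.+1) harm R (s * b).
Let z : R := zeta 2.
Let Lam : R := ln (s * V)%N%:R.

Lemma coprime_sum_moebius :
  \sum_(1 <= b < V.+1) \sum_(1 <= d < (s * b).+1) (coprime d b)%:R / d%:R =
  \sum_(1 <= g < V.+1) mu g / g%:R * F (V %/ g).
Proof.
transitivity (\sum_(1 <= b < V.+1) \sum_(1 <= d < (s * b).+1) \sum_(1 <= g < V.+1)
   (if (g %| d)%N && (g %| b)%N then mu g / d%:R else 0)).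
  rewrite big_nat [RHS]big_nat; apply: eq_bigr => b /andP[b1 bV].
  rewrite big_nat [RHS]big_nat; apply: eq_bigr => d /andP[d1 _].
  have gb : (0 < gcdn d b <= V)%N.
    apply/andP; split; first by rewrite gcdn_gt0 d1.
    by apply: (@leq_trans b) => //; rewrite dvdn_leq // dvdn_gcdr.
  rewrite /coprime -(sum_moebius R gb) mulr_suml big_mkcond; apply: eq_bigr => g _.
  by rewrite dvdn_gcd; case: ifP => //; rewrite mul0r.
transitivity (\sum_(1 <= b < V.+1) \sum_(1 <= g < V.+1 | (g %| b)%N)
   \sum_(1 <= d < (s * b).+1 | (g %| d)%N) mu g / d%:R).
  apply: eq_bigr => b _; rewrite exchange_big /= [RHS]big_mkcond; apply: eq_bigr => g _.
  case: ifP => gb; last by rewrite big1 // => d _; rewrite andbF.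
  by rewrite [RHS]big_mkcond; apply: eq_bigr => d _; rewrite andbT.
rewrite (exchange_big_dep xpredT) //= big_nat [RHS]big_nat; apply: eq_bigr => g /andP[g1 _].
rewrite sum_multiples // /F mulr_sumr; apply: eq_bigr => b _.
rewrite sum_multiples // mulnCA mulKn // /harm mulr_sumr; apply: eq_bigr => d _.
by rewrite natrM invfM mulrA.
Qed.

Let F_near x : (0 < x)%N -> `|F x - x%:R * ln (s * x)%N%:R| <= x%:R.
Proof.
move=> x0; have sR : 0 < s%:R :> R by rewrite ltr0n.
have xR : 0 < x%:R :> R by rewrite ltr0n.
have e : \sum_(1 <= b < x.+1) ln ((s * b)%N%:R : R) = x%:R * ln s%:R + \sum_(1 <= b < x.+1) ln b%:R.
  have -> : x%:R * ln s%:R = \sum_(1 <= b < x.+1) ln s%:R :> R by rewrite sumr_const_nat subn1 mulr_natl.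
  rewrite -big_split [LHS]big_nat [RHS]big_nat; apply: eq_bigr => b /andP[b1 _].
  by rewrite natrM lnM // posrE ltr0n.
have lo : \sum_(1 <= b < x.+1) ln ((s * b)%N%:R : R) <= F x.
  rewrite /F [leLHS]big_nat [leRHS]big_nat; apply: ler_sum => b /andP[b1 _].
  have sb : (0 < s * b)%N by rewrite muln_gt0 s0.
  by case/andP: (harm_bounds R sb).
have hi : F x <= x%:R + \sum_(1 <= b < x.+1) ln ((s * b)%N%:R : R).
  have -> : x%:R = \sum_(1 <= b < x.+1) 1 :> R by rewrite sumr_const_nat subn1.
  rewrite -big_split /F [leLHS]big_nat [leRHS]big_nat; apply: ler_sum => b /andP[b1 _].
  have sb : (0 < s * b)%N by rewrite muln_gt0 s0.
  by case/andP: (harm_bounds R sb).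
have /andP[f1 f2] := sum_ln_bounds R x0.
rewrite natrM lnM ?posrE // mulrDr ler_norml.
move: lo hi f1 f2; rewrite e; move: (\sum_(_ <= _ < _) ln _) (F x) (x%:R * ln s%:R) (x%:R * ln x%:R) => *.
by apply/andP; split; lra.
Qed.

Let VR : 0 < V%:R :> R. Proof. by rewrite ltr0n. Qed.
Let sR : 1 <= s%:R :> R. Proof. by rewrite ler1n. Qed.
Let LamE : Lam = ln s%:R + ln V%:R.
Proof. by rewrite /Lam natrM lnM // posrE ?ltr0n. Qed.
Let Lam0 : 0 <= Lam. Proof. by apply: ln_ge0; rewrite ler1n muln_gt0 s0. Qed.

(** Beside the error of [F_near], the rounding of [V / g] to an integer changes the factor in front
    of the logarithm by at most [1], and this costs at most [Lam + 1]. *)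
Let F_quotient g : (0 < g <= V)%N ->
  `|F (V %/ g) - V%:R / g%:R * (Lam - ln g%:R)| <= V%:R / g%:R + (Lam + 1).
Proof.
move=> /andP[g0 gV]; have gR : 1 <= g%:R :> R by rewrite ler1n.
set x := (V %/ g)%N; have x0 : (0 < x)%N by rewrite divn_gt0.
have xR : 0 < x%:R :> R by rewrite ltr0n.
pose v : R := V%:R / g%:R.
have g0R : 0 < g%:R :> R by rewrite ltr0n.
have xv : x%:R <= v by rewrite /v ler_pdivlMr // -natrM ler_nat leq_trunc_div.
have vx : v <= x%:R + 1 by rewrite /v ler_pdivrMr // natr1 -natrM ler_nat ltnW // ltn_ceil.
have v0 : 0 < v by apply: lt_le_trans xv.
have lnv : Lam - ln g%:R = ln s%:R + ln v.
  by rewrite LamE /v ln_div ?posrE // addrA.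
have lns : 0 <= ln s%:R :> R by apply: ln_ge0.
have lng : 0 <= ln g%:R :> R by apply: ln_ge0.
have lv0 : 0 <= ln v by apply: ln_ge0; apply: le_trans xv; rewrite ler1n.
have xlx : ln (x%:R : R) <= ln v by rewrite ler_ln ?posrE.
have d1 : x%:R * (ln v - ln x%:R) <= 1.
  rewrite -ln_div ?posrE //.
  have -> : v / x%:R = 1 + (v - x%:R) / x%:R by field; rewrite gt_eqF.
  apply: (@le_trans _ _ (x%:R * ((v - x%:R) / x%:R))).
    apply: ler_wpM2l; first exact: ltW.
    apply: le_ln1Dx; apply: lt_le_trans (_ : 0 <= _); first by rewrite ltrN10.
    by rewrite divr_ge0 ?subr_ge0 // ltW.
  rewrite mulrCA mulfV ?gt_eqF // mulr1; lra.
have := F_near x0; rewrite natrM lnM ?posrE //; last by apply: lt_le_trans sR.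
rewrite -/v lnv !ler_norml => /andP[f1 f2].
have p1 : 0 <= x%:R * (ln v - ln x%:R) by apply: mulr_ge0; [exact: ltW | lra].
have p2 : 0 <= (v - x%:R) * (ln s%:R + ln v) by apply: mulr_ge0; lra.
have p3 : (v - x%:R) * (ln s%:R + ln v) <= Lam.
  apply: (@le_trans _ _ (1 * (ln s%:R + ln v))); first by apply: ler_wpM2r; lra.
  by rewrite mul1r -lnv; lra.
have e : v * (ln s%:R + ln v) = (v - x%:R) * (ln s%:R + ln v) + x%:R * (ln v - ln x%:R) + x%:R * (ln s%:R + ln x%:R) by ring.
rewrite e; move: f1 f2 p1 p2 p3 d1; move: ((v - x%:R) * _) (x%:R * (ln v - _)) (x%:R * (_ + ln x%:R)) => *.
by apply/andP; split; lra.
Qed.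

Let M : R := \sum_(1 <= g < V.+1) mu g / g%:R ^+ 2.

Let sum_inv_sqr_le : \sum_(1 <= g < V.+1) (g%:R ^+ 2)^-1 <= 2 :> R.
Proof. by have := sum_inv_sqr_tail R V (isT : (0 < 1)%N); rewrite add1n divr1. Qed.

(** If [zeta 2] is truncated at [V / g] in the term of index [g], Moebius inversion gives exactly
    [1]. The difference consists of tails, each at most [2 g / V]. *)
Let M_near : `|z * M - 1| <= 2 * harm R V / V%:R.
Proof.
pose Z m : R := \sum_(1 <= n < m.+1) (n%:R ^+ 2)^-1.
have one : \sum_(1 <= g < V.+1) mu g / g%:R ^+ 2 * Z (V %/ g)%N = 1.
  transitivity (\sum_(1 <= g < V.+1) \sum_(1 <= n < V.+1 | (g %| n)%N) mu g / n%:R ^+ 2).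
    rewrite big_nat [RHS]big_nat; apply: eq_bigr => g /andP[g1 _].
    rewrite sum_multiples // /Z mulr_sumr; apply: eq_bigr => m _.
    by rewrite (natrM R g m) exprMn [in RHS]invfM [RHS]mulrA.
  rewrite (exchange_big_dep xpredT) //= big_ltn // [X in _ + X]big_nat [X in _ + X]big1 => [|n /andP[n1 nV]].
    rewrite addr0 -mulr_suml (_ : \sum_(1 <= i < V.+1 | _) mu i = 1) ?mul1r ?expr1n ?invr1 //.
    by have h1V : (0 < 1 <= V)%N := V0; rewrite (sum_moebius R h1V) eqxx.
  have hn : (0 < n <= V)%N by rewrite (ltn_trans _ n1).
  rewrite -mulr_suml (sum_moebius R hn).
  by rewrite (_ : (n == 1)%N = false) ?mul0r //; apply: gtn_eqF.
rewrite -[X in _ - X]one /M mulr_sumr -sumrB; apply: le_trans (ler_norm_sum _ _ _) _.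
apply: (@le_trans _ _ (\sum_(1 <= g < V.+1) g%:R^-1 * (2 / V%:R))); last first.
  rewrite -mulr_suml (_ : \sum_(1 <= i < V.+1) i%:R^-1 = harm R V) //.
  by move: (harm R V) => h; rewrite le_eqVlt; apply/orP; left; apply/eqP; ring.
rewrite [leLHS]big_nat [leRHS]big_nat; apply: ler_sum => g /andP[g1 gV].
have gR : 0 < g%:R :> R by rewrite ltr0n.
have /andP[z1 z2] := zeta2_bounds R (V %/ g).
rewrite [z * _]mulrC -mulrBr normrM normrM normfV normrX (ger0_norm (ltW gR)).
have zz : `|z - Z (V %/ g)%N| <= 2 * g%:R / V%:R.
  rewrite ger0_norm ?subr_ge0 // lerBlDl; apply: le_trans z2 _; rewrite lerD2l.
  rewrite -mulrA; apply: ler_wpM2l => //; rewrite ler_pdivlMr // mulrC ler_pdivrMr ?ltr0n //.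
  by rewrite -natrM ler_nat ltnW // mulnC ltn_ceil.
apply: (@le_trans _ _ (1 / g%:R ^+ 2 * (2 * g%:R / V%:R))).
  apply: ler_pM => //; first by rewrite divr_ge0 // exprn_ge0 // ltW.
  by rewrite ler_pM2r ?invr_gt0 ?exprn_gt0 //; apply: moebius_le1.
by rewrite le_eqVlt; apply/orP; left; apply/eqP; field; rewrite !gt_eqF.
Qed.

Lemma zeta2_ge1 : 1 <= z.
Proof. by have /andP[h _] := zeta2_bounds R 1; apply: le_trans h; rewrite big_nat1 expr1n invr1. Qed.

(** Three errors: the rounding in [F_quotient], the dropped [ln g], whose sum against [1 / g ^ 2]
    converges, and the replacement of the truncated Moebius sum by [1 / z]. *)
Lemma coprime_sum_asymptotic :
  `|\sum_(1 <= b < V.+1) \sum_(1 <= d < (s * b).+1) (coprime d b)%:R / d%:R - V%:R * Lam / z| <=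
  6 * V%:R + (3 * Lam + 1) * harm R V.
Proof.
rewrite coprime_sum_moebius.
pose A : R := \sum_(1 <= g < V.+1) mu g / g%:R * (V%:R / g%:R * (Lam - ln g%:R)).
have h1 : `|\sum_(1 <= g < V.+1) mu g / g%:R * F (V %/ g) - A| <= 2 * V%:R + (Lam + 1) * harm R V.
  rewrite /A -sumrB; apply: le_trans (ler_norm_sum _ _ _) _.
  apply: (@le_trans _ _ (\sum_(1 <= g < V.+1) ((g%:R ^+ 2)^-1 * V%:R + g%:R^-1 * (Lam + 1)))).
    rewrite [leLHS]big_nat [leRHS]big_nat; apply: ler_sum => g /andP[g1 gV].
    have gR : 0 < g%:R :> R by rewrite ltr0n.
    rewrite -mulrBr normrM normrM normfV (ger0_norm (ltW gR)).
    apply: (@le_trans _ _ (1 / g%:R * (V%:R / g%:R + (Lam + 1)))).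
      apply: ler_pM => //; first by rewrite divr_ge0.
        by rewrite ler_pM2r ?invr_gt0 //; apply: moebius_le1.
      by apply: F_quotient; rewrite g1.
    by rewrite le_eqVlt; apply/orP; left; apply/eqP; field; rewrite gt_eqF.
  rewrite big_split /= -!mulr_suml; apply: lerD; last by rewrite mulrC.
  by apply: ler_wpM2r; first exact: ltW.
have h2 : `|A - V%:R * Lam * M| <= 4 * V%:R.
  have -> : A - V%:R * Lam * M = - (V%:R * \sum_(1 <= g < V.+1) mu g * (ln g%:R / g%:R ^+ 2)).
    rewrite /A /M !mulr_sumr -sumrB -sumrN big_nat [RHS]big_nat; apply: eq_bigr => g /andP[g1 _].
    by field; rewrite pnatr_eq0 -lt0n.
  rewrite normrN normrM (ger0_norm (ltW VR)) mulrC; apply: ler_wpM2r; first exact: ltW.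
  apply: le_trans (ler_norm_sum _ _ _) _; apply: le_trans (sum_ln_sqr_le R V).
  rewrite [leLHS]big_nat [leRHS]big_nat; apply: ler_sum => g /andP[g1 _].
  have l0 : 0 <= ln g%:R / g%:R ^+ 2 :> R by rewrite divr_ge0 ?exprn_ge0 // ln_ge0 // ler1n.
  rewrite normrM (ger0_norm l0) -[leRHS]mul1r; apply: ler_wpM2r => //; exact: moebius_le1.
have z1 := zeta2_ge1.
have h3 : `|V%:R * Lam * M - V%:R * Lam / z| <= 2 * Lam * harm R V.
  have z0 : 0 < z by apply: lt_le_trans z1.
  have -> : V%:R * Lam * M - V%:R * Lam / z = V%:R * Lam * ((z * M - 1) / z) by field; rewrite gt_eqF.
  rewrite normrM (ger0_norm (mulr_ge0 (ltW VR) Lam0)).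
  apply: (@le_trans _ _ (V%:R * Lam * (2 * harm R V / V%:R))).
    apply: ler_wpM2l; first by rewrite mulr_ge0 // ltW.
    rewrite normrM normfV (ger0_norm (ltW z0)) ler_pdivrMr //; apply: le_trans M_near _.
    rewrite -[leLHS]mulr1; apply: ler_wpM2l => //; by rewrite divr_ge0 // mulr_ge0 // harm_ge0.
  by rewrite le_eqVlt; apply/orP; left; apply/eqP; field; rewrite gt_eqF.
have := ler_distD A (\sum_(1 <= g < V.+1) mu g / g%:R * F (V %/ g)) (V%:R * Lam / z).
have := ler_distD (V%:R * Lam * M) A (V%:R * Lam / z).
move: h1 h2 h3; rewrite !mulrDl; move: (harm R V) => H.
rewrite !mul1r -!mulrA; lra.
Qed.

End CoprimeSum.

(** * The asymptotic formula *)

Lemma expn_le_exp2 k : exists K, forall u, (u ^ k <= K * 2 ^ u)%N.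
Proof.
case: k => [|k]; first by exists 1%N => u; rewrite mul1n expn_gt0.
exists (k.+1 ^ k.+1)%N => u; apply: (@leq_trans ((k.+1 * 2 ^ (u %/ k.+1)) ^ k.+1)).
  rewrite leq_exp2r //; apply: ltnW; apply: leq_trans (ltn_ceil u (ltn0Sn k)) _.
  by rewrite mulnC leq_mul2l ltn_expl.
by rewrite expnMn -expnM leq_mul2l leq_pexp2l ?leq_trunc_div ?orbT.
Qed.

(** Such [u] is at most logarithmic in [l]; for large [u] the cube [u ^ 3] is already [O(l)], and
    one factor [u] is given up to absorb the constant. *)
Lemma sqr_le_of_exp2_le a : exists l0, forall l u, (l0 <= l)%N -> (2 ^ u <= 2 * (l + 40))%N -> (a * u ^ 2 <= l)%N.
Proof.
have [K hK] := expn_le_exp2 3.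
pose U := (a * (82 * K))%N; exists (a * U ^ 2 + 1)%N => l u hl h.
case: (leqP u U) => uU.
  by apply: leq_trans hl; apply: leq_trans (leq_addr _ _); rewrite leq_mul2l leq_exp2r ?uU ?orbT.
have l1 : (1 <= l)%N by apply: leq_trans hl; rewrite addn1.
have K0 : (0 < 82 * K)%N by move: (hK 1%N); rewrite muln_gt0; case: (K).
rewrite -(leq_pmul2l K0) mulnA (mulnC _ a) -/U.
apply: (@leq_trans (u ^ 3)); first by rewrite expnS leq_mul2r ltnW ?orbT.
apply: leq_trans (hK u) _; apply: leq_trans (leq_mul (leqnn K) h) _.
by move: l1; clear; nia.
Qed.

Lemma nat_root k n : (0 < k)%N -> exists t, (t ^ k <= n < t.+1 ^ k)%N.
Proof.
move=> k0; elim: n => [|n [t /andP[h1 h2]]]; first by exists 0%N; rewrite exp0n // exp1n.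
case: (leqP (t.+1 ^ k) n.+1) => h; last by exists t; rewrite h (leq_trans h1).
by exists t.+1; rewrite h (leq_ltn_trans h2) // ltn_exp2r.
Qed.

Definition divisor_total (N : nat) : nat :=
  (\sum_(1 <= b < N.+1) \sum_(1 <= a < N.+1) size (divisors (a * b ^ 2 + 1)))%N.

Lemma divisor_total_split (R : realType) N s :
  `|(divisor_total N)%:R - 2 * N%:R * \sum_(1 <= b < N.+1) \sum_(1 <= d < (s * b).+1) (coprime d b)%:R / d%:R|
  <= 2 * (\sum_(1 <= b < N.+1) `|modulus_error R N s b|) + \sum_(1 <= b < N.+1) (corner N s b)%:R :> R.
Proof.
rewrite /divisor_total natr_sum !mulr_sumr -sumrB -big_split.
apply: le_trans (ler_norm_sum _ _ _) _; rewrite [leLHS]big_nat [leRHS]big_nat; apply: ler_sum => b /andP[b1 bN].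
set W := (s * b + (N * b ^ 2 + 1))%N.
have := @hyperbola N b b1 (s * b) W (leq_addr _ _) (leq_addl _ _).
rewrite /= /corner -/W; set X := (\sum_(1 <= d < (s * b).+1) \sum_(1 <= e < _) _)%N.
set Y := (\sum_((s * b).+1 <= d < W.+1) _)%N; set T := (\sum_(1 <= a < N.+1) _)%N => h.
have hR : T%:R + X%:R = 2 * (\sum_(1 <= d < (s * b).+1) cnt N b d)%N%:R + Y%:R :> R.
  by rewrite -natrD h natrD natrM.
have me : modulus_error R N s b = (\sum_(1 <= d < (s * b).+1) cnt N b d)%N%:R -
    N%:R * \sum_(1 <= d < (s * b).+1) (coprime d b)%:R / d%:R.
  rewrite /modulus_error sumrB natr_sum; congr (_ - _); rewrite mulr_sumr; apply: eq_bigr => d _.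
  by rewrite mulrAC mulrA.
rewrite natrD.
have -> : T%:R - 2 * N%:R * \sum_(1 <= d < (s * b).+1) (coprime d b)%:R / d%:R =
   2 * modulus_error R N s b + (Y%:R - X%:R).
  by rewrite me -mulrA; move: hR; lra.
apply: le_trans (ler_normD _ _) _; rewrite normrM (ger0_norm (ler0n R 2)) lerD2l.
by apply: le_trans (ler_normB _ _) _; rewrite !normr_nat addrC.
Qed.

Section Assembly.
Variable R : realType.
Let z : R := zeta 2.

Lemma divisor_total_coprime_sum : exists (C : R) (N0 : nat), forall N s, (N0 <= N)%N ->
  (s ^ 2 <= N < s.+1 ^ 2)%N ->
  `|(divisor_total N)%:R - 2 * N%:R * \sum_(1 <= b < N.+1) \sum_(1 <= d < (s * b).+1) (coprime d b)%:R / d%:R|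
  <= C * (N%:R ^+ 2 * Num.sqrt (ln N%:R)).
Proof.
(* Here [650 = 5 * 130]: the bound [u ^ 130 <= K' t] is obtained through fifth powers, [t ^ 5] being
   comparable to [l] and so to [2 ^ u]. *)
have [K hK] := expn_le_exp2 650.
(* Makes [k0], the quotient of [l] by [40 u], at least [2100 u]. *)
have [l0 hl0] := sqr_le_of_exp2_le (2100 * 40).
pose K' := (K * (2 * 41 * 2 ^ 5))%N.
have [c hc] : exists c : R, c = 700 ^+ 64 by eexists.
have c0 : 0 <= c by rewrite hc exprn_ge0.
pose C1 : R := 2 * ((97 + (190 * 138)) + 564 * ((216 * 80) + (648 * 80 * 65) * c)) + (186 * 216 * 80 + 190 * 138).
have C10 : 0 <= C1 by rewrite /C1 !addr_ge0 // !mulr_ge0 // !addr_ge0 // !mulr_ge0 // !addr_ge0 // !mulr_ge0.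
exists (C1 * Num.sqrt (2 * K'%:R)), (2 ^ (l0 + 1))%N => N s NN sN.
apply: le_trans (divisor_total_split R N s) _.
have N0 : (0 < N)%N by apply: leq_trans NN; rewrite expn_gt0.
pose l := trunc_log 2 N.
have lN : (2 ^ l <= N < 2 ^ l.+1)%N by apply: trunc_log_bounds.
have ll : (l0 + 1 <= l)%N by apply: trunc_log_max.
have l1 : (1 <= l)%N by apply: leq_trans ll; rewrite addn1.
pose L := (l + 40)%N; pose u := (trunc_log 2 L).+1.
have L0 : (0 < L)%N by rewrite /L addn_gt0 orbT.
have /andP[uL Lu] : (2 ^ trunc_log 2 L <= L < 2 ^ u)%N by apply: trunc_log_bounds.
have u2 : (2 ^ u <= 2 * (l + 40))%N by rewrite /u expnS leq_mul2l uL.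
have hu := hl0 l u (leq_trans (leq_addr _ _) ll) u2.
pose k0 := (l %/ (40 * u))%N.
have u40 : (0 < 40 * u)%N by rewrite muln_gt0.
have uk : (2100 * u <= k0)%N.
  rewrite leq_divRL //; apply: leq_trans hu; rewrite -mulnn; clear; lia.
have ul : (40 * u <= l)%N.
  by apply: leq_trans hu; rewrite -mulnn /u; clear; nia.
have k0l : (40 * u * k0 <= l <= 80 * u * k0)%N.
  have [h1 h2 _] := div_sandwich u40 ul; rewrite mulnC h1 /=.
  by apply: leq_trans h2 _; rewrite (_ : 80 = 2 * 40)%N // -!mulnA leq_mul2l /= mulnC -mulnA.
have [t tl] := @nat_root 5 l isT.
have t0 : (0 < t)%N by case: (posnP t) tl => // -> /andP[_]; rewrite exp1n ltnS leqNgt l1.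
have E1 := @total_error R N s l L u k0 t lN sN erefl Lu k0l uk t0 tl c hc.
have E2 := @corner_total R N s l L u k0 t lN sN erefl Lu k0l uk t0 tl.
have lnN := @ln_pow2_ge R N l lN.
have N2 : 0 <= N%:R ^+ 2 :> R by rewrite exprn_ge0.
(* The square of the left side is [u ^ 130 t ^ 4], against [t ^ 5 <= l]: the spare factor [t]
   absorbs every power of [log log N]. *)
have key : u%:R ^+ 65 * t%:R ^+ 2 <= Num.sqrt (2 * K'%:R) * Num.sqrt (ln N%:R) :> R.
  have ln0 : 0 <= ln (N%:R : R) by apply: ln_ge0; rewrite ler1n.
  have ut0 : 0 <= u%:R ^+ 65 * t%:R ^+ 2 :> R by rewrite mulr_ge0 // exprn_ge0.
  rewrite -sqrtrM ?mulr_ge0 // -[leLHS](ger0_norm ut0) -[leLHS]sqrtr_sqr.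
  rewrite ler_sqrt ?mulr_ge0 //.
  have n1 : (u ^ 130 <= K' * t)%N.
    rewrite -(@leq_exp2r _ _ 5) // -expnM; apply: leq_trans (hK u) _.
    apply: (@leq_trans (K * (2 * (41 * l)))).
      rewrite leq_mul2l; apply/orP; right; apply: leq_trans u2 _.
      by rewrite leq_mul2l /=; move: l1; clear; lia.
    apply: (@leq_trans (K' * t ^ 5)); last first.
      rewrite expnMn leq_mul2r; apply/orP; right.
      by case: (K') => // k; rewrite -{1}(expn1 k.+1) leq_pexp2l.
    apply: (@leq_trans (K * (2 * (41 * (2 ^ 5 * t ^ 5))))); last first.
      by rewrite /K'; move: (t ^ 5)%N; clear; lia.
    rewrite leq_mul2l; apply/orP; right; rewrite leq_mul2l /= leq_mul2l /=.
    case/andP: tl => _ h; apply: ltnW; apply: leq_trans h _; rewrite -expnMn leq_exp2r //.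
    by rewrite mul2n -addnn -addn1 leq_add2l.
  have n2 : (u ^ 130 * t ^ 4 <= K' * l)%N.
    case/andP: tl => h _; apply: (@leq_trans (K' * t ^ 5)); last by rewrite leq_mul2l h orbT.
    by rewrite (expnS t 4) mulnA leq_mul2r n1 orbT.
  have n3 : (u%:R ^+ 65 * t%:R ^+ 2) ^+ 2 <= K'%:R * l%:R :> R.
    by rewrite exprMn -!exprM -!natrX -!natrM ler_nat.
  apply: le_trans n3 _; rewrite (mulrC 2) -mulrA; apply: ler_wpM2l => //.
  by rewrite [leRHS]mulrC -ler_pdivrMr.
have P : 2 * (\sum_(1 <= b < N.+1) `|modulus_error R N s b|) + \sum_(1 <= b < N.+1) (corner N s b)%:R <=
   C1 * (N%:R ^+ 2 * (u%:R ^+ 65 * t%:R ^+ 2)) :> R.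
  rewrite /C1 (mulrDl (2 * _)) -(mulrA 2); apply: lerD => //; exact: ler_wpM2l.
apply: le_trans P _; rewrite -mulrA; apply: ler_wpM2l => //.
by rewrite [leRHS]mulrCA; apply: ler_wpM2l.
Qed.

Lemma divisor_total_asymptotic : exists (C : R) (N0 : nat), forall N, (N0 <= N)%N ->
  `|(divisor_total N)%:R - 3 / z * (N%:R ^+ 2 * ln N%:R)| <= C * (N%:R ^+ 2 * Num.sqrt (ln N%:R)).
Proof.
have [C [N0 H]] := divisor_total_coprime_sum.
exists (C + 500), (N0 + 4)%N => N hN.
have [s sN] := @nat_root 2 N isT.
have N4 : (4 <= N)%N by apply: leq_trans hN; rewrite leq_addl.
have N1 : (0 < N)%N by apply: leq_trans N4.
have s1 : (0 < s)%N by case: (posnP s) sN => // -> /andP[_]; rewrite exp1n ltnS leqNgt N1.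
have := H N s (leq_trans (leq_addr _ _) hN) sN.
have := @coprime_sum_asymptotic R s N s1 N1.
set G := \sum_(1 <= b < N.+1) _; set Lam := ln _; rewrite -/z => h1 h2.
have z1 : 1 <= z := zeta2_ge1 R.
have z0 : 0 < z by apply: lt_le_trans z1.
pose n : R := N%:R; pose y : R := ln n.
have nR : 1 <= n by rewrite ler1n.
have n0 : 0 < n by apply: lt_le_trans nR.
have y1 : 1 <= y.
  apply: (@le_trans _ _ (ln ((2 : R) ^+ 2))).
    by rewrite lnXn // mulr2n; have := ln2_ge R; lra.
  by rewrite ler_ln ?posrE ?exprn_gt0 // -natrX ler_nat.
have Ls : Lam = ln s%:R + y by rewrite /Lam natrM lnM ?posrE ?ltr0n.
have sR : 1 <= s%:R :> R by rewrite ler1n.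
case/andP: (sN) => sN1 sN2.
have ys1 : 2 * ln s%:R <= y.
  rewrite mulr_natl -lnXn ?ltr0n // ler_ln ?posrE ?exprn_gt0 ?ltr0n //.
  by rewrite -natrX ler_nat.
have ln_s : ln (s%:R + 1) <= ln s%:R + 1 :> R.
  have /andP[_] := ln_succ R s1; rewrite -natr1 => h.
  have : s%:R^-1 <= 1 :> R by rewrite invf_le1 // ltr0n.
  by move: h; lra.
have ys2 : y <= 2 * ln (s%:R + 1).
  rewrite mulr_natl -lnXn ?ltr_pwDl ?ltr0n // ler_ln ?posrE ?exprn_gt0 ?ltr_pwDl ?ltr0n //.
  by rewrite natr1 -natrX ler_nat ltnW.
(* This absorbs the product of two logarithms in the error of [coprime_sum_asymptotic]. *)
have ys : y ^+ 2 <= 4 * n.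
  have h : y <= 2 * s%:R.
    apply: le_trans ys2 _; apply: ler_wpM2l => //; rewrite addrC; apply: le_ln1Dx.
    by apply: lt_le_trans (ler0n R s); rewrite ltrN10.
  apply: (@le_trans _ _ ((2 * s%:R) ^+ 2)); first by rewrite lerXn2r ?nnegrE //; lra.
  have : s%:R ^+ 2 <= n by rewrite -natrX ler_nat.
  by rewrite exprMn; lra.
have hh : harm R N <= 1 + y by case/andP: (harm_bounds R N1).
have h0 := harm_ge0 R N.
(* As [s] is about [sqrt N], [ln (s N)] is about [3 / 2] times [ln N]; with the factor [2] from
   [hyperbola] this gives the constant [3] of the theorem. *)
have Lam_hi : Lam <= 3 / 2 * y by rewrite Ls; lra.
have Lam_lo : 3 / 2 * y - 1 <= Lam by rewrite Ls; lra.
have G1 : `|G - n * Lam / z| <= 100 * n.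
  apply: le_trans h1 _; rewrite -/n.
  apply: (@le_trans _ _ (6 * n + (6 * y) * (2 * y))).
    rewrite lerD2l; apply: ler_pM => //; [by lra | by lra | by lra].
  by rewrite mulrACA -expr2; lra.
have q1 : 1 <= Num.sqrt y by rewrite -sqrtr1 ler_sqrt // (le_trans _ y1).
have e : (divisor_total N)%:R - 3 / z * (n ^+ 2 * y) =
  ((divisor_total N)%:R - 2 * n * G) + 2 * n * (G - n * Lam / z) + 2 * n ^+ 2 / z * (Lam - 3 / 2 * y).
  by field; rewrite gt_eqF.
rewrite -/n -/y e.
have p1 : `|2 * n * (G - n * Lam / z)| <= 200 * n ^+ 2.
  rewrite normrM ger0_norm; last by rewrite mulr_ge0 // ltW.
  apply: (@le_trans _ _ (2 * n * (100 * n))); first by apply: ler_wpM2l => //; rewrite mulr_ge0 // ltW.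
  by rewrite le_eqVlt; apply/orP; left; apply/eqP; ring.
have n2 : 0 <= n ^+ 2 by rewrite exprn_ge0 // ltW.
have p2 : `|2 * n ^+ 2 / z * (Lam - 3 / 2 * y)| <= 2 * n ^+ 2.
  rewrite normrM ger0_norm; last by rewrite divr_ge0 ?mulr_ge0 // ltW.
  apply: (@le_trans _ _ (2 * n ^+ 2 / z * 1)).
    apply: ler_wpM2l; first by rewrite divr_ge0 ?mulr_ge0 // ltW.
    by rewrite ler_norml; apply/andP; split; lra.
  by rewrite mulr1 ler_pdivrMr // -[leLHS]mulr1; apply: ler_wpM2l => //; rewrite mulr_ge0.
apply: le_trans (ler_normD _ _) _; apply: le_trans (lerD (ler_normD _ _) (lexx _)) _.
have nq : n ^+ 2 <= n ^+ 2 * Num.sqrt y by rewrite -[leLHS]mulr1; apply: ler_wpM2l.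
rewrite [leRHS]mulrDl; move: h2 p1 p2 nq n2; rewrite -/n -/y => h2 p1 p2 nq n2.
apply: le_trans (lerD (lerD h2 p1) p2) _; rewrite -addrA lerD2l.
by move: nq n2; move: (n ^+ 2 * Num.sqrt y) (n ^+ 2) => w v; lra.
Qed.

Lemma divisor_sumE (X : R) : divisor_sum X = divisor_total (Num.truncn X).
Proof. by rewrite /divisor_sum exchange_big. Qed.

Lemma divisor_sum_estimate : exists (C X0 : R), forall X, X0 <= X ->
  `|(divisor_sum X)%:R - 3 / z * (X ^+ 2 * ln X)| <= C * (X ^+ 2 * Num.sqrt (ln X)).
Proof.
have [C [N0 H]] := divisor_total_asymptotic.
exists (`|C| + 12), (N0%:R + expR 1) => X hX.
have e1 : 1 + 1 <= expR 1 :> R by apply: expR_ge1Dx.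
have N0R : 0 <= N0%:R :> R by [].
have X1 : 2 <= X by lra.
have X0 : 0 < X by lra.
rewrite divisor_sumE; set N := Num.truncn X.
have /andP[NX XN] : N%:R <= X < N.+1%:R by apply: truncn_itv; exact: ltW.
have hN : (N0 <= N)%N by rewrite -ltnS -(ltr_nat R); apply: le_lt_trans XN; lra.
have N1 : (0 < N)%N by rewrite -ltnS -(ltr_nat R); apply: le_lt_trans XN; lra.
have nR : 1 <= N%:R :> R by rewrite ler1n.
have n0 : 0 < N%:R :> R by rewrite ltr0n.
have lX1 : 1 <= ln X.
  by rewrite -[leLHS](expRK 1) ler_ln ?posrE ?expR_gt0 //; lra.
have lNX : ln N%:R <= ln X by rewrite ler_ln ?posrE.
have lN0 : 0 <= ln (N%:R : R) by apply: ln_ge0.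
have lXN : ln X - ln N%:R <= N%:R^-1.
  have /andP[_] := ln_succ R N1; apply: le_trans; rewrite lerD2r ler_ln ?posrE ?ltr0n //; exact: ltW.
have lXX : ln X < X by apply: ln_sublinear.
have q1 : 1 <= Num.sqrt (ln X) by rewrite -sqrtr1 ler_sqrt // (le_trans _ lX1).
have X20 : 0 <= X ^+ 2 by rewrite exprn_ge0 // ltW.
have NX2 : N%:R ^+ 2 <= X ^+ 2 by rewrite lerXn2r ?nnegrE // ltW.
have z1 : 1 <= z := zeta2_ge1 R.
have z0 : 0 < z by apply: lt_le_trans z1.
have d1 : 0 <= X ^+ 2 * ln X - N%:R ^+ 2 * ln N%:R.
  by rewrite subr_ge0; apply: ler_pM => //; rewrite exprn_ge0.
(* Replacing [X] by its integer part moves the main term by [O(X ^ 2 ln X / X)] per power of [X],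
   generously [O(X ^ 2)], which is below the error term. *)
have d2 : X ^+ 2 * ln X - N%:R ^+ 2 * ln N%:R <= 4 * X ^+ 2.
  have -> : X ^+ 2 * ln X - N%:R ^+ 2 * ln N%:R = (X ^+ 2 - N%:R ^+ 2) * ln X + N%:R ^+ 2 * (ln X - ln N%:R) by ring.
  have h1 : (X ^+ 2 - N%:R ^+ 2) * ln X <= 3 * X * X.
    apply: ler_pM; rewrite ?subr_ge0 //; [lra | | exact: ltW].
    rewrite subr_sqr; apply: (@le_trans _ _ (1 * (X + N%:R))); last by lra.
    by apply: ler_wpM2r; rewrite -?natr1 in XN *; lra.
  have h2 : N%:R ^+ 2 * (ln X - ln N%:R) <= N%:R.
    apply: (@le_trans _ _ (N%:R ^+ 2 * N%:R^-1)); first by apply: ler_wpM2l => //; rewrite exprn_ge0.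
    by rewrite expr2 mulfK ?gt_eqF.
  have h3 : X <= X * X by rewrite -[leLHS]mulr1; apply: ler_wpM2l; lra.
  by rewrite expr2 in h1 *; lra.
have -> : (divisor_total N)%:R - 3 / z * (X ^+ 2 * ln X) =
   ((divisor_total N)%:R - 3 / z * (N%:R ^+ 2 * ln N%:R)) - 3 / z * (X ^+ 2 * ln X - N%:R ^+ 2 * ln N%:R) by ring.
apply: le_trans (ler_normB _ _) _; rewrite [leRHS]mulrDl; apply: lerD.
  apply: le_trans (H N hN) _; apply: (@le_trans _ _ (`|C| * (N%:R ^+ 2 * Num.sqrt (ln N%:R)))).
    by apply: ler_wpM2r; rewrite ?ler_norm // mulr_ge0 ?sqrtr_ge0 ?exprn_ge0.
  apply: ler_wpM2l => //; apply: ler_pM; rewrite ?sqrtr_ge0 ?exprn_ge0 //.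
  by rewrite ler_sqrt // (le_trans _ lX1).
rewrite normrM (ger0_norm d1) ger0_norm; last by rewrite divr_ge0 // ltW.
apply: (@le_trans _ _ (3 * (4 * X ^+ 2))).
  apply: ler_pM => //; first by rewrite divr_ge0 // ltW.
  by rewrite ler_pdivrMr // -[leLHS]mulr1; apply: ler_wpM2l.
have : X ^+ 2 <= X ^+ 2 * Num.sqrt (ln X) by rewrite -[leLHS]mulr1; apply: ler_wpM2l.
by lra.
Qed.

End Assembly.

Local Open Scope classical_set_scope.
Local Open Scope ring_scope.

Theorem theorem1p2 (R : realType) :
  exists E : R -> R,
    E =O_ (at_pinfty R) (fun X : R => (ln (ln X) / ln X) `^ (1 / 2)) /\
    \forall X \near +oo,
      (divisor_sum X)%:R = (1 + E X) * (3 / zeta (2 : R)) * X ^+ 2 * ln X.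
Proof.
have [C [X0 H]] := divisor_sum_estimate R.
set z : R := zeta 2 in H *.
have z0 : 0 < z by apply: lt_le_trans (zeta2_ge1 R).
pose m (X : R) := 3 / z * (X ^+ 2 * ln X).
(* [E] is the relative error itself; the identity requires only that [m X] be nonzero, which holds
   for [X > 1]. *)
exists (fun X => (divisor_sum X)%:R / m X - 1); split; last first.
  exists 1; split; first exact: num_real.
  move=> X X1; have lX : 0 < ln X by apply: ln_gt0.
  have X_gt0 : 0 < X by apply: lt_trans X1.
  rewrite /m; field; rewrite !gt_eqF //.
apply/eqO_exP; exists (`|C| * z + 1).
  by rewrite ltr_pwDr // mulr_ge0 // ltW.
(* Beyond [exp (exp 1)] the iterated logarithm is at least [1], so the bound [(ln X) ^ (-1/2)] for
   the relative error implies the one to be proved. *)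
exists (`|X0| + expR (expR 1)); split; first exact: num_real.
move=> X hX.
have XX0 : X0 <= X.
  apply: le_trans (ler_norm _) _; apply: ltW; apply: le_lt_trans hX; by rewrite lerDl expR_ge0.
have Xe : expR (expR 1) < X by apply: le_lt_trans hX; rewrite lerDr.
have X_gt0 : 0 < X by apply: lt_trans Xe; apply: expR_gt0.
have lX : expR 1 <= ln X by rewrite -[leLHS]expRK ler_ln ?posrE ?expR_gt0 // ltW.
have lX0 : 0 < ln X by apply: lt_le_trans lX; apply: expR_gt0.
have llX : 1 <= ln (ln X) by rewrite -[leLHS]expRK ler_ln ?posrE ?expR_gt0.
have ratio0 : 0 <= ln (ln X) / ln X by rewrite divr_ge0 ?(le_trans _ llX) // ltW.
have m0 : 0 < m X by rewrite /m !mulr_gt0 ?invr_gt0 // ?exprn_gt0.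
rewrite (ger0_norm (powR_ge0 _ _)) div1r powR12_sqrt //.
set q := Num.sqrt (ln X).
have q0 : 0 < q by rewrite sqrtr_gt0.
have qq : q ^+ 2 = ln X by rewrite sqr_sqrtr // ltW.
have target : q^-1 <= Num.sqrt (ln (ln X) / ln X).
  have ll0 : 0 <= ln (ln X) by apply: le_trans llX.
  rewrite sqrtrM // sqrtrV; last exact: ltW.
  rewrite -/q -[leLHS]mul1r.
  by apply: ler_wpM2r; rewrite ?invr_ge0 ?(ltW q0) // -sqrtr1 ler_sqrt // (le_trans _ llX).
have -> : (divisor_sum X)%:R / m X - 1 = ((divisor_sum X)%:R - m X) / m X by field; rewrite gt_eqF.
apply: (@le_trans _ _ (`|C| * z * q^-1)); last first.
  apply: ler_pM => //; [by rewrite mulr_ge0 // ltW | by rewrite invr_ge0 ltW | by rewrite lerDl].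
rewrite normrM normfV (ger0_norm (ltW m0)) ler_pdivrMr //; apply: le_trans (H X XX0) _.
rewrite -/q /m -qq; apply: (@le_trans _ _ (`|C| * (X ^+ 2 * q))).
  by apply: ler_wpM2r; rewrite ?ler_norm // mulr_ge0 ?exprn_ge0 // ltW.
rewrite (_ : `|C| * z / q * _ = `|C| * (3 * (X ^+ 2 * q))); last by field; rewrite !gt_eqF.
apply: ler_wpM2l => //; have : 0 <= X ^+ 2 * q by rewrite mulr_ge0 ?exprn_ge0 // ltW.
by lra.
Qed.
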